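(* Let $n\ge2$ and let $L$, $S_\Delta$, $\Omega_{int}$, $\Omega_{ext}=\mathbb R^n\setminus\overline{\Omega_{int}}$ be as in the context. Suppose that the ergosphere is characteristic, i.e. $\sum_{j,k=1}^n g^{jk}(x)\nu_j(x)\nu_k(x)=0$ for all $x\in S_\Delta$, and that $$\sum_{j=1}^n g^{j0}(x)\nu_j(x)<0\quad\text{for all }x\in S_\Delta,$$ where $\nu=(\nu_1,\dots,\nu_n)$ is the unit normal to $S_\Delta$ pointing out of $\Omega_{int}$. Then for every $T>0$ there is a constant $C>0$ such that every $u\in H^2(\Omega_{ext}\times(0,T))$ satisfying $$Lu=f\ \text{ in }\Omega_{ext}\times(0,T),\qquad u(0,x)=\varphi_0(x),\quad u_{x_0}(0,x)=\varphi_1(x)\ \text{ for } x\in\Omega_{ext}$$ (no boundary condition being imposed on $S_\Delta\times(0,T)$) obeys $$\max_{0\le x_0\le T}\big(\|u(x_0,\cdot)\|_{1,\Omega_{ext}}^2+\|u_{x_0}(x_0,\cdot)\|_{0,\Omega_{ext}}^2\big)-\int_0^T\!\!\int_{S_\Delta}\Big(u_{x_0}^2-\sum_{j,k=1}^n g^{jk}u_{x_j}u_{x_k}\Big)\Big(\sum_{j=1}^n g^{j0}\nu_j\Big)\,ds\,dx_0$$ $$\le C\big(\|\varphi_0\|_{1,\Omega_{ext}}^2+\|\varphi_1\|_{0,\Omega_{ext}}^2\big)+C\int_0^T\|f(x_0,\cdot)\|_{0,\Omega_{ext}}^2\,dx_0 .$$ Here $\|\cdot\|_{m,\Omega_{ext}}$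 is the norm of $H^m(\Omega_{ext})$ and $ds$ is the area element on $S_\Delta$.
   Context: Operator: with $x_0\in\mathbb R$ the time variable and $x=(x_1,\dots,x_n)$, $$Lu=\sum_{j,k=0}^n\frac{1}{\sqrt{(-1)^n g(x)}}\frac{\partial}{\partial x_j}\Big(\sqrt{(-1)^n g(x)}\,g^{jk}(x)\frac{\partial u}{\partial x_k}\Big),$$ where $[g^{jk}(x)]_{j,k=0}^n$ is a real symmetric matrix independent of $x_0$, $g(x)=(\det[g^{jk}(x)]_{j,k=0}^n)^{-1}$, the quadratic form $\sum_{j,k=0}^n g^{jk}(x)\xi_j\xi_k$ has signature $(1,-1,\dots,-1)$ for every $x$. The coefficients $g^{jk}$, $0\le j,k\le n$, are smooth and bounded together with all their derivatives of any order; there is $C_0>0$ with $g^{00}(x)\ge C_0$ for all $x$, and $\sum_{j,k=1}^n g^{jk}(x)\xi_j\xi_k\le -C_0\sum_{j=1}^n\xi_j^2$ for all $x\in\overline{\Omega_{ext}}$ with $|x|$ large. Ergosphere: $\Delta(x)=\det[g^{jk}(x)]_{j,k=1}^n$ and $S_\Delta=\{x:\Delta(x)=0\}$, assumed to be a smooth closed (compact) hypersurface in $\mathbb R^n$ with interior $\Omega_{int}$ (bounded side) and exterior $\Omega_{ext}$; it is assumed that $(-1)^n\Delta>0$ in $\Omega_{ext}$ (equivalently, $[g^{jk}(x)]_{j,k=1}^n$ is negative definite there) and $(-1)^n\Delta<0$ in $\Omega_{int}$. *)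

(* Defs.v *)
From HB Require Import structures.
From mathcomp Require Import all_boot all_order all_algebra.
From mathcomp Require Import all_classical all_reals all_analysis.
Import Order.TTheory GRing.Theory Num.Theory.
Import numFieldNormedType.Exports.

Set Implicit Arguments.
Unset Strict Implicit.
Unset Printing Implicit Defensive.

Local Open Scope classical_set_scope.
Local Open Scope ring_scope.

(* The coordinate maps generate the Borel sigma-algebra of R^n. *)
Fact measure_rV_display : measure_display.
Proof. exact: default_measure_display. Qed.

Section rV_measurable.
Context (R : realType) (n : nat).

Let coors (i : 'I_n) (x : 'rV[R]_n) : measurableTypeR R := x ord0 i.

Let rV_set0 : g_sigma_preimage coors set0.
Proof. exact: sigma_algebra0. Qed.

Let rV_setC A : g_sigma_preimage coors A -> g_sigma_preimage coors (~` A).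
Proof. exact: sigma_algebraC. Qed.

Let rV_bigcup (F : (set 'rV[R]_n)^nat) :
  (forall i, g_sigma_preimage coors (F i)) ->
  g_sigma_preimage coors (\bigcup_i (F i)).
Proof. exact: sigma_algebra_bigcup. Qed.

HB.instance Definition _ := @isMeasurable.Build measure_rV_display
  'rV[R]_n (g_sigma_preimage coors) rV_set0 rV_setC rV_bigcup.

Lemma measurable_coord (i : 'I_n) :
  measurable_fun [set: 'rV[R]_n]
    (fun x : 'rV[R]_n => x ord0 i : measurableTypeR R).
Proof.
move=> _ Y mY; rewrite setTI; apply: sub_sigma_algebra => /=.
rewrite -bigcup_seq/=; exists i => /=; first by rewrite mem_index_enum.
by exists Y => //; rewrite setTI.
Qed.

Lemma measurable_fun_rV d (T : measurableType d) (f : T -> 'rV[R]_n) :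
  (forall i, measurable_fun [set: T]
    (fun t => f t ord0 i : measurableTypeR R)) ->
  measurable_fun [set: T] f.
Proof.
move=> mf.
suff H : g_sigma_preimage (fun i => coors i \o f) `<=` measurable.
  move: H; rewrite g_sigma_preimage_comp => H _ A mA; apply: H.
  by exists A.
apply: smallest_sub; first exact: sigma_algebra_measurable.
rewrite -bigcup_seq => A [i _ [B mB <-]].
exact: (mf i).
Qed.

End rV_measurable.

(* The vector obtained from y by inserting t at position i. *)
Definition insert_rV (R : realType) (n : nat) (i : 'I_n) (t : R)
    (y : 'rV[R]_n.-1) : 'rV[R]_n :=
  \row_j oapp (fun k => y ord0 k) t (unlift i j).

Section lebesgue_rV.
Context (R : realType).

Section step.
Context (n : nat) (m : {sigma_finite_measure set 'rV[R]_n -> \bar R}).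

Let ins (p : measurableTypeR R * 'rV[R]_n) : 'rV[R]_n.+1 :=
  insert_rV ord0 (p.1 : R) p.2.

Let mins : measurable_fun [set: measurableTypeR R * 'rV[R]_n] ins.
Proof.
apply: measurable_fun_rV => i.
case: (unliftP ord0 i) => [k ->|->].
  rewrite (_ : (fun _ => _) = (fun x : 'rV[R]_n => x ord0 k : measurableTypeR R)
     \o snd); first exact: measurableT_comp (measurable_coord k) _.
  by apply/funext => p /=; rewrite /ins mxE liftK.
rewrite (_ : (fun _ => _) = fst); first exact: measurable_fst.
by apply/funext => p /=; rewrite /ins mxE unlift_none.
Qed.

Definition lebesgue_step : set 'rV[R]_n.+1 -> \bar R :=
  pushforward (@lebesgue_measure R \x m)%E ins.

Let mpre A : measurable A -> measurable (ins @^-1` A).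
Proof. by move=> mA; rewrite -[X in measurable X]setTI; exact: mins. Qed.

Let step0 : lebesgue_step set0 = 0%E.
Proof. by rewrite /lebesgue_step /pushforward preimage_set0 measure0. Qed.

Let step_ge0 A : (0 <= lebesgue_step A)%E.
Proof. exact: measure_ge0. Qed.

Let step_sigma_additive : semi_sigma_additive lebesgue_step.
Proof.
move=> F mF tF mUF; rewrite /lebesgue_step /pushforward preimage_bigcup.
apply: measure_semi_sigma_additive.
- by move=> i; exact: mpre.
- apply/trivIsetP => /= i j _ _ ij; rewrite -preimage_setI.
  by move/trivIsetP : tF => /(_ _ _ _ _ ij) ->//; rewrite preimage_set0.
- by rewrite -preimage_bigcup; exact: mpre.
Qed.

HB.instance Definition _ := isMeasure.Build _ _ _
  lebesgue_step step0 step_ge0 step_sigma_additive.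

Let step_sigma_finite : sigma_finite setT lebesgue_step.
Proof.
have /sigma_finiteP[F [TF ndF Foo]] := sigma_finiteT (@lebesgue_measure R).
have /sigma_finiteP[G [TG ndG Goo]] := sigma_finiteT m.
pose del (x : 'rV[R]_n.+1) : measurableTypeR R * 'rV[R]_n :=
  (x ord0 ord0, col' ord0 x).
have mdel : measurable_fun setT del.
  apply/measurable_fun_pairP; split; first exact: measurable_coord.
  apply: measurable_fun_rV => i.
  rewrite (_ : (fun _ => _) = (fun x : 'rV[R]_n.+1 => x ord0 (lift ord0 i) :
    measurableTypeR R)); first exact: measurable_coord.
  by apply/funext => x; rewrite /= mxE.
have insK : cancel ins del.
  move=> [t y]; rewrite /del /ins !mxE unlift_none /=; congr pair.
  by apply/rowP => k; rewrite !mxE liftK.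
exists (fun k => del @^-1` (F k `*` G k)).
  apply/seteqP; split=> x _ //.
  have [k _ Fx] : (\bigcup_k F k) (del x).1 by rewrite -TF.
  have [l _ Gx] : (\bigcup_k G k) (del x).2 by rewrite -TG.
  exists (maxn k l) => //; split.
  - by move: Fx; exact/subsetPset/ndF/leq_maxl.
  - by move: Gx; exact/subsetPset/ndG/leq_maxr.
move=> k; have [mFk Fk] := Foo k; have [mGk Gk] := Goo k.
have mFG : measurable (F k `*` G k) by exact: measurableX.
split; first by rewrite -[X in measurable X]setTI; exact: mdel.
rewrite /lebesgue_step /pushforward -comp_preimage.
rewrite (_ : del \o ins = id); last by apply/funext => p; exact: insK.
by rewrite preimage_id product_measure1E// lte_mul_pinfty// ge0_fin_numE.
Qed.

HB.instance Definition _ := Measure_isSigmaFinite.Build _ _ _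
  lebesgue_step step_sigma_finite.

End step.

(* Lebesgue measure on R^(n+1) = R x R^n is the product measure. *)
Fixpoint lebesgue_rV (n : nat) : {sigma_finite_measure set 'rV[R]_n -> \bar R} :=
  if n is n'.+1 then lebesgue_step (lebesgue_rV n') else dirac (0 : 'rV[R]_0).

End lebesgue_rV.

Section calculus.
Context (R : realType) (n : nat).
Implicit Types (f g : 'rV[R]_n -> R) (U : set 'rV[R]_n).

Definition pderiv (i : 'I_n) f : 'rV[R]_n -> R :=
  fun x => 'D_(delta_mx ord0 i) f x.

Definition pderivs (s : seq 'I_n) f : 'rV[R]_n -> R := foldr pderiv f s.

Definition smooth f := forall s : seq 'I_n,
  continuous (pderivs s f) /\
  forall i x, derivable (pderivs s f) x (delta_mx ord0 i).

Definition bounded_derivatives f := forall s : seq 'I_n,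
  exists M : R, forall x, `|pderivs s f x| <= M.

Definition gradient f (x : 'rV[R]_n) : 'rV[R]_n := \row_i pderiv i f x.

Definition test_function U f :=
  [/\ smooth f, compact (closure [set x | f x != 0])
    & closure [set x | f x != 0] `<=` U].

End calculus.

Section hypersurfaces.
Context (R : realType) (n : nat).
Implicit Types (S Omega : set 'rV[R]_n) (nu : 'rV[R]_n -> 'rV[R]_n).

Definition smooth_hypersurface S := forall x, S x ->
  exists (U : set 'rV[R]_n) (phi : 'rV[R]_n -> R),
  [/\ open U, U x, smooth phi
    & forall y, U y -> (S y <-> phi y = 0) /\ gradient phi y != 0].

Definition outer_unit_normal Omega S nu := forall x, S x ->
  \sum_i nu x ord0 i ^+ 2 = 1 /\
  exists (U : set 'rV[R]_n) (phi : 'rV[R]_n -> R),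
  [/\ open U, U x, smooth phi,
      forall y, U y -> [/\ S y <-> phi y = 0, Omega y <-> phi y < 0
                         & gradient phi y != 0]
    & exists2 c : R, 0 < c & gradient phi x = c *: nu x].

(* The area measure of S: it is carried by S, and ds = sqrt(1 + |grad h|^2) dy
   on every piece of S which is a graph x_i = h(y), where y is x with its i-th
   coordinate removed. These conditions determine sigma when S is a smooth
   hypersurface. *)
Definition area_measure S (sigma : {measure set 'rV[R]_n -> \bar R}) :=
  sigma (~` S) = 0%E /\
  forall (i : 'I_n) (U : set 'rV[R]_n) (h : 'rV[R]_n.-1 -> R),
    open U -> smooth h ->
    (forall x, U x -> S x <-> x ord0 i = h (col' i x)) ->
  forall A : set 'rV[R]_n, measurable A -> A `<=` U ->
  sigma (S `&` A) =
    (\int[lebesgue_rV R n.-1]_(y in [set y | A (insert_rV i (h y) y)])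
       (Num.sqrt (1 + \sum_j pderiv j h y ^+ 2))%:E)%E.

End hypersurfaces.

Section sobolev.
Context (R : realType) (n : nat).
Local Notation mu := (lebesgue_rV R n).
Implicit Types (Omega : set 'rV[R]_n) (f g : 'rV[R]_n -> R).

Definition normL2sq Omega f : \bar R :=
  (\int[mu]_(x in Omega) (f x ^+ 2)%:E)%E.

Definition inL2 Omega f :=
  measurable_fun Omega f /\ (normL2sq Omega f < +oo)%E.

Definition inL1loc Omega f := forall K : set 'rV[R]_n,
  compact K -> K `<=` Omega -> mu.-integrable K (EFin \o f).

Definition weak_pderiv Omega (i : 'I_n) f g :=
  [/\ inL1loc Omega f, inL1loc Omega g
    & forall psi, test_function Omega psi ->
      (\int[mu]_(x in Omega) (f x * pderiv i psi x)%:E =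
       - \int[mu]_(x in Omega) (g x * psi x)%:E)%E].

(* df lists the first-order weak derivatives of f. *)
Definition inH1 Omega f (df : 'I_n -> 'rV[R]_n -> R) :=
  inL2 Omega f /\ forall i, inL2 Omega (df i) /\ weak_pderiv Omega i f (df i).

Definition inH2 Omega f (df : 'I_n -> 'rV[R]_n -> R) :=
  inH1 Omega f df /\ forall i, exists d2f, inH1 Omega (df i) d2f.

(* The set below has at most one element, so this is the square of the H^1
   norm on H^1, and +oo outside of H^1. *)
Definition normH1sq Omega f : \bar R := ereal_inf
  [set r | exists2 df, inH1 Omega f df &
     r = (normL2sq Omega f + \sum_i normL2sq Omega (df i))%E].

End sobolev.

Section traces.
Context (R : realType) (n : nat) (Omega : set 'rV[R]_n) (T : R).

(* Points of space-time are the vectors (x_0, x_1, ..., x_n). *)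
Definition cylinder : set 'rV[R]_n.+1 :=
  [set z | Omega (col' ord0 z) /\ 0 < z ord0 ord0 < T].

Definition slice (w : 'rV[R]_n.+1 -> R) (t : R) : 'rV[R]_n -> R :=
  fun x => w (insert_rV ord0 t x).

(* W is the representative of w in C([0, T]; L^2(Omega)); the trace of w at
   the time t is W t. *)
Definition time_trace (w : 'rV[R]_n.+1 -> R) (W : R -> 'rV[R]_n -> R) :=
  [/\ forall t, t \in `[0, T] -> inL2 Omega (W t),
      forall t, t \in `[0, T] ->
        (normL2sq Omega (W s \- W t)) @[s --> within `[0, T] (nbhs t)] --> 0%E
    & {ae @lebesgue_measure R, forall t, t \in `]0, T[ ->
        {ae lebesgue_rV R n, forall x, Omega x -> W t x = slice w t x}}].

(* v is the trace on S x (0, T) of w in H^1(Omega x (0, T)): the limit, in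
   L^2(S x (0, T)), of the restrictions of smooth functions which approach w
   in H^1(Omega x (0, T)). *)
Definition lateral_trace (S : set 'rV[R]_n)
    (sigma : {measure set 'rV[R]_n -> \bar R}) (w v : 'rV[R]_n.+1 -> R) :=
  measurable_fun setT v /\
  exists (dw : 'I_n.+1 -> 'rV[R]_n.+1 -> R)
         (psi : nat -> 'rV[R]_n.+1 -> R),
  [/\ inH1 cylinder w dw,
      forall k, smooth (psi k),
      (normL2sq cylinder (psi k \- w)) @[k --> \oo] --> 0%E,
      forall j,
        (normL2sq cylinder (pderiv j (psi k) \- dw j)) @[k --> \oo] --> 0%E
    & (\int[@lebesgue_measure R]_(t in `[0%R, T])
         \int[sigma]_(x in S) (slice (psi k \- v) t x ^+ 2)%:E)%E
        @[k --> \oo] --> 0%E].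

End traces.

Section operator.
Context (R : realType) (n : nat) (gm : 'rV[R]_n -> 'M[R]_n.+1).

Definition space_block (x : 'rV[R]_n) : 'M[R]_n := row' ord0 (col' ord0 (gm x)).

(* By Sylvester's law of inertia: the quadratic form of A has signature
   (1, -1, ..., -1). *)
Definition lorentzian (A : 'M[R]_n.+1) := exists2 P : 'M[R]_n.+1,
  P \in unitmx &
  P *m A *m P^T = diag_mx (\row_j (if j == ord0 then 1 else -1)).

(* the density sqrt((-1)^n g), with g = 1 / det [g^{jk}] *)
Definition density (x : 'rV[R]_n) : R :=
  Num.sqrt ((-1) ^+ n * (\det (gm x))^-1).

(* L u = f on D, where du lists the first-order derivatives of u *)
Definition solves (D : set 'rV[R]_n.+1) (du : 'I_n.+1 -> 'rV[R]_n.+1 -> R)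
    (f : 'rV[R]_n.+1 -> R) :=
  exists2 p : 'I_n.+1 -> 'I_n.+1 -> 'rV[R]_n.+1 -> R,
    forall j k, weak_pderiv D j
      (fun z => density (col' ord0 z) * gm (col' ord0 z) j k * du k z) (p j k) &
    {ae lebesgue_rV R n.+1, forall z, D z ->
      \sum_j \sum_k (density (col' ord0 z))^-1 * p j k z = f z}.

End operator.

(* Main.v *)
(* Contract the energy-momentum tensor of L for the field v_l = d_l u with the
   multiplier X^k = g^{k0}. The time component of the flux is coercive on
   Omega_ext, where the space block is negative definite and g^{00} > 0, and
   uniformly so up to S. The divergence of the flux is bounded by (L u)^2, by the
   squares of the commutators d_i v_k - d_k v_i and by |v|^2; a weight
   exp(- lambda x_0) absorbs |v|^2. Since S is characteristic, the tangential
   terms disappear from the flux through S, which is, up to a positive factor,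
   (sum_j g^{j0} nu_j) (v_0^2 - sum_{jk} g^{jk} v_j v_k): it has a sign, so no
   boundary condition is needed.

   The lateral traces come with smooth functions psi_l -> d_l u in H^1, chosen
   separately for every l. The inequality is therefore proved for smooth fields
   that need not be gradients; the commutators of the psi_l tend to 0, and the
   boundary form, being nonnegative on S, passes to the limit by the
   parallelogram identity. The value of w at the time t is recovered as the time
   average of w + K(t, .) d_0 w for an explicit kernel K, which makes the traces
   continuous in t; testing with products eta(x_0) chi(x), where eta approximates
   the indicator function of (0, t), bounds u(t) by u(0) and d_0 u and shows
   that the traces of d_j u are the weak derivatives of the trace of u. *)
Require Import Defs.
From HB Require Import structures.
From mathcomp Require Import all_boot all_order all_algebra.
From mathcomp Require Import all_classical all_reals all_analysis.
From mathcomp Require Import measurable_realfun perm ring lra.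
Import Order.TTheory GRing.Theory Num.Theory.
Import numFieldNormedType.Exports.

Set Implicit Arguments.
Unset Strict Implicit.
Unset Printing Implicit Defensive.

Local Open Scope classical_set_scope.
Local Open Scope ring_scope.

(** * Smooth functions *)

Section continuity.
Context (R : realType) (n : nat).

(** The obstacle on [S] is that the space block degenerates there. A vanishing determinant means
    that the lower component $g_{00}$ is 0: the vector field of time translations is null, and the
    covectors without time component are its orthogonal complement. By the reversed Cauchy-Schwarz
    inequality the space block is still negative semidefinite on [S]. A covector at which a
    semidefinite form vanishes lies in its kernel, so the scalar condition that [S] is
    characteristic gives the vector equations $\sum_j g^{jk}\nu_j=0$; these remove the tangential
    terms and leave a form with a sign.

    Coercivity of the time component rests on $g^{00}>0$ and the signature alone. Compactness makes
    it uniform on a large box, and ellipticity takes over outside.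

    The exterior is unbounded and the fields are only square integrable, so every flux carries a
    plateau cut-off of radius about [m], whose gradient is of order [1/m]. The area measure is
    specified on graphs, hence the divergence theorem is built from charts and a partition of unity.

    The estimate of the derivatives does not involve [u]; integration in time then bounds [u]. *)

Lemma continuous_rV (T : topologicalType) (f : T -> 'rV[R]_n) (x : T) :
  (forall i, {for x, continuous (fun t => f t ord0 i)}) -> {for x, continuous f}.
Proof.
move=> cf A [P nP sPA]; rewrite /= nbhs_filterE.
have : \forall t \near x, forall i, P ord0 i (f t ord0 i).
  apply: filter_forall => i; apply: cf; exact: nP.
by apply: filterS => t H; apply: sPA => i j; rewrite ord1; exact: H.
Qed.

Lemma continuous_coord (i : 'I_n) : continuous (fun x : 'rV[R]_n => x ord0 i).
Proof. exact: coord_continuous. Qed.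

End continuity.

Section partial_derivatives.
Context (R : realType) (n : nat).
Local Notation V := 'rV[R]_n.
Local Notation e_ i := (delta_mx ord0 i : V).
Implicit Types (f g : V -> R).

(** Every directional derivative below is computed along its line, where the one-variable chain
    rule, mean value theorem and fundamental theorem apply. Total differentiability in several
    variables is never invoked, in keeping with [smooth], which speaks of partial derivatives
    only. *)
Lemma is_derive_line f (x v : V) (d : R) :
  is_derive x v f d <-> is_derive (0 : R) 1 (fun h : R => f (h *: v + x)) d.
Proof.
have E : 'D_v f x = 'D_1 (fun h : R => f (h *: v + x)) 0.
  rewrite /derive; set g1 := (X in lim (X @ _)).
  set g2 := (X in _ = lim (X @ _)).
  have -> // : g1 = g2.
  by rewrite /g1 /g2; apply/funext => h /=; rewrite addr0 scale0r add0r [_%:A]mulr1.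
split=> -[dx dE]; apply: DeriveDef.
- exact: (@derivable1P R _ _ f x v).1.
- by rewrite -E.
- exact: (@derivable1P R _ _ f x v).2.
- by rewrite E.
Qed.

Lemma is_derive_compl (g : R -> R) f (x v : V) (df dg : R) :
  is_derive x v f df -> is_derive (f x) 1 g dg ->
  is_derive x v (g \o f) (dg * df).
Proof.
move=> /is_derive_line fx gx; apply/is_derive_line.
have -> : (fun h : R => (g \o f) (h *: v + x)) = g \o (fun h : R => f (h *: v + x)) by [].
apply: is_derive1_comp.
by rewrite scale0r add0r; exact: gx.
Qed.

Lemma is_derive_at0P (F : R -> R) (d : R) :
  is_derive (0 : R) 1 F d <-> (fun h => h^-1 * (F h - F 0)) @ 0^' --> d.
Proof.
have E : (fun h : R => h^-1 *: ((F \o shift 0) (h *: (1 : R)) - F 0)) =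
    (fun h => h^-1 * (F h - F 0)).
  by apply/funext => h /=; rewrite addr0 [_%:A]mulr1.
split=> [[dF <-]|H].
  by move: dF; rewrite /derivable /derive E.
apply: DeriveDef; first by rewrite /derivable E; apply/cvg_ex; exists d.
by rewrite /derive E; exact/cvg_lim.
Qed.

Lemma is_derive_line_at f (x v : V) (t d : R) :
  is_derive (t *: v + x) v f d ->
  is_derive t 1 (fun h : R => f (h *: v + x)) d.
Proof.
move=> /is_derive_line H.
have -> : (fun h : R => f (h *: v + x)) =
    (fun h : R => f (h *: v + (t *: v + x))) \o (fun s => s - t).
  by apply/funext => h /=; rewrite addrA -scalerDl subrK.
rewrite -[d]mulr1; apply: is_derive1_comp; first by rewrite subrr; exact: H.
by apply: is_derive_eq; rewrite subr0.
Qed.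

Lemma mvt_line f (x v : V) (a b : R) :
  (forall t, derivable f (t *: v + x) v) -> a <= b ->
  exists2 c, a <= c <= b &
    f (b *: v + x) - f (a *: v + x) = 'D_v f (c *: v + x) * (b - a).
Proof.
move=> df ab.
have der (t : R) : is_derive t 1 (fun h : R => f (h *: v + x)) ('D_v f (t *: v + x)).
  exact/is_derive_line_at/derivableP/df.
have [c cab ->] := @MVT_segment R _ (fun t => 'D_v f (t *: v + x)) a b ab
    (fun t _ => der t)
    (@derivable_within_continuous _ _ _ `[a, b] (fun t _ => @ex_derive _ _ _ _ _ _ _ (der t))).
by exists c => //; move: cab; rewrite in_itv.
Qed.

Lemma mvt_line_abs f (x v : V) (t : R) :
  (forall y, derivable f y v) ->
  exists2 c, `|c| <= `|t| &
    f (t *: v + x) - f x = 'D_v f (c *: v + x) * t.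
Proof.
move=> df; have [t0|t0] := leP 0 t.
  have [c /andP[c0 ct] E] := @mvt_line f x v 0 t (fun s => df _) t0.
  exists c; first by rewrite !ger0_norm.
  by move: E; rewrite scale0r add0r subr0.
have [c /andP[c0 ct] E] := @mvt_line f x v t 0 (fun s => df _) (ltW t0).
exists c; first by rewrite !ler0_norm ?lerN2// ltW.
by rewrite -opprB -[X in f X - _]add0r -(scale0r v) E sub0r mulrN opprK.
Qed.

(* No differentiability beyond the two partial derivatives is needed: the
   increment is split along the two directions. *)
Lemma is_derive_curve f (x v w : V) (eta : R -> R) (deta : R) :
  (forall y, derivable f y w) -> {for x, continuous ('D_w f)} ->
  derivable f x v -> eta 0 = 0 -> is_derive (0 : R) 1 eta deta ->
  is_derive (0 : R) 1 (fun h : R => f (h *: v + eta h *: w + x))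
    ('D_v f x + 'D_w f x * deta).
Proof.
move=> dw cw dv eta0 deta1.
pose y h := h *: v + x.
have /choice[c cP] : forall h, exists c, `|c| <= `|eta h| /\
    f (eta h *: w + y h) - f (y h) = 'D_w f (c *: w + y h) * eta h.
  by move=> h; have [c ? ?] := mvt_line_abs (y h) (eta h) dw; exists c.
have ceta : eta h @[h --> (0 : R)] --> (0 : R).
  rewrite -[X in _ --> X]eta0; apply: differentiable_continuous.
  by apply/derivable1_diffP; exact: ex_derive.
have cc : c h @[h --> (0 : R)] --> (0 : R).
  apply/norm_cvg0P.
  apply: (@squeeze_cvgr _ _ _ _ (cst 0) (fun h => `|eta h|)).
  - by apply: nearW => h; rewrite normr_ge0/=; case: (cP h).
  - exact: cvg_cst.
  - exact/norm_cvg0P.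
have cy : (c h *: w + y h) @[h --> (0 : R)] --> x.
  have -> : nbhs x = nbhs (0 *: w + (0 *: v + x)) by rewrite !scale0r !add0r.
  apply: cvgD; first by apply: cvgZr_tmp.
  by apply: cvgD; [apply: cvgZr_tmp; exact: cvg_id | exact: cvg_cst].
move: dv => /derivableP/is_derive_line/is_derive_at0P dv.
move: deta1 => /is_derive_at0P; rewrite eta0 => deta1.
apply/is_derive_at0P; rewrite eta0 !scale0r !add0r.
apply: (@cvg_trans _ ((h^-1 * (f (h *: v + x) - f (0 *: v + x)) +
   'D_w f (c h *: w + y h) * (h^-1 * (eta h - 0))) @[h --> 0^'])).
  apply: near_eq_cvg; apply: nearW => h /=.
  have [_] := cP h; rewrite /y scale0r add0r subr0 => E.
  rewrite mulrCA -E -mulrDr; congr (_ * _).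
  by rewrite addrC addrA subrK addrCA addrA.
apply: cvgD; first exact: dv.
apply: cvgM; last exact: deta1.
apply: (@cvg_comp _ _ _ (fun h => c h *: w + y h) ('D_w f) (0^') (nbhs x)).
  apply: cvg_trans cy; apply: cvg_app; exact: nbhs_dnbhs.
exact: cw.
Qed.

End partial_derivatives.

Lemma is_derive_val (K : numFieldType) (V W : normedModType K) (f : V -> W)
  x v d : is_derive x v f d -> 'D_v f x = d.
Proof. by case. Qed.

Lemma is_derive_ex (K : numFieldType) (V W : normedModType K) (f : V -> W)
  x v d : is_derive x v f d -> derivable f x v.
Proof. by case. Qed.

Section smooth_algebra.
Context (R : realType) (n : nat).
Local Notation V := 'rV[R]_n.
Local Notation e_ i := (delta_mx ord0 i : V).
Implicit Types (f g : V -> R).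

Definition C1 f := continuous f /\
  forall i, (forall x, derivable f x (e_ i)) /\ continuous (pderiv i f).

Lemma pderivs_rcons s i f : pderivs (rcons s i) f = pderivs s (pderiv i f).
Proof. by elim: s => //= j s ->. Qed.

Lemma smooth_pderiv i f : smooth f -> smooth (pderiv i f).
Proof. by move=> sf s; rewrite -pderivs_rcons; exact: sf. Qed.

Lemma smooth_continuous f : smooth f -> continuous f.
Proof. by move=> sf; have [] := sf [::]. Qed.

Lemma smooth_derivable f i x : smooth f -> derivable f x (e_ i).
Proof. by move=> sf; have [_] := sf [::]; exact. Qed.

Lemma smooth_C1 f : smooth f -> C1 f.
Proof.
move=> sf; split; first exact: smooth_continuous.
move=> i; split; first by move=> x; exact: smooth_derivable.
exact/smooth_continuous/smooth_pderiv.
Qed.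

(** Spares inductions on the list of indices in [smooth], where the function changes at every step:
    smoothness becomes coinductive, and a proof only has to exhibit a class stable under
    differentiation. *)
Lemma smooth_coind (C : (V -> R) -> Prop) :
  (forall f, C f -> continuous f /\
     forall i, (forall x, derivable f x (e_ i)) /\ C (pderiv i f)) ->
  forall f, C f -> smooth f.
Proof.
move=> HC f Cf s.
suff : C (pderivs s f) by move=> /HC[cf df]; split=> // i; case: (df i).
by elim: s => //= i s /HC[_] /(_ i)[].
Qed.

(** The derivatives of a reciprocal, a square root or a composite are polynomials in functions of
    the same kind. Closing a class of generators under sums and products gives a class stable under
    differentiation as soon as the derivatives of the generators stay in it. *)
Inductive alg (G : (V -> R) -> Prop) : (V -> R) -> Prop :=
| alg_gen f : G f -> alg G f
| alg_add f g : alg G f -> alg G g -> alg G (fun x => f x + g x)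
| alg_mul f g : alg G f -> alg G g -> alg G (fun x => f x * g x).

Lemma is_deriveMx f g (x v : V) (df dg : R) :
  is_derive x v f df -> is_derive x v g dg ->
  is_derive x v (fun y => f y * g y) (f x * dg + g x * df).
Proof. by move=> ? ?; exact: is_deriveM. Qed.

Lemma is_deriveDx f g (x v : V) (df dg : R) :
  is_derive x v f df -> is_derive x v g dg ->
  is_derive x v (fun y => f y + g y) (df + dg).
Proof. by move=> ? ?; exact: is_deriveD. Qed.

Lemma pderivM f g i (x : V) : derivable f x (e_ i) -> derivable g x (e_ i) ->
  pderiv i (fun y => f y * g y) x = f x * pderiv i g x + g x * pderiv i f x.
Proof.
move=> /derivableP df /derivableP dg.
exact: is_derive_val (is_deriveMx df dg).
Qed.

Lemma pderivD f g i (x : V) : derivable f x (e_ i) -> derivable g x (e_ i) ->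
  pderiv i (fun y => f y + g y) x = pderiv i f x + pderiv i g x.
Proof.
move=> /derivableP df /derivableP dg.
exact: is_derive_val (is_deriveDx df dg).
Qed.

Lemma alg_smooth (G : (V -> R) -> Prop) :
  (forall f, G f -> continuous f /\
     forall i, (forall x, derivable f x (e_ i)) /\ alg G (pderiv i f)) ->
  forall f, alg G f -> smooth f.
Proof.
move=> HG; apply: smooth_coind => f; elim => {f}.
- by move=> f /HG.
- move=> f g Af [cf df] Ag [cg dg]; split.
    by move=> x; exact: (cvgD (cf x) (cg x)).
  move=> i; have [dfi Afi] := df i; have [dgi Agi] := dg i; split.
    by move=> x; exact: derivableD.
  rewrite (_ : pderiv i _ = fun x => pderiv i f x + pderiv i g x).
    exact: alg_add.
  by apply/funext => x; exact: pderivD.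
- move=> f g Af [cf df] Ag [cg dg]; split.
    by move=> x; exact: (cvgM (cf x) (cg x)).
  move=> i; have [dfi Afi] := df i; have [dgi Agi] := dg i; split.
    by move=> x; exact: derivableM.
  rewrite (_ : pderiv i _ = fun x => f x * pderiv i g x + g x * pderiv i f x).
    by apply: alg_add; apply: alg_mul.
  by apply/funext => x; exact: pderivM.
Qed.

Let smooth_gen f : smooth f -> continuous f /\
     forall i, (forall x, derivable f x (e_ i)) /\ alg (@smooth R n) (pderiv i f).
Proof.
move=> sf; split; first exact: smooth_continuous.
move=> i; split; first by move=> x; exact: smooth_derivable.
exact/alg_gen/smooth_pderiv.
Qed.

Lemma smoothD f g : smooth f -> smooth g -> smooth (fun x => f x + g x).
Proof.
by move=> sf sg; apply: (alg_smooth smooth_gen); apply: alg_add; exact: alg_gen.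
Qed.

Lemma smoothM f g : smooth f -> smooth g -> smooth (fun x => f x * g x).
Proof.
by move=> sf sg; apply: (alg_smooth smooth_gen); apply: alg_mul; exact: alg_gen.
Qed.

Lemma pderiv_cst (c : R) i : pderiv i (fun _ : V => c) = fun=> 0.
Proof. by apply/funext => x; exact: derive_cst. Qed.

Lemma smooth_cst (c : R) : smooth (fun _ : V => c).
Proof.
apply: (@smooth_coind (fun f => exists c, f = fun=> c)); last by exists c.
move=> _ [{}c ->]; split; first exact: cst_continuous.
move=> i; split; first by move=> x; exact: derivable_cst.
by exists 0; exact: pderiv_cst.
Qed.

Lemma smoothN f : smooth f -> smooth (fun x => - f x).
Proof.
move=> sf; rewrite (_ : (fun x => _) = (fun x => (-1) * f x)).
  exact: (smoothM (smooth_cst _) sf).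
by apply/funext => x; rewrite mulN1r.
Qed.

Lemma smoothB f g : smooth f -> smooth g -> smooth (fun x => f x - g x).
Proof. by move=> sf sg; exact: (smoothD sf (smoothN sg)). Qed.

Lemma smooth_sum (I : Type) (r : seq I) (P : pred I) (F : I -> V -> R) :
  (forall i, smooth (F i)) -> smooth (fun x => \sum_(i <- r | P i) F i x).
Proof.
move=> sF; elim: r => [|a r IH].
  rewrite (_ : (fun x => _) = fun=> 0); first exact: smooth_cst.
  by apply/funext => x; rewrite big_nil.
rewrite (_ : (fun x => _) = if P a then
  (fun x => F a x + \sum_(i <- r | P i) F i x) else
  (fun x => \sum_(i <- r | P i) F i x)); first by case: (P a); [exact: (smoothD (sF a) IH)|exact: IH].
by apply/funext => x; rewrite big_cons; case: (P a).
Qed.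

Lemma smooth_prod (I : Type) (r : seq I) (P : pred I) (F : I -> V -> R) :
  (forall i, smooth (F i)) -> smooth (fun x => \prod_(i <- r | P i) F i x).
Proof.
move=> sF; elim: r => [|a r IH].
  rewrite (_ : (fun x => _) = fun=> 1); first exact: smooth_cst.
  by apply/funext => x; rewrite big_nil.
rewrite (_ : (fun x => _) = if P a then
  (fun x => F a x * \prod_(i <- r | P i) F i x) else
  (fun x => \prod_(i <- r | P i) F i x)); first by case: (P a); [exact: (smoothM (sF a) IH)|exact: IH].
by apply/funext => x; rewrite big_cons; case: (P a).
Qed.

Lemma is_derive_coord (k : 'I_n) (x v : V) :
  is_derive x v (fun y : V => y ord0 k) (v ord0 k).
Proof.
apply/is_derive_line.
rewrite (_ : (fun h => _) = (fun h : R => h * v ord0 k + x ord0 k)).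
  by apply: is_derive_eq; rewrite scaler0 add0r addr0 [_%:A]mulr1.
by apply/funext => h; rewrite !mxE.
Qed.

Lemma smooth_coord (k : 'I_n) : smooth (fun y : V => y ord0 k).
Proof.
apply: (@smooth_coind (fun f => f = (fun y : V => y ord0 k) \/ smooth f)); last by left.
move=> f [->|sf].
  split; first exact: continuous_coord.
  move=> i; split; first by move=> x; exact: is_derive_ex (is_derive_coord k x _).
  right; rewrite (_ : pderiv _ _ = fun=> (e_ i) ord0 k); first exact: smooth_cst.
  by apply/funext => x; exact: is_derive_val (is_derive_coord k x _).
split; first exact: smooth_continuous.
move=> i; split; first by move=> x; exact: smooth_derivable.
by right; exact: smooth_pderiv.
Qed.

(** [gs] lists the successive derivatives of the outer function, so that all the [gs k \o f],
    together with the smooth functions, generate an algebra stable under differentiation. *)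
Lemma smooth_comp (gs : nat -> R -> R) f :
  (forall k (t : R), is_derive t 1 (gs k) (gs k.+1 t)) ->
  smooth f -> smooth (gs 0%N \o f).
Proof.
move=> dgs sf.
pose G g := smooth g \/ exists k, g = gs k \o f.
apply: (@alg_smooth G); last by apply: alg_gen; right; exists 0%N.
move=> g [sg|[k ->]].
  split; first exact: smooth_continuous.
  move=> i; split; first by move=> x; exact: smooth_derivable.
  by apply: alg_gen; left; exact: smooth_pderiv.
split.
  move=> x; apply: continuous_comp; first exact: smooth_continuous.
  by apply: differentiable_continuous; apply/derivable1_diffP; exact: ex_derive.
have D i x : is_derive x (e_ i) (gs k \o f) (gs k.+1 (f x) * pderiv i f x).
  by apply: (is_derive_compl _ (dgs k _)); apply: derivableP; exact: smooth_derivable.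
move=> i; split; first by move=> x; exact: is_derive_ex (D i x).
rewrite (_ : pderiv _ _ = fun x => gs k.+1 (f x) * pderiv i f x).
  apply: alg_mul; apply: alg_gen; first by right; exists k.+1.
  by left; exact: smooth_pderiv.
by apply/funext => x; exact: is_derive_val (D i x).
Qed.

Lemma smoothV f : smooth f -> (forall x, f x != 0) -> smooth (fun x => (f x)^-1).
Proof.
move=> sf f0; pose G g := smooth g \/ g = (fun x => (f x)^-1).
apply: (@alg_smooth G); last by apply: alg_gen; right.
move=> g [sg|->].
  split; first exact: smooth_continuous.
  move=> i; split; first by move=> x; exact: smooth_derivable.
  by apply: alg_gen; left; exact: smooth_pderiv.
split.
  by move=> x; exact: (cvgV (f0 x) (@smooth_continuous f sf x)).
move=> i; split; first by move=> x; apply: derivableV => //; exact: smooth_derivable.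
rewrite (_ : pderiv _ _ = fun x => (- pderiv i f x * (f x)^-1) * (f x)^-1).
  apply: alg_mul; last by apply: alg_gen; right.
  apply: alg_mul; last by apply: alg_gen; right.
  by apply: alg_gen; left; apply: smoothN; exact: smooth_pderiv.
apply/funext => x; rewrite /pderiv deriveV//; last exact: smooth_derivable.
by rewrite /GRing.scale/= -exprVn; ring.
Qed.

Lemma smooth_sqrt f : smooth f -> (forall x, 0 < f x) ->
  smooth (fun x => Num.sqrt (f x)).
Proof.
move=> sf f0.
pose G g := smooth g \/ g = (fun x => Num.sqrt (f x)).
apply: (@alg_smooth G); last by apply: alg_gen; right.
have sV : smooth (fun x => (f x)^-1) by apply: (smoothV sf) => x; rewrite gt_eqF.
move=> g [sg|->].
  split; first exact: smooth_continuous.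
  move=> i; split; first by move=> x; exact: smooth_derivable.
  by apply: alg_gen; left; exact: smooth_pderiv.
have D i x : is_derive x (e_ i) (Num.sqrt \o f) ((2 * Num.sqrt (f x))^-1 * pderiv i f x).
  apply: is_derive_compl; first by apply: derivableP; exact: smooth_derivable.
  exact: is_derive1_sqrt.
split.
  by move=> x; apply: continuous_comp; [exact: smooth_continuous|exact: sqrt_continuous].
move=> i; split; first by move=> x; exact: is_derive_ex (D i x).
(* The factor [1 / sqrt f] is written [sqrt f / f]: the derivative is then a smooth function times
   the generator [sqrt f], and no new generator appears. *)
rewrite (_ : pderiv _ _ = fun x => (2^-1 * pderiv i f x * (f x)^-1) * Num.sqrt (f x)).
  apply: alg_mul; last by apply: alg_gen; right.
  apply: alg_gen; left; apply: (smoothM _ sV); apply: (smoothM (smooth_cst _)).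
  exact: smooth_pderiv.
apply/funext => x; rewrite /pderiv (is_derive_val (D i x)).
have s0 : 0 < Num.sqrt (f x) by rewrite sqrtr_gt0.
have -> : (f x)^-1 = (Num.sqrt (f x) ^+ 2)^-1 by rewrite sqr_sqrtr// ltW.
by rewrite /pderiv; field; rewrite gt_eqF.
Qed.

End smooth_algebra.

(** * Smooth cut-off functions *)

Section flat_function.
Context {R : realType}.
Implicit Types (P : {poly R}) (s : R).

(** The functions [P(1/s) exp(-1/s)], continued by 0 to [s <= 0], form a family stable under
    differentiation; the polynomial in [1/s] records the effect of the derivatives. *)
Definition flat P s : R := if 0 < s then P.[s^-1] * expR (- s^-1) else 0.

Lemma flat_le0 P s : s <= 0 -> flat P s = 0.
Proof. by rewrite /flat ltNge => ->. Qed.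

Let expRNX_le (y : R) k : 0 < y -> y ^+ k * expR (- y) <= k`!%:R.
Proof.
move=> y0; case: k => [|k].
  by rewrite expr0 mul1r fact0 expR_le1 oppr_le0 ltW.
rewrite expRN ler_pdivrMr ?expR_gt0// -ler_pdivrMl ?ltr0n ?fact_gt0//.
by rewrite mulrC (le_trans _ (expR_ge1Dxn k (ltW y0)))// lerDr.
Qed.

Lemma flat_bounded P : exists2 C : R, 0 <= C & forall s, `|flat P s| <= C.
Proof.
exists (\sum_(i < size P) `|P`_i| * (i`!)%:R).
  by apply: sumr_ge0 => i _; rewrite mulr_ge0.
move=> s; rewrite /flat; case: ifPn => [s0|_].
  rewrite horner_coef mulr_suml; apply: (le_trans (ler_norm_sum _ _ _)).
  apply: ler_sum => i _; rewrite -mulrA normrM ler_wpM2l//.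
  rewrite ger0_norm ?expRNX_le ?invr_gt0//.
  by rewrite mulr_ge0 ?expR_ge0// exprn_ge0// invr_ge0 ltW.
by rewrite normr0 sumr_ge0// => i _; rewrite mulr_ge0.
Qed.

(** Applied to ['X * P], the uniform bound of [flat_bounded] gains a factor [1/s]. *)
Lemma flat_linear P : exists2 C : R, 0 <= C & forall s, `|flat P s| <= C * `|s|.
Proof.
have [C C0 HC] := flat_bounded ('X * P).
exists C => // s; have [s0|s0] := leP s 0; first by rewrite flat_le0// normr0 mulr_ge0.
have := HC s; rewrite /flat s0 hornerM hornerX -mulrA normrM.
by rewrite normfV (gtr0_norm s0) mulrC ler_pdivrMr.
Qed.

Lemma is_derive_flat P s : is_derive s 1 (flat P) (flat ('X^2 * (P - P^`())) s).
Proof.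
have [s0|s0|->] := ltgtP s 0.
- rewrite flat_le0 ?ltW//; apply: (@near_eq_is_derive _ _ _ (cst 0)).
    near=> t; rewrite flat_le0//; apply: ltW; near: t; exact: lt_nbhsl.
- apply: (@near_eq_is_derive _ _ _ (fun t : R => P.[t^-1] * expR (- t^-1))).
    by near=> t; rewrite /flat ifT//; near: t; exact: lt_nbhsr.
  have sn0 : s != 0 by rewrite gt_eqF.
  have D1 : is_derive s 1 (fun t : R => t^-1) (- (s ^- 2)).
    have := @is_deriveV R id s 1 1 sn0 (is_derive_id s 1).
    by rewrite [_ *: _]mulr1.
  have D2 : is_derive s 1 (fun t : R => P.[t^-1]) (P^`().[s^-1] * (- (s ^- 2))).
    by apply: (@is_derive1_comp _ (horner P) (fun t : R => t^-1)).
  have D3 : is_derive s 1 (fun t : R => expR (- t^-1)) (expR (- s^-1) * (s ^- 2)).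
    apply: (@is_derive1_comp _ expR (fun t : R => - t^-1)).
    by apply: is_derive_eq; rewrite opprK.
  apply: is_derive_eq (is_deriveM D2 D3) _.
  rewrite /flat s0 hornerM hornerD hornerN hornerXn /GRing.scale/=.
  by rewrite -exprVn; ring.
(* At the origin the difference quotient of [flat P] is itself [flat ('X * P)], which is O(|h|) and
   so tends to 0. *)
- rewrite flat_le0//; apply/is_derive_at0P.
  have [C C0 HC] := flat_linear ('X * P).
  rewrite flat_le0//; apply/norm_cvg0P.
  apply: (@squeeze_cvgr _ _ _ _ (cst 0) (fun h => C * `|h|)).
  + near=> h; rewrite normr_ge0/= subr0.
    apply: le_trans (HC h); rewrite le_eqVlt; apply/orP; left; apply/eqP; congr (`|_|).
    rewrite /flat; case: ifP => h0; last by rewrite mulr0.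
    by rewrite hornerM hornerX mulrA.
  + exact: cvg_cst.
  + have -> : nbhs (0 : R) = nbhs (C * `|0 : R|) by rewrite normr0 mulr0.
    apply: cvgM; first exact: cvg_cst.
    by apply: cvg_norm; exact: nbhs_dnbhs.
Unshelve. all: by end_near.
Qed.

Definition theta : R -> R := flat 1.

Lemma theta_gt0 s : 0 < s -> 0 < theta s.
Proof. by move=> s0; rewrite /theta /flat s0 hornerC mul1r expR_gt0. Qed.

Lemma theta_le0 s : s <= 0 -> theta s = 0.
Proof. exact: flat_le0. Qed.

Lemma theta_ge0 s : 0 <= theta s.
Proof.
by have [/theta_le0 ->//|/theta_gt0/ltW] := leP s 0.
Qed.

Lemma theta_le1 s : theta s <= 1.
Proof.
rewrite /theta /flat; case: ifP => // s0.
by rewrite hornerC mul1r expR_le1 oppr_le0 invr_ge0 ltW.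
Qed.

Definition theta' : R -> R := flat ('X^2).

Lemma is_derive_theta s : is_derive s 1 theta (theta' s).
Proof.
have := is_derive_flat 1 s.
by rewrite derivC subr0 mulr1.
Qed.

Lemma theta'_ge0 s : 0 <= theta' s.
Proof.
rewrite /theta' /flat; case: ifP => // s0.
by rewrite mulr_ge0 ?expR_ge0// hornerXn exprn_ge0// invr_ge0 ltW.
Qed.

Fixpoint flat_iter (k : nat) : {poly R} :=
  if k is k'.+1 then 'X^2 * (flat_iter k' - (flat_iter k')^`()) else 1.

Lemma is_derive_flat_iter k s :
  is_derive s 1 (flat (flat_iter k)) (flat (flat_iter k.+1) s).
Proof. exact: is_derive_flat. Qed.

Lemma smooth_theta n (f : 'rV[R]_n -> R) : smooth f -> smooth (theta \o f).
Proof.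
by move=> sf; apply: (@smooth_comp R n (fun k => flat (flat_iter k)) f is_derive_flat_iter sf).
Qed.

Lemma continuous_theta : continuous theta.
Proof.
move=> s; apply: differentiable_continuous; apply/derivable1_diffP.
exact: is_derive_ex (is_derive_theta s).
Qed.

Lemma continuous_theta' : continuous theta'.
Proof.
move=> s; apply: differentiable_continuous; apply/derivable1_diffP.
exact: is_derive_ex (is_derive_flat _ s).
Qed.

(** For positive [s] the distance to 1 is [1 - exp(-1/(k s)) <= 1/(k s)]. With this, rescaled
    [theta] approximates the indicators of open boxes and of the sides of a chart. *)
Lemma theta_scale_cvg s :
  theta (k%:R * s) @[k --> \oo] --> ((0 < s)%R%:R : R).
Proof.
have [s0|s0] := leP s 0.
  rewrite (_ : (fun _ => _) = cst 0); first exact: cvg_cst.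
  by apply/funext => k; rewrite theta_le0// mulr_ge0_le0.
apply/cvgrPdist_le => /= e e0.
near=> k.
have k0 : 0 < k%:R :> R by rewrite ltr0n; near: k; exists 1%N.
rewrite ger0_norm ?subr_ge0 ?theta_le1// /theta /flat mulr_gt0// hornerC mul1r.
rewrite lerBlDr -lerBlDl; apply: le_trans (expR_ge1Dx _).
rewrite lerD2l lerN2 invfM ler_pdivrMr// -[leRHS]invrK.
rewrite lef_pV2 ?posrE ?invr_gt0 ?mulr_gt0//.
near: k; exact: nbhs_infty_ger.
Unshelve. all: by end_near.
Qed.

End flat_function.

Section boxes.
Context {R : realType} {n : nat}.
Local Notation V := 'rV[R]_n.
Implicit Types (a b x : V) (k : nat).

Definition open_box a b : set V :=
  [set x | forall i, a ord0 i < x ord0 i < b ord0 i].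
Definition closed_box a b : set V :=
  [set x | forall i, a ord0 i <= x ord0 i <= b ord0 i].

Lemma open_closed_box a b : open_box a b `<=` closed_box a b.
Proof. by move=> x abx i; have /andP[/ltW-> /ltW->] := abx i. Qed.

Lemma compact_closed_box a b : compact (closed_box a b).
Proof.
have := @rV_compact R n (fun i => `[a ord0 i, b ord0 i]%classic)
  (fun i => @segment_compact R _ _).
congr (compact _); apply/seteqP; split=> x /= H i; by have := H i; rewrite /= in_itv.
Qed.

Lemma closed_closed_box a b : closed (closed_box a b).
Proof. apply: compact_closed; [exact: norm_hausdorff|exact: compact_closed_box]. Qed.

Lemma open_open_box a b : open (open_box a b).
Proof.
rewrite openE => x abx; rewrite /interior.
suff : \forall y \near x, forall i, a ord0 i < (y : V) ord0 i < b ord0 i by [].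
apply: (@filter_forall V _ (fun i (y : V) => a ord0 i < y ord0 i < b ord0 i) (nbhs x)) => i; have /andP[ax xb] := abx i.
have c := @continuous_coord R n i x.
near=> y; apply/andP; split; near: y.
  by apply: (c [set t | a ord0 i < t]); exact: lt_nbhsr.
by apply: (c [set t | t < b ord0 i]); exact: lt_nbhsl.
Unshelve. all: by end_near.
Qed.

Lemma normrV_lt x (r : R) : 0 < r -> (`|x| < r) = [forall i, `|x ord0 i| < r].
Proof.
move=> r0; apply/idP/forallP => [xr i|H].
  apply: le_lt_trans xr; rewrite [leRHS]mx_normrE.
  by apply: (@le_bigmax_cond _ _ _ _ (ord0, i) xpredT (fun ij => `|x ij.1 ij.2|)).
rewrite [ltLHS]mx_normrE; apply/bigmax_ltP; split=> // -[j i] _ /=.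
by rewrite ord1.
Qed.

Lemma normrV_le x (r : R) : 0 <= r -> (`|x| <= r) = [forall i, `|x ord0 i| <= r].
Proof.
move=> r0; apply/idP/forallP => [xr i|H].
  apply: le_trans xr; rewrite [leRHS]mx_normrE.
  by apply: (@le_bigmax_cond _ _ _ _ (ord0, i) xpredT (fun ij => `|x ij.1 ij.2|)).
rewrite [leLHS]mx_normrE; apply/bigmax_leP; split=> // -[j i] _ /=.
by rewrite ord1.
Qed.

Lemma coord_le_norm x i : `|x ord0 i| <= `|x|.
Proof. by have := lexx `|x|; rewrite {1}normrV_le// => /forallP. Qed.

Lemma nbhs_box (A : set V) x : nbhs x A -> exists2 r : R, 0 < r &
  closed_box (x - const_mx r) (x + const_mx r) `<=` A.
Proof.
move=> /nbhs_ballP[e /= e0 sA]; exists (e / 2) => [|y Hy]; first by rewrite divr_gt0.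
apply: sA; rewrite -ball_normE /ball_/= normrV_lt//; apply/forallP => i.
have := Hy i; rewrite !mxE => /andP[h1 h2]; rewrite ltr_norml; apply/andP; split; lra.
Qed.

(** The parameter has two uses: [k = 1] gives the functions of the partition of unity, and as [k]
    grows the bumps tend to the indicator of the open box. *)
Definition box_bump a b k x : R :=
  \prod_i (theta (k%:R * (x ord0 i - a ord0 i)) * theta (k%:R * (b ord0 i - x ord0 i))).

Lemma bump_ge0 a b k x : 0 <= box_bump a b k x.
Proof. by apply: prodr_ge0 => i _; rewrite mulr_ge0// theta_ge0. Qed.

Lemma bump_le1 a b k x : box_bump a b k x <= 1.
Proof.
rewrite /box_bump; apply: prodr_ile1 => i.
by rewrite mulr_ge0 ?theta_ge0//= mulr_ile1 ?theta_ge0 ?theta_le1.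
Qed.

Lemma bump_gt0 a b k x : (0 < k)%N -> open_box a b x -> 0 < box_bump a b k x.
Proof.
move=> k0 abx; apply: prodr_gt0 => i _; have /andP[ax xb] := abx i.
by rewrite mulr_gt0// theta_gt0// mulr_gt0 ?ltr0n// subr_gt0.
Qed.

Lemma bump_eq0 a b k x : ~ open_box a b x -> box_bump a b k x = 0.
Proof.
move=> /existsNP[i /negP]; rewrite negb_and -!leNgt => H.
rewrite /box_bump (bigD1 i)//=; case/orP: H => H.
  by rewrite theta_le0 ?mul0r// mulr_ge0_le0// subr_le0.
by rewrite (@theta_le0 R (_ * (b _ _ - _))) ?mulr0 ?mul0r// mulr_ge0_le0// subr_le0.
Qed.

Lemma smooth_bump a b k : smooth (box_bump a b k).
Proof.
apply: smooth_prod => i; apply: smoothM.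
  apply: (@smooth_theta R n (fun x => k%:R * (x ord0 i - a ord0 i))).
  apply: (smoothM (smooth_cst _)); by apply: smoothB; [exact: smooth_coord|exact: smooth_cst].
apply: (@smooth_theta R n (fun x => k%:R * (b ord0 i - x ord0 i))).
apply: (smoothM (smooth_cst _)); by apply: smoothB; [exact: smooth_cst|exact: smooth_coord].
Qed.

Lemma cvg_prodR (I : Type) (r : seq I) (P : pred I) (F : I -> nat -> R) (l : I -> R) :
  (forall i, F i k @[k --> \oo] --> l i) ->
  \prod_(i <- r | P i) F i k @[k --> \oo] --> \prod_(i <- r | P i) l i.
Proof.
move=> H; elim: r => [|i r IH].
  by under eq_fun do rewrite big_nil; rewrite big_nil; exact: cvg_cst.
under eq_fun do rewrite big_cons; rewrite big_cons; case: (P i) => //.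
exact: cvgM (H i) IH.
Qed.

Lemma bump_cvg a b x : box_bump a b k x @[k --> \oo] --> (\1_(open_box a b) x : R).
Proof.
rewrite indicE.
have -> : (x \in open_box a b)%:R = \prod_(i < n)
    ((0 < x ord0 i - a ord0 i)%R%:R * (0 < b ord0 i - x ord0 i)%R%:R) :> R.
  have [/set_mem H|/negP H] := boolP (x \in open_box a b).
    by rewrite big1// => i _; have /andP[h1 h2] := H i; rewrite !subr_gt0 h1 h2 mulr1.
  have /existsNP[i /negP] : ~ open_box a b x by move=> ?; apply: H; exact/mem_set.
  rewrite (bigD1 i)//= !subr_gt0 negb_and => /orP[/negPf->|/negPf->].
    by rewrite !mul0r.
  by rewrite mulr0 mul0r.
by apply: cvg_prodR => i; apply: cvgM; exact: theta_scale_cvg.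
Qed.

Lemma test_functionP (U K : set V) (f : V -> R) : smooth f -> compact K ->
  (forall x, f x != 0 -> K x) -> K `<=` U -> test_function U f.
Proof.
move=> sf cK fK KU.
have sK : closure [set x | f x != 0] `<=` K.
  have /closure_id-> : closed K by apply: compact_closed cK; exact: norm_hausdorff.
  exact: closure_subset.
split=> //; last exact: subset_trans sK KU.
exact: subclosed_compact (@closed_closure _ _) cK sK.
Qed.

Lemma test_bump (U : set V) a b k : closed_box a b `<=` U -> test_function U (box_bump a b k).
Proof.
apply: test_functionP; [exact: smooth_bump|exact: compact_closed_box|].
move=> x /eqP nz; apply: open_closed_box; apply: contrapT => H; apply: nz; exact: bump_eq0.
Qed.

Lemma test_functionM (U : set V) (f g : V -> R) :
  test_function U f -> smooth g -> test_function U (fun x => g x * f x).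
Proof.
move=> [sf cf fU] sg; apply: (test_functionP (smoothM sg sf) cf) => // x nz.
by apply: subset_closure => /=; apply: contraNN nz => /eqP ->; rewrite mulr0.
Qed.

End boxes.

Section insertion.
Context {R : realType} {n : nat}.
Implicit Types (i : 'I_n) (x : 'rV[R]_n) (y : 'rV[R]_n.-1).

Lemma insert_rV_same i (t : R) y : insert_rV i t y ord0 i = t.
Proof. by rewrite mxE unlift_none. Qed.

Lemma insert_rV_lift i (t : R) y (j : 'I_n.-1) :
  insert_rV i t y ord0 (lift i j) = y ord0 j.
Proof. by rewrite mxE liftK. Qed.

Lemma col'_insert_rV i (t : R) y : col' i (insert_rV i t y) = y.
Proof. by apply/rowP => j; rewrite mxE insert_rV_lift. Qed.

Lemma insert_rV_col' i x : insert_rV i (x ord0 i) (col' i x) = x.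
Proof.
apply/rowP => j; have [k ->|->] := unliftP i j; last by rewrite insert_rV_same.
by rewrite insert_rV_lift mxE.
Qed.

Lemma insert_rVDl i (s t : R) y :
  insert_rV i (s + t) y = s *: delta_mx ord0 i + insert_rV i t y.
Proof.
apply/rowP => j; rewrite !mxE; have [k ->|->] := unliftP i j.
  by rewrite ?liftK ?unlift_none /= [lift i k == i]eq_sym (negPf (neq_lift _ _)) ?andbF mulr0 add0r.
by rewrite ?unlift_none /= eqxx mulr1.
Qed.

Lemma insert_rVDr i (t h : R) (j : 'I_n.-1) y :
  insert_rV i t (h *: delta_mx ord0 j + y) =
  h *: delta_mx ord0 (lift i j) + insert_rV i t y.
Proof.
apply/rowP => l; rewrite !mxE; have [k ->|->] := unliftP i l.
  by rewrite ?liftK /= !mxE (inj_eq (@lift_inj _ i)).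
by rewrite ?unlift_none /= (negPf (neq_lift _ _)) ?andbF mulr0 add0r.
Qed.

Lemma continuous_insert_rV (T : topologicalType) i (f : T -> R) (g : T -> 'rV[R]_n.-1) (p : T) :
  {for p, continuous f} -> {for p, continuous g} ->
  {for p, continuous (fun q => insert_rV i (f q) (g q))}.
Proof.
move=> cf cg; apply: continuous_rV => j; have [k ->|->] := unliftP i j.
  rewrite (_ : (fun t => _) = (fun t => g t ord0 k)).
    by apply: (@continuous_comp _ _ _ g (fun y : 'rV[R]_n.-1 => y ord0 k)) => //; exact: continuous_coord.
  by apply/funext => t; rewrite insert_rV_lift.
rewrite (_ : (fun t => _) = f)//.
by apply/funext => t; rewrite insert_rV_same.
Qed.

Lemma is_derive_insert_same (f : 'rV[R]_n -> R) i (t : R) y d :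
  is_derive (insert_rV i t y) (delta_mx ord0 i) f d ->
  is_derive t 1 (fun s : R => f (insert_rV i s y)) d.
Proof.
have E s : insert_rV i s y = s *: delta_mx ord0 i + insert_rV i 0 y.
  by rewrite -insert_rVDl addr0.
rewrite E => /is_derive_line_at; congr is_derive.
by apply/funext => s; rewrite -E.
Qed.

Lemma is_derive_insert_lift (f : 'rV[R]_n -> R) i (t : R) y (j : 'I_n.-1) d :
  is_derive (insert_rV i t y) (delta_mx ord0 (lift i j)) f d ->
  is_derive y (delta_mx ord0 j) (fun z => f (insert_rV i t z)) d.
Proof.
move=> /is_derive_line H; apply/is_derive_line; move: H; congr is_derive.
by apply/funext => s; rewrite insert_rVDr.
Qed.

End insertion.

Section increments.
Context {R : realType} {n : nat}.
Local Notation V := 'rV[R]_n.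
Local Notation e_ i := (delta_mx ord0 i : V).

Lemma mvt_unit (f : V -> R) (x v : V) (t : R) : (forall y, derivable f y v) ->
  exists2 s, 0 <= s <= 1 & f (t *: v + x) - f x = 'D_v f ((s * t) *: v + x) * t.
Proof.
move=> df; have [t0|t0|->] := ltgtP t 0.
- have [c /andP[c0 ct] E] := @mvt_line _ _ f x v t 0 (fun s => df _) (ltW t0).
  exists (c / t).
    by rewrite ler_ndivlMr// mul0r ct ler_ndivrMr// mul1r.
  rewrite divfK ?lt_eqF//; move: E; rewrite scale0r add0r sub0r mulrN => E.
  by rewrite -opprB E opprK.
- have [c /andP[c0 ct] E] := @mvt_line _ _ f x v 0 t (fun s => df _) (ltW t0).
  exists (c / t).
    by rewrite ler_pdivlMr// mul0r c0 ler_pdivrMr// mul1r.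
  by rewrite divfK ?gt_eqF//; move: E; rewrite scale0r add0r subr0.
- by exists 0; rewrite ?lexx ?ler01// scale0r add0r subrr mulr0.
Qed.

(* The coordinates of y are replaced one at a time by those of x. *)
Lemma increment_le (f : V -> R) (a b x y : V) (M d : R) :
  (forall j z, derivable f z (e_ j)) ->
  (forall j z, closed_box a b z -> `|pderiv j f z| <= M) ->
  closed_box a b x -> closed_box a b y -> 
  (forall i, `|x ord0 i - y ord0 i| <= d) -> `|f x - f y| <= n%:R * (M * d).
Proof.
move=> df Mf ax ay xy.
pose z (k : nat) : V := \row_j (if (j < k)%N then x ord0 j else y ord0 j).
have -> : x = z n by apply/rowP => j; rewrite mxE ltn_ord.
have -> : y = z 0%N by apply/rowP => j; rewrite mxE.
rewrite -(telescope_sumr (fun k => f (z k)) (leq0n n)) big_mkord.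
apply: (le_trans (ler_norm_sum _ _ _)).
rewrite -[n in n%:R]card_ord -sumr_const mulr_suml; apply: ler_sum => k _; rewrite mul1r.
pose t := x ord0 k - y ord0 k.
have zE s : (s *: (e_ k) + z k) = \row_j (if j == k then s + y ord0 k else z k ord0 j).
  apply/rowP => j; rewrite !mxE; have [->|] := eqVneq j k; first by rewrite ltnn mulr1.
  by rewrite ?andbF mulr0 add0r.
have -> : z k.+1 = t *: (e_ k) + z k.
  rewrite zE; apply/rowP => j; rewrite !mxE ltnS leq_eqVlt -val_eqE /=.
  by case: eqP => //= jk; rewrite subrK (val_inj jk).
have [s /andP[s0 s1] ->] := mvt_unit (z k) t (df k).
have M0 : 0 <= M by apply: le_trans (Mf k x ax).
rewrite normrM; apply: ler_pM (xy k) => //.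
rewrite -/(pderiv k f _); apply: Mf => j; rewrite zE mxE.
case: eqP => [->|_]; last by rewrite mxE; case: ifP => _.
have /andP[ax1 ax2] := ax k; have /andP[ay1 ay2] := ay k.
rewrite /t; apply/andP; split; nra.
Qed.

Lemma continuous_bounded_box (f : V -> R) a b : continuous f ->
  exists2 M : R, 0 <= M & forall x, closed_box a b x -> `|f x| <= M.
Proof.
move=> cf; have : compact (f @` closed_box a b).
  apply: continuous_compact; last exact: compact_closed_box.
  exact: continuous_subspaceT.
move=> /compact_bounded[M [Mr HM]].
exists (`|M| + 1) => [|x abx]; first by rewrite addr_ge0.
apply: (HM (`|M| + 1)); last by exists x.
by rewrite (le_lt_trans (ler_norm _))// ltrDl.
Qed.

End increments.

Section plateau.
Context {R : realType} {n : nat}.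
Local Notation V := 'rV[R]_n.
Local Notation e_ i := (delta_mx ord0 i : V).

Definition sqdist (c : V) (d : R) (x : V) := \sum_i (d * (x ord0 i - c ord0 i)) ^+ 2.

(** [d] is the inverse of the radius. The quotient is smooth because its denominator never vanishes:
    with [q] for [sqdist c d x], the arguments [2 - q] and [q - 1] are never both nonpositive. *)
Definition plateau (c : V) (d : R) (x : V) : R :=
  theta (2 - sqdist c d x) * (theta (2 - sqdist c d x) + theta (sqdist c d x - 1))^-1.

Lemma smooth_sqdist c d : smooth (sqdist c d).
Proof.
apply: smooth_sum => i.
rewrite (_ : (fun x => _) = (fun x : V => (d * (x ord0 i - c ord0 i)) * (d * (x ord0 i - c ord0 i)))).
  by apply: smoothM; apply: smoothM; try exact: smooth_cst; apply: smoothB; [exact: smooth_coord|exact: smooth_cst|exact: smooth_coord|exact: smooth_cst].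
by apply/funext => x; rewrite expr2.
Qed.

Let den_gt0 (q : R) : 0 < theta (2 - q) + theta (q - 1).
Proof.
have [q2|q2] := ltP q 2.
  by rewrite ltr_pwDl ?theta_ge0// theta_gt0// subr_gt0.
by rewrite ltr_wpDl ?theta_ge0// theta_gt0//; lra.
Qed.

Lemma smooth_plateau c d : smooth (plateau c d).
Proof.
have s1 : smooth (fun x => theta (2 - sqdist c d x)).
  apply: (@smooth_theta R n (fun x => 2 - sqdist c d x)).
  by apply: smoothB; [exact: smooth_cst|exact: smooth_sqdist].
apply: (smoothM s1); apply: smoothV => [|x]; last by rewrite gt_eqF.
apply: (smoothD s1); apply: (@smooth_theta R n (fun x => sqdist c d x - 1)).
by apply: smoothB; [exact: smooth_sqdist|exact: smooth_cst].
Qed.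

Lemma plateau_eq1 c d x : sqdist c d x <= 1 -> plateau c d x = 1.
Proof.
move=> q1; have := den_gt0 (sqdist c d x); rewrite /plateau.
rewrite (@theta_le0 R (_ - 1)) ?subr_le0// addr0 => p.
by rewrite divff// gt_eqF.
Qed.

Lemma plateau_eq0 c d x : 2 <= sqdist c d x -> plateau c d x = 0.
Proof. by move=> q1; rewrite /plateau theta_le0 ?mul0r// subr_le0. Qed.

Lemma plateau_ge0 c d x : 0 <= plateau c d x.
Proof. by rewrite mulr_ge0 ?theta_ge0// invr_ge0 ltW. Qed.

Lemma plateau_le1 c d x : plateau c d x <= 1.
Proof. by rewrite ler_pdivrMr// mul1r lerDl theta_ge0. Qed.

Lemma sqdist_coord c d x i : sqdist c d x < 2 -> `|d * (x ord0 i - c ord0 i)| <= 2.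
Proof.
rewrite /sqdist (bigD1 i)//= => H.
have {H} : (d * (x ord0 i - c ord0 i)) ^+ 2 < 2.
  by apply: le_lt_trans H; rewrite lerDl sumr_ge0// => j _; rewrite sqr_ge0.
by move: (d * _) => s s2; rewrite ler_norml; apply/andP; split; nra.
Qed.

(** All plateaus are rescaled translates of [plateau 0 1], whose derivative is bounded on a box and
    vanishes outside it. The factor [d] is what makes the cut-off errors disappear for large
    radii. *)
Lemma plateau_pderiv_bounded i : exists2 M : R, 0 <= M &
  forall c d x, 0 < d -> `|pderiv i (plateau c d) x| <= M * d.
Proof.
have cp : continuous (pderiv i (plateau 0 1)).
  exact/smooth_continuous/smooth_pderiv/smooth_plateau.
have [M M0 HM] := continuous_bounded_box (const_mx (- 2)) (const_mx 2) cp.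
exists M => // c d x d0.
have E z : plateau c d z = plateau 0 1 (d *: (z - c)).
  rewrite /plateau; have -> // : sqdist c d z = sqdist 0 1 (d *: (z - c)).
  by apply: eq_bigr => j _; rewrite !mxE subr0 mul1r.
have -> : pderiv i (plateau c d) x = d * pderiv i (plateau 0 1) (d *: (x - c)).
  apply: is_derive_val; apply/is_derive_line.
  have := derivableP (@smooth_derivable _ _ _ i (d *: (x - c)) (smooth_plateau 0 1)).
  move=> /is_derive_line H.
  rewrite (_ : (fun h => _) = (fun h : R => plateau 0 1 (h *: e_ i + d *: (x - c))) \o (fun h : R => d * h)).
    rewrite mulrC; apply: is_derive1_comp; first by rewrite mulr0.
    by apply: is_derive_eq; rewrite [_%:A]mulr1.
  by apply/funext => h /=; rewrite E -addrA scalerDr scalerA.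
rewrite normrM (gtr0_norm d0) mulrC ler_pM2r//.
move: (d *: (x - c)) => z.
have [zin|/forallPn[j]] := boolP [forall j, `|z ord0 j| <= 2].
  by apply: HM => j; rewrite !mxE; have := forallP zin j; rewrite ler_norml.
rewrite -ltNge => z2.
have -> : pderiv i (plateau 0 1) z = 0; last by rewrite normr0.
rewrite /pderiv -(@near_eq_derive _ _ _ (cst 0)) ?derive_cst//.
have q2 : 2 < sqdist 0 1 z.
  rewrite /sqdist (bigD1 j)//= -[ltLHS]addr0 ltr_leD ?sumr_ge0// => [|k _]; last exact: sqr_ge0.
  by rewrite mxE subr0 mul1r -(real_normK (num_real _)); nra.
have := @smooth_continuous R n (sqdist 0 1) (smooth_sqdist 0 1) z.
move=> /(_ [set t | 2 < t] (lt_nbhsr q2)) H; near=> y.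
have /ltW qy : 2 < sqdist 0 1 y by near: y.
by rewrite plateau_eq0.
Unshelve. all: by end_near.
Qed.

End plateau.

(** * Smooth hypersurfaces as graphs *)

Lemma continuous_distP (R : realType) (n : nat) (f : 'rV[R]_n -> R) :
  (forall (y : 'rV[R]_n) (e : R), 0 < e -> \forall z \near y, `|f y - f z| < e) ->
  continuous f.
Proof.
move=> H y; suff : f z @[z --> (y : 'rV[R]_n)] --> f y by [].
by apply/(@cvgrPdist_lt _ _ _ (nbhs (y : 'rV[R]_n))) => e e0; exact: H.
Qed.

Lemma continuous_box (R : realType) (n : nat) (f : 'rV[R]_n -> R) (x : 'rV[R]_n) (e : R) :
  continuous f -> 0 < e -> exists2 r : R, 0 < r &
  forall y, closed_box (x - const_mx r) (x + const_mx r) y -> `|f y - f x| < e.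
Proof.
move=> cf e0; have cx : f z @[z --> x] --> f x by exact: cf.
move/(@cvgrPdist_lt _ _ _ (nbhs x)) : cx => /(_ e e0) /nbhs_box[r r0 H].
by exists r; [exact: r0|move=> y yb; rewrite distrC; exact: H].
Qed.

Section implicit_function.
Context {R : realType} {n : nat}.
Local Notation V := 'rV[R]_n.
Local Notation e_ i := (delta_mx ord0 i : V).
Variables (F : V -> R) (i : 'I_n) (c0 : R).
Hypotheses (sF : smooth F) (c0_gt0 : 0 < c0)
  (F_incr : forall x, c0 <= pderiv i F x).

Let slope (t s : R) (y : 'rV[R]_n.-1) : t <= s ->
  F (insert_rV i t y) + c0 * (s - t) <= F (insert_rV i s y).
Proof.
move=> ts; have [r _] := mvt_unit (insert_rV i t y) (s - t) (fun z => @smooth_derivable _ _ _ i z sF).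
rewrite -insert_rVDl subrK -lerBrDl => ->.
by rewrite ler_wpM2r// ?subr_ge0//; exact: F_incr.
Qed.

(** The slope is at least [c0] along the whole line through [y], so that [F] changes sign between
    [-A] and [A], where [A] is the modulus of its value at height 0 divided by [c0]. The solution
    therefore exists for every [y], not only locally. *)
Let sol (y : 'rV[R]_n.-1) : exists t, F (insert_rV i t y) = 0.
Proof.
pose A := `|F (insert_rV i 0 y)| / c0.
have A0 : 0 <= A by rewrite divr_ge0// ltW.
have cA : c0 * A = `|F (insert_rV i 0 y)| by rewrite mulrC divfK// gt_eqF.
have h1 := slope y A0; have := @slope (- A) 0 y.
rewrite oppr_le0 => /(_ A0) h2.
move: h1 h2; rewrite subr0 sub0r opprK cA => h1 h2.
have n1 := ler_norm (F (insert_rV i 0 y)).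
have n2 := ler_norm (- F (insert_rV i 0 y)); rewrite normrN in n2.
have AA : - A <= A by rewrite ge0_cp.
have [||t _ ?] := @IVT R (fun t => F (insert_rV i t y)) _ _ 0 AA; last by exists t.
  apply: continuous_subspaceT => t.
  apply: (@continuous_comp _ _ _ (fun t => insert_rV i t y) F); last exact: smooth_continuous.
  apply: continuous_insert_rV; [exact: cvg_id|exact: cvg_cst].
by rewrite ge_min le_max; apply/andP; split; apply/orP; [left|right]; lra.
Qed.

Definition implicit (y : 'rV[R]_n.-1) : R := sval (cid (sol y)).
Local Notation h := implicit.
Local Notation G y := (insert_rV i (h y) y).

Let Fh y : F (G y) = 0.
Proof. by rewrite /h; case: cid. Qed.

Lemma implicit_lt x : F x < 0 <-> x ord0 i < h (col' i x).
Proof.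
have E := insert_rV_col' i x.
have H t s : t < s -> F (insert_rV i t (col' i x)) < F (insert_rV i s (col' i x)).
  move=> ts; apply: lt_le_trans (slope _ (ltW ts)).
  by rewrite ltrDl mulr_gt0// subr_gt0.
split=> [|xh]; last by rewrite -E -(Fh (col' i x)); exact: H.
move=> Fx; rewrite ltNge; move: Fx; rewrite ltNge; apply: contraNN.
rewrite le_eqVlt => /orP[/eqP xh|xh]; first by rewrite -E -xh Fh.
by rewrite -E -(Fh (col' i x)) ltW// H.
Qed.

Lemma implicit_eq x : F x = 0 <-> x ord0 i = h (col' i x).
Proof.
have E := insert_rV_col' i x.
split=> [F0|xh]; last by rewrite -E xh Fh.
have [xh|xh|//] := ltgtP (x ord0 i) (h (col' i x)).
  by move/implicit_lt : xh; rewrite F0 ltxx.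
have := slope (col' i x) (ltW xh); rewrite Fh E F0 add0r.
by rewrite leNgt mulr_gt0// subr_gt0.
Qed.

(** [F] is positive at height [h y + e] and negative at height [h y - e], and stays so over nearby
    points [z]; monotonicity traps [h z] in between. *)
Lemma implicit_continuous : continuous h.
Proof.
apply: continuous_distP => y e e0.
have cF s : {for y, continuous (fun z => F (insert_rV i s z))}.
  apply: (@continuous_comp _ _ _ (fun z => insert_rV i s z) F); last exact: smooth_continuous.
  by apply: continuous_insert_rV; [exact: cst_continuous|exact: cvg_id].
have Fp : 0 < F (insert_rV i (h y + e) y).
  apply: lt_le_trans (@slope (h y) _ y _); last by rewrite lerDl ltW.
  by rewrite Fh add0r addrC addKr mulr_gt0.
have Fm : F (insert_rV i (h y - e) y) < 0.
  have := @slope (h y - e) (h y) y; rewrite Fh subKr lerBlDr lerDl => /(_ (ltW e0)).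
  have : 0 < c0 * e by rewrite mulr_gt0.
  lra.
have c1 := cF (h y + e) [set t | 0 < t] (lt_nbhsr Fp).
have c2 := cF (h y - e) [set t | t < 0] (lt_nbhsl Fm).
near=> z.
have /implicit_lt : F (insert_rV i (h y - e) z) < 0 by near: z.
rewrite insert_rV_same col'_insert_rV => l1.
have Fz : 0 < F (insert_rV i (h y + e) z) by near: z.
have l2 : h z < h y + e.
  rewrite ltNge; apply/negP => l; have := slope z l; rewrite Fh => l'.
  have : 0 <= c0 * (h z - (h y + e)) by rewrite mulr_ge0 ?subr_ge0// ltW.
  lra.
by rewrite ltr_norml; apply/andP; split; lra.
Unshelve. all: by end_near.
Qed.

(** The increment of [F] along the graph is zero. Split into a step in the direction [lift i j] and
    a vertical step, the latter evaluated by the mean value theorem, it expresses the difference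
    quotient of [h] through that of [F]. *)
Lemma is_derive_implicit (y : 'rV[R]_n.-1) j :
  is_derive y (delta_mx ord0 j) h
    (- (pderiv (lift i j) F (G y) * (pderiv i F (G y))^-1)).
Proof.
pose w := (delta_mx ord0 (lift i j) : V); pose v := (delta_mx ord0 j : 'rV[R]_n.-1).
apply/is_derive_line/is_derive_at0P; rewrite scale0r add0r -/v.
pose eta t := h (t *: v + y) - h y.
have GE t : G (t *: v + y) = eta t *: e_ i + (t *: w + G y).
  by rewrite -insert_rVDr -insert_rVDl subrK.
have /choice[s sP] : forall t, exists s, 0 <= s <= 1 /\
    F (G (t *: v + y)) - F (t *: w + G y) =
     pderiv i F ((s * eta t) *: e_ i + (t *: w + G y)) * eta t.
  move=> t; have [s ? E] := mvt_unit (t *: w + G y) (eta t) (fun z => @smooth_derivable _ _ _ i z sF).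
  by exists s; rewrite GE.
have ceta : eta t @[t --> (0 : R)] --> (0 : R).
  suff : eta t @[t --> (0 : R)] --> eta 0 by rewrite /eta scale0r add0r subrr.
  apply: cvgB; last exact: cvg_cst.
  apply: (@cvg_comp _ _ _ (fun t : R => t *: v + y) h _ (nbhs (0 *: v + y))).
    by apply: cvgD; [apply: cvgZr_tmp; exact: cvg_id | exact: cvg_cst].
  exact: implicit_continuous.
have cs : s t * eta t @[t --> (0 : R)] --> (0 : R).
  apply/norm_cvg0P; apply: (@squeeze_cvgr _ _ _ _ (cst 0) (fun t => `|eta t|)).
  - apply: nearW => t; rewrite normr_ge0/= normrM ler_piMl//.
    by have [/andP[s0 s1] _] := sP t; rewrite ger0_norm.
  - exact: cvg_cst.
  - exact/norm_cvg0P.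
have cx : ((s t * eta t) *: e_ i + (t *: w + G y)) @[t --> (0 : R)] --> G y.
  have -> : nbhs (G y) = nbhs (0 *: e_ i + (0 *: w + G y)) by rewrite !scale0r !add0r.
  apply: cvgD; first by apply: cvgZr_tmp.
  by apply: cvgD; [apply: cvgZr_tmp; exact: cvg_id | exact: cvg_cst].
have dF x : pderiv i F x != 0 by rewrite gt_eqF// (lt_le_trans c0_gt0).
have /derivableP/is_derive_line/is_derive_at0P : derivable F (G y) w.
  exact: smooth_derivable.
rewrite scale0r add0r Fh => D.
apply: (@cvg_trans _ ((- ((t^-1 * (F (t *: w + G y) - 0)) *
   (pderiv i F ((s t * eta t) *: e_ i + (t *: w + G y)))^-1)) @[t --> 0^'])).
  apply: near_eq_cvg; apply: nearW => t /=.
  have [_] := sP t; rewrite Fh sub0r subr0 -/(eta t) => E.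
  by rewrite -mulrA -mulrN -mulNr E [_ * eta t]mulrC mulfK.
apply: cvgN; apply: cvgM; first exact: D.
apply: cvgV; first exact: dF.
apply: (@cvg_comp _ _ _ (fun t => (s t * eta t) *: e_ i + (t *: w + G y)) (pderiv i F) (0^') (nbhs (G y))).
  apply: cvg_trans cx; apply: cvg_app; exact: nbhs_dnbhs.
exact: smooth_continuous (smooth_pderiv i sF) (G y).
Qed.

(** The class of the functions [Phi(h y, y)] with [Phi] smooth on the whole space is stable under
    differentiation, the slope of the graph being such a function; [h] itself is the case where
    [Phi] is the [i]-th coordinate. *)
Lemma smooth_implicit : smooth h.
Proof.
have dF x : pderiv i F x != 0 by rewrite gt_eqF// (lt_le_trans c0_gt0).
pose D j (x : V) := - (pderiv (lift i j) F x * (pderiv i F x)^-1).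
have sD j : smooth (D j).
  apply: smoothN; apply: smoothM; first exact: smooth_pderiv.
  by apply: smoothV => //; exact: smooth_pderiv.
apply: (@smooth_coind R n.-1 (fun f => exists2 Phi : V -> R, smooth Phi & f = fun y => Phi (G y))); last first.
  exists (fun x => x ord0 i); first exact: smooth_coord.
  by apply/funext => y; rewrite insert_rV_same.
move=> _ [Phi sPhi ->]; split.
  move=> y; apply: (@continuous_comp _ _ _ (fun y => G y) Phi); last exact: smooth_continuous.
  by apply: continuous_insert_rV; [exact: implicit_continuous|exact: cvg_id].
move=> j.
have H y : is_derive y (delta_mx ord0 j) (fun y => Phi (G y))
    (pderiv (lift i j) Phi (G y) + pderiv i Phi (G y) * D j (G y)).
  apply/is_derive_line.
  pose eta (t : R) := h (t *: delta_mx ord0 j + y) - h y.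
  rewrite (_ : (fun t => _) = (fun t : R => Phi (t *: delta_mx ord0 (lift i j) + eta t *: e_ i + G y))).
    apply: is_derive_curve.
    - by move=> x; exact: smooth_derivable.
    - exact: (@smooth_continuous R n _ (smooth_pderiv i sPhi) (G y)).
    - exact: smooth_derivable.
    - by rewrite /eta scale0r add0r subrr.
    - have /is_derive_line H := is_derive_implicit y j.
      by apply: is_derive_eq; rewrite subr0.
  by apply/funext => t; rewrite -addrA -insert_rVDl subrK -insert_rVDr.
split; first by move=> y; exact: is_derive_ex (H y).
exists (fun x => pderiv (lift i j) Phi x + pderiv i Phi x * D j x).
  apply: smoothD; first exact: smooth_pderiv.
  by apply: smoothM; [exact: smooth_pderiv|exact: sD].
by apply/funext => y; exact: is_derive_val (H y).
Qed.

End implicit_function.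

Section local_graph.
Context {R : realType} {n : nat}.
Local Notation V := 'rV[R]_n.
Local Notation e_ i := (delta_mx ord0 i : V).
Implicit Types (phi : V -> R) (c : V).

Lemma pderivZ (k : R) (f : V -> R) i : smooth f ->
  pderiv i (fun x => k * f x) = fun x => k * pderiv i f x.
Proof.
move=> sf; apply/funext => x; rewrite pderivM.
- by rewrite pderiv_cst mulr0 addr0.
- exact: derivable_cst.
- exact: smooth_derivable.
Qed.

Lemma derive_at_min (f : V -> R) x v : (forall y, derivable f y v) ->
  (forall y, f x <= f y) -> 'D_v f x = 0.
Proof.
move=> df fx; apply: is_derive_val; apply/is_derive_line.
apply: (@derive1_at_min R _ (-1) 1).
- by rewrite (@le_trans _ _ 0)// lerN10.
- by move=> t _; apply: is_derive_ex (is_derive_line_at (derivableP (df _))).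
- by rewrite in_itv/= ltrN10 ltr01.
- by move=> t _; rewrite scale0r add0r.
Qed.

(* Away from [c] the function is replaced by its linear part, so that the
   partial derivative keeps a positive lower bound on the whole space. *)
Lemma increasing_extension phi c (i : 'I_n) : smooth phi -> phi c = 0 ->
  0 < pderiv i phi c ->
  exists (F : V -> R) (W : set V) (c0 : R), [/\ smooth F, 0 < c0,
    forall x, c0 <= pderiv i F x, open W & W c] /\ forall x, W x -> F x = phi x.
Proof.
move=> sphi phic di.
pose l (x : V) := \sum_j pderiv j phi c * (x ord0 j - c ord0 j).
have sl : smooth l.
  apply: smooth_sum => j; apply: smoothM; first exact: smooth_cst.
  by apply: smoothB; [exact: smooth_coord|exact: smooth_cst].
have dl j : pderiv j l = fun=> pderiv j phi c.
  apply/funext => x; apply: is_derive_val; apply/is_derive_line.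
  rewrite (_ : (fun h => _) = (fun h : R => h * pderiv j phi c + l x)).
    by apply: is_derive_eq; rewrite scaler0 add0r addr0 [_%:A]mulr1.
  apply/funext => h; rewrite /l (bigD1 j)//= [in RHS](bigD1 j)//= !mxE !eqxx mulr1 addrA.
  congr (_ + _); first by ring.
  by apply: eq_bigr => k kj; rewrite !mxE (negPf kj) andbF mulr0 add0r.
pose r x := phi x - l x.
have sr : smooth r by exact: smoothB.
have lc : l c = 0 by apply: big1 => j _; rewrite subrr mulr0.
have rc : r c = 0 by rewrite /r phic lc subrr.
have dr j x : pderiv j r x = pderiv j phi x - pderiv j phi c.
  rewrite /r pderivD; [|exact: smooth_derivable|apply: derivableN; exact: smooth_derivable].
  congr (_ + _); rewrite /pderiv deriveN; last exact: smooth_derivable.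
  by have := congr1 (fun f => f x) (dl j); rewrite /pderiv => ->.
have [M M0 HM] := @plateau_pderiv_bounded R n i.
pose a := pderiv i phi c; have a0 : 0 < a by [].
(* The two error terms below add up to at most [eps (1 + 2 M n)], which is less than [a / 2]. *)
pose eps := a / (4 * (1 + M * n%:R)).
have Mn : 0 <= M * n%:R by rewrite mulr_ge0.
have eps0 : 0 < eps by rewrite divr_gt0// mulr_gt0//; lra.
have [d d0 Hd] : exists2 d : R, 0 < d & forall x, closed_box (c - const_mx d) (c + const_mx d) x ->
    forall j, `|pderiv j r x| <= eps.
  have : \forall x \near c, forall j, `|pderiv j r (x : V)| <= eps.
    apply: (@filter_forall V _ (fun j x => `|pderiv j r x| <= eps) (nbhs c)) => j.
    have := @smooth_continuous R n _ (smooth_pderiv j sphi) c.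
    move=> /(_ (ball (pderiv j phi c) eps) (nbhsx_ballx _ _ eps0)) H; near=> x.
    rewrite dr distrC ltW//.
    by have : ball (pderiv j phi c) eps (pderiv j phi x) by near: x.
  by move=> /nbhs_box[d d0 H]; exists d.
(* With this scale [chi] vanishes outside the box of half-width [d], inside which the derivatives of
   [r] are controlled. *)
pose chi := plateau c (2 / d).
have d2 : 0 < 2 / d by rewrite divr_gt0.
have schi : smooth chi by exact: smooth_plateau.
exists (fun x => l x + chi x * r x), [set x | sqdist c (2 / d) x < 1], (a / 2).
have cbox : closed_box (c - const_mx d) (c + const_mx d) c.
  by move=> j; rewrite !mxE lerBlDr !lerDl ltW.
have box_of x : sqdist c (2 / d) x < 2 -> closed_box (c - const_mx d) (c + const_mx d) x.
  move=> q j; have := sqdist_coord j q.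
  rewrite normrM (gtr0_norm d2) mulrAC ler_pdivrMr// ler_pM2l// ler_norml => /andP[h1 h2].
  by rewrite !mxE; apply/andP; split; lra.
split; last first.
  move=> x /= /ltW q; rewrite /chi plateau_eq1// mul1r /r; ring.
split.
- exact: (smoothD sl (smoothM schi sr)).
- by rewrite divr_gt0.
- move=> x; rewrite pderivD; [|exact: smooth_derivable|apply: smooth_derivable; exact: smoothM].
  rewrite dl pderivM; [|exact: smooth_derivable|exact: smooth_derivable].
  have [q|q] := ltP (sqdist c (2 / d) x) 2; last first.
    have chi0 : chi x = 0 by exact: plateau_eq0.
    (* A zero of the nonnegative function [chi] is a minimum, hence a critical point; this covers
       the sphere at which [chi] becomes 0 as well as its exterior. *)
    suff -> : pderiv i chi x = 0 by rewrite chi0 mul0r mulr0 !addr0 -/a; lra.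
    apply: derive_at_min => [y|y]; last by rewrite -/(chi x) chi0 plateau_ge0.
    exact: smooth_derivable.
  have xb := box_of x q.
  have h1 : `|chi x * pderiv i r x| <= eps.
    rewrite normrM -[eps]mul1r ler_pM//; last exact: Hd.
    by rewrite ger0_norm ?plateau_ge0 ?plateau_le1.
  have h2 : `|r x * pderiv i chi x| <= 2 * (M * n%:R) * eps.
    have : `|r x| <= n%:R * (eps * d).
      rewrite -[r x]subr0 -rc.
      apply: (increment_le (fun j z => @smooth_derivable _ _ _ j z sr) _ xb cbox).
        by move=> j z zb; exact: Hd.
      move=> j; have := xb j; rewrite !mxE ler_norml => /andP[? ?].
      by apply/andP; split; lra.
    move=> rx; rewrite normrM; apply: le_trans (ler_pM _ _ rx (HM c _ x d2)) _ => //.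
    by rewrite le_eqVlt; apply/orP; left; apply/eqP; field; rewrite gt_eqF.
  have aE : eps * (4 * (1 + M * n%:R)) = a.
    by rewrite divfK// gt_eqF// mulr_gt0//; lra.
  move: h1 h2; rewrite !ler_norml -/a => /andP[h1 _] /andP[h2 _].
  have : 0 < eps * (M * n%:R) + eps by rewrite ltr_wpDl// mulr_ge0// ltW.
  lra.
- apply: (@open_comp _ _ (sqdist c (2 / d)) [set t | t < 1]); last exact: open_lt.
  by move=> x _; exact: (@smooth_continuous R n _ (smooth_sqdist c (2 / d))).
- by rewrite /= /sqdist big1// => j _; rewrite subrr mulr0 expr0n.
Unshelve. all: by end_near.
Qed.

(** When the selected partial derivative is negative, the implicit function theorem is applied to
    [- phi], and [sg] remembers the reversal of the sides. *)
Lemma local_graph phi c : smooth phi -> phi c = 0 -> gradient phi c != 0 ->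
  exists (i : 'I_n) (sg : R) (h : 'rV[R]_n.-1 -> R) (W : set V),
  [/\ sg = 1 \/ sg = -1, smooth h, open W, W c &
   forall x, W x -> (phi x = 0 <-> x ord0 i = h (col' i x)) /\
     (phi x < 0 <-> sg * (x ord0 i - h (col' i x)) < 0)].
Proof.
move=> sphi phic /eqP g0.
have [i di] : exists i, pderiv i phi c != 0.
  apply: contrapT => /forallNP H; apply: g0; apply/rowP => i; rewrite !mxE.
  by apply/eqP/negPn/negP; exact: H.
have [dn|dp|d0] := ltgtP (pderiv i phi c) 0; last by rewrite d0 eqxx in di.
- have sN : smooth (fun x => -1 * phi x) by exact: (smoothM (smooth_cst _) sphi).
  have [||F [W [c0 [[sF c0p Fi oW Wc] E]]]] := @increasing_extension _ c i sN.
  + by rewrite phic mulr0.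
  + by rewrite pderivZ// mulN1r oppr_gt0.
  exists i, (-1), (implicit sF c0p Fi), W; split => //; [by right|exact: smooth_implicit|].
  move=> x Wx; have e := E x Wx.
  have P1 := implicit_eq sF c0p Fi x; have P2 := implicit_lt sF c0p Fi x.
  move: P1 P2; rewrite e mulN1r; move: (implicit _ _ _ _) => t P1 P2.
  split; first by rewrite -P1; split => [->|/eqP]; rewrite ?oppr0// oppr_eq0 => /eqP.
  have [lt|gt|eq] := ltgtP (x ord0 i) t.
  + by have := P2.2 lt; split=> ?; lra.
  + split => [_|_]; first lra.
    have [p|p|p] := ltgtP (phi x) 0 => //; [|by rewrite p oppr0 in P1; have := P1.1 erefl; lra].
    have lt : x ord0 i < t by apply: P2.1; lra.
    by move: (lt_trans lt gt); rewrite ltxx.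
  + by have := P1.2 eq; split=> ?; lra.
- have [||F [W [c0 [[sF c0p Fi oW Wc] E]]]] := @increasing_extension phi c i sphi => //.
  exists i, 1, (implicit sF c0p Fi), W; split => //; [by left|exact: smooth_implicit|].
  move=> x Wx; have e := E x Wx; rewrite -e mul1r subr_lt0.
  by split; [exact: implicit_eq|exact: implicit_lt].
Qed.

End local_graph.

Section symmetry_of_second_derivatives.
Context {R : realType} {n : nat}.
Local Notation V := 'rV[R]_n.
Local Notation e_ i := (delta_mx ord0 i : V).

Let mul01_le (s h : R) : 0 <= s <= 1 -> 0 < h -> 0 <= s * h <= h.
Proof.
by move=> /andP[s0 s1] h0; rewrite mulr_ge0 ?(ltW h0)//= ler_piMl// ltW.
Qed.

Let in_box k l (x : V) (h r s t : R) : 0 < h -> 2 * h <= r ->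
  0 <= s <= 1 -> 0 <= t <= 1 ->
  closed_box (x - const_mx r) (x + const_mx r) ((s * h) *: e_ k + ((t * h) *: e_ l + x)).
Proof.
move=> h0 rh s01 t01 m; rewrite !mxE.
have /andP[? ?] := mul01_le s01 h0; have /andP[? ?] := mul01_le t01 h0.
by case: (m == k); case: (m == l); rewrite ?mulr1 ?mulr0 /=; apply/andP; split; lra.
Qed.

Let second_difference (f : V -> R) (x : V) i j (s t : R) : smooth f ->
  exists2 ab : R * R, (0 <= ab.1 <= 1) && (0 <= ab.2 <= 1) &
  f (t *: e_ j + (s *: e_ i + x)) - f (s *: e_ i + x) - (f (t *: e_ j + x) - f x) =
  pderiv j (pderiv i f) ((ab.2 * t) *: e_ j + ((ab.1 * s) *: e_ i + x)) * t * s.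
Proof.
move=> sf; pose g y := f (t *: e_ j + y) - f y.
have Dg y : is_derive y (e_ i) g (pderiv i f (t *: e_ j + y) - pderiv i f y).
  have D1 : is_derive y (e_ i) (fun y => f (t *: e_ j + y)) (pderiv i f (t *: e_ j + y)).
    apply/is_derive_line.
    have /derivableP/is_derive_line := @smooth_derivable _ _ _ i (t *: e_ j + y) sf.
    by congr is_derive; apply/funext => h; congr f; rewrite addrCA.
  have D2 := derivableP (@smooth_derivable _ _ _ i y sf).
  exact: (is_deriveB D1 D2).
have [a a01 E] := mvt_unit x s (fun y => is_derive_ex (Dg y)).
have [b b01 E2] := mvt_unit ((a * s) *: e_ i + x) t
  (fun y => @smooth_derivable _ _ _ j y (smooth_pderiv i sf)).
exists (a, b); first by rewrite a01 b01.
rewrite -/(g _) -/(g x) E (is_derive_val (Dg _)); congr (_ * _).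
exact: E2.
Qed.

(** The second difference over a small square is symmetric in the two directions, and by two mean
    value theorems it gives either mixed derivative at some point of the square; continuity does the
    rest. It is used on test functions. *)
Lemma pderivC (f : V -> R) i j : smooth f ->
  pderiv j (pderiv i f) = pderiv i (pderiv j f).
Proof.
move=> sf; apply/funext => x.
have near_box k l (e : R) : 0 < e -> exists2 r : R, 0 < r &
    forall y, closed_box (x - const_mx r) (x + const_mx r) y ->
    `|pderiv k (pderiv l f) y - pderiv k (pderiv l f) x| < e.
  by apply: continuous_box; exact/smooth_continuous/smooth_pderiv/smooth_pderiv.
apply/eqP; rewrite -subr_eq0 -normr_le0; apply/ler_addgt0Pl => e e0; rewrite addr0.
have e2 : 0 < e / 2 by rewrite divr_gt0.
have [r1 r10 H1] := near_box j i _ e2; have [r2 r20 H2] := near_box i j _ e2.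
have [h h0 [h1 h2]] : exists2 h, 0 < h & 2 * h <= r1 /\ 2 * h <= r2.
  exists (Num.min r1 r2 / 2); first by rewrite divr_gt0// lt_min r10.
  by split; rewrite mulrC divfK// ge_min lexx ?orbT.
have [[a b] /= /andP[a01 b01] E1] := second_difference x i j h h sf.
have [[c d] /= /andP[c01 d01] E2] := second_difference x j i h h sf.
have := H1 _ (in_box j i x h0 h1 b01 a01); have := H2 _ (in_box i j x h0 h2 d01 c01).
have : pderiv j (pderiv i f) ((b * h) *: e_ j + ((a * h) *: e_ i + x)) =
       pderiv i (pderiv j f) ((d * h) *: e_ i + ((c * h) *: e_ j + x)).
  apply: (@mulIf _ h); first by rewrite gt_eqF.
  apply: (@mulIf _ h); first by rewrite gt_eqF.
  apply: etrans (esym E1) _; apply: etrans _ E2.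
  have -> : h *: e_ j + (h *: e_ i + x) = h *: e_ i + (h *: e_ j + x) by rewrite addrCA.
  move: (f (_ + (_ + _))) (f (_ *: e_ i + _)) (f (_ *: e_ j + _)) (f x); clear => A B C D.
  by ring.
move=> ->; move: (pderiv i _ _) (pderiv i _ _) (pderiv j _ _) => u v w.
rewrite !ltr_norml ler_norml; clear => /andP[? ?] /andP[? ?].
by apply/andP; split; lra.
Qed.

End symmetry_of_second_derivatives.

(** * Lebesgue measure on row vectors *)

Section measurability.
Context {R : realType} {n : nat}.
Local Notation V := 'rV[R]_n.

Lemma measurable_open_box (a b : V) : measurable (open_box a b).
Proof.
have -> : open_box a b = \bigcap_(i in [set: 'I_n]) ((fun x : V => x ord0 i) @^-1` `]a ord0 i, b ord0 i[).
  by apply/seteqP; split=> x H i; have := H i; rewrite /= in_itv/=; [|apply].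
apply: fin_bigcap_measurable => // i _.
rewrite -[X in measurable X]setTI; apply: measurable_coord => //.
Qed.

Lemma rat_box (U : set V) (x : V) : open U -> U x -> exists ab : 'rV[rat]_n * 'rV[rat]_n,
  open_box (map_mx ratr ab.1) (map_mx ratr ab.2) x /\
  closed_box (map_mx (ratr : rat -> R) ab.1) (map_mx ratr ab.2) `<=` U.
Proof.
move=> oU Ux; have /nbhs_box[r r0 H] : nbhs x U by exact: open_nbhs_nbhs.
have /choice[a aP] i : exists q : rat, x ord0 i - r < ratr q < x ord0 i.
  have [q] := @rat_in_itvoo R (x ord0 i - r) (x ord0 i) (ltac:(rewrite ltrBlDr ltrDl; exact: r0)).
  by rewrite in_itv/=; exists q.
have /choice[b bP] i : exists q : rat, x ord0 i < ratr q < x ord0 i + r.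
  have [q] := @rat_in_itvoo R (x ord0 i) (x ord0 i + r) (ltac:(rewrite ltrDl; exact: r0)).
  by rewrite in_itv/=; exists q.
exists (\row_i a i, \row_i b i); split=> [i|y Hy] /=.
  by rewrite !mxE; have /andP[_ ->] := aP i; have /andP[-> _] := bP i.
apply: H => i; have := Hy i; rewrite !mxE => /andP[h1 h2].
have /andP[a1 _] := aP i; have /andP[_ b2] := bP i.
by rewrite (le_trans (ltW a1) h1) (le_trans h2 (ltW b2)).
Qed.

(** The rational boxes, enumerated through [pickle], form a countable cover whose closed boxes still
    lie in [U]. Countability yields measurability; the closed boxes leave room for the supports of
    test functions. *)
Lemma open_bigcup_boxes (U : set V) : open U -> U =
  \bigcup_(k in [set k : nat | exists2 ab : 'rV[rat]_n * 'rV[rat]_n, unpickle k = Some ab &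
      closed_box (map_mx (ratr : rat -> R) ab.1) (map_mx ratr ab.2) `<=` U])
    (if unpickle k is Some ab then
       open_box (map_mx (ratr : rat -> R) (ab : 'rV[rat]_n * 'rV[rat]_n).1) (map_mx ratr ab.2) else set0).
Proof.
move=> oU; apply/seteqP; split=> x.
  move=> /(rat_box oU)[ab [xab abU]]; exists (pickle ab); rewrite /= pickleK//.
  by exists ab.
by move=> [k [ab -> abU]] /open_closed_box; exact: abU.
Qed.

Lemma measurable_open (U : set V) : open U -> measurable U.
Proof.
move=> /open_bigcup_boxes->; apply: bigcup_measurable => k _.
by case: unpickle => [ab|]; [exact: measurable_open_box|exact: measurable0].
Qed.

Lemma measurable_closed (F : set V) : closed F -> measurable F.
Proof. by move=> cF; rewrite -[F]setCK; apply: measurableC; apply: measurable_open; exact: closed_openC. Qed.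

Lemma measurable_compact (K : set V) : compact K -> measurable K.
Proof. by move=> cK; apply: measurable_closed; apply: compact_closed cK; exact: norm_hausdorff. Qed.

Lemma measurable_closed_box (a b : V) : measurable (closed_box a b).
Proof. by apply: measurable_compact; exact: compact_closed_box. Qed.

Lemma measurable_within (D : set V) (f : V -> R) : measurable D ->
  {within D, continuous f} -> measurable_fun D (f : V -> measurableTypeR R).
Proof.
move=> mD /continuousP cf.
apply: (measurability _ (measurable_realfun.RGenOpens.measurableE R)).
move=> _ [_ [a [b ->] <-]].
have := cf `]a, b[%classic (@interval_open R (BRight a) (BLeft b) isT isT).
rewrite open_subspaceP => -[W oW E].
have -> : D `&` f @^-1` `]a, b[ = W `&` D.
  by rewrite E setIC.
by apply: measurableI => //; exact: measurable_open.
Qed.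

Lemma continuous_measurable (f : V -> R) (D : set V) : measurable D -> continuous f ->
  measurable_fun D (f : V -> measurableTypeR R).
Proof.
move=> mD cf; apply: measurable_within => //; exact: continuous_subspaceT.
Qed.

End measurability.

Section fubini.
Context {R : realType}.
Local Notation leb := (@lebesgue_measure R).

Lemma measurable_insert_rV n (i : 'I_n) :
  measurable_fun [set: measurableTypeR R * 'rV[R]_n.-1]
    (fun p => insert_rV i (p.1 : R) p.2).
Proof.
apply: measurable_fun_rV => j; case: (unliftP i j) => [k ->|->].
  rewrite (_ : (fun _ => _) = (fun x : 'rV[R]_n.-1 => x ord0 k : measurableTypeR R) \o snd).
    exact: measurableT_comp (measurable_coord k) _.
  by apply/funext => p /=; rewrite insert_rV_lift.
rewrite (_ : (fun _ => _) = fst); first exact: measurable_fst.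
by apply/funext => p; rewrite insert_rV_same.
Qed.

Lemma insert_insert n (j : 'I_n.+1) (s t : R) (z : 'rV[R]_n) :
  insert_rV (lift ord0 j) s (insert_rV ord0 t z : 'rV[R]_n.+1) =
  insert_rV ord0 t (insert_rV j s z) :> 'rV[R]_n.+2.
Proof.
apply/rowP => l; have [l' ->|->] := unliftP ord0 l; last first.
  rewrite insert_rV_same (_ : ord0 = lift (lift ord0 j) (ord0 : 'I_n.+1)); last exact/val_inj.
  by rewrite insert_rV_lift insert_rV_same.
rewrite insert_rV_lift; have [k ->|->] := unliftP j l'; last by rewrite !insert_rV_same.
rewrite insert_rV_lift (_ : lift ord0 (lift j k) = lift (lift ord0 j) (lift (ord0 : 'I_n.+1) k)).
  by rewrite !insert_rV_lift.
by apply/val_inj; rewrite /= /bump /= !add1n ltnS addnS.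
Qed.

Local Open Scope ereal_scope.

Lemma ge0_integral_insert0 n (f : 'rV[R]_n.+1 -> \bar R) :
  measurable_fun [set: 'rV[R]_n.+1] f -> (forall x, 0 <= f x) ->
  \int[lebesgue_rV R n.+1]_x f x =
  \int[leb \x lebesgue_rV R n]_p f (insert_rV ord0 (p.1 : R) p.2).
Proof.
move=> mf f0.
transitivity (\int[pushforward (leb \x lebesgue_rV R n)
    (fun p : measurableTypeR R * 'rV[R]_n => insert_rV ord0 (p.1 : R) p.2 : 'rV[R]_n.+1)]_x f x).
  reflexivity.
rewrite (@ge0_integral_pushforward _ _ _ _ _ _ (@measurable_insert_rV n.+1 ord0))//.
Qed.

Let mfi n (i : 'I_n) (f : 'rV[R]_n -> \bar R) : measurable_fun [set: 'rV[R]_n] f ->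
  measurable_fun [set: measurableTypeR R * 'rV[R]_n.-1] (fun p : measurableTypeR R * 'rV[R]_n.-1 => f (insert_rV i (p.1 : R) p.2)).
Proof. by move=> mf; exact: measurableT_comp mf (measurable_insert_rV i). Qed.

(** [lebesgue_rV] is built by splitting off coordinate 0, whereas graphs and partial derivatives
    single out an arbitrary coordinate. Induction on [n]: for [i = 0] Tonelli exchanges the two
    integrals, otherwise coordinate 0 is split off and the hypothesis applies to the remaining
    ones. *)
Lemma ge0_integral_insert n (i : 'I_n) (f : 'rV[R]_n -> \bar R) :
  measurable_fun [set: 'rV[R]_n] f -> (forall x, 0 <= f x) ->
  \int[lebesgue_rV R n]_x f x =
  \int[lebesgue_rV R n.-1]_y \int[leb]_t f (insert_rV i t y).
Proof.
elim: n i f => [[//]|n IH i f mf f0].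
rewrite ge0_integral_insert0//; have [j ij|->] := unliftP ord0 i; last first.
  rewrite (@fubini_tonelli1 _ _ _ _ _ _ _ _ (mfi ord0 mf))//.
  by rewrite (@fubini_tonelli _ _ _ _ _ _ _ _ (mfi ord0 mf)).
case: n IH i f mf f0 j ij => [|n] IH i f mf f0 j ij; first by case: j ij.
rewrite (@fubini_tonelli1 _ _ _ _ _ _ _ _ (mfi ord0 mf))// /fubini_F/=.
transitivity (\int[leb]_t \int[lebesgue_rV R n]_z \int[leb]_s
   f (insert_rV ord0 t (insert_rV j s z))).
  apply: eq_integral => t _; rewrite (IH j)//.
  apply: (measurableT_comp mf).
  exact: (measurable_fun_pair2 t (@measurable_insert_rV n.+2 ord0)).
have mG : measurable_fun [set: 'rV[R]_n.+1] (fun y : 'rV[R]_n.+1 => \int[leb]_s f (insert_rV i s y)).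
  exact: (@measurable_fun_fubini_tonelli_G _ _ _ _ _ _ _ (mfi i mf)).
rewrite ge0_integral_insert0//; last by move=> y; exact: integral_ge0.
rewrite (@fubini_tonelli1 _ _ _ _ _ _ _ _ (@mfi n.+1 ord0 _ mG)) => [|p]; last exact: integral_ge0.
apply: eq_integral => t _; apply: eq_integral => z _ /=; apply: eq_integral => s _.
by rewrite ij insert_insert.
Qed.

Lemma ge0_integral_insert_prod n (i : 'I_n) (f : 'rV[R]_n -> \bar R) :
  measurable_fun [set: 'rV[R]_n] f -> (forall x, 0 <= f x) ->
  \int[lebesgue_rV R n]_x f x =
  \int[leb \x lebesgue_rV R n.-1]_p f (insert_rV i (p.1 : R) p.2).
Proof.
move=> mf f0; rewrite (ge0_integral_insert i)//.
have f0' (p : measurableTypeR R * 'rV[R]_n.-1) : 0 <= f (insert_rV i (p.1 : R) p.2) by [].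
rewrite (@fubini_tonelli1 _ _ _ _ _ _ _ _ (mfi i mf) f0').
by rewrite (@fubini_tonelli _ _ _ _ _ _ _ _ (mfi i mf) f0').
Qed.

Lemma lebesgue_insert n (i : 'I_n) (A : set 'rV[R]_n) : measurable A ->
  lebesgue_rV R n A = pushforward (leb \x lebesgue_rV R n.-1)
    (fun p : measurableTypeR R * 'rV[R]_n.-1 => insert_rV i (p.1 : R) p.2 : 'rV[R]_n) A.
Proof.
move=> mA; rewrite /pushforward.
have mB : measurable ((fun p : measurableTypeR R * 'rV[R]_n.-1 => insert_rV i (p.1 : R) p.2 : 'rV[R]_n) @^-1` A).
  by rewrite -[X in measurable X]setTI; exact: measurable_insert_rV.
have mI : measurable_fun [set: 'rV[R]_n] (fun x : 'rV[R]_n => (\1_A x : R)%:E).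
  by apply/measurable_EFinP; exact: measurable_indic.
transitivity (\int[lebesgue_rV R n]_x (\1_A x : R)%:E); first by rewrite integral_indic// setIT.
rewrite (ge0_integral_insert_prod i)//.
transitivity (\int[leb \x lebesgue_rV R n.-1]_p (\1_((fun p : measurableTypeR R * 'rV[R]_n.-1 => insert_rV i (p.1 : R) p.2 : 'rV[R]_n) @^-1` A) p : R)%:E).
  by [].
by rewrite integral_indic// setIT.
Qed.

Lemma integrable_insert n (i : 'I_n) (f : 'rV[R]_n -> \bar R) :
  (lebesgue_rV R n).-integrable setT f ->
  (leb \x lebesgue_rV R n.-1).-integrable setT
    (fun p : measurableTypeR R * 'rV[R]_n.-1 => f (insert_rV i (p.1 : R) p.2)).
Proof.
move=> /integrableP[mf fi]; apply/integrableP; split; first exact: mfi.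
by move: fi; rewrite (ge0_integral_insert_prod i)//; exact: measurableT_comp.
Qed.

Lemma integral_insert n (i : 'I_n) (f : 'rV[R]_n -> \bar R) :
  (lebesgue_rV R n).-integrable setT f ->
  \int[lebesgue_rV R n]_x f x = \int[lebesgue_rV R n.-1]_y \int[leb]_t f (insert_rV i t y).
Proof.
move=> fi; have mf := measurable_int _ fi.
have := integral21_prod_meas1 (integrable_insert i fi); rewrite /fubini_G /= => ->.
rewrite [LHS]integralE [RHS]integralE; congr (_ - _).
  rewrite (ge0_integral_insert_prod i (measurable_funepos mf) (funepos_ge0 f)).
  by apply: eq_integral => p _; rewrite !funeposE.
rewrite (ge0_integral_insert_prod i (measurable_funeneg mf) (funeneg_ge0 f)).
  by apply: eq_integral => p _; rewrite !funenegE.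
Qed.

Lemma integral_insert0 n (f : 'rV[R]_n.+1 -> \bar R) :
  (lebesgue_rV R n.+1).-integrable setT f ->
  \int[lebesgue_rV R n.+1]_x f x = \int[leb]_t \int[lebesgue_rV R n]_y f (insert_rV ord0 t y).
Proof.
move=> fi; rewrite (integral_insert ord0)//.
have H := @integrable_insert n.+1 ord0 f fi.
have := integral21_prod_meas1 H; have := integral12_prod_meas1 H.
by rewrite /fubini_G /fubini_F /= => -> ->.
Qed.

Lemma closed_box_fin_measure n (a b : 'rV[R]_n) :
  lebesgue_rV R n (closed_box a b) < +oo.
Proof.
elim: n a b => [|n IH] a b.
  by rewrite /= diracE ltry.
have mc := measurable_closed_box a b.
rewrite (@lebesgue_insert n.+1 ord0)// /pushforward.
apply: (@le_lt_trans _ _ ((leb \x lebesgue_rV R n)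
   (`[a ord0 ord0, b ord0 ord0]%classic `*` closed_box (col' ord0 a) (col' ord0 b)))).
  apply: le_measure; rewrite ?inE.
  - by rewrite -[X in measurable X]setTI; exact: measurable_insert_rV.
  - by apply: measurableX => //; exact: measurable_closed_box.
  - move=> p H; split; first by have := H ord0; rewrite /= insert_rV_same in_itv.
    by move=> j; have := H (lift ord0 j); rewrite insert_rV_lift !mxE.
rewrite product_measure1E//; last exact: measurable_closed_box.
apply: lte_mul_pinfty; [exact: measure_ge0| |exact: (IH (col' ord0 a) (col' ord0 b))].
rewrite ge0_fin_numE//.
have := @lebesgue_measure_itv R `[a ord0 ord0, b ord0 ord0]; rewrite /= => ->.
by case: ifP => _; [rewrite -EFinB ltry|rewrite ltry].
Qed.

Lemma compact_fin_measure n (K : set 'rV[R]_n) : compact K -> lebesgue_rV R n K < +oo.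
Proof.
move=> cK; have /compact_bounded[M [Mr HM]] := cK.
pose a : R := (`|M| + 1)%R.
apply: (@le_lt_trans _ _ (lebesgue_rV R n (closed_box (const_mx (- a)%R) (const_mx a)))).
  apply: le_measure; rewrite ?inE; [exact: measurable_compact|
    exact: measurable_closed_box|].
  move=> x Kx i; rewrite !mxE -ler_norml; apply: le_trans (coord_le_norm x i) _.
  by apply: (HM a) => //; rewrite /a (le_lt_trans (ler_norm M))// ltrDl.
exact: closed_box_fin_measure.
Qed.

Lemma continuous_integrable n (f : 'rV[R]_n -> R) (K : set 'rV[R]_n) :
  continuous f -> compact K -> (lebesgue_rV R n).-integrable K (EFin \o f).
Proof.
move=> cf cK; apply: measurable_bounded_integrable.
- exact: measurable_compact.
- exact: compact_fin_measure.
- by apply: continuous_measurable => //; exact: measurable_compact.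
- have : compact (f @` K) by apply: continuous_compact => //; exact: continuous_subspaceT.
  move=> /compact_bounded[M [Mr HM]]; exists M; split => // t Mt x Kx /=.
  by apply: HM => //; exists x.
Qed.

End fubini.

(** * Square integrable functions *)

Section square_integrable.
Context d (T : measurableType d) (R : realType).
Variable mu : {measure set T -> \bar R}.
Variables (D : set T) (mD : measurable D).
Implicit Types f g h : T -> R.

(** The notions of [normL2sq] and [inL2] over an arbitrary measure space: these two are instances by
    conversion, and so are the square integrable functions of time. *)
Definition sq f : \bar R := (\int[mu]_(x in D) (f x ^+ 2)%:E)%E.
Definition L2 f := measurable_fun D f /\ (sq f < +oo)%E.

Lemma sq_ge0 f : (0 <= sq f)%E.
Proof. by apply: integral_ge0 => x _; rewrite lee_fin sqr_ge0. Qed.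

Lemma measurable_sq f : measurable_fun D f ->
  measurable_fun D (fun x => ((f x) ^+ 2)%:E).
Proof. by move=> mf; apply/measurable_EFinP; exact: measurable_funX. Qed.

Lemma le_sq f g : measurable_fun D f -> measurable_fun D g ->
  (forall x, D x -> `|f x| <= `|g x|) -> (sq f <= sq g)%E.
Proof.
move=> mf mg fg; apply: ge0_le_integral => //.
- by move=> x _; rewrite lee_fin sqr_ge0.
- exact: measurable_sq.
- exact: measurable_sq.
- move=> x Dx; rewrite lee_fin -(real_normK (num_real (f x))).
  by rewrite -(real_normK (num_real (g x))) ler_sqr ?nnegrE// fg.
Qed.

Lemma sqZ c f : measurable_fun D f -> sq (fun x => c * f x) = ((c ^+ 2)%:E * sq f)%E.
Proof.
move=> mf; rewrite /sq -ge0_integralZl//.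
- by apply: eq_integral => x _; rewrite exprMn EFinM.
- exact: measurable_sq.
- by move=> x _; rewrite lee_fin sqr_ge0.
- by rewrite lee_fin sqr_ge0.
Qed.

Lemma sqD_le f g : measurable_fun D f -> measurable_fun D g ->
  (sq (fun x => (f x + g x)%R) <= 2%:E * sq f + 2%:E * sq g)%E.
Proof.
move=> mf mg; rewrite /sq -!ge0_integralZl//; try exact: measurable_sq;
  try by move=> x _; rewrite lee_fin sqr_ge0.
rewrite -ge0_integralD//.
- apply: ge0_le_integral => //.
  + by move=> x _; rewrite lee_fin sqr_ge0.
  + by apply: measurable_sq; exact: measurable_funD.
  + by apply: emeasurable_funD; apply: measurable_funeM; exact: measurable_sq.
  + move=> x _; rewrite -!EFinM -EFinD lee_fin -subr_ge0.
    by rewrite (_ : _ - _ = (f x - g x) ^+ 2) ?sqr_ge0//; ring.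
- by move=> x _; rewrite -EFinM lee_fin mulr_ge0// sqr_ge0.
- by apply: measurable_funeM; exact: measurable_sq.
- by move=> x _; rewrite -EFinM lee_fin mulr_ge0// sqr_ge0.
- by apply: measurable_funeM; exact: measurable_sq.
Qed.

Lemma L2D f g : L2 f -> L2 g -> L2 (fun x => f x + g x).
Proof.
move=> [mf sf] [mg sg]; split; first exact: measurable_funD.
apply: le_lt_trans (sqD_le mf mg) _.
by rewrite lte_add_pinfty// lte_mul_pinfty// ge0_fin_numE// sq_ge0.
Qed.

Lemma L2Z c f : L2 f -> L2 (fun x => c * f x).
Proof.
move=> [mf sf]; split; first exact: measurable_funM.
by rewrite sqZ// lte_mul_pinfty// lee_fin sqr_ge0.
Qed.

Lemma L2N f : L2 f -> L2 (fun x => - f x).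
Proof.
move=> /(L2Z (-1)); congr (L2 _); apply/funext => x; exact: mulN1r.
Qed.

Lemma L2B f g : L2 f -> L2 g -> L2 (fun x => f x - g x).
Proof. by move=> f2 g2; apply: L2D f2 (L2N g2). Qed.

Lemma L2_bounded_mul (c : T -> R) (M : R) f : measurable_fun D c -> (forall x, D x -> `|c x| <= M) ->
  L2 f -> L2 (fun x => c x * f x).
Proof.
move=> mc cM [mf sf]; split; first exact: measurable_funM.
apply: (@le_lt_trans _ _ (sq (fun x => M * f x)%R)); last by have [] := L2Z M (conj mf sf).
apply: le_sq; [exact: measurable_funM|exact: measurable_funM|].
move=> x Dx; rewrite !normrM ler_wpM2r//; apply: le_trans (cM x Dx) _.
exact: ler_norm.
Qed.

Lemma L2_mul_integrable f g : L2 f -> L2 g -> mu.-integrable D (fun x => (f x * g x)%:E).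
Proof.
move=> [mf sf] [mg sg].
apply: (@le_integrable _ _ _ _ _ mD _ (fun x => ((f x ^+ 2)%:E + (g x ^+ 2)%:E)%E)).
- by apply/measurable_EFinP; exact: measurable_funM.
- move=> x _; rewrite /= lee_fin normrM [leRHS]ger0_norm ?addr_ge0 ?sqr_ge0//.
  rewrite -(real_normK (num_real (f x))) -(real_normK (num_real (g x))).
  move: `|f x| `|g x| (normr_ge0 (f x)) (normr_ge0 (g x)) => a b a0 b0; nra.
- apply: integrableD => //; apply/integrableP; split; [exact: measurable_sq| |exact: measurable_sq|].
    by under eq_integral do rewrite gee0_abs ?lee_fin ?sqr_ge0//.
  by under eq_integral do rewrite gee0_abs ?lee_fin ?sqr_ge0//.
Qed.

Lemma L2_sq_integrable f : L2 f -> mu.-integrable D (fun x => (f x ^+ 2)%:E).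
Proof.
by move=> f2; have := L2_mul_integrable f2 f2; congr (mu.-integrable _ _).
Qed.

Definition ip f g : R := fine (\int[mu]_(x in D) (f x * g x)%:E).

Lemma ipE f g : L2 f -> L2 g -> (\int[mu]_(x in D) (f x * g x)%:E)%E = (ip f g)%:E.
Proof.
move=> f2 g2; rewrite /ip fineK//; apply: integrable_fin_num => //.
exact: L2_mul_integrable.
Qed.

Lemma sqE f : L2 f -> sq f = (ip f f)%:E.
Proof. by move=> f2; rewrite -ipE//. Qed.

Lemma ip_ge0 f : 0 <= ip f f.
Proof. by rewrite /ip fine_ge0//; exact: sq_ge0. Qed.

Lemma ipC f g : ip f g = ip g f.
Proof. by rewrite /ip; congr fine; apply: eq_integral => x _; rewrite mulrC. Qed.

Lemma ipDl f g h : L2 f -> L2 g -> L2 h ->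
  ip (fun x => f x + g x) h = ip f h + ip g h.
Proof.
move=> f2 g2 h2; apply: EFin_inj; rewrite EFinD -!ipE//; last exact: L2D.
rewrite -integralD_EFin//; try exact: L2_mul_integrable.
by apply: eq_integral => x _; rewrite /= mulrDl.
Qed.

Lemma ipZl c f g : L2 f -> L2 g -> ip (fun x => c * f x) g = c * ip f g.
Proof.
move=> f2 g2; apply: EFin_inj; rewrite EFinM -!ipE//; last exact: L2Z.
rewrite -integralZl//; last exact: L2_mul_integrable.
by apply: eq_integral => x _; rewrite /= -EFinM mulrA.
Qed.

Lemma ipBl f g h : L2 f -> L2 g -> L2 h ->
  ip (fun x => f x - g x) h = ip f h - ip g h.
Proof.
move=> f2 g2 h2.
have E : (fun x => - g x) = (fun x => -1 * g x) by apply/funext => x; rewrite mulN1r.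
by rewrite ipDl//; [rewrite E ipZl// mulN1r|exact: L2N].
Qed.

(** The square norm of [s f + t g] is nonnegative. Writing [A], [B], [C] for the three products,
    take [(s, t)] to be [(B, -C)] if [B] is positive and [(-C, A)] if [A] is; when both vanish, the
    pairs [(1, C)] and [(1, -C)] give [C = 0]. *)
Lemma ip_cauchy_schwarz f g : L2 f -> L2 g -> ip f g ^+ 2 <= ip f f * ip g g.
Proof.
move=> f2 g2.
have H (s t : R) : 0 <= s ^+ 2 * ip f f + 2 * s * t * ip f g + t ^+ 2 * ip g g.
  have := ip_ge0 (fun x => s * f x + t * g x).
  have sf2 := L2Z s f2; have tg2 := L2Z t g2.
  rewrite ipDl//; last exact: L2D.
  rewrite !(ipC _ (fun x => s * f x + t * g x)) !ipDl// !ipZl// !(ipC _ (fun x => _ * _)) !ipZl//.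
  by rewrite (ipC g f); congr (_ <= _); ring.
have := ip_ge0 f; have := ip_ge0 g; move: H; move: (ip f f) (ip g g) (ip f g) => A B C; clear.
move=> H B0 A0; have [B1|] := ltP 0 B.
  have := H B (- C); rewrite (_ : _ + _ = B * (A * B - C ^+ 2)); last by ring.
  by rewrite pmulr_rge0// subr_ge0.
move=> B1; have {B0 B1} B0 : B = 0 by apply/eqP; rewrite eq_le B1 B0.
have [|] := ltP 0 A => A1.
  have := H (- C) A; rewrite (_ : _ + _ = A * (A * B - C ^+ 2)); last by ring.
  by rewrite pmulr_rge0// subr_ge0.
have {A0 A1} A0 : A = 0 by apply/eqP; rewrite eq_le A1 A0.
by have := H 1 C; have := H 1 (- C); rewrite A0 B0; nra.
Qed.

End square_integrable.

(** * Lorentzian forms *)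

Section cauchy_schwarz.
Context {R : realType}.

Lemma cauchy_schwarz_sum (I : Type) (r : seq I) (P : pred I) (a b : I -> R) :
  (\sum_(i <- r | P i) a i * b i) ^+ 2 <=
  (\sum_(i <- r | P i) a i ^+ 2) * (\sum_(i <- r | P i) b i ^+ 2).
Proof.
set A := \sum_(i <- r | P i) a i ^+ 2; set B := \sum_(i <- r | P i) b i ^+ 2.
set C := \sum_(i <- r | P i) _.
have H (s t : R) : 0 <= s ^+ 2 * A - 2 * s * t * C + t ^+ 2 * B.
  have -> : s ^+ 2 * A - 2 * s * t * C + t ^+ 2 * B =
      \sum_(i <- r | P i) (s * a i - t * b i) ^+ 2.
    rewrite /A /B /C !mulr_sumr -sumrB -big_split/=; apply: eq_bigr => i _; ring.
  by apply: sumr_ge0 => i _; exact: sqr_ge0.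
have A0 : 0 <= A by apply: sumr_ge0 => i _; exact: sqr_ge0.
have B0 : 0 <= B by apply: sumr_ge0 => i _; exact: sqr_ge0.
have [B1|] := ltP 0 B.
  have := H B C; rewrite (_ : _ + _ = B * (A * B - C ^+ 2)); last by ring.
  by rewrite pmulr_rge0// subr_ge0.
move=> B1; have {B0 B1} B0 : B = 0 by apply/eqP; rewrite eq_le B1 B0.
have [|] := ltP 0 A => A1.
  have := H C A; rewrite (_ : _ + _ = A * (A * B - C ^+ 2)); last by ring.
  by rewrite pmulr_rge0// subr_ge0.
have {A0 A1} A0 : A = 0 by apply/eqP; rewrite eq_le A1 A0.
have := H C 1; have := H C (-1); rewrite A0 B0 mulr0 !mulr0 => h1 h2.
by nra.
Qed.

End cauchy_schwarz.

Section bilinear.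
Context {R : realType} {n : nat}.
Local Notation V := 'rV[R]_n.+1.
Implicit Types (A : 'M[R]_n.+1) (u v w : V).

Definition bil A u v : R := \sum_j \sum_k A j k * u ord0 j * v ord0 k.

Lemma bilE A u v : bil A u v = (u *m A *m v^T) ord0 ord0.
Proof.
rewrite mxE /bil exchange_big/=; apply: eq_bigr => k _.
rewrite !mxE mulr_suml; apply: eq_bigr => j _.
by rewrite [A j k * _]mulrC.
Qed.

Lemma bilDl A u v w : bil A (u + v) w = bil A u w + bil A v w.
Proof. by rewrite !bilE !mulmxDl mxE. Qed.

Lemma bilZl A c u w : bil A (c *: u) w = c * bil A u w.
Proof. by rewrite !bilE -!scalemxAl mxE. Qed.

Lemma bilC A u v : A^T = A -> bil A u v = bil A v u.
Proof.
move=> sA; rewrite /bil exchange_big/=; apply: eq_bigr => j _; apply: eq_bigr => k _.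
by rewrite -[in LHS]sA mxE mulrAC.
Qed.

Lemma bilDr A u v w : A^T = A -> bil A w (u + v) = bil A w u + bil A w v.
Proof. by move=> sA; rewrite bilC// bilDl !(bilC w). Qed.

Lemma bilZr A c u w : A^T = A -> bil A w (c *: u) = c * bil A w u.
Proof. by move=> sA; rewrite bilC// bilZl (bilC u). Qed.

Lemma bil_delta A (j : 'I_n.+1) u : A^T = A ->
  bil A (delta_mx ord0 j) u = \sum_k A j k * u ord0 k.
Proof.
move=> sA; rewrite /bil (bigD1 j)//= [X in _ + X]big1 ?addr0.
  by apply: eq_bigr => k _; rewrite mxE !eqxx mulr1.
by move=> i ij; rewrite big1// => k _; rewrite mxE (negPf ij) andbF mulr0 mul0r.
Qed.

Lemma lorentzian_coordinates A : lorentzian A ->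
  exists2 Q : 'M[R]_n.+1, Q \in unitmx &
  forall u v, bil A u v = (u *m Q) ord0 ord0 * (v *m Q) ord0 ord0 -
    \sum_(i < n) (u *m Q) ord0 (lift ord0 i) * (v *m Q) ord0 (lift ord0 i).
Proof.
move=> [P uP E]; exists (invmx P) => [|u v]; first by rewrite unitmx_inv.
pose D : 'M[R]_n.+1 := diag_mx (\row_j (if j == ord0 then 1 else -1)).
have -> : bil A u v = ((u *m invmx P) *m D *m (v *m invmx P)^T) ord0 ord0.
  rewrite bilE /D -E trmx_mul !mulmxA mulmxKV// -(mulmxA (u *m A)).
  by rewrite -trmx_mul mulVmx// trmx1 mulmx1.
move: (u *m _) (v *m _) => a b; rewrite mxE big_ord_recl; congr (_ + _).
  by rewrite mul_mx_diag !mxE eqxx mulr1.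
rewrite -sumrN; apply: eq_bigr => i _.
by rewrite mul_mx_diag !mxE /= mulrN1 mulNr.
Qed.

(* The reversed Cauchy-Schwarz inequality in Lorentzian signature. *)
Lemma causal_orthogonal A w u : lorentzian A -> w != 0 -> 0 <= bil A w w ->
  bil A w u = 0 -> bil A u u <= 0.
Proof.
move=> /lorentzian_coordinates[Q uQ E] w0; rewrite !E.
have {w0} : w *m Q != 0.
  apply: contraNneq w0 => wQ; rewrite -[w](mulmxK uQ) wQ mul0mx//.
move: (w *m Q) (u *m Q) => a b a0.
set sa := \sum_(i < n) a _ _ * a _ _; set sb := \sum_(i < n) b _ _ * b _ _.
set sc := \sum_(i < n) a _ _ * b _ _ => h1 h2.
have cs : sc ^+ 2 <= sa * sb.
  have := cauchy_schwarz_sum (index_enum 'I_n) xpredT (fun i => a ord0 (lift ord0 i)) (fun i => b ord0 (lift ord0 i)).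
  by rewrite /sa /sb; under [X in _ <= X * _]eq_bigr do rewrite expr2; under [X in _ <= _ * X]eq_bigr do rewrite expr2.
have sa0 : 0 <= sa by apply: sumr_ge0 => i _; rewrite -expr2 sqr_ge0.
have sb0 : 0 <= sb by apply: sumr_ge0 => i _; rewrite -expr2 sqr_ge0.
have t0 : a ord0 ord0 != 0.
  apply: contraNneq a0 => t0; have sa1 : sa = 0 by move: h1; rewrite t0; lra.
  apply/eqP/rowP => j; rewrite mxE; have [i ->|->//] := unliftP ord0 j.
  have /psumr_eq0P H : forall i : 'I_n, true -> 0 <= a ord0 (lift ord0 i) * a ord0 (lift ord0 i).
    by move=> k _; rewrite -expr2 sqr_ge0.
  by have /eqP := H sa1 i isT; rewrite mulf_eq0 orbb => /eqP.
have p : 0 < a ord0 ord0 ^+ 2 by rewrite exprn_even_gt0.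
rewrite -(pmulr_rle0 _ p); move: h1 h2 cs sa0 sb0 p; move: (a _ _) (b _ _) => x y; clear.
move=> h1 h2 cs sa0 sb0 p.
have e : x * y = sc by lra.
have : sa * sb <= x ^+ 2 * sb by rewrite ler_wpM2r//; lra.
have : x ^+ 2 * (y * y - sb) = sc ^+ 2 - x ^+ 2 * sb by rewrite -e; ring.
lra.
Qed.

(** Strict because the space part of [u] in diagonalising coordinates cannot vanish: orthogonality
    to the timelike [w] would then make [u] zero. This strictness yields coercivity of the energy,
    also at the points of [S]. *)
Lemma timelike_orthogonal A w u : lorentzian A -> 0 < bil A w w ->
  bil A w u = 0 -> u != 0 -> bil A u u < 0.
Proof.
move=> /lorentzian_coordinates[Q uQ E] + + u0; rewrite !E.
have {u0} : u *m Q != 0.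
  apply: contraNneq u0 => wQ; rewrite -[u](mulmxK uQ) wQ mul0mx//.
move: (w *m Q) (u *m Q) => a b b0.
set sa := \sum_(i < n) a _ _ * a _ _; set sb := \sum_(i < n) b _ _ * b _ _.
set sc := \sum_(i < n) a _ _ * b _ _ => h1 h2.
have cs : sc ^+ 2 <= sa * sb.
  have := cauchy_schwarz_sum (index_enum 'I_n) xpredT (fun i => a ord0 (lift ord0 i)) (fun i => b ord0 (lift ord0 i)).
  by rewrite /sa /sb; under [X in _ <= X * _]eq_bigr do rewrite expr2; under [X in _ <= _ * X]eq_bigr do rewrite expr2.
have sa0 : 0 <= sa by apply: sumr_ge0 => i _; rewrite -expr2 sqr_ge0.
have sb0 : 0 <= sb by apply: sumr_ge0 => i _; rewrite -expr2 sqr_ge0.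
have p : 0 < a ord0 ord0 ^+ 2 by rewrite expr2; lra.
have sbp : 0 < sb.
  rewrite lt_neqAle sb0 andbT eq_sym; apply: contraNneq b0 => sb1.
  have /psumr_eq0P H : forall i : 'I_n, true -> 0 <= b ord0 (lift ord0 i) * b ord0 (lift ord0 i).
    by move=> k _; rewrite -expr2 sqr_ge0.
  have Hb i : b ord0 (lift ord0 i) = 0.
    by have /eqP := H sb1 i isT; rewrite mulf_eq0 orbb => /eqP.
  apply/eqP/rowP => j; rewrite mxE; have [i ->//|->] := unliftP ord0 j.
  have sc0 : sc = 0 by apply: big1 => i _; rewrite Hb mulr0.
  have /eqP : a ord0 ord0 * b ord0 ord0 = 0 by lra.
  by rewrite mulf_eq0 => /orP[/eqP a0|/eqP//]; move: p; rewrite a0 expr0n ltxx.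
rewrite -(pmulr_rlt0 _ p); move: h1 h2 cs sa0 sbp p; move: (a _ _) (b _ _) => x y; clear.
move=> h1 h2 cs sa0 sb0 p.
have e : x * y = sc by lra.
have : sa * sb < x ^+ 2 * sb by rewrite ltr_pM2r//; lra.
have : x ^+ 2 * (y * y - sb) = sc ^+ 2 - x ^+ 2 * sb by rewrite -e; ring.
lra.
Qed.

End bilinear.

(** * Weak derivatives *)

Section everywhere_dominated.
Context d (T : measurableType d) (R : realType) (mu : {measure set T -> \bar R}).

Lemma dominated_cvg_real (D : set T) (f_ : nat -> T -> R) (f g : T -> R) :
  measurable D -> (forall k, measurable_fun D (f_ k)) ->
  (forall x, D x -> f_ k x @[k --> \oo] --> f x) ->
  mu.-integrable D (EFin \o g) -> (forall k x, D x -> `|f_ k x| <= g x) ->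
  mu.-integrable D (EFin \o f) /\
  (\int[mu]_(x in D) (f_ k x)%:E @[k --> \oo] --> \int[mu]_(x in D) (f x)%:E)%E.
Proof.
move=> mD mf cf gi fg.
have mlim : measurable_fun D f by exact: (measurable_fun_cvg mf cf).
have [|||||fi _ H] := @dominated_convergence _ _ _ mu _ mD (fun k x => (f_ k x)%:E)
    (fun x => (f x)%:E) (fun x => (g x)%:E).
- by move=> k; exact/measurable_EFinP.
- exact/measurable_EFinP.
- by apply: aeW => x Dx; apply/cvg_EFin; [exact: nearW|exact: cf].
- exact: gi.
- by apply: aeW => x k Dx; rewrite lee_fin; exact: fg.
by split; [exact: fi|exact: H].
Qed.

End everywhere_dominated.

Section one_dimension.
Context {R : realType}.
Local Notation leb := (@lebesgue_measure R).

Lemma FTC (g dg : R -> R) a b : a < b -> (forall t : R, is_derive t 1 g (dg t)) ->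
  continuous dg ->
  (\int[leb]_(t in `[a, b]) (dg t)%:E = (g b - g a)%:E)%E.
Proof.
move=> ab dE cdg.
have cg : continuous g.
  by move=> t; apply: differentiable_continuous; apply/derivable1_diffP; exact: is_derive_ex (dE t).
rewrite EFinB; apply: continuous_FTC2 => //.
- exact: continuous_subspaceT.
- split.
  + by move=> t _; exact: is_derive_ex (dE t).
  + by apply: cvg_at_right_filter; exact: cg.
  + by apply: cvg_at_left_filter; exact: cg.
- by move=> t _; rewrite derive1E; exact: is_derive_val (dE t).
Qed.

Lemma integral_derivative0 (g dg : R -> R) a b :
  (forall t : R, is_derive t 1 g (dg t)) -> continuous dg ->
  (forall t, ~ (a <= t <= b) -> g t = 0 /\ dg t = 0) ->
  (\int[leb]_t (dg t)%:E = 0)%E.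
Proof.
move=> dE cdg g0.
(* The endpoints are moved strictly outside the support; [min] and [max] cover the case [b < a],
   where [g] vanishes identically. *)
pose a' := Num.min a b - 1; pose b' := Num.max a b + 1.
have h1 : Num.min a b <= a by rewrite ge_min lexx.
have h2 : a <= Num.max a b by rewrite le_max lexx.
have h3 : b <= Num.max a b by rewrite le_max lexx orbT.
have ab : a' < b' by rewrite /a' /b'; lra.
have [ga _] : g a' = 0 /\ dg a' = 0.
  by apply: g0; rewrite /a' => /andP[h _]; lra.
have [gb _] : g b' = 0 /\ dg b' = 0.
  by apply: g0; rewrite /b' => /andP[_ h]; lra.
transitivity (\int[leb]_(t in `[a', b']) (dg t)%:E)%E; last by rewrite (FTC ab dE cdg) ga gb subrr.
rewrite [RHS]integral_mkcond; apply: eq_integral => t _.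
rewrite patchE; case: ifPn => // /negP tab.
have [_ ->//] : g t = 0 /\ dg t = 0.
apply: g0 => /andP[at1 tb]; apply: tab; rewrite inE/= in_itv/=.
by rewrite /a' /b'; apply/andP; split; lra.
Qed.

End one_dimension.

Section integration_by_parts.
Context {R : realType} {n : nat}.
Local Notation V := 'rV[R]_n.
Local Notation mu := (lebesgue_rV R n).
Implicit Types (f g Psi : V -> R) (a b : V).

Lemma continuous_box_integrable f a b : continuous f ->
  (forall x, ~ closed_box a b x -> f x = 0) -> mu.-integrable setT (EFin \o f).
Proof.
move=> cf f0.
have -> : EFin \o f = (EFin \o f) \_ (closed_box a b).
  apply/funext => x; rewrite patchE; case: ifPn => // /negP xab /=.
  by rewrite f0// => H; apply: xab; exact/mem_set.
apply: (proj1 (integrable_mkcond _ (measurable_closed_box a b))).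
by apply: continuous_integrable => //; exact: compact_closed_box.
Qed.

Lemma pderiv_eq0 Psi a b i : (forall x, ~ closed_box a b x -> Psi x = 0) ->
  forall x, ~ closed_box a b x -> pderiv i Psi x = 0.
Proof.
move=> P0 x xab; rewrite /pderiv -(@near_eq_derive _ _ _ (cst 0)) ?derive_cst//.
have : nbhs x (~` closed_box a b).
  by apply: open_nbhs_nbhs; split => //; apply: closed_openC; exact: closed_closed_box.
by apply: filterS => y /P0 ->.
Qed.

Lemma integral_pderiv0 Psi a b i : (forall x, derivable Psi x (delta_mx ord0 i)) ->
  continuous (pderiv i Psi) ->
  (forall x, ~ closed_box a b x -> Psi x = 0) ->
  (\int[mu]_x (pderiv i Psi x)%:E = 0)%E.
Proof.
move=> dPi cdPi P0; have dP0 := pderiv_eq0 i P0.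
rewrite (integral_insert i); last exact: (continuous_box_integrable cdPi dP0).
rewrite integral0_eq// => y _.
apply: (@integral_derivative0 R (fun t => Psi (insert_rV i t y)) _ (a ord0 i) (b ord0 i)).
- by move=> t; apply: is_derive_insert_same; apply: derivableP; exact: dPi.
- move=> t; apply: (@continuous_comp _ _ _ (fun t => insert_rV i t y) (pderiv i Psi)); last exact: cdPi.
  by apply: continuous_insert_rV; [exact: cvg_id|exact: cst_continuous].
- move=> t tab; have tN : ~ closed_box a b (insert_rV i t y).
    by move=> /(_ i); rewrite insert_rV_same.
  by rewrite P0// dP0.
Qed.

End integration_by_parts.

(** * The fundamental lemma of the calculus of variations *)

Section fundamental_lemma.
Context {R : realType} {n : nat}.
Local Notation V := 'rV[R]_n.
Local Notation mu := (lebesgue_rV R n).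
Implicit Types (Omega : set V) (f g : V -> R) (a b c d : V).

Definition max_rV a c : V := \row_i Num.max (a ord0 i) (c ord0 i).
Definition min_rV b d : V := \row_i Num.min (b ord0 i) (d ord0 i).

Lemma open_boxI a b c d :
  open_box c d `&` open_box a b = open_box (max_rV a c) (min_rV b d).
Proof.
apply/seteqP; split=> [x [xcd xab] i|x H].
  rewrite !mxE gt_max lt_min; have /andP[-> ->] := xcd i.
  by have /andP[-> ->] := xab i.
by split=> i; have := H i; rewrite !mxE gt_max lt_min => /andP[/andP[h1 h2] /andP[h3 h4]]; rewrite ?h1 ?h2 ?h3 ?h4.
Qed.

Lemma closed_box_sub a b c d :
  closed_box (max_rV a c) (min_rV b d) `<=` closed_box a b.
Proof.
move=> x H i; have := H i; rewrite !mxE ge_max le_min.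
by move=> /andP[/andP[h1 _] /andP[h2 _]]; rewrite h1 h2.
Qed.

(** The bumps of the box are admissible test functions because the closed box lies in [Omega]; they
    tend to the indicator of the open box, and the products with [f] are dominated by [|f|]. *)
Lemma integral_box_eq0 Omega f a b : measurable Omega -> inL1loc Omega f ->
  (forall psi, test_function Omega psi -> (\int[mu]_(x in Omega) (f x * psi x)%:E = 0)%E) ->
  closed_box a b `<=` Omega -> (\int[mu]_(x in open_box a b) (f x)%:E = 0)%E.
Proof.
move=> mO fL f0 abO.
have mc := measurable_closed_box a b.
have fi : mu.-integrable (closed_box a b) (EFin \o f).
  by apply: fL => //; exact: compact_closed_box.
have mfc := measurable_int _ fi.
pose F k x := (f x * box_bump a b k x)%:E.
have E k : (\int[mu]_(x in closed_box a b) F k x = 0)%E.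
  rewrite -(f0 (box_bump a b k)); last exact: test_bump.
  rewrite [LHS]integral_mkcond [RHS]integral_mkcond; apply: eq_integral => x _.
  rewrite !patchE; case: ifPn => [/set_mem /abO/mem_set->//|/negP xab].
  case: ifPn => // _; rewrite bump_eq0 ?mulr0// => /open_closed_box/mem_set.
  exact: xab.
have mF k : measurable_fun (closed_box a b) (F k).
  apply/measurable_EFinP; apply: measurable_funM; first exact/measurable_EFinP.
  by apply: continuous_measurable => //; exact/smooth_continuous/smooth_bump.
have [||||_ H] := @dominated_cvg_real _ _ _ mu _ (fun k x => f x * box_bump a b k x)
    (fun x => f x * \1_(open_box a b) x) (fun x => `|f x|) mc.
- by move=> k; apply/measurable_EFinP; exact: mF.
- by move=> x _; apply: cvgM; [exact: cvg_cst|exact: bump_cvg].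
- exact: (integrable_abse fi).
- move=> k x _; rewrite normrM ler_piMr// ger0_norm ?bump_ge0//.
  exact: bump_le1.
move: H; under eq_fun do rewrite E.
move=> /(cvg_lim (@ereal_hausdorff R)); rewrite lim_cst// => H.
rewrite [RHS]H [LHS]integral_mkcond [RHS]integral_mkcond; apply: eq_integral => x _.
rewrite !patchE indicE; case: ifPn => [xo|xo]; last by case: ifP => _; rewrite ?mulr0.
rewrite mulr1 ifT//; apply/mem_set/open_closed_box; exact/set_mem.
Qed.

Lemma open_boxes_generate :
  @measurable _ V = <<s [set A | exists ab : V * V, A = open_box ab.1 ab.2] >>.
Proof.
apply/seteqP; split; last first.
  apply: smallest_sub; first exact: sigma_algebra_measurable.
  by move=> _ [ab ->]; exact: measurable_open_box.
set G := [set A | _].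
have open_gen (U : set V) : open U -> @measurable _ (g_sigma_algebraType G) U.
  move=> /open_bigcup_boxes->; apply: bigcup_measurable => k _.
  case: unpickle => [ab|]; last exact: measurable0.
  by apply: sub_sigma_algebra; exists (map_mx ratr ab.1, map_mx ratr ab.2).
apply: smallest_sub; first exact: smallest_sigma_algebra.
rewrite -bigcup_seq => A [i _ [B mB <-]].
have mi : measurable_fun [set: g_sigma_algebraType G] ((fun x : V => x ord0 i) : g_sigma_algebraType G -> measurableTypeR R).
  apply: (measurability _ (measurable_realfun.RGenOpens.measurableE R)).
  move=> _ [_ [u [v ->] <-]]; rewrite setTI; apply: open_gen.
  apply: open_comp; last exact: interval_open.
  by move=> x _; exact: continuous_coord.
exact: (mi measurableT B mB).
Qed.

(** The sets whose intersection with the box carries integral 0 form a Dynkin system. It contains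
    the open boxes, which are stable under intersection and generate the measurable sets; a function
    all of whose integrals are 0 vanishes almost everywhere. *)
Lemma box_ae_eq0 Omega f a b : measurable Omega -> inL1loc Omega f ->
  (forall psi, test_function Omega psi -> (\int[mu]_(x in Omega) (f x * psi x)%:E = 0)%E) ->
  closed_box a b `<=` Omega ->
  {ae mu, forall x, open_box a b x -> f x = 0}.
Proof.
move=> mO fL f0 abO; have mb := measurable_open_box a b.
have fi : mu.-integrable (open_box a b) (EFin \o f).
  apply: (integrableS (measurable_closed_box a b)) => //; first exact: open_closed_box.
  by apply: fL => //; exact: compact_closed_box.
have mf := measurable_int _ fi.
suff H S : measurable S -> (\int[mu]_(x in S `&` open_box a b) (f x)%:E = 0)%E.
  have := @integral_ae_eq _ _ _ mu _ mb (cst 0)%E (EFin \o f) fi (measurable_cst _).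
  have E : forall S, S `<=` open_box a b -> measurable S ->
      (\int[mu]_(x in S) (EFin \o f) x = \int[mu]_(x in S) cst 0 x)%E.
    by move=> S Sab mS; rewrite -{1}(setIidl Sab) H// integral0.
  move=> /(_ E); apply: filterS => x /= fx xab.
  by apply: EFin_inj; exact: fx.
move: S; rewrite open_boxes_generate.
apply: (dynkin_induction (P := fun S => \int[mu]_(x in S `&` open_box a b) (f x)%:E = 0)%E open_boxes_generate).
- move=> _ _ [cd ->] [cd' ->]; rewrite open_boxI.
  by exists (max_rV cd'.1 cd.1, min_rV cd'.2 cd.2).
- by rewrite setTI (integral_box_eq0 mO fL f0 abO).
- move=> _ [cd ->]; rewrite open_boxI (integral_box_eq0 mO fL f0)//.
  exact: subset_trans (@closed_box_sub a b cd.1 cd.2) abO.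
- move=> S mS S0; have := integral_box_eq0 mO fL f0 abO.
  rewrite -[X in (\int[mu]_(x in X) _)%E](setTI (open_box a b)) -(setUv S) setIUl.
  rewrite integral_setU//; [|exact: measurableI|apply: measurableI => //; exact: measurableC| |].
  + by rewrite S0 add0e.
  + by apply: (measurable_funS mb) => // x [|] [].
  + by apply/disj_setPS => x [[Sx _] [nSx _]].
- move=> F mF tF F0; rewrite setI_bigcupl integral_bigcup.
  + by rewrite eseries0// => k _ _; exact: F0.
  + apply/trivIsetP => i j _ _ ij; rewrite setIACA setIid.
    by move/trivIsetP : tF => /(_ i j I I ij) ->; rewrite set0I.
  + by move=> k; exact: measurableI.
  + rewrite -setI_bigcupl; apply: (integrableS mb) => //.
    by apply: measurableI => //; exact: bigcupT_measurable.
Qed.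

(** Countably many rational boxes exhaust [Omega], so that the exceptional null sets can be
    united. *)
Lemma fundamental_lemma Omega f : open Omega -> inL1loc Omega f ->
  (forall psi, test_function Omega psi -> (\int[mu]_(x in Omega) (f x * psi x)%:E = 0)%E) ->
  {ae mu, forall x, Omega x -> f x = 0}.
Proof.
move=> oO fL f0; have mO := measurable_open oO.
pose P (k : nat) (x : V) := forall ab : 'rV[rat]_n * 'rV[rat]_n, unpickle k = Some ab ->
  closed_box (map_mx (ratr : rat -> R) ab.1) (map_mx ratr ab.2) `<=` Omega ->
  open_box (map_mx (ratr : rat -> R) ab.1) (map_mx ratr ab.2) x -> f x = 0.
have : {ae mu, forall x, forall k, P k x}.
  apply: ae_foralln => k; rewrite /P; case E : (unpickle k) => [ab|]; last first.
    by apply: aeW => x ab; discriminate.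
  have [abO|abO] := pselect (closed_box (map_mx (ratr : rat -> R) ab.1) (map_mx ratr ab.2) `<=` Omega).
    have := box_ae_eq0 mO fL f0 abO.
    by apply: filterS => x H _ [<-] _; exact: H.
  by apply: aeW => x _ [<-].
apply: filterS => x H Ox; have [ab [xab abO]] := rat_box oO Ox.
by apply: (H (pickle ab) ab) => //; rewrite pickleK.
Qed.

End fundamental_lemma.

Section weak_derivatives.
Context {R : realType} {n : nat}.
Local Notation V := 'rV[R]_n.
Local Notation mu := (lebesgue_rV R n).
Variables (Omega : set V) (oO : open Omega).
Implicit Types (f g psi a : V -> R).
Let mO := measurable_open oO.

Lemma L1locD f g : inL1loc Omega f -> inL1loc Omega g -> inL1loc Omega (fun x => f x + g x).
Proof.
move=> fL gL K cK KO.
have -> : EFin \o (fun x => f x + g x) = ((EFin \o f) \+ (EFin \o g))%E by [].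
by apply: integrableD; [exact: measurable_compact|exact: fL|exact: gL].
Qed.

Lemma L1locM a f : continuous a -> inL1loc Omega f -> inL1loc Omega (fun x => a x * f x).
Proof.
move=> ca fL K cK KO; have mK := measurable_compact cK.
have : compact (a @` K) by apply: continuous_compact => //; exact: continuous_subspaceT.
move=> /compact_bounded[M [Mr HM]].
have fi := fL K cK KO.
apply: (@le_integrable _ _ _ _ _ mK _ (fun x => ((`|M| + 1) * f x)%:E)).
- apply/measurable_EFinP; apply: measurable_funM; first exact: continuous_measurable.
  by apply/measurable_EFinP; exact: measurable_int fi.
- move=> x Kx; rewrite /= lee_fin !normrM ler_wpM2r// [leRHS]ger0_norm ?addr_ge0//.
  by apply: (HM (`|M| + 1)); [rewrite (le_lt_trans (ler_norm M))// ltrDl|exists x].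
- by under eq_fun do rewrite EFinM; apply: integrableZl.
Qed.

Lemma L1locN f : inL1loc Omega f -> inL1loc Omega (fun x => - f x).
Proof.
move=> /(@L1locM (cst (-1)) f (@cst_continuous _ _ _)); congr inL1loc.
by apply/funext => x; rewrite mulN1r.
Qed.

Lemma test_pderiv i psi : test_function Omega psi -> test_function Omega (pderiv i psi).
Proof.
move=> [sp cp pO]; apply: (test_functionP (smooth_pderiv i sp) cp) => // x /eqP nz.
apply: contrapT => xN; apply: nz; rewrite /pderiv -(@near_eq_derive _ _ _ (cst 0)) ?derive_cst//.
have : nbhs x (~` closure [set x | psi x != 0]).
  by apply: open_nbhs_nbhs; split => //; apply: closed_openC; exact: closed_closure.
apply: filterS => y yN /=; apply/esym/eqP/negPn/negP => nzy; apply: yN.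
exact: subset_closure.
Qed.

Lemma test_integrable f psi : inL1loc Omega f -> test_function Omega psi ->
  mu.-integrable Omega (fun x => (f x * psi x)%:E).
Proof.
move=> fL [sp cp pO]; set K := closure _ in cp pO.
apply: (proj2 (integrable_mkcond _ mO)).
have -> : (fun x => (f x * psi x)%:E) \_ Omega = (fun x => (psi x * f x)%:E) \_ K.
  apply/funext => x; rewrite !patchE; case: ifPn => [/set_mem Ox|/negP xO].
    rewrite mulrC; case: ifPn => // /negP xK; have [->|nz] := eqVneq (psi x) 0; first by rewrite mul0r.
    by exfalso; apply: xK; apply/mem_set; exact: subset_closure.
  by case: ifPn => // /set_mem /pO/mem_set.
apply: (proj1 (integrable_mkcond _ (measurable_compact cp))).
by apply: L1locM => //; exact: smooth_continuous.
Qed.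

Lemma weak_pderiv_unique i f g1 g2 : weak_pderiv Omega i f g1 -> weak_pderiv Omega i f g2 ->
  {ae mu, forall x, Omega x -> g1 x = g2 x}.
Proof.
move=> [fL g1L H1] [_ g2L H2].
have := @fundamental_lemma R n Omega (fun x => g1 x - g2 x) oO (L1locD g1L (L1locN g2L)).
have H psi : test_function Omega psi -> (\int[mu]_(x in Omega) ((g1 x - g2 x) * psi x)%:E = 0)%E.
  move=> tp; under eq_integral do rewrite mulrBl EFinB.
  have i1 := test_integrable g1L tp; have i2 := test_integrable g2L tp.
  rewrite integralB//; have := H1 psi tp; rewrite (H2 psi tp) => /oppe_inj ->.
  by rewrite subee// integrable_fin_num.
by move=> /(_ H); apply: filterS => x h /h /eqP; rewrite subr_eq0 => /eqP.
Qed.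

(** The derivative of [f] is tested with [a psi]. The rule converts the divergence form of the
    operator, whose coefficients are smooth, into the non-divergence form [wave]. *)
Lemma weak_pderivM i a f g : smooth a -> weak_pderiv Omega i f g ->
  weak_pderiv Omega i (fun x => a x * f x) (fun x => pderiv i a x * f x + a x * g x).
Proof.
move=> sa [fL gL H]; have ca := smooth_continuous sa.
have cda := smooth_continuous (smooth_pderiv i sa).
split; [exact: L1locM|by apply: L1locD; exact: L1locM|].
move=> psi tp; have [sp _ _] := tp.
have := H _ (test_functionM tp sa).
have tap := test_functionM (test_pderiv i tp) sa.
have tpa := test_functionM tp (smooth_pderiv i sa).
have E x : (f x * pderiv i (fun x => a x * psi x) x)%:E =
    ((f x * (a x * pderiv i psi x))%:E + (f x * (pderiv i a x * psi x))%:E)%E.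
  rewrite pderivM; [|exact: smooth_derivable|exact: smooth_derivable].
  by rewrite -EFinD; congr EFin; ring.
under eq_integral do rewrite E.
rewrite integralD//; [|exact: test_integrable|exact: test_integrable].
move=> H1.
have E1 : (\int[mu]_(x in Omega) (a x * f x * pderiv i psi x)%:E =
    \int[mu]_(x in Omega) (f x * (a x * pderiv i psi x))%:E)%E.
  by apply: eq_integral => x _; congr EFin; ring.
have E2 : (\int[mu]_(x in Omega) ((pderiv i a x * f x + a x * g x) * psi x)%:E =
    \int[mu]_(x in Omega) (f x * (pderiv i a x * psi x))%:E +
    \int[mu]_(x in Omega) (g x * (a x * psi x))%:E)%E.
  rewrite -integralD//; [|exact: (test_integrable fL tpa)|exact: (test_integrable gL (test_functionM tp sa))].
  by apply: eq_integral => x _; rewrite -EFinD; congr EFin; ring.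
rewrite E1 E2; move: H1.
have : (\int[mu]_(x in Omega) (f x * (a x * pderiv i psi x))%:E)%E \is a fin_num.
  by apply: integrable_fin_num => //; exact: test_integrable.
have : (\int[mu]_(x in Omega) (f x * (pderiv i a x * psi x))%:E)%E \is a fin_num.
  by apply: integrable_fin_num => //; exact: test_integrable.
have : (\int[mu]_(x in Omega) (g x * (a x * psi x))%:E)%E \is a fin_num.
  by apply: integrable_fin_num => //; exact: (test_integrable gL (test_functionM tp sa)).
move: (integral _ _ _) (integral _ _ _) (integral _ _ _) => [x| |] [y| |] [z| |] //= _ _ _ [e].
by congr EFin; lra.
Qed.

(** Moving both derivatives onto the test function leaves the same mixed derivative of [psi] on
    either side. Hence the commutators of the fields approximating the gradient of [u] tend to 0. *)
Lemma weak_pderivC i j u ui uj uij uji : weak_pderiv Omega i u ui -> weak_pderiv Omega j u uj ->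
  weak_pderiv Omega j ui uij -> weak_pderiv Omega i uj uji ->
  {ae mu, forall x, Omega x -> uij x = uji x}.
Proof.
move=> [uL uiL Hi] [_ ujL Hj] [_ uijL Hij] [_ ujiL Hji].
have := @fundamental_lemma R n Omega (fun x => uij x - uji x) oO (L1locD uijL (L1locN ujiL)).
have H psi : test_function Omega psi -> (\int[mu]_(x in Omega) ((uij x - uji x) * psi x)%:E = 0)%E.
  move=> tp; have [sp _ _] := tp; under eq_integral do rewrite mulrBl EFinB.
  have i1 := test_integrable uijL tp; have i2 := test_integrable ujiL tp.
  rewrite integralB//; suff -> : (\int[mu]_(x in Omega) (uij x * psi x)%:E =
      \int[mu]_(x in Omega) (uji x * psi x)%:E)%E by rewrite subee// integrable_fin_num.
  have e3 := Hi _ (test_pderiv j tp); have e4 := Hj _ (test_pderiv i tp).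
  rewrite (pderivC j i sp) in e3.
  apply: oppe_inj; apply: etrans (esym (Hij _ tp)) _; apply: etrans _ (Hji _ tp).
  by apply: oppe_inj; exact: etrans (esym e3) e4.
by move=> /(_ H); apply: filterS => x h /h /eqP; rewrite subr_eq0 => /eqP.
Qed.

End weak_derivatives.

Section C1_functions.
Context {R : realType} {n : nat}.
Local Notation V := 'rV[R]_n.
Implicit Types (f g : V -> R).

Lemma C1_derivable f x i : C1 f -> derivable f x (delta_mx ord0 i).
Proof. by move=> [_ /(_ i)[+ _]]; exact. Qed.

Lemma C1_continuous f : C1 f -> continuous f.
Proof. by case. Qed.

Lemma C1_pderiv_continuous f i : C1 f -> continuous (pderiv i f).
Proof. by move=> [_ /(_ i)[]]. Qed.

Lemma continuousMx f g : continuous f -> continuous g -> continuous (fun x => f x * g x).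
Proof. by move=> cf cg x; exact: (cvgM (cf x) (cg x)). Qed.

Lemma continuousDx f g : continuous f -> continuous g -> continuous (fun x => f x + g x).
Proof. by move=> cf cg x; exact: (cvgD (cf x) (cg x)). Qed.

Lemma continuousBx f g : continuous f -> continuous g -> continuous (fun x => f x - g x).
Proof. by move=> cf cg x; exact: (cvgB (cf x) (cg x)). Qed.

Lemma continuous_sumx (I : Type) (r : seq I) (P : pred I) (F : I -> V -> R) :
  (forall i, continuous (F i)) -> continuous (fun x => \sum_(i <- r | P i) F i x).
Proof.
move=> sF; elim: r => [|a r IH].
  rewrite (_ : (fun x => _) = fun=> 0); first exact: cst_continuous.
  by apply/funext => x; rewrite big_nil.
rewrite (_ : (fun x => _) = if P a then
  (fun x => F a x + \sum_(i <- r | P i) F i x) else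
  (fun x => \sum_(i <- r | P i) F i x)).
  by case: (P a); [exact: (continuousDx (sF a) IH)|exact: IH].
by apply/funext => x; rewrite big_cons; case: (P a).
Qed.

Lemma C1M f g : C1 f -> C1 g -> C1 (fun x => f x * g x).
Proof.
move=> cf cg; have [f0 f1] := cf; have [g0 g1] := cg.
split; first exact: continuousMx.
move=> i; split; first by move=> x; apply: derivableM; exact: C1_derivable.
rewrite (_ : pderiv i _ = fun x => f x * pderiv i g x + g x * pderiv i f x).
  by apply: continuousDx; apply: continuousMx => //; exact: C1_pderiv_continuous.
by apply/funext => x; apply: pderivM; exact: C1_derivable.
Qed.

Lemma continuous_col' (i : 'I_n) : continuous (fun x : V => col' i x : 'rV[R]_n.-1).
Proof.
move=> x; apply: continuous_rV => j.
rewrite (_ : (fun t => _) = (fun t : V => t ord0 (lift i j))); first exact: continuous_coord.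
by apply/funext => t; rewrite mxE.
Qed.

End C1_functions.

Lemma eq_integral_dom d (T : measurableType d) (R : realType) (m : {measure set T -> \bar R})
  (A B : set T) (f : T -> \bar R) : (forall x, A x -> ~ B x -> f x = 0%E) ->
  (forall x, B x -> ~ A x -> f x = 0%E) -> (\int[m]_(x in A) f x = \int[m]_(x in B) f x)%E.
Proof.
move=> AB BA; rewrite [LHS]integral_mkcond [RHS]integral_mkcond; apply: eq_integral => t _.
rewrite !patchE; case: ifPn => [/set_mem At|/negP At]; case: ifPn => [/set_mem Bt|/negP Bt] //.
- by apply: AB => // Bt'; apply: Bt; exact: mem_set.
- by rewrite BA// => At'; apply: At; exact: mem_set.
Qed.

Section half_line.
Context {R : realType}.
Local Notation leb := (@lebesgue_measure R).

(** [sg] treats the half-lines on both sides of [h] at once, so that the two orientations of a chart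
    need no separate arguments later. *)
Lemma integral_half_line (g dg : R -> R) (sg h a b : R) : sg = 1 \/ sg = -1 ->
  (forall t : R, is_derive t 1 g (dg t)) -> continuous dg ->
  (forall t, ~ (a <= t <= b) -> g t = 0 /\ dg t = 0) ->
  (\int[leb]_(t in [set t | (0 < sg * (t - h))%R]) (dg t)%:E = (- (sg * g h))%:E)%E.
Proof.
move=> sg1 dE cdg g0.
pose a' := Num.min a h - 1; pose b' := Num.max b h + 1.
have h1 : Num.min a h <= a by rewrite ge_min lexx.
have h2 : Num.min a h <= h by rewrite ge_min lexx orbT.
have h3 : b <= Num.max b h by rewrite le_max lexx.
have h4 : h <= Num.max b h by rewrite le_max lexx orbT.
have ah : a' < h by rewrite /a'; lra.
have hb : h < b' by rewrite /b'; lra.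
have [ga _] : g a' = 0 /\ dg a' = 0.
  by apply: g0; rewrite /a' => /andP[hh _]; lra.
have [gb _] : g b' = 0 /\ dg b' = 0.
  by apply: g0; rewrite /b' => /andP[_ hh]; lra.
have mdg : measurable_fun [set: measurableTypeR R] dg by exact: continuous_measurable_fun.
case: sg1 => ->.
- transitivity (\int[leb]_(t in `]h, b']) (dg t)%:E)%E; last first.
    rewrite integral_itv_obnd_cbnd; last by apply/measurable_EFinP; apply: measurable_funTS; exact: mdg.
    by rewrite (FTC hb dE cdg) gb mul1r sub0r.
  apply: eq_integral_dom => t /=; rewrite in_itv/= mul1r subr_gt0.
    move=> ht; rewrite ht/= => /negP; rewrite -ltNge => bt.
    by have [_ ->] : g t = 0 /\ dg t = 0 by apply: g0; move: bt; rewrite /b' => bt /andP[_ ?]; lra.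
  by move=> /andP[ht _].
- transitivity (\int[leb]_(t in `[a', h[) (dg t)%:E)%E; last first.
    rewrite integral_itv_bndo_bndc; last by apply/measurable_EFinP; apply: measurable_funTS; exact: mdg.
    by rewrite (FTC ah dE cdg) ga mulN1r opprK subr0.
  apply: eq_integral_dom => t /=; rewrite in_itv/= mulN1r opprB subr_gt0.
    move=> ht; rewrite ht andbT => /negP; rewrite -ltNge => bt.
    by have [_ ->] : g t = 0 /\ dg t = 0 by apply: g0; move: bt; rewrite /a' => bt /andP[? _]; lra.
  by move=> /andP[_ ht].
Qed.

End half_line.

Section density_measure.
Context d1 d2 (X : measurableType d1) (Y : measurableType d2) (R : realType).
Local Open Scope ereal_scope.
Import HBNNSimple.

(* [m] is the image under [p] of the measure with density [J] on [P]. *)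
Lemma ge0_integral_density (m : {measure set X -> \bar R}) (mu : {measure set Y -> \bar R})
  (D : set X) (P : set Y) (p : Y -> X) (J : Y -> R) (f : X -> \bar R) :
  measurable D -> measurable P -> measurable_fun [set: Y] p ->
  measurable_fun [set: Y] J -> (forall y, (0 <= J y)%R) ->
  P = p @^-1` D ->
  (forall A, measurable A -> A `<=` D -> m A = \int[mu]_(y in p @^-1` A) (J y)%:E) ->
  measurable_fun [set: X] f -> (forall x, 0 <= f x) ->
  \int[m]_(x in D) f x = \int[mu]_(y in P) (f (p y) * (J y)%:E).
Proof.
move=> mD mP mp mJ J0 PE mA mf f0.
have mfD : measurable_fun D f by exact: measurable_funTS.
have mJP : measurable_fun P (fun y => (J y)%:E) by apply/measurable_EFinP; exact: measurable_funTS.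
have J0E y : 0 <= (J y)%:E by rewrite lee_fin.
have mpre A : measurable A -> measurable (p @^-1` A).
  by move=> mA'; rewrite -[X in measurable X]setTI; exact: mp.
pose f_ := nnsfun_approx mD mfD.
have mfp k : measurable_fun P (fun y => (f_ k (p y))%:E).
  apply/measurable_EFinP; apply: measurable_funTS; apply: measurableT_comp => //.
transitivity (limn (fun k => \int[m]_(x in D) (f_ k x)%:E)).
  rewrite -monotone_convergence//.
  - apply: eq_integral => y /[!inE] yD; apply/esym/cvg_lim => //.
    by apply: cvg_nnsfun_approx=> // *; apply: f0; rewrite inE.
  - by move=> k; exact/measurable_EFinP/measurable_funTS.
  - by move=> k y _; rewrite lee_fin.
  - by move=> y _ k l kl; rewrite lee_fin; exact/lefP/nd_nnsfun_approx.
rewrite [X in limn X](_ : _ = (fun k => \int[mu]_(y in P) ((f_ k (p y))%:E * (J y)%:E))).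
  rewrite -monotone_convergence//; last 3 first.
  - by move=> k; apply: emeasurable_funM.
  - by move=> k x _ /=; rewrite mule_ge0// lee_fin.
  - by move=> x _ k l kl; rewrite lee_wpmul2r// lee_fin; exact/lefP/nd_nnsfun_approx.
  apply: eq_integral => x /[!inE] Px; apply/cvg_lim => //.
  apply: cvgeZr => //; apply: cvg_nnsfun_approx=> //; move: Px; rewrite PE//.
apply/funext => k.
have mfk r : measurable (f_ k @^-1` [set r]) by exact: measurable_sfunP.
have mfkp r : measurable (p @^-1` (f_ k @^-1` [set r])) by exact: mpre.
transitivity (\sum_(r \in range (f_ k))
    \int[mu]_(y in P) ((r * \1_(f_ k @^-1` [set r]) (p y))%:E * (J y)%:E)).
  under eq_integral do rewrite fimfunE -fsumEFin//.
  rewrite ge0_integral_fsum//; last 2 first.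
  - by move=> y; exact/measurable_EFinP/measurable_funM.
  - by move=> y x _; rewrite nnfun_muleindic_ge0.
  apply: eq_fsbigr => r /set_mem[x0 _ rE]; have r0 : (0 <= r)%R by rewrite -rE.
  rewrite integralZl_indic_nnsfun// integral_indic//=.
  rewrite (eq_integral (fun y => r%:E * (\1_(f_ k @^-1` [set r]) (p y) * J y)%:E)); last first.
    by move=> y _; rewrite -!EFinM mulrA.
  rewrite ge0_integralZl//; last 2 first.
  - apply/measurable_EFinP; apply: measurable_funM; last exact: measurable_funTS.
    exact: (@measurable_indic _ _ _ _ (p @^-1` (f_ k @^-1` [set r]))).
  - by move=> y _; rewrite lee_fin mulr_ge0.
  congr (_ * _); rewrite mA; [|exact: measurableI|by move=> x []].
  rewrite preimage_setI setIC -PE integral_mkcondr; apply: eq_integral => y _.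
  rewrite patchE indicE.
  have -> : (p y \in f_ k @^-1` [set r]) = (y \in p @^-1` (f_ k @^-1` [set r])).
    by apply/idP/idP; rewrite !inE.
  by case: ifP => _; rewrite ?mul1r ?mul0r.
rewrite -ge0_integral_fsum//.
- apply: eq_integral => x _; rewrite -ge0_mule_fsuml; last by move=> r; exact: nnfun_muleindic_ge0.
  by rewrite fsumEFin// -fimfunE.
- move=> r; apply: emeasurable_funM => //; apply/measurable_EFinP; apply: measurable_funM => //.
  exact: (@measurable_indic _ _ _ _ (p @^-1` (f_ k @^-1` [set r]))).
- by move=> r x _; rewrite mule_ge0// nnfun_muleindic_ge0.
Qed.

End density_measure.

(** * The divergence theorem outside a compact hypersurface *)

Section covers.
Context {R : realType} {n : nat}.
Local Notation V := 'rV[R]_n.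

Lemma compact_boxes (K : set V) (P : V -> V -> Prop) : compact K ->
  (forall x, K x -> exists a b, open_box a b x /\ P a b) ->
  exists s : seq (V * V), (forall ab, ab \in s -> P ab.1 ab.2) /\
    forall x, K x -> exists2 ab, ab \in s & open_box ab.1 ab.2 x.
Proof.
move=> cK HP.
have : exists f : V -> V * V, forall x, K x -> open_box (f x).1 (f x).2 x /\ P (f x).1 (f x).2.
  suff /choice[f fP] : forall x, exists ab : V * V, K x -> open_box ab.1 ab.2 x /\ P ab.1 ab.2 by exists f.
  move=> x; have [Kx|NK] := pselect (K x); last by exists (0, 0).
  by have [a [b H]] := HP x Kx; exists (a, b).
move=> [f fP].
move: cK; rewrite compact_cover => /(_ _ K (fun x => open_box (f x).1 (f x).2)).
case.
- by move=> x _; exact: open_open_box.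
- by move=> x Kx; exists x => //; have [] := fP x Kx.
- move=> D DK Kcov; exists [seq f x | x <- (finmap.enum_fset D : seq V)]; split.
    by move=> ab /mapP[x xD ->]; have := DK x xD => /set_mem /fP[].
  by move=> x /Kcov[y yD xy]; exists (f y) => //; apply/mapP; exists y.
Qed.

(** A local-to-global principle for properties of sets: finiteness of the area and measurability of
    the normal are obtained from charts in this way. *)
Lemma compact_box_ind (K : set V) (Q : set V -> Prop) : compact K -> Q set0 ->
  (forall A B, measurable A -> measurable B -> Q A -> Q B -> Q (A `|` B)) ->
  (forall x, K x -> exists a b, open_box a b x /\ Q (K `&` open_box a b)) -> Q K.
Proof.
move=> cK Q0 QU HQ.
have [s [sQ sK]] := compact_boxes cK HQ.
have -> : K = \big[setU/set0]_(ab <- s) (K `&` open_box ab.1 ab.2).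
  apply/seteqP; split=> [x Kx|x].
    have [ab abs abx] := sK x Kx.
    by rewrite -bigcup_seq; exists ab.
  by rewrite -bigcup_seq => -[ab _ []].
have mK := measurable_compact cK.
rewrite big_seq.
suff [] : measurable (\big[setU/set0]_(ab <- s | ab \in s) (K `&` open_box ab.1 ab.2)) /\
  Q (\big[setU/set0]_(ab <- s | ab \in s) (K `&` open_box ab.1 ab.2)) by [].
apply: (big_ind (fun A => measurable A /\ Q A)).
- by split; [exact: measurable0|].
- by move=> A B [mA QA] [mB QB]; split; [exact: measurableU|exact: QU].
- by move=> ab /sQ; split => //; apply: measurableI => //; exact: measurable_open_box.
Qed.

End covers.

Section charts.
Context {R : realType} {n : nat}.
Local Notation V := 'rV[R]_n.
Local Notation e_ i := (delta_mx ord0 i : V).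
Local Notation mu := (lebesgue_rV R n).

Variables (S Oi : set V) (nu : V -> V) (sigma : {measure set V -> \bar R}).
Hypotheses (cS : compact S) (oOi : open Oi) (OiS : Oi `&` S = set0)
  (clOi : closure Oi = Oi `|` S) (nuP : outer_unit_normal Oi S nu)
  (sigmaP : area_measure S sigma).
Local Notation Oe := (~` closure Oi).

(* Near a point of [S], the sign of [chart_fun i sg h] separates [Oi] from [Oe]. *)
Definition chart_fun (i : 'I_n) (sg : R) (h : 'rV[R]_n.-1 -> R) (x : V) : R :=
  sg * (x ord0 i - h (col' i x)).

Definition chart i sg h (B : set V) := [/\ sg = 1 \/ sg = -1, smooth h, open B
  & forall x, B x -> (S x <-> x ord0 i = h (col' i x)) /\ (Oi x <-> chart_fun i sg h x < 0)].

Definition chart_grad (i : 'I_n) (sg : R) (h : 'rV[R]_n.-1 -> R) (x : V) (k : 'I_n) : R :=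
  if unlift i k is Some j then - (sg * pderiv j h (col' i x)) else sg.

(** Both the density of the area on the graph and the Euclidean norm of [chart_grad]; this
    coincidence turns the surface integral of the normal component of a field into the integral,
    over the base of the graph, of its product with [chart_grad]. *)
Definition chart_area (h : 'rV[R]_n.-1 -> R) y : R := Num.sqrt (1 + \sum_j pderiv j h y ^+ 2).

Lemma chart_area_gt0 h y : 0 < chart_area h y.
Proof. by rewrite sqrtr_gt0 ltr_wpDr// sumr_ge0// => j _; rewrite sqr_ge0. Qed.

Lemma continuous_chart_area h : smooth h -> continuous (chart_area h).
Proof.
move=> sh y.
apply: (@continuous_comp _ _ _ (fun y => 1 + \sum_j pderiv j h y ^+ 2) Num.sqrt); last exact: sqrt_continuous.
apply: continuousDx; first exact: cst_continuous.
apply: continuous_sumx => j; rewrite (_ : (fun y => _) = fun y => pderiv j h y * pderiv j h y).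
  by apply: continuousMx; exact: (@smooth_continuous _ _ _ (smooth_pderiv j sh)).
by apply/funext => z; rewrite expr2.
Qed.

Lemma ex_chart x : S x -> exists i (sg : R) h B, chart i sg h B /\ B x.
Proof.
move=> Sx; have [_ [U [phi [oU Ux sphi phiP _]]]] := nuP Sx.
have [Sphi _ gphi] := phiP x Ux.
have [i [sg [h [W [sg1 sh oW Wx HW]]]]] := local_graph sphi (proj1 Sphi Sx) gphi.
exists i, sg, h, (U `&` W); split; last by split.
split => //; first exact: openI.
move=> y [Uy Wy]; have [Sy Oy _] := phiP y Uy; have [H1 H2] := HW y Wy.
split; first exact: (iff_trans Sy H1).
exact: (iff_trans Oy H2).
Qed.

Lemma chart_ext i sg h B x : chart i sg h B -> B x -> (Oe x <-> 0 < chart_fun i sg h x).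
Proof.
move=> [sg1 _ _ HB] Bx; have [H1 H2] := HB x Bx; rewrite clOi.
have H3 : S x <-> chart_fun i sg h x = 0.
  rewrite H1 /chart_fun; split=> [->|]; first by rewrite subrr mulr0.
  by case: sg1 => -> /eqP; rewrite ?mul1r ?mulN1r ?oppr_eq0 subr_eq0 => /eqP.
split=> [/not_orP[/H2 N1 /H3 N2]|p [/H2|/H3 e0]].
- by have [//|//|//] := ltgtP (chart_fun i sg h x) 0.
- by move: p => /lt_trans/[apply]; rewrite ltxx.
- by move: p; rewrite e0 ltxx.
Qed.

Lemma chart_grad_same i sg h x : chart_grad i sg h x i = sg.
Proof. by rewrite /chart_grad unlift_none. Qed.

Lemma chart_grad_lift i sg h x j :
  chart_grad i sg h x (lift i j) = - (sg * pderiv j h (col' i x)).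
Proof. by rewrite /chart_grad liftK. Qed.

Lemma col'D i (x y : V) (t : R) :
  col' i (t *: x + y) = t *: (col' i x : 'rV[R]_n.-1) + col' i y.
Proof. by apply/rowP => j; rewrite !mxE. Qed.

Lemma col'_delta_same i : col' i (e_ i) = 0 :> 'rV[R]_n.-1.
Proof. by apply/rowP => j; rewrite !mxE [lift _ _ == _]eq_sym (negPf (neq_lift _ _)) andbF. Qed.

Lemma col'_delta_lift i j : col' i (e_ (lift i j)) = delta_mx ord0 j :> 'rV[R]_n.-1.
Proof. by apply/rowP => k; rewrite !mxE (inj_eq (@lift_inj _ i)). Qed.

Lemma chart_fun_deriv i sg h x k : smooth h ->
  is_derive x (e_ k) (chart_fun i sg h) (chart_grad i sg h x k).
Proof.
move=> sh; have [j ->|->] := unliftP i k.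
  rewrite chart_grad_lift; apply/is_derive_line.
  rewrite (_ : (fun t => _) = fun t : R => sg * (x ord0 i - h (t *: delta_mx ord0 j + col' i x))); last first.
    apply/funext => t; rewrite /chart_fun col'D col'_delta_lift !mxE.
    by rewrite (negPf (neq_lift _ _)) andbF mulr0 add0r.
  have := proj1 (is_derive_line _ _ _ _) (derivableP (@smooth_derivable _ _ h j (col' i x) sh)).
  move=> H; have -> : - (sg * pderiv j h (col' i x)) = sg *: (0 - pderiv j h (col' i x)).
    by rewrite sub0r [_ *: _]mulrN.
  exact: (@is_deriveZ _ _ _ (cst (x ord0 i) - (fun t : R => h (t *: delta_mx ord0 j + col' i x)))
    sg _ _ _ (is_deriveB (is_derive_cst _ _ _) H)).
rewrite chart_grad_same; apply/is_derive_line.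
rewrite (_ : (fun t => _) = fun t : R => sg * (t + (x ord0 i - h (col' i x)))); last first.
  by apply/funext => t; rewrite /chart_fun col'D col'_delta_same scaler0 add0r !mxE !eqxx mulr1 addrA.
apply: is_derive_eq; rewrite ?scaler0 ?addr0; exact: mulr1.
Qed.

Lemma chart_grad_continuous i sg h k : smooth h -> continuous (fun x => chart_grad i sg h x k).
Proof.
move=> sh; have [j ->|->] := unliftP i k; last first.
  rewrite (_ : (fun x => _) = fun=> sg); first exact: cst_continuous.
  by apply/funext => x; rewrite chart_grad_same.
rewrite (_ : (fun x => _) = fun x => - sg * pderiv j h (col' i x)).
  apply: continuousMx; first exact: cst_continuous.
  move=> x; apply: continuous_comp; first exact: continuous_col'.
  exact: (@smooth_continuous _ _ _ (smooth_pderiv j sh)).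
by apply/funext => x; rewrite chart_grad_lift mulNr.
Qed.

Lemma chart_fun_continuous i sg h : smooth h -> continuous (chart_fun i sg h).
Proof.
move=> sh; rewrite (_ : chart_fun _ _ _ = fun x => sg * (x ord0 i + (-1) * h (col' i x))).
  apply: continuousMx; first exact: cst_continuous.
  apply: continuousDx; first exact: continuous_coord.
  apply: continuousMx; first exact: cst_continuous.
  move=> x; apply: continuous_comp; first exact: continuous_col'.
  exact: (@smooth_continuous _ _ _ sh).
by apply/funext => x; rewrite mulN1r.
Qed.

(** [nu] comes with its own defining function [phi]. The derivatives of [phi] along curves of the
    graph vanish, so its gradient is a multiple of the chart gradient; the multiple is nonnegative
    because both functions are negative on [Oi], and comparing lengths determines it. *)
Lemma chart_normal i sg h B x k : chart i sg h B -> B x -> S x ->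
  chart_grad i sg h x k = chart_area h (col' i x) * nu x ord0 k.
Proof.
move=> [sg1 sh oB HB] Bx Sx; have [nu1 [U [phi [oU Ux sphi phiP [c c0 gE]]]]] := nuP Sx.
have dE l : pderiv l phi x = c * nu x ord0 l.
  by have := congr1 (fun v : V => v ord0 l) gE; rewrite !mxE.
have phix : phi x = 0 by have [/proj1/(_ Sx)] := phiP x Ux.
have sg2 : sg * sg = 1 by case: sg1 => ->; rewrite ?mulrNN mulr1.
have UB : nbhs x (U `&` B) by apply: open_nbhs_nbhs; split; [exact: openI|].
(* The curve moves in the direction [lift i j] and follows the graph vertically by [eta], so that
   near 0 it stays in [S], where [phi] is 0. *)
have tangent j : pderiv (lift i j) phi x = - (pderiv j h (col' i x) * pderiv i phi x).
  pose eta (t : R) : R := h (t *: delta_mx ord0 j + col' i x) - h (col' i x).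
  have deta : is_derive (0 : R) 1 eta (pderiv j h (col' i x)).
    have H := proj1 (is_derive_line _ _ _ _) (derivableP (@smooth_derivable _ _ h j (col' i x) sh)).
    rewrite -[pderiv _ _ _]subr0; exact: (is_deriveB H (is_derive_cst _ _ _)).
  have eta0 : eta 0 = 0 by rewrite /eta scale0r add0r subrr.
  have ceta : eta t @[t --> (0 : R)] --> (0 : R).
    rewrite -[X in _ --> X]eta0; apply: differentiable_continuous.
    by apply/derivable1_diffP; exact: is_derive_ex deta.
  have H := @is_derive_curve R n phi x (e_ (lift i j)) (e_ i) eta _
    (fun y => @smooth_derivable _ _ _ i y sphi)
    (@smooth_continuous _ _ _ (smooth_pderiv i sphi) x)
    (@smooth_derivable _ _ _ (lift i j) x sphi) eta0 deta.
  have curve : (t *: e_ (lift i j) + eta t *: e_ i + x) @[t --> (0 : R)] --> x.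
    have -> : nbhs x = nbhs (0 *: e_ (lift i j) + 0 *: e_ i + x) by rewrite !scale0r !add0r.
    apply: cvgD; last exact: cvg_cst.
    by apply: cvgD; [apply: cvgZr_tmp; exact: cvg_id|exact: cvgZr_tmp].
  have := is_derive_val H; rewrite -(@near_eq_derive _ _ _ (cst 0)).
  - rewrite derive_cst => /esym/eqP; rewrite addr_eq0 => /eqP E.
    by rewrite [LHS]E mulrC.
  - have C : \forall t \near (0 : R), (U `&` B) (t *: e_ (lift i j) + eta t *: e_ i + x) := curve _ UB.
    apply: filterS C => t [Uy By].
    have [Sy _ _] := phiP _ Uy; have [Sy' _] := HB _ By.
    apply/esym/Sy/Sy'; rewrite -addrA !col'D col'_delta_lift col'_delta_same scaler0 add0r.
    rewrite !mxE (negPf (neq_lift _ _)) !andbF mulr0 add0r !eqxx mulr1 /eta.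
    have [/(_ Sx) -> _] := (HB x Bx).1; by rewrite subrK.
pose al := sg * pderiv i phi x.
have gN l : c * nu x ord0 l = al * chart_grad i sg h x l.
  rewrite -dE /al; have [j ->|->] := unliftP i l.
    rewrite chart_grad_lift tangent mulrN; congr (- _).
    by transitivity (sg * sg * (pderiv j h (col' i x) * pderiv i phi x)); [rewrite sg2 mul1r|ring].
  by rewrite chart_grad_same mulrAC sg2 mul1r.
(* If [al] were negative, [sg] times the difference quotient of [phi] in the direction [e_i] would
   be negative near 0. But a short step of sign [- sg] enters [Oi], where [phi < 0], and there this
   quantity is nonnegative. *)
have al0 : 0 <= al.
  rewrite leNgt; apply/negP => aln.
  have /is_derive_at0P := proj1 (is_derive_line _ _ _ _) (derivableP (@smooth_derivable _ _ phi i x sphi)).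
  rewrite scale0r add0r phix => H.
  have {}H : sg * (t^-1 * (phi (t *: e_ i + x) - 0)) @[t --> 0^'] --> al.
    exact: cvgM (cvg_cst _) H.
  have line : (t *: e_ i + x) @[t --> (0 : R)] --> x.
    have -> : nbhs x = nbhs (0 *: e_ i + x) by rewrite scale0r add0r.
    apply: cvgD; last exact: cvg_cst.
    by apply: cvgZr_tmp; exact: cvg_id.
  have : \forall t \near (0 : R)^', sg * (t^-1 * (phi (t *: e_ i + x) - 0)) < 0.
    by move/cvgrPdist_lt : H => /(_ (- al)); rewrite oppr_gt0 => /(_ aln);
      apply: filterS => t; rewrite ltr_distlC => /andP[_]; rewrite subrr.
  move=> /(filterI (nbhs_dnbhs (line _ UB))).
  rewrite /dnbhs/= /within/= => /nbhs_ballP[e /= e0 He].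
  have sgn : sg != 0 by case: sg1 => ->; rewrite ?oppr_eq0 oner_eq0.
  pose t := - sg * (e / 2).
  have /He[|[Ut Bt]] : ball (0 : R) e t.
    rewrite /ball/= sub0r normrN /t normrM normrN ger0_norm ?ltW// ?divr_gt0//.
    have -> : `|sg| = 1 by case: sg1 => ->; rewrite ?normrN normr1.
    by rewrite mul1r ltr_pdivrMr// ltr_pMr// ltr1n.
  - by rewrite /t mulf_neq0 ?oppr_eq0// gt_eqF// divr_gt0.
  rewrite subr0 => neg.
  have [_ /proj1 Op _] := phiP _ Ut; have [_ /proj2 Oq] := HB _ Bt.
  have ct : chart_fun i sg h (t *: e_ i + x) < 0.
    rewrite /chart_fun col'D col'_delta_same scaler0 add0r !mxE !eqxx mulr1.
    have [/(_ Sx) -> _] := (HB x Bx).1; rewrite addrK /t mulrA mulrN sg2 mulN1r oppr_lt0.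
    by rewrite divr_gt0.
  have pn := Op (Oq ct).
  move: neg; rewrite ltNge => /negP; apply; rewrite mulrA.
  apply: mulr_le0; last exact: ltW.
  have -> : sg * t^-1 = sg * (- sg)^-1 * (e / 2)^-1 by rewrite /t invfM mulrA.
  rewrite invrN mulrN divff// mulN1r oppr_le0 invr_ge0 divr_ge0// ltW//.
have norm2 : c ^+ 2 = al ^+ 2 * chart_area h (col' i x) ^+ 2.
  have sum2 : \sum_l (chart_grad i sg h x l) ^+ 2 = chart_area h (col' i x) ^+ 2.
    rewrite sqr_sqrtr; last by rewrite addr_ge0// sumr_ge0// => j _; rewrite sqr_ge0.
    rewrite (bigD1_ord i)//= chart_grad_same expr2 sg2; congr (_ + _); apply: eq_bigr => j _.
    by rewrite chart_grad_lift sqrrN exprMn expr2 sg2 mul1r.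
  rewrite -sum2 mulr_sumr -[LHS]mulr1 -nu1 mulr_sumr; apply: eq_bigr => l _.
  by rewrite -!exprMn gN.
have J0 := chart_area_gt0 h (col' i x).
have cE : c = al * chart_area h (col' i x).
  apply/eqP; rewrite -(@eqrXn2 _ 2%N)//; last by rewrite mulr_ge0// ltW.
    by rewrite exprMn norm2.
  exact: ltW.
have aln : al != 0 by apply: contraTneq c0 => a0; rewrite cE a0 mul0r ltxx.
apply: (mulfI aln); rewrite -gN cE; ring.
Qed.

Section local_formula.
Variables (i : 'I_n) (sg : R) (h : 'rV[R]_n.-1 -> R) (B : set V) (a b : V) (F : 'I_n -> V -> R).
Hypotheses (ch : chart i sg h B) (abB : closed_box a b `<=` B)
  (F1 : forall j, C1 (F j)) (F0 : forall j x, ~ closed_box a b x -> F j x = 0).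

Let sg2 : sg * sg = 1.
Proof. by have [[] ->] := ch; rewrite ?mulrNN mulr1. Qed.

Let sh : smooth h. Proof. by have [] := ch. Qed.

Let psi := chart_fun i sg h.
Let N := chart_grad i sg h.
Let G x := \sum_j F j x * N x j.
Let dG x := \sum_j pderiv i (F j) x * N x j.
Let divF x := \sum_j pderiv j (F j) x.

Let cN j : continuous (fun x => N x j). Proof. exact: chart_grad_continuous. Qed.

Let cG : continuous G.
Proof. by apply: continuous_sumx => j; apply: continuousMx; [exact: C1_continuous|exact: cN]. Qed.

Let cdG : continuous dG.
Proof. by apply: continuous_sumx => j; apply: continuousMx; [exact: C1_pderiv_continuous|exact: cN]. Qed.

Let cdivF : continuous divF.
Proof. by apply: continuous_sumx => j; exact: C1_pderiv_continuous. Qed.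

(** [chart_grad] does not depend on the coordinate [i], so that only the factors [F j] are
    differentiated. *)
Let dG_derive x : is_derive x (e_ i) G (dG x).
Proof.
have NE (t : R) j : N (t *: e_ i + x) j = N x j.
  by rewrite /N /chart_grad col'D col'_delta_same scaler0 add0r.
apply/is_derive_line.
rewrite (_ : (fun t => _) = fun t : R => \sum_j F j (t *: e_ i + x) * N x j); last first.
  by apply/funext => t; apply: eq_bigr => j _; rewrite NE.
rewrite /dG; elim: (index_enum _) => [|j r IH].
  rewrite (_ : (fun x => _) = fun=> 0); last by apply/funext => y; rewrite big_nil.
  by rewrite big_nil; exact: is_derive_cst.
rewrite (_ : (fun x => _) = (fun t : R => F j (t *: e_ i + x) * N x j +
  \sum_(j <- r) F j (t *: e_ i + x) * N x j)); last first.
  by apply/funext => y; rewrite big_cons.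
rewrite big_cons; apply: is_deriveD.
have H := proj1 (is_derive_line _ _ _ _) (derivableP (@C1_derivable _ _ _ x i (F1 j))).
rewrite (_ : (fun t => _) = (fun t : R => N x j * F j (t *: e_ i + x))); last first.
  by apply/funext => t; rewrite mulrC.
rewrite mulrC; exact: is_deriveZ.
Qed.

Let G0 x : ~ closed_box a b x -> G x = 0.
Proof. by move=> xN; rewrite /G big1// => j _; rewrite F0// mul0r. Qed.

Let dG0 x : ~ closed_box a b x -> dG x = 0.
Proof. by move=> xN; rewrite /dG big1// => j _; rewrite (pderiv_eq0 i (F0 j) xN) mul0r. Qed.

Let divF0 x : ~ closed_box a b x -> divF x = 0.
Proof. by move=> xN; rewrite /divF big1// => j _; rewrite (pderiv_eq0 j (F0 j) xN). Qed.

Let Th (k : nat) x : R := theta (k%:R * psi x).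

Let Th_derive k x j : is_derive x (e_ j) (Th k) (k%:R * theta' (k%:R * psi x) * N x j).
Proof.
have H := chart_fun_deriv i sg x j sh.
have H1 : is_derive x (e_ j) (fun y => k%:R * psi y) (k%:R * N x j) by exact: is_deriveZ.
have := is_derive_compl H1 (is_derive_theta (k%:R * psi x)).
by rewrite mulrCA mulrA.
Qed.

Let cTh k : continuous (Th k).
Proof.
move=> x; apply: (@continuous_comp _ _ _ (fun x => k%:R * psi x) theta); last exact: continuous_theta.
apply: continuousMx; [exact: cst_continuous|exact: chart_fun_continuous].
Qed.

Let cTh' k : continuous (fun x => k%:R * theta' (k%:R * psi x)).
Proof.
apply: continuousMx; first exact: cst_continuous.
move=> x; apply: (@continuous_comp _ _ _ (fun x => k%:R * psi x) theta'); last exact: continuous_theta'.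
apply: continuousMx; [exact: cst_continuous|exact: chart_fun_continuous].
Qed.

(* The boundary layer created by the cut-off [Th k] is the same for [F] and for
   the field [G e_i], so that it cancels from the difference. *)
Let cutoff_identity k : (\int[mu]_x (Th k x * (divF x - sg * dG x))%:E = 0)%E.
Proof.
have dTF j x : is_derive x (e_ j) (fun x => Th k x * F j x)
    (Th k x * pderiv j (F j) x + F j x * (k%:R * theta' (k%:R * psi x) * N x j)).
  by apply: is_deriveMx => //; apply: derivableP; exact: C1_derivable.
have dTG x : is_derive x (e_ i) (fun x => Th k x * G x)
    (Th k x * dG x + G x * (k%:R * theta' (k%:R * psi x) * N x i)).
  exact: is_deriveMx.
have TF0 j x : ~ closed_box a b x -> Th k x * F j x = 0 by move=> /F0 ->; rewrite mulr0.
have TG0 x : ~ closed_box a b x -> Th k x * G x = 0 by move=> /G0 ->; rewrite mulr0.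
have pTF j : pderiv j (fun x => Th k x * F j x) =
    fun x => Th k x * pderiv j (F j) x + F j x * (k%:R * theta' (k%:R * psi x) * N x j).
  by apply/funext => x; apply: is_derive_val; exact: dTF.
have pTG : pderiv i (fun x => Th k x * G x) =
    fun x => Th k x * dG x + G x * (k%:R * theta' (k%:R * psi x) * N x i).
  by apply/funext => x; apply: is_derive_val; exact: dTG.
have cpTF j : continuous (pderiv j (fun x => Th k x * F j x)).
  rewrite pTF; apply: continuousDx; apply: continuousMx => //.
  - exact: C1_pderiv_continuous.
  - exact: C1_continuous.
  - exact: continuousMx.
have cpTG : continuous (pderiv i (fun x => Th k x * G x)).
  by rewrite pTG; apply: continuousDx; apply: continuousMx => //; exact: continuousMx.
have iTF j : (\int[mu]_x (pderiv j (fun x => Th k x * F j x) x)%:E = 0)%E.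
  by apply: (integral_pderiv0 _ (cpTF j) (TF0 j)) => x; exact: is_derive_ex (dTF j x).
have iTG : (\int[mu]_x (pderiv i (fun x => Th k x * G x) x)%:E = 0)%E.
  by apply: (integral_pderiv0 _ cpTG TG0) => x; exact: is_derive_ex (dTG x).
have bTF j := continuous_box_integrable (cpTF j) (pderiv_eq0 j (TF0 j)).
have bTG := continuous_box_integrable cpTG (pderiv_eq0 i TG0).
transitivity (\int[mu]_x ((\sum_j (pderiv j (fun x => Th k x * F j x) x)%:E)
   - sg%:E * (pderiv i (fun x => Th k x * G x) x)%:E))%E.
  apply: eq_integral => x _; rewrite sumEFin -EFinM -EFinB; congr EFin.
  rewrite pTG (eq_bigr (fun j => Th k x * pderiv j (F j) x +
    (k%:R * theta' (k%:R * psi x)) * (F j x * N x j))); last first.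
    by move=> j _; rewrite pTF; ring.
  rewrite big_split/= -!mulr_sumr -/(divF x) -/(G x) /N chart_grad_same.
  transitivity (Th k x * (divF x - sg * dG x) + (1 - sg * sg) * (k%:R * theta' (k%:R * psi x) * G x)).
    by rewrite sg2; ring.
  by ring.
rewrite integralB//; last 2 first.
- by apply: integrable_sum => // j _; exact: bTF.
- by apply: integrableZl => //; exact: bTG.
rewrite integral_sum// big1 ?sub0e; last by move=> j _; exact: iTF.
by rewrite integralZl// iTG mule0 oppe0.
Qed.

Let P := [set x | 0 < psi x].

Let mP : measurable P.
Proof.
apply: measurable_open; apply: (@open_comp _ _ psi [set t | 0 < t]); last exact: open_gt.
by move=> x _; exact: chart_fun_continuous.
Qed.

Let ibox f : continuous f -> (forall x, ~ closed_box a b x -> f x = 0) ->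
  mu.-integrable P (EFin \o f).
Proof. by move=> cf f0; apply: (integrableS measurableT) => //; exact: continuous_box_integrable cf f0. Qed.

(** The limit of [cutoff_identity], in which only the indicator of the side [P] remains: the
    divergence of [F] may be replaced by a derivative in the single direction [i]. *)
Let bulk : (\int[mu]_(x in P) (divF x)%:E = sg%:E * \int[mu]_(x in P) (dG x)%:E)%E.
Proof.
pose q x := divF x - sg * dG x.
have cq : continuous q.
  exact: (continuousBx cdivF (continuousMx (@cst_continuous V R sg) cdG)).
have q0 x : ~ closed_box a b x -> q x = 0.
  by move=> xN; rewrite /q divF0// dG0// mulr0 subrr.
have iq := continuous_box_integrable cq q0.
have [||||_ H] := @dominated_cvg_real _ _ R mu setT (fun k x => Th k x * q x)
  (fun x => (0 < psi x)%R%:R * q x) (fun x => `|q x|) measurableT.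
- by move=> k; apply: continuous_measurable => //; exact: continuousMx.
- move=> x _; apply: cvgM; last exact: cvg_cst.
  exact: theta_scale_cvg.
- exact: (integrable_abse iq).
- move=> k x _; rewrite normrM ler_piMl// ger0_norm ?theta_ge0// theta_le1//.
have q0P : (\int[mu]_(x in P) (q x)%:E = 0)%E.
  rewrite integral_mkcond (eq_integral (fun x => ((0 < psi x)%R%:R * q x)%:E)); last first.
    move=> x _; rewrite patchE; case: ifPn => [/set_mem Px|/negP xP].
      by rewrite (_ : (0 < psi x)%R = true) ?mul1r.
    by case: ltP => [p|_]; [case: xP; rewrite inE|rewrite mul0r].
  apply: (cvg_unique _ H) => //.
  rewrite (_ : (fun k => _) = cst 0%E); first exact: cvg_cst.
  by apply/funext => k; exact: cutoff_identity.
move: q0P; rewrite (eq_integral (fun x => (divF x)%:E - sg%:E * (dG x)%:E)%E); last first.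
  by move=> x _; rewrite /q EFinB EFinM.
have iD := ibox cdivF divF0; have iG := ibox cdG dG0.
rewrite integralB//; last exact: integrableZl.
rewrite integralZl// => /eqP; rewrite sube_eq ?add0e; first by move/eqP.
  exact: integrable_fin_num.
by rewrite fin_num_adde_defr// fin_numM// integrable_fin_num.
Qed.

Let p (y : 'rV[R]_n.-1) : V := insert_rV i (h y) y.

Let cp : continuous p.
Proof.
move=> y; apply: (@continuous_insert_rV R n _ i h id); first exact: (@smooth_continuous _ _ _ sh).
exact: cvg_id.
Qed.

Let p0 f y : (forall x, ~ closed_box a b x -> f x = 0 :> R) ->
  ~ closed_box (col' i a) (col' i b) y -> f (p y) = 0.
Proof.
move=> f0 yN; apply: f0 => H; apply: yN => j.
by have := H (lift i j); rewrite /p insert_rV_lift !mxE.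
Qed.

Let ip0 f : continuous f -> (forall x, ~ closed_box a b x -> f x = 0) ->
  (lebesgue_rV R n.-1).-integrable setT (fun y => (f (p y))%:E).
Proof.
move=> cf f0; apply: (@continuous_box_integrable R n.-1 (f \o p) (col' i a) (col' i b)).
  by move=> y; apply: continuous_comp; [exact: cp|exact: cf].
by move=> y; exact: p0.
Qed.

(** After [bulk] the integral splits into integrals over half-lines parallel to [e_i] that end on
    the graph, where the fundamental theorem leaves the value of [G]. *)
Lemma chart_flux : (\int[mu]_(x in Oe) (divF x)%:E =
  - \int[lebesgue_rV R n.-1]_y (G (p y))%:E)%E.
Proof.
transitivity (\int[mu]_(x in P) (divF x)%:E)%E.
  apply: eq_integral_dom => x.
    have [xab xO xP|xab _ _] := pselect (closed_box a b x); last by rewrite divF0.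
    by exfalso; apply: xP; apply/(chart_ext ch) => //; exact: abB.
  have [xab xO xP|xab _ _] := pselect (closed_box a b x); last by rewrite divF0.
  by exfalso; apply: xP; apply/(chart_ext ch) => //; exact: abB.
rewrite bulk integral_mkcond.
have iG : mu.-integrable setT ((EFin \o dG) \_ P).
  by apply: (proj1 (integrable_mkcond _ mP)); exact: ibox.
rewrite (integral_insert i iG).
rewrite (eq_integral (fun y => (- sg)%:E * (G (p y))%:E)%E); last first.
  move=> y _.
  transitivity (\int[lebesgue_measure]_(t in [set t | (0 < sg * (t - h y))%R]) (dG (insert_rV i t y))%:E)%E.
    rewrite [RHS]integral_mkcond; apply: eq_integral => t _; rewrite !patchE.
    have -> : (insert_rV i t y \in P) = (t \in [set t | 0 < sg * (t - h y)]).
      by apply/idP/idP => /set_mem H; apply/mem_set; move: H;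
        rewrite /P/= /psi /chart_fun insert_rV_same col'_insert_rV.
    by [].
  have tG (t : R) : is_derive t 1 (fun t => G (insert_rV i t y)) (dG (insert_rV i t y)).
    by apply: is_derive_insert_same; exact: dG_derive.
  have tc : continuous (fun t : R => dG (insert_rV i t y)).
    move=> t; apply: (@continuous_comp _ _ _ (fun t => insert_rV i t y) dG); last exact: cdG.
    by apply: (@continuous_insert_rV R n _ i id (fun=> y)); [exact: cvg_id|exact: cvg_cst].
  have t0 t : ~ (a ord0 i <= t <= b ord0 i) -> G (insert_rV i t y) = 0 /\ dG (insert_rV i t y) = 0.
    move=> tN; have xN : ~ closed_box a b (insert_rV i t y).
      by move=> /(_ i); rewrite insert_rV_same.
    by rewrite G0// dG0.
  have sg1 : sg = 1 \/ sg = -1 by have [] := ch.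
  have -> := @integral_half_line R _ _ sg (h y) (a ord0 i) (b ord0 i) sg1 tG tc t0.
  by rewrite -EFinM mulNr.
rewrite integralZl//; last exact: ip0 cG G0.
by rewrite muleA -EFinM mulrN sg2 mulN1e.
Qed.

(** On [S] inside the box this is the normal component of [F]; unlike [nu], which is constrained on
    [S] only, it is continuous on the whole space. *)
Let f x := G x / chart_area h (col' i x).

Let carea : continuous (fun x => (chart_area h (col' i x))^-1).
Proof.
move=> x.
have cJ : {for x, continuous (fun x : V => chart_area h (col' i x))}.
  apply: (@continuous_comp _ _ _ (fun x : V => col' i x) (chart_area h)); first exact: continuous_col'.
  exact: (continuous_chart_area sh).
by apply: (cvgV _ cJ); rewrite gt_eqF// chart_area_gt0.
Qed.

Let cf : continuous f.
Proof. by apply: continuousMx; [exact: cG|exact: carea]. Qed.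

Let D := S `&` closed_box a b.

Let mD : measurable D.
Proof. by apply: measurableI; [exact: measurable_compact|exact: measurable_closed_box]. Qed.

Let pS y : closed_box a b (p y) -> D (p y).
Proof.
move=> H; split => //; have [_ _ _ /(_ _ (abB H)) [E _]] := ch; apply/E.
by rewrite /p insert_rV_same col'_insert_rV.
Qed.

Lemma chart_surface_measure A : measurable A -> A `<=` D ->
  sigma A = (\int[lebesgue_rV R n.-1]_(y in p @^-1` A) (chart_area h y)%:E)%E.
Proof.
move=> mA AD; have [_ _ oB HB] := ch; have [_ /(_ i B h oB sh)] := sigmaP.
move=> /(_ (fun x Bx => (HB x Bx).1) A mA) <-; last by move=> x /AD[_ /abB].
by congr (sigma _); apply/seteqP; split=> x; [move=> Ax; split => //; have [] := AD x Ax|case].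
Qed.

Lemma chart_surface_integral : (\int[sigma]_(x in S) (\sum_j F j x * nu x ord0 j)%:E =
  \int[lebesgue_rV R n.-1]_y (G (p y))%:E)%E.
Proof.
transitivity (\int[sigma]_(x in D) (f x)%:E)%E.
  transitivity (\int[sigma]_(x in D) (\sum_j F j x * nu x ord0 j)%:E)%E.
    apply: eq_integral_dom => x; last by case.
    move=> Sx xD; rewrite big1// => j _; rewrite F0 ?mul0r// => H; exact: xD.
  apply: eq_integral => x /set_mem[Sx /abB Bx]; congr EFin.
  rewrite /f /G mulr_suml; apply: eq_bigr => j _.
  rewrite /N (chart_normal j ch Bx Sx) mulrCA mulrAC mulfV ?mul1r//.
  by rewrite gt_eqF// chart_area_gt0.
have mf (g : R -> R) : continuous g -> measurable_fun [set: V] (fun x => (g (f x))%:E).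
  move=> cg; apply/measurable_EFinP; apply: continuous_measurable => // x.
  by apply: continuous_comp; [exact: cf|exact: cg].
have mp : measurable_fun [set: 'rV[R]_n.-1] p.
  apply: measurable_fun_rV => j; apply: continuous_measurable => // y.
  apply: (@continuous_comp _ _ _ p (fun x : V => x ord0 j)); [exact: cp|exact: continuous_coord].
have mJ : measurable_fun [set: 'rV[R]_n.-1] (chart_area h).
  by apply: continuous_measurable => //; exact: (continuous_chart_area sh).
have mpD : measurable (p @^-1` D) by rewrite -[X in measurable X]setTI; exact: mp.
(* The change of variables is stated for nonnegative integrands; it is applied to the positive and
   to the negative part of [f], both of the form [g \o f]. *)
have step (g : R -> R) : continuous g -> (forall s, 0 <= g s) ->
    (\int[sigma]_(x in D) (g (f x))%:E = \int[lebesgue_rV R n.-1]_(y in p @^-1` D) (g (f (p y)) * chart_area h y)%:E)%E.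
  move=> cg g0.
  rewrite (@ge0_integral_density _ _ _ _ _ sigma (lebesgue_rV R n.-1) D (p @^-1` D) p (chart_area h))//.
  - by move=> y; exact/ltW/chart_area_gt0.
  - by move=> A; exact: chart_surface_measure.
  - exact: mf.
  - by move=> x; rewrite lee_fin.
have fp y : f (p y) * chart_area h y = G (p y).
  by rewrite /f /p col'_insert_rV divfK// gt_eqF// chart_area_gt0.
have -> : (\int[lebesgue_rV R n.-1]_y (G (p y))%:E =
    \int[lebesgue_rV R n.-1]_(y in p @^-1` D) (f (p y) * chart_area h y)%:E)%E.
  transitivity (\int[lebesgue_rV R n.-1]_(y in p @^-1` D) (G (p y))%:E)%E.
    apply: eq_integral_dom => y; last by move=> _ /(_ I).
    by move=> _ yD; rewrite (G0 (fun H => yD (pS H))).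
  by apply: eq_integral => y _; rewrite fp.
rewrite [LHS]integralE [RHS]integralE; congr (_ - _)%E.
- transitivity (\int[sigma]_(x in D) (Num.max (f x) 0)%:E)%E.
    by apply: eq_integral => x _; rewrite funeposE/= EFin_max.
  rewrite (step (fun s => Num.max s 0)).
  + apply: eq_integral => y _; rewrite funeposE/= -EFin_max; congr EFin.
    by rewrite maxr_pMl ?mul0r// ltW// chart_area_gt0.
  + by move=> s; apply: continuous_max; [exact: cvg_id|exact: cvg_cst].
  + by move=> s; rewrite le_max lexx orbT.
- transitivity (\int[sigma]_(x in D) (Num.max (- f x) 0)%:E)%E.
    by apply: eq_integral => x _; rewrite funenegE/= EFin_max EFinN.
  rewrite (step (fun s => Num.max (- s) 0)).
  + apply: eq_integral => y _; rewrite funenegE/= -EFin_max; congr EFin.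
    by rewrite maxr_pMl ?mul0r ?mulNr// ltW// chart_area_gt0.
  + by move=> s; apply: continuous_max; [exact: opp_continuous|exact: cvg_cst].
  + by move=> s; rewrite le_max lexx orbT.
Qed.

End local_formula.

Lemma chart_box x : S x -> exists i (sg : R) h B a b,
  [/\ chart i sg h B, closed_box a b `<=` B & open_box a b x].
Proof.
move=> Sx; have [i [sg [h [B [ch Bx]]]]] := ex_chart Sx.
have oB : open B by have [] := ch.
have [r r0 rB] := nbhs_box (open_nbhs_nbhs (conj oB Bx)).
exists i, sg, h, B, (x - const_mx r), (x + const_mx r); split => // j.
by rewrite !mxE ltrBlDr ltrDl r0.
Qed.

(** In a chart the area of a piece of [S] is the integral of a continuous density over a bounded
    base, and the normal is the continuous field [chart_grad / chart_area]. Both facts then pass to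
    finite unions of pieces. *)
Lemma surface_measure_fin_normal : (sigma S < +oo)%E /\
  forall j, measurable_fun S (fun x => nu x ord0 j : measurableTypeR R).
Proof.
have mS := measurable_compact cS.
apply: (@compact_box_ind R n S (fun A => (sigma A < +oo)%E /\
  forall j, measurable_fun A (fun x => nu x ord0 j : measurableTypeR R))) => //.
- by rewrite measure0; split => // j; exact: measurable_fun_set0.
- move=> A1 A2 mA1 mA2 [s1 m1] [s2 m2]; split.
    by apply: le_lt_trans (measureU2 _ mA1 mA2) _; rewrite lte_add_pinfty.
  by move=> j; apply/measurable_funU.
- move=> x Sx; have [i [sg [h [B [a [b [ch abB xab]]]]]]] := chart_box Sx.
  exists a, b; split => //; set A := S `&` _.
  have mA : measurable A by apply: measurableI => //; exact: measurable_open_box.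
  have AD : A `<=` S `&` closed_box a b by move=> y [Sy /open_closed_box].
  have [_ sh _ _] := ch; have cJ := continuous_chart_area sh.
  split.
    rewrite (chart_surface_measure ch abB mA AD).
    have mp : measurable ((fun y : 'rV[R]_n.-1 => insert_rV i (h y) y) @^-1` A).
      rewrite -[X in measurable X]setTI.
      apply: (@measurable_fun_rV R n _ _ (fun y : 'rV[R]_n.-1 => insert_rV i (h y) y)) => // j.
      apply: continuous_measurable => // y.
      apply: (@continuous_comp _ _ _ (fun y : 'rV[R]_n.-1 => insert_rV i (h y) y) (fun x : V => x ord0 j)); last exact: continuous_coord.
      apply: (@continuous_insert_rV R n _ i h id); first exact: (@smooth_continuous _ _ _ sh).
      exact: cvg_id.
    have J0 y : (0 <= (chart_area h y)%:E)%E by rewrite lee_fin ltW// chart_area_gt0.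
    apply: (@le_lt_trans _ _ (\int[lebesgue_rV R n.-1]_(y in closed_box (col' i a) (col' i b)) (chart_area h y)%:E)%E).
      apply: ge0_subset_integral => //; first exact: measurable_closed_box.
      + by apply/measurable_EFinP; apply: continuous_measurable => //; exact: measurable_closed_box.
      + move=> y [_ yab] j; have := open_closed_box yab (lift i j).
        by rewrite insert_rV_lift !mxE.
    have := continuous_integrable cJ (@compact_closed_box _ _ (col' i a) (col' i b)).
    by move=> /(integrable_lty (measurable_closed_box _ _)).
  move=> j; apply: (eq_measurable_fun (fun y => chart_grad i sg h y j / chart_area h (col' i y))).
    move=> y /set_mem[Sy yab].
    rewrite (chart_normal j ch (abB _ (open_closed_box yab)) Sy) mulrAC mulfV ?mul1r//.
    by rewrite gt_eqF// chart_area_gt0.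
  apply: measurable_funTS; apply: measurable_funM; first exact: (continuous_measurable measurableT (@chart_grad_continuous i sg h j sh)).
  apply: continuous_measurable => // y.
  have cJ' : {for y, continuous (fun x : V => chart_area h (col' i x))}.
    by apply: (@continuous_comp _ _ _ (fun x : V => col' i x) (chart_area h)); [exact: continuous_col'|exact: cJ].
  by apply: (cvgV _ cJ'); rewrite gt_eqF// chart_area_gt0.
Qed.

Lemma surface_measure_fin : (sigma S < +oo)%E.
Proof. by case: surface_measure_fin_normal. Qed.

Lemma measurable_normal j : measurable_fun S (fun x => nu x ord0 j : measurableTypeR R).
Proof. by case: surface_measure_fin_normal. Qed.

Lemma normal_le1 x j : S x -> `|nu x ord0 j| <= 1.
Proof.
move=> Sx; have [nu1 _] := nuP Sx.
rewrite -[leRHS]normr1 -ler_sqr ?nnegrE//; apply: (@le_trans _ _ (nu x ord0 j ^+ 2)).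
  by rewrite real_normK ?num_real.
by rewrite normr1 expr1n -nu1 (bigD1 j)//= lerDl sumr_ge0// => k _; rewrite sqr_ge0.
Qed.

Lemma surface_integrable (f : V -> R) j : continuous f ->
  sigma.-integrable S (fun x => (f x * nu x ord0 j)%:E).
Proof.
move=> cf; have mS := measurable_compact cS.
have [M [Mr HM]] : bounded_set (f @` S).
  by apply: compact_bounded; apply: continuous_compact cS; exact: continuous_subspaceT.
apply: (@measurable_bounded_integrable _ _ R sigma (fun x => f x * nu x ord0 j) S) => //.
- exact: surface_measure_fin.
- by apply: measurable_funM; [exact: continuous_measurable|exact: measurable_normal].
- exists (`|M| + 1); split; first exact: num_real.
  move=> K KM x Sx /=; rewrite normrM.
  apply: (@le_trans _ _ (`|f x| * 1)); first by rewrite ler_wpM2l// normal_le1.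
  rewrite mulr1; apply: (HM K); last by exists x.
  by apply: le_lt_trans KM; rewrite (le_trans (ler_norm M))// lerDl.
Qed.

Definition divergence_formula (F : 'I_n -> V -> R) :=
  (\int[mu]_(x in Oe) (\sum_j pderiv j (F j) x)%:E =
   - \int[sigma]_(x in S) (\sum_j F j x * nu x ord0 j)%:E)%E.

(** Three kinds of points: on [S] a chart gives the formula; in [Oi] both sides vanish; in the
    exterior the surface term is 0 and the other side is the integral of the divergence of a
    compactly supported field. *)
Lemma local_divergence x : exists a b, open_box a b x /\
  forall F, (forall j, C1 (F j)) -> (forall j y, ~ closed_box a b y -> F j y = 0) ->
    divergence_formula F.
Proof.
have mOe : measurable Oe by apply: measurable_open; apply: closed_openC; exact: closed_closure.
have noS (F : 'I_n -> V -> R) a b : (forall j y, ~ closed_box a b y -> F j y = 0 :> R) -> closed_box a b `&` S = set0 ->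
    (\int[sigma]_(x in S) (\sum_j F j x * nu x ord0 j)%:E = 0)%E.
  move=> F0 abS; rewrite integral0_eq// => y Sy; rewrite big1// => j _.
  rewrite F0 ?mul0r// => yab; have : (closed_box a b `&` S) y by [].
  by rewrite abS.
have [Sx|NS] := pselect (S x).
  have [i [sg [h [B [a [b [ch abB xab]]]]]]] := chart_box Sx.
  exists a, b; split => // F F1 F0; rewrite /divergence_formula.
  by rewrite (chart_flux ch abB F1 F0) (chart_surface_integral ch abB F1 F0).
have box_in (A : set V) : open A -> A x -> exists a b, open_box a b x /\ closed_box a b `<=` A.
  move=> oA Ax; have [r r0 rA] := nbhs_box (open_nbhs_nbhs (conj oA Ax)).
  exists (x - const_mx r), (x + const_mx r); split => // j.
  by rewrite !mxE ltrBlDr ltrDl r0.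
have [Ox|NO] := pselect (Oi x).
  have [a [b [xab abO]]] := box_in _ oOi Ox; exists a, b; split => // F F1 F0.
  rewrite /divergence_formula (noS _ a b)//; last first.
    by apply/disjoints_subset => y /abO Oy Sy; have : (Oi `&` S) y by []; rewrite OiS.
  rewrite oppe0 integral0_eq// => y Oy; rewrite big1// => j _.
  apply: (pderiv_eq0 j (F0 j)) => /abO Oiy; apply: Oy; exact: subset_closure.
have Oex : Oe x by rewrite clOi => -[].
have oOe : open Oe by apply: closed_openC; exact: closed_closure.
have [a [b [xab abO]]] := box_in _ oOe Oex; exists a, b; split => // F F1 F0.
rewrite /divergence_formula (noS _ a b)//; last first.
  by apply/disjoints_subset => y /abO Oy Sy; apply: Oy; rewrite clOi; right.
have cp j : continuous (pderiv j (F j)) by exact: C1_pderiv_continuous.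
have ij j := continuous_box_integrable (cp j) (pderiv_eq0 j (F0 j)).
transitivity (\int[mu]_x (\sum_j (pderiv j (F j) x)%:E))%E.
  rewrite [RHS](eq_integral (fun x => (\sum_j pderiv j (F j) x)%:E)); last first.
    by move=> y _; rewrite sumEFin.
  apply: eq_integral_dom => y; first by move=> _ /(_ I).
  move=> _ Oy; rewrite big1// => j _.
  by apply: (pderiv_eq0 j (F0 j)) => /abO.
rewrite integral_sum// oppe0 big1// => j _.
by apply: (integral_pderiv0 _ (cp j) (F0 j)) => y; exact: C1_derivable.
Qed.

Let divergenceD a b F G : (forall j, C1 (F j)) -> (forall j, C1 (G j)) ->
  (forall j y, ~ closed_box a b y -> F j y = 0) -> (forall j y, ~ closed_box a b y -> G j y = 0) ->
  divergence_formula F -> divergence_formula G -> divergence_formula (fun j x => F j x + G j x).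
Proof.
move=> F1 G1 F0 G0 HF HG.
have mOe : measurable Oe by apply: measurable_open; apply: closed_openC; exact: closed_closure.
have bulk (H : 'I_n -> V -> R) : (forall j, C1 (H j)) -> (forall j y, ~ closed_box a b y -> H j y = 0) ->
    mu.-integrable Oe (fun x => (\sum_j pderiv j (H j) x)%:E).
  move=> H1 H0; under eq_fun do rewrite -sumEFin.
  apply: integrable_sum => // j _; apply: (integrableS measurableT) => //.
  by apply: (@continuous_box_integrable _ _ _ a b); [exact: C1_pderiv_continuous|apply: pderiv_eq0; exact: H0].
have surf (H : 'I_n -> V -> R) : (forall j, C1 (H j)) ->
    sigma.-integrable S (fun x => (\sum_j H j x * nu x ord0 j)%:E).
  move=> H1; under eq_fun do rewrite -sumEFin.
  apply: integrable_sum => [|j _]; first exact: measurable_compact.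
  by apply: surface_integrable; exact: C1_continuous.
rewrite /divergence_formula.
rewrite (eq_integral (fun x => (\sum_j pderiv j (F j) x)%:E + (\sum_j pderiv j (G j) x)%:E)%E); last first.
  move=> x _; rewrite -EFinD -big_split/=; congr EFin; apply: eq_bigr => j _.
  by apply: pderivD; exact: C1_derivable.
rewrite (@integralD _ _ _ mu Oe mOe _ _ (bulk F F1 F0) (bulk G G1 G0)).
rewrite [in RHS](eq_integral (fun x => (\sum_j F j x * nu x ord0 j)%:E + (\sum_j G j x * nu x ord0 j)%:E)%E); last first.
  by move=> x _; rewrite -EFinD -big_split/=; congr EFin; apply: eq_bigr => j _; rewrite mulrDl.
have mS := measurable_compact cS.
rewrite (@integralD _ _ _ sigma S mS _ _ (surf F F1) (surf G G1)) HF HG.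
by rewrite fin_num_oppeD// integrable_fin_num//; exact: surf.
Qed.

Theorem divergence_theorem F a b : (forall j, C1 (F j)) ->
  (forall j y, ~ closed_box a b y -> F j y = 0) -> divergence_formula F.
Proof.
move=> F1 F0.
have [s [sP sK]] := @compact_boxes R n _ (fun a b => forall F, (forall j, C1 (F j)) ->
  (forall j y, ~ closed_box a b y -> F j y = 0) -> divergence_formula F)
  (@compact_closed_box _ _ a b) (fun x _ => local_divergence x).
pose bump (ab : V * V) x := box_bump ab.1 ab.2 1 x.
(* [e] vanishes on the box and is positive outside it: the sum [W] is then positive everywhere, and
   division by [W] gives a smooth partition of unity on the box. *)
pose e (x : V) : R := \sum_i (theta (a ord0 i - x ord0 i) + theta (x ord0 i - b ord0 i)).
pose W x := \sum_(ab <- s) bump ab x + e x.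
have sW : smooth W.
  apply: smoothD; apply: smooth_sum => i; first exact: smooth_bump.
  apply: smoothD.
    apply: (@smooth_theta R n (fun x => a ord0 i - x ord0 i)).
    by apply: smoothB; [exact: smooth_cst|exact: smooth_coord].
  apply: (@smooth_theta R n (fun x => x ord0 i - b ord0 i)).
  by apply: smoothB; [exact: smooth_coord|exact: smooth_cst].
have e0 x : closed_box a b x -> e x = 0.
  move=> abx; rewrite /e big1// => i _; have /andP[ax xb] := abx i.
  by rewrite !theta_le0 ?addr0// subr_le0.
have W0 x : 0 < W x.
  have s0 : 0 <= \sum_(ab <- s) bump ab x by apply: sumr_ge0 => ab _; exact: bump_ge0.
  have e1 : 0 <= e x by apply: sumr_ge0 => i _; rewrite addr_ge0 ?theta_ge0.
  have [abx|/existsNP[i /negP iN]] := pselect (closed_box a b x).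
    rewrite ltr_wpDr//; have [ab abs xab] := sK x abx.
    rewrite lt_neqAle s0 andbT eq_sym; apply/negP => /eqP.
    have p0 : 0 < bump ab x by exact: bump_gt0.
    move=> E; move: p0; rewrite ltNge => /negP; apply; rewrite -E.
    rewrite (big_rem ab)//= lerDl; apply: sumr_ge0 => ab' _; exact: bump_ge0.
  rewrite ltr_wpDl// /e (bigD1 i)//= ltr_pwDl//; last first.
    by apply: sumr_ge0 => k _; rewrite addr_ge0 ?theta_ge0.
  move: iN; rewrite negb_and -!ltNge => /orP[h|h].
    by rewrite ltr_pwDl ?theta_ge0// theta_gt0// subr_gt0.
  by rewrite ltr_wpDl ?theta_ge0// theta_gt0// subr_gt0.
have cb ab : C1 (bump ab) by exact/smooth_C1/smooth_bump.
pose G j x := F j x * (W x)^-1.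
have G1 j : C1 (G j).
  apply: C1M => //; apply: smooth_C1; apply: smoothV => // x; by rewrite gt_eqF.
have G0 j y : ~ closed_box a b y -> G j y = 0 by move=> yN; rewrite /G F0// mul0r.
have -> : F = fun j x => \sum_(ab <- s) bump ab x * G j x.
  apply/funext => j; apply/funext => x; rewrite -mulr_suml.
  have [abx|xN] := pselect (closed_box a b x); last by rewrite F0// G0// mulr0.
  have -> : \sum_(ab <- s) bump ab x = W x by rewrite /W e0// addr0.
  by rewrite /G mulrCA mulfV ?mulr1// gt_eqF.
have bG1 ab j : C1 (fun x => bump ab x * G j x) by exact: C1M.
(* Induction over sublists: at every stage additivity of the formula needs partial sums that are of
   class C1 and supported in the common box. *)
have {sK W0 e0 sW} : forall r : seq (V * V), {subset r <= s} ->
    (forall j, C1 (fun x => \sum_(ab <- r) bump ab x * G j x)) /\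
    divergence_formula (fun j x => \sum_(ab <- r) bump ab x * G j x).
  elim=> [_|ab r IH rs].
    have E : (fun (j : 'I_n) (x : V) => \sum_(ab <- [::]) bump ab x * G j x) = fun _ => cst 0.
      by apply/funext => j; apply/funext => x; rewrite big_nil.
    split; first by move=> j; rewrite (congr1 (fun f => f j) E); exact/smooth_C1/smooth_cst.
    rewrite E /divergence_formula integral0_eq; last first.
      by move=> x _; rewrite big1// => j _; rewrite pderiv_cst.
    by rewrite integral0_eq ?oppe0// => x _; rewrite big1// => j _; rewrite mul0r.
  have [|r1 rd] := IH; first by move=> ab' ab'r; apply: rs; rewrite inE ab'r orbT.
  have E : (fun (j : 'I_n) (x : V) => \sum_(ab <- ab :: r) bump ab x * G j x) =
      fun j x => bump ab x * G j x + \sum_(ab <- r) bump ab x * G j x.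
    by apply/funext => j; apply/funext => x; rewrite big_cons.
  split.
    move=> j; rewrite (congr1 (fun f => f j) E).
    have [c1 d1] := bG1 ab j; have [c2 d2] := r1 j; split; first exact: continuousDx.
    move=> i; have [d1i c1i] := d1 i; have [d2i c2i] := d2 i.
    split; first by move=> x; exact: derivableD.
    rewrite (_ : pderiv i _ = fun x => pderiv i (fun x => bump ab x * G j x) x +
      pderiv i (fun x => \sum_(ab <- r) bump ab x * G j x) x); first exact: continuousDx.
    by apply/funext => x; apply: pderivD.
  rewrite E; apply: (@divergenceD a b) => //.
  - by move=> j y /G0 ->; rewrite mulr0.
  - by move=> j y /G0 Gy; rewrite big1// => ab' _; rewrite Gy mulr0.
  - apply: (sP ab); first by apply: rs; rewrite inE eqxx.
      by move=> j; exact: bG1.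
    move=> j y yN; rewrite /bump bump_eq0 ?mul0r// => /open_closed_box//.
by move=> /(_ s (fun _ => id))[].
Qed.

End charts.

(** * The energy-momentum tensor *)

Ltac nonneg := repeat (first [assumption | exact: sqr_ge0 | apply: addr_ge0 | apply: mulr_ge0]).

Section stress.
Context {R : realType} {n : nat}.
Local Notation I := 'I_n.+1.
Implicit Types (G : I -> I -> R) (DG : I -> I -> I -> R) (v c : I -> R) (Dv : I -> I -> R).

(* The energy-momentum tensor contracted with the multiplier [G^{k0} v_k]. *)
Definition stress G v (i : I) : R :=
  (\sum_l G i l * v l) * (\sum_k G k ord0 * v k)
  - 2^-1 * (G i ord0 * \sum_l \sum_m G l m * (v l * v m)).

(** The derivative in the direction [i] of the component [i] of [stress], as pure algebra: [DG] and
    [Dv] stand for the derivatives of the coefficients and of the field. [Dv] is not assumed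
    symmetric, since the fields need not be gradients. *)
Definition dstress G DG v Dv (i : I) : R :=
  ((\sum_l G i l * v l) * (\sum_k (G k ord0 * Dv i k + v k * DG i k ord0)) +
   (\sum_k G k ord0 * v k) * (\sum_l (G i l * Dv i l + v l * DG i i l)))
  - 2^-1 * (G i ord0 * (\sum_l \sum_m (G l m * (v l * Dv i m + v m * Dv i l) + v l * v m * DG i l m))
    + (\sum_l \sum_m G l m * (v l * v m)) * DG i i ord0).

(** The operator in non-divergence form, with [v] in place of the gradient of [u] and [c] for the
    first-order coefficients. *)
Definition wave G Dv v c := \sum_i \sum_l G i l * Dv i l + \sum_l c l * v l.

(** The terms with derivatives of [v] are the principal part of [wave] times the multiplier, plus a
    double sum in which exchanging [i] and [k] leaves only the commutators [Dv i k - Dv k i]. All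
    the others are quadratic in [v], with coefficients made of [G], [DG] and [c]. *)
Lemma sum_dstress G DG v Dv c : (forall j k, G j k = G k j) ->
  \sum_i dstress G DG v Dv i =
  (wave G Dv v c - \sum_l c l * v l + \sum_i \sum_l v l * DG i i l) * (\sum_k G k ord0 * v k)
  + \sum_i \sum_k (\sum_l G i l * v l) * (G k ord0 * (Dv i k - Dv k i))
  + \sum_i (\sum_l G i l * v l) * (\sum_k v k * DG i k ord0)
  - 2^-1 * \sum_i (G i ord0 * (\sum_l \sum_m v l * v m * DG i l m)
    + (\sum_l \sum_m G l m * (v l * v m)) * DG i i ord0).
Proof.
move=> Gs; pose a i := \sum_l G i l * v l.
pose X := \sum_k G k ord0 * v k.
have sym i : \sum_l \sum_m G l m * (v l * Dv i m + v m * Dv i l) = 2 * \sum_k a k * Dv i k.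
  have E1 : \sum_l \sum_m G l m * (v l * Dv i m) = \sum_k a k * Dv i k.
    rewrite exchange_big/=; apply: eq_bigr => k _; rewrite /a mulr_suml; apply: eq_bigr => l _.
    by rewrite (Gs k l) mulrA.
  have E2 : \sum_l \sum_m G l m * (v m * Dv i l) = \sum_k a k * Dv i k.
    by apply: eq_bigr => k _; rewrite /a mulr_suml; apply: eq_bigr => l _; rewrite mulrA.
  rewrite mulr_natl mulr2n -{1}E1 -E2 -big_split/=; apply: eq_bigr => l _.
  by rewrite -big_split/=; apply: eq_bigr => m _; rewrite mulrDr.
have step i : dstress G DG v Dv i =
    X * (\sum_l G i l * Dv i l) + X * (\sum_l v l * DG i i l)
    + (a i * (\sum_k G k ord0 * Dv i k) - \sum_k a k * (G i ord0 * Dv i k))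
    + a i * (\sum_k v k * DG i k ord0)
    - 2^-1 * (G i ord0 * (\sum_l \sum_m v l * v m * DG i l m)
    + (\sum_l \sum_m G l m * (v l * v m)) * DG i i ord0).
  rewrite /dstress -/(a i) -/X.
  have -> : \sum_l \sum_m (G l m * (v l * Dv i m + v m * Dv i l) + v l * v m * DG i l m) =
     2 * (\sum_k a k * Dv i k) + \sum_l \sum_m v l * v m * DG i l m.
    by rewrite -sym -big_split/=; apply: eq_bigr => l _; rewrite -big_split.
  rewrite !big_split/=.
  have -> : \sum_k a k * (G i ord0 * Dv i k) = G i ord0 * \sum_k a k * Dv i k.
    by rewrite mulr_sumr; apply: eq_bigr => k _; ring.
  by field.
have E1 : \sum_i X * (\sum_l G i l * Dv i l) = X * \sum_i \sum_l G i l * Dv i l.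
  by rewrite mulr_sumr.
have E2 : \sum_i X * (\sum_l v l * DG i i l) = X * \sum_i \sum_l v l * DG i i l.
  by rewrite mulr_sumr.
have E3 : \sum_i (a i * (\sum_k G k ord0 * Dv i k) - \sum_k a k * (G i ord0 * Dv i k)) =
   \sum_i \sum_k a i * (G k ord0 * (Dv i k - Dv k i)).
  rewrite sumrB [in X in _ - X]exchange_big/= -sumrB; apply: eq_bigr => i _.
  by rewrite mulr_sumr -sumrB; apply: eq_bigr => k _; ring.
pose b i := G i ord0 * (\sum_l \sum_m v l * v m * DG i l m)
    + (\sum_l \sum_m G l m * (v l * v m)) * DG i i ord0.
have E4 : \sum_i 2^-1 * b i = 2^-1 * \sum_i b i by rewrite mulr_sumr.
rewrite (eq_bigr _ (fun i _ => step i)) sumrB -/(b _) E4 big_split/= big_split/= big_split/= E1 E2 E3.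
rewrite /wave -/X; congr (_ + _ + _ - _).
set p := \sum_i \sum_l G i l * Dv i l; set q := \sum_l c l * v l; by ring.
Qed.

Let norm_sum_le (a b : I -> R) M : 0 <= M -> (forall i, `|a i| <= M) ->
  `|\sum_i a i * b i| <= M * \sum_i `|b i|.
Proof.
move=> M0 aM; apply: le_trans (ler_norm_sum _ _ _) _; rewrite mulr_sumr; apply: ler_sum => i _.
by rewrite normrM ler_wpM2r.
Qed.

Let sum_const_le (a : I -> R) M : (forall i, a i <= M) -> \sum_i a i <= n.+1%:R * M.
Proof.
move=> aM; apply: le_trans (ler_sum _ (fun i _ => aM i)) _.
by rewrite sumr_const card_ord mulr_natl.
Qed.

Let sqr_sum_le (a : I -> R) : (\sum_i `|a i|) ^+ 2 <= n.+1%:R * \sum_i a i ^+ 2.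
Proof.
have := cauchy_schwarz_sum (index_enum I) xpredT (fun i => 1) (fun i => `|a i|).
under eq_bigr do rewrite mul1r; move=> /le_trans; apply.
rewrite expr1n sumr_const card_ord -mulr_natl mulr1 ler_wpM2l//.
by apply: ler_sum => i _; rewrite real_normK ?num_real.
Qed.

Lemma dstress_bound M : exists2 C : R, 0 <= C & forall G DG v Dv c,
  (forall j k, G j k = G k j) -> (forall j k, `|G j k| <= M) ->
  (forall i j k, `|DG i j k| <= M) -> (forall l, `|c l| <= M) ->
  `|\sum_i dstress G DG v Dv i| <=
  C * (wave G Dv v c ^+ 2 + \sum_i \sum_k (Dv i k - Dv k i) ^+ 2 + \sum_l v l ^+ 2).
Proof.
pose N : R := n.+1%:R.
have N0 : 0 <= N by exact: ler0n.
pose m := `|M|; have m0 : 0 <= m by exact: normr_ge0.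
(* The coefficient of [s ^+ 2]: [m^2 (1 + N)] from the two first-order sums multiplied by the
   multiplier, and [N m^2] from each of the last two sums of [sum_dstress]. *)
pose C0 := m ^+ 2 * (1 + N) + N * m ^+ 2 * 2.
have C00 : 0 <= C0 by rewrite /C0 addr_ge0// ?mulr_ge0// ?addr_ge0// sqr_ge0.
(* Cauchy-Schwarz exchanges the squares of sums of absolute values for sums of squares:
   [kap^2 <= N^2 K] and [s^2 <= N V], which gives the factors [N * N] and [N]. *)
exists (m + m ^+ 2 * (N * N) + N * (C0 + m + m ^+ 2)).
  nonneg.
move=> G DG v Dv c Gs GM' DGM' cM'.
have GM j k : `|G j k| <= m by rewrite (le_trans (GM' j k))// ler_norm.
have DGM i j k : `|DG i j k| <= m by rewrite (le_trans (DGM' i j k))// ler_norm.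
have cM l : `|c l| <= m by rewrite (le_trans (cM' l))// ler_norm.
rewrite (sum_dstress DG v Dv c Gs).
set F := wave _ _ _ _; set s := \sum_l `|v l|.
have s0 : 0 <= s by apply: sumr_ge0.
set K := \sum_i \sum_k (Dv i k - Dv k i) ^+ 2.
pose kap := \sum_i \sum_k `|Dv i k - Dv k i|.
have kap0 : 0 <= kap by apply: sumr_ge0 => i _; apply: sumr_ge0.
have s2 : s ^+ 2 <= N * \sum_l v l ^+ 2 by exact: sqr_sum_le.
have kap2 : kap ^+ 2 <= N * N * K.
  have := sqr_sum_le (fun i => \sum_k `|Dv i k - Dv k i|).
  have -> : \sum_i `|\sum_k `|Dv i k - Dv k i| | = kap.
    by apply: eq_bigr => i _; rewrite ger0_norm// sumr_ge0.
  move=> /le_trans; apply; rewrite -mulrA ler_wpM2l// /K mulr_sumr; apply: ler_sum => i _.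
  exact: sqr_sum_le.
have H1 : `|\sum_k G k ord0 * v k| <= m * s by exact: norm_sum_le.
have H2 : `|\sum_l c l * v l| <= m * s by exact: norm_sum_le.
have Ha i : `|\sum_l G i l * v l| <= m * s by exact: norm_sum_le.
have Hd i j : `|\sum_l v l * DG i l j| <= m * s.
  by under eq_bigr do rewrite mulrC; exact: norm_sum_le.
have Hd' i : `|\sum_l v l * DG i i l| <= m * s.
  by under eq_bigr do rewrite mulrC; exact: norm_sum_le.
have H3 : `|\sum_i \sum_l v l * DG i i l| <= N * (m * s).
  by apply: le_trans (ler_norm_sum _ _ _) _; exact: sum_const_le.
have quad (A : I -> I -> R) : (forall j k, `|A j k| <= m) ->
    `|\sum_j \sum_k A j k * (v j * v k)| <= m * s ^+ 2.
  move=> Am; apply: le_trans (ler_norm_sum _ _ _) _.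
  rewrite expr2 mulrA /s mulr_sumr; apply: ler_sum => j _.
  apply: le_trans (ler_norm_sum _ _ _) _; rewrite -/s.
  rewrite -mulrA [s * _]mulrC mulrA /s mulr_sumr; apply: ler_sum => k _.
  by rewrite !normrM mulrA ler_wpM2r// ler_wpM2r.
have Hq := quad G GM.
have Hq' i : `|\sum_l \sum_m0 v l * v m0 * DG i l m0| <= m * s ^+ 2.
  have := quad (DG i) (DGM i); congr (`|_| <= _).
  by apply: eq_bigr => l _; apply: eq_bigr => k _; rewrite mulrC.
have H4 : `|\sum_i \sum_k (\sum_l G i l * v l) * (G k ord0 * (Dv i k - Dv k i))| <= m ^+ 2 * s * kap.
  apply: le_trans (ler_norm_sum _ _ _) _; rewrite /kap mulr_sumr; apply: ler_sum => i _.
  apply: le_trans (ler_norm_sum _ _ _) _; rewrite mulr_sumr; apply: ler_sum => k _.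
  rewrite !normrM mulrA ler_wpM2r//.
  have -> : m ^+ 2 * s = m * s * m by ring.
  by apply: ler_pM.
have H5 : `|\sum_i (\sum_l G i l * v l) * (\sum_k v k * DG i k ord0)| <= N * (m * s) ^+ 2.
  apply: le_trans (ler_norm_sum _ _ _) _; apply: sum_const_le => i.
  by rewrite normrM expr2; apply: ler_pM.
have H6 : `|\sum_i (G i ord0 * (\sum_l \sum_m v l * v m * DG i l m)
    + (\sum_l \sum_m G l m * (v l * v m)) * DG i i ord0)| <= N * (2 * (m * (m * s ^+ 2))).
  apply: le_trans (ler_norm_sum _ _ _) _; apply: sum_const_le => i.
  apply: le_trans (ler_normD _ _) _; rewrite mulr_natl mulr2n; apply: lerD.
    by rewrite normrM; apply: ler_pM.
  by rewrite normrM mulrC; apply: ler_pM.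
apply: le_trans (ler_normB _ _) _; rewrite normrM (ger0_norm (_ : 0 <= 2^-1))//.
apply: (@le_trans _ _ ((`|F| + m * s + N * (m * s)) * (m * s) + m ^+ 2 * s * kap + N * (m * s) ^+ 2
   + 2^-1 * (N * (2 * (m * (m * s ^+ 2)))))).
  apply: lerD; last by rewrite ler_pM2l.
  apply: le_trans (ler_normD _ _) _; apply: lerD => //.
  apply: le_trans (ler_normD _ _) _; apply: lerD => //.
  rewrite normrM; apply: ler_pM => //.
  apply: le_trans (ler_normD _ _) _; apply: lerD => //.
  by apply: le_trans (ler_normB _ _) _; apply: lerD.
have F2 : `|F| ^+ 2 = F ^+ 2 by rewrite real_normK ?num_real.
set V := \sum_l v l ^+ 2 in s2 *.
have V0 : 0 <= V by apply: sumr_ge0 => l _; rewrite sqr_ge0.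
have K0 : 0 <= K by apply: sumr_ge0 => l _; apply: sumr_ge0 => k _; rewrite sqr_ge0.
rewrite -/s -/kap -/K in H1 H2 s2 kap2 *.
apply: (@le_trans _ _ (m * F ^+ 2 + m ^+ 2 * kap ^+ 2 + (C0 + m + m ^+ 2) * s ^+ 2)).
  rewrite -F2 /C0; move: (normr_ge0 F) => f0.
  have A1 : m * (`|F| * s) <= m * (`|F| ^+ 2 + s ^+ 2).
    by rewrite ler_wpM2l//; nra.
  have A2 : m ^+ 2 * (s * kap) <= m ^+ 2 * (s ^+ 2 + kap ^+ 2).
    by rewrite ler_wpM2l ?sqr_ge0//; nra.
  rewrite -subr_ge0; rewrite -subr_ge0 in A1; rewrite -subr_ge0 in A2.
  apply: le_trans (addr_ge0 A1 A2) _; rewrite le_eqVlt; apply/orP; left; apply/eqP; by field.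
have B1 : m ^+ 2 * kap ^+ 2 <= m ^+ 2 * (N * N * K) by rewrite ler_wpM2l ?sqr_ge0.
have B2 : (C0 + m + m ^+ 2) * s ^+ 2 <= (C0 + m + m ^+ 2) * (N * V).
  apply: ler_wpM2l => //; nonneg.
apply: le_trans (lerD (lerD (lexx _) B1) B2) _.
have cf0 : 0 <= C0 + m + m ^+ 2.
  nonneg.
have p1 : 0 <= m * (K + V).
  nonneg.
have p2 : 0 <= m ^+ 2 * (N * N) * (F ^+ 2 + V).
  nonneg.
have p3 : 0 <= N * (C0 + m + m ^+ 2) * (F ^+ 2 + K).
  nonneg.
rewrite -subr_ge0; apply: le_trans (addr_ge0 (addr_ge0 p1 p2) p3) _.
rewrite le_eqVlt; apply/orP; left; apply/eqP; by ring.
Qed.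

Lemma stress_bound M : exists2 C : R, 0 <= C & forall G v,
  (forall j k, `|G j k| <= M) -> forall i, `|stress G v i| <= C * \sum_l v l ^+ 2.
Proof.
pose m := `|M|; have m0 : 0 <= m by exact: normr_ge0.
exists ((m ^+ 2 + m ^+ 2) * n.+1%:R); first by rewrite mulr_ge0 ?ler0n// addr_ge0// sqr_ge0.
move=> G v GM' i.
have GM j k : `|G j k| <= m by rewrite (le_trans (GM' j k))// ler_norm.
set s := \sum_l `|v l|; have s0 : 0 <= s by apply: sumr_ge0.
have s2 : s ^+ 2 <= n.+1%:R * \sum_l v l ^+ 2 by exact: sqr_sum_le.
apply: (@le_trans _ _ ((m ^+ 2 + m ^+ 2) * s ^+ 2)); last first.
  by rewrite -mulrA ler_wpM2l// addr_ge0// sqr_ge0.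
have Ha j : `|\sum_l G j l * v l| <= m * s by exact: norm_sum_le.
have Hx : `|\sum_k G k ord0 * v k| <= m * s by exact: norm_sum_le.
have Hq : `|\sum_l \sum_k G l k * (v l * v k)| <= m * s ^+ 2.
  apply: le_trans (ler_norm_sum _ _ _) _.
  rewrite expr2 mulrA /s mulr_sumr; apply: ler_sum => j _.
  apply: le_trans (ler_norm_sum _ _ _) _; rewrite -/s.
  rewrite -mulrA [s * _]mulrC mulrA /s mulr_sumr; apply: ler_sum => k _.
  by rewrite !normrM mulrA ler_wpM2r// ler_wpM2r.
apply: le_trans (ler_normB _ _) _; rewrite mulrDl; apply: lerD.
  by rewrite normrM -exprMn expr2; apply: ler_pM.
rewrite !normrM (ger0_norm (_ : 0 <= 2^-1))//.
have p : `|G i ord0| * `|\sum_l \sum_k G l k * (v l * v k)| <= m * (m * s ^+ 2) by apply: ler_pM.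
apply: (@le_trans _ _ (1 * (m * (m * s ^+ 2)))); last by rewrite mul1r expr2 mulrA.
by apply: ler_pM => //; rewrite invf_le1// ler1n.
Qed.

End stress.

(** * Space-time cylinders *)

Section cylinders.
Context {R : realType} {n : nat} (Omega : set 'rV[R]_n) (T : R).
Local Notation V := 'rV[R]_n.
Local Notation V1 := 'rV[R]_n.+1.
Local Notation leb := (@lebesgue_measure R).
Local Notation mu := (lebesgue_rV R n).
Local Notation mu1 := (lebesgue_rV R n.+1).
Local Notation cyl := (cylinder Omega T).

Lemma open_cylinder : open Omega -> open cyl.
Proof.
move=> oO; have -> : cyl = ((fun z : V1 => col' ord0 z : V) @^-1` Omega) `&`
    ((fun z : V1 => z ord0 ord0) @^-1` [set s | 0 < s] `&` (fun z : V1 => z ord0 ord0) @^-1` [set s | s < T]).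
  apply/seteqP; split=> z; first by move=> [Oz /andP[z0 zT]].
  by move=> [Oz [z0 zT]]; split => //; apply/andP.
apply: openI.
  by apply: open_comp => // z _; exact: continuous_col'.
apply: openI; apply: open_comp; try (by move=> z _; exact: continuous_coord).
  exact: open_gt.
exact: open_lt.
Qed.

Lemma cylinder_insert s x : cyl (insert_rV ord0 s x) <-> Omega x /\ s \in `]0, T[.
Proof.
by rewrite /cylinder/= insert_rV_same (@col'_insert_rV _ n.+1) in_itv.
Qed.

Hypothesis mO : measurable Omega.

Lemma measurable_cylinder : measurable cyl.
Proof.
have -> : cyl = ((fun z : V1 => col' ord0 z : V) @^-1` Omega) `&`
    ((fun z : V1 => z ord0 ord0 : measurableTypeR R) @^-1` `]0, T[%classic).
  by apply/seteqP; split=> z /=; rewrite in_itv.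
apply: measurableI; rewrite -[X in measurable X]setTI.
  apply: (@measurable_fun_rV R n _ _ (fun z : V1 => col' ord0 z : V)) => // i.
  rewrite (_ : (fun _ => _) = (fun z : V1 => z ord0 (lift ord0 i) : measurableTypeR R)).
    exact: measurable_coord.
  by apply/funext => z; rewrite mxE.
by apply: measurable_coord => //.
Qed.

(** Integrals over the cylinder become integrals over the whole space of the extension by 0, to
    which the Fubini statements for [insert_rV] apply; the extension factors into one in time and
    one in space. *)
Let patch_insert (f : V1 -> \bar R) s x : (f \_ cyl) (insert_rV ord0 s x) =
  (fun x => ((fun s => f (insert_rV ord0 s x)) \_ `]0, T[%classic) s) \_ Omega x.
Proof.
rewrite !patchE; case: ifPn => [/set_mem/cylinder_insert[/mem_set -> sT]|/negP H].
  by rewrite mem_set.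
case: ifPn => // /set_mem Ox; case: ifPn => // /set_mem/= sT.
by exfalso; apply: H; apply/mem_set/cylinder_insert.
Qed.

Let mf0 (f : V1 -> \bar R) : measurable_fun cyl f -> measurable_fun [set: V1] (f \_ cyl).
Proof. by move=> mf; apply/(measurable_restrictT _ measurable_cylinder). Qed.

Let mfi (f : V1 -> \bar R) : measurable_fun cyl f ->
  measurable_fun [set: measurableTypeR R * V] (fun p => (f \_ cyl) (insert_rV ord0 (p.1 : R) p.2)).
Proof. by move=> mf; exact: measurableT_comp (mf0 mf) (@measurable_insert_rV R n.+1 ord0). Qed.

Let itv_integral (f : V1 -> \bar R) x : Omega x ->
  (\int[leb]_(s in `]0%R, T[) f (insert_rV ord0 s x) = \int[leb]_s (f \_ cyl) (insert_rV ord0 s x))%E.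
Proof.
move=> Ox; rewrite integral_mkcond; apply: eq_integral => s _.
by rewrite patch_insert [RHS]patchE mem_set.
Qed.

Let space_integral (f : V1 -> \bar R) s : s \in `]0, T[ ->
  (\int[mu]_(x in Omega) f (insert_rV ord0 s x) = \int[mu]_x (f \_ cyl) (insert_rV ord0 s x))%E.
Proof.
move=> sT; rewrite integral_mkcond; apply: eq_integral => x _.
rewrite patch_insert !patchE; case: ifPn => // _.
by rewrite mem_set.
Qed.

Let outside_s (f : V1 -> \bar R) s : s \notin `]0, T[ ->
  (\int[mu]_x (f \_ cyl) (insert_rV ord0 s x) = 0)%E.
Proof.
move=> sT; rewrite integral0_eq// => x _; rewrite patchE; case: ifPn => // /set_mem/cylinder_insert[_].
by rewrite (negPf sT).
Qed.

Let outside_x (f : V1 -> \bar R) x : ~ Omega x ->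
  (\int[leb]_s (f \_ cyl) (insert_rV ord0 s x) = 0)%E.
Proof.
move=> NO; rewrite integral0_eq// => s _; rewrite patchE; case: ifPn => // /set_mem/cylinder_insert[] //.
Qed.

Let to_time (F : R -> \bar R) (f : V1 -> \bar R) : (forall s, F s = \int[mu]_x (f \_ cyl) (insert_rV ord0 s x))%E ->
  (\int[leb]_s F s = \int[leb]_(s in `]0%R, T[) \int[mu]_(x in Omega) f (insert_rV ord0 s x))%E.
Proof.
move=> FE; rewrite [RHS]integral_mkcond; apply: eq_integral => s _; rewrite patchE FE.
case: ifPn => [/set_mem/=|/negP sT]; first by move=> /space_integral ->.
by rewrite outside_s//; apply/negP => H; apply: sT; exact/mem_set.
Qed.

Let to_space (F : V -> \bar R) (f : V1 -> \bar R) : (forall x, F x = \int[leb]_s (f \_ cyl) (insert_rV ord0 s x))%E ->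
  (\int[mu]_x F x = \int[mu]_(x in Omega) \int[leb]_(s in `]0%R, T[) f (insert_rV ord0 s x))%E.
Proof.
move=> FE; rewrite [RHS]integral_mkcond; apply: eq_integral => x _; rewrite patchE FE.
case: ifPn => [/set_mem Ox|/negP NO]; first by rewrite itv_integral.
by rewrite outside_x// => H; apply: NO; exact/mem_set.
Qed.

Lemma ge0_integral_cyl_time (f : V1 -> \bar R) : measurable_fun cyl f -> (forall z, (0 <= f z)%E) ->
  (\int[mu1]_(z in cyl) f z = \int[leb]_(s in `]0%R, T[) \int[mu]_(x in Omega) f (insert_rV ord0 s x))%E.
Proof.
move=> mf f0; rewrite integral_mkcond.
have p0 z : (0 <= (f \_ cyl) z)%E by rewrite erestrict_ge0.
rewrite (ge0_integral_insert0 (mf0 mf) p0).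
rewrite (@fubini_tonelli1 _ _ _ _ _ _ _ _ (mfi mf)) => [|p]; last exact: p0.
exact: to_time.
Qed.

Lemma ge0_integral_cyl_space (f : V1 -> \bar R) : measurable_fun cyl f -> (forall z, (0 <= f z)%E) ->
  (\int[mu1]_(z in cyl) f z = \int[mu]_(x in Omega) \int[leb]_(s in `]0%R, T[) f (insert_rV ord0 s x))%E.
Proof.
move=> mf f0; rewrite integral_mkcond.
have p0 z : (0 <= (f \_ cyl) z)%E by rewrite erestrict_ge0.
rewrite (@ge0_integral_insert R n.+1 ord0 _ (mf0 mf) p0).
exact: to_space.
Qed.

Lemma integral_cyl_time (f : V1 -> \bar R) : mu1.-integrable cyl f ->
  (\int[mu1]_(z in cyl) f z = \int[leb]_(s in `]0%R, T[) \int[mu]_(x in Omega) f (insert_rV ord0 s x))%E.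
Proof.
move=> fi; rewrite integral_mkcond.
rewrite (integral_insert0 (proj1 (integrable_mkcond _ measurable_cylinder) fi)).
exact: to_time.
Qed.

Lemma integral_cyl_space (f : V1 -> \bar R) : mu1.-integrable cyl f ->
  (\int[mu1]_(z in cyl) f z = \int[mu]_(x in Omega) \int[leb]_(s in `]0%R, T[) f (insert_rV ord0 s x))%E.
Proof.
move=> fi; rewrite integral_mkcond.
rewrite (@integral_insert R n.+1 ord0 _ (proj1 (integrable_mkcond _ measurable_cylinder) fi)).
exact: to_space.
Qed.

Lemma measurable_slice (f : V1 -> \bar R) s : measurable_fun cyl f -> s \in `]0, T[ ->
  measurable_fun Omega (fun x => f (insert_rV ord0 s x)).
Proof.
move=> mf sT; have := measurable_funTS (D := Omega) (measurable_fun_pair2 s (mfi mf)).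
apply: eq_measurable_fun => x /set_mem Ox; rewrite patchE mem_set//.
exact/cylinder_insert.
Qed.

Lemma measurable_time_slice (f : V1 -> \bar R) x : measurable_fun cyl f -> Omega x ->
  measurable_fun `]0, T[%classic (fun s : measurableTypeR R => f (insert_rV ord0 (s : R) x)).
Proof.
move=> mf Ox; have := measurable_funTS (D := `]0, T[%classic) (measurable_fun_pair1 x (mfi mf)).
apply: eq_measurable_fun => s /set_mem/= sT; rewrite patchE mem_set//.
exact/cylinder_insert.
Qed.

Lemma measurable_integral_slice (f : V1 -> \bar R) : measurable_fun cyl f -> (forall z, (0 <= f z)%E) ->
  measurable_fun `]0, T[%classic (fun s : measurableTypeR R => \int[mu]_(x in Omega) f (insert_rV ord0 (s : R) x))%E.
Proof.
move=> mf f0.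
have p0 (p : measurableTypeR R * V) : (0 <= (f \_ cyl) (insert_rV ord0 (p.1 : R) p.2))%E by rewrite erestrict_ge0.
have H : measurable_fun [set: measurableTypeR R] (fun s : measurableTypeR R => \int[mu]_x (f \_ cyl) (insert_rV ord0 (s : R) x))%E.
  exact: (@measurable_fun_fubini_tonelli_F _ _ _ _ _ _ _ (mfi mf) p0).
apply: (eq_measurable_fun _ _ (measurable_funTS H)) => s /set_mem/= sT.
by rewrite space_integral.
Qed.

Lemma measurable_time_integral (f : V1 -> \bar R) : measurable_fun cyl f -> (forall z, (0 <= f z)%E) ->
  measurable_fun Omega (fun x => \int[leb]_(s in `]0%R, T[) f (insert_rV ord0 s x))%E.
Proof.
move=> mf f0.
have p0 (p : measurableTypeR R * V) : (0 <= (f \_ cyl) (insert_rV ord0 (p.1 : R) p.2))%E by rewrite erestrict_ge0.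
have H : measurable_fun [set: V] (fun x => \int[leb]_s (f \_ cyl) (insert_rV ord0 s x))%E.
  exact: (@measurable_fun_fubini_tonelli_G _ _ _ _ _ _ _ (mfi mf) p0).
apply: (eq_measurable_fun _ _ (measurable_funTS H)) => x /set_mem Ox.
by rewrite itv_integral.
Qed.

Lemma integrable_time_slice (f : V1 -> \bar R) : mu1.-integrable cyl f ->
  {ae mu, forall x, Omega x -> leb.-integrable `]0, T[%classic (fun s => f (insert_rV ord0 s x))}.
Proof.
move=> fi; have := @integrable_insert R n.+1 ord0 _ (proj1 (integrable_mkcond _ measurable_cylinder) fi).
move=> /ae_integrable2; apply: filterS => x H Ox.
apply: (proj2 (integrable_mkcond _ _)) => //; apply: eq_integrable H => // s _.
by rewrite /= patch_insert patchE mem_set.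
Qed.

End cylinders.

Section slices.
Context {R : realType} {n : nat}.
Local Notation V := 'rV[R]_n.
Local Notation V1 := 'rV[R]_n.+1.
Implicit Types f : V1 -> R.

Lemma continuous_slice f t : continuous f -> continuous (slice f t).
Proof.
move=> cf x; apply: (@continuous_comp _ _ _ (fun x : V => insert_rV ord0 t x : V1) f); last exact: cf.
by apply: (@continuous_insert_rV R n.+1 _ ord0 (fun=> t) id); [exact: (@cst_continuous V R t x)|exact: cvg_id].
Qed.

Lemma is_derive_slice f t x j : C1 f ->
  is_derive x (delta_mx ord0 j : V) (slice f t) (slice (pderiv (lift ord0 j) f) t x).
Proof.
move=> f1; apply: (@is_derive_insert_lift R n.+1 f ord0 t x j).
by apply: derivableP; exact: C1_derivable.
Qed.

Lemma pderiv_slice f t j : C1 f -> pderiv j (slice f t) = slice (pderiv (lift ord0 j) f) t.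
Proof. by move=> f1; apply/funext => x; apply: is_derive_val; exact: is_derive_slice. Qed.

Lemma C1_slice f t : C1 f -> C1 (slice f t).
Proof.
move=> f1; split; first exact/continuous_slice/C1_continuous.
move=> j; split; first by move=> x; exact: is_derive_ex (is_derive_slice t x j f1).
by rewrite pderiv_slice//; apply: continuous_slice; exact: C1_pderiv_continuous.
Qed.

Lemma is_derive_time f (s : R) x : C1 f ->
  is_derive s 1 (fun t : R => f (insert_rV ord0 t x)) (pderiv ord0 f (insert_rV ord0 s x)).
Proof.
move=> f1; apply: (@is_derive_insert_same R n.+1); apply: derivableP; exact: C1_derivable.
Qed.

Lemma continuous_time_line f x : continuous f -> continuous (fun t : R => f (insert_rV ord0 t x)).
Proof.
move=> cf t; apply: (@continuous_comp _ _ _ (fun t : R => insert_rV ord0 t x : V1) f); last exact: cf.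
by apply: (@continuous_insert_rV R n.+1 _ ord0 id (fun=> x)); [exact: cvg_id|exact: cvg_cst].
Qed.

Lemma FTC_open (g dg : R -> R) a b : a < b -> (forall t : R, is_derive t 1 g (dg t)) ->
  continuous dg -> (\int[@lebesgue_measure R]_(t in `]a, b[) (dg t)%:E = (g b - g a)%:E)%E.
Proof.
move=> ab dE cdg; rewrite -(FTC ab dE cdg).
have mdg : measurable_fun [set: measurableTypeR R] dg by exact: continuous_measurable_fun.
rewrite integral_itv_bndo_bndc; last by apply/measurable_EFinP; apply: measurable_funTS; exact: mdg.
by rewrite integral_itv_obnd_cbnd//; apply/measurable_EFinP; apply: measurable_funTS; exact: mdg.
Qed.

End slices.

Section slab.
Context {R : realType} {n : nat}.
Local Notation V := 'rV[R]_n.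
Local Notation V1 := 'rV[R]_n.+1.
Local Notation leb := (@lebesgue_measure R).
Local Notation mu := (lebesgue_rV R n).
Local Notation mu1 := (lebesgue_rV R n.+1).

Lemma integrable_cyl_box (Omega : set V) (t : R) (f : V1 -> R) a b : measurable Omega ->
  continuous f -> (forall z, ~ closed_box a b (col' ord0 z) -> f z = 0) ->
  mu1.-integrable (cylinder Omega t) (EFin \o f).
Proof.
move=> mO cf f0; have mc := measurable_cylinder t mO.
pose K : set V1 := closed_box (insert_rV ord0 0 a) (insert_rV ord0 t b).
have mK : measurable K by exact: measurable_closed_box.
have fK : mu1.-integrable setT ((EFin \o f) \_ K).
  apply: (proj1 (integrable_mkcond _ mK)).
  by apply: continuous_integrable => //; exact: compact_closed_box.
apply: (eq_integrable mc _ _ _ (integrableS measurableT mc (@subsetT _ _) fK)).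
move=> z /set_mem[Oz /andP[z0 zt]]; rewrite patchE; case: ifPn => // /negP zK /=.
rewrite f0// => H; apply: zK; apply/mem_set => i; have [j ->|->] := unliftP ord0 i.
  by rewrite !insert_rV_lift; have := H j; rewrite mxE.
by rewrite !insert_rV_same !ltW.
Qed.

Variables (S Oi : set V) (nu : V -> V) (sigma : {measure set V -> \bar R}).
Hypotheses (cS : compact S) (oOi : open Oi) (OiS : Oi `&` S = set0)
  (clOi : closure Oi = Oi `|` S) (nuP : outer_unit_normal Oi S nu)
  (sigmaP : area_measure S sigma).
Local Notation Oe := (~` closure Oi).

Lemma open_exterior : open Oe.
Proof. by apply: closed_openC; exact: closed_closure. Qed.

Lemma measurable_exterior : measurable Oe.
Proof. exact: measurable_open open_exterior. Qed.

(** The time component is integrated along each vertical line and the space components by the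
    divergence theorem in each slice, so that no surface measure on the boundary of the cylinder
    enters. Compactness of the support is asked in space only. *)
Theorem slab_identity (B : 'I_n.+1 -> V1 -> R) a b t : 0 < t -> (forall i, C1 (B i)) ->
  (forall i z, ~ closed_box a b (col' ord0 z) -> B i z = 0) ->
  (\int[mu1]_(z in cylinder Oe t) (\sum_i pderiv i (B i) z)%:E =
   \int[mu]_(x in Oe) (slice (B ord0) t x)%:E - \int[mu]_(x in Oe) (slice (B ord0) 0 x)%:E +
   \int[leb]_(s in `]0%R, t[) \int[sigma]_(x in S)
      (- \sum_j slice (B (lift ord0 j)) s x * nu x ord0 j)%:E)%E.
Proof.
move=> t0 B1 B0; have mO := measurable_exterior; have mc := measurable_cylinder t mO.
have sl0 s i x : ~ closed_box a b x -> slice (B i) s x = 0.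
  by move=> H; apply: B0; rewrite (@col'_insert_rV _ n.+1).
have oz (z : V1) : ~ closed_box a b (col' ord0 z) -> \near z, ~ closed_box a b (col' ord0 z).
  move=> H; apply: open_nbhs_nbhs; split => //.
  apply: (@open_comp _ _ (fun z : V1 => col' ord0 z : V) (~` closed_box a b)).
    by move=> w _; exact: continuous_col'.
  by apply: closed_openC; exact: closed_closed_box.
have dB0 i k z : ~ closed_box a b (col' ord0 z) -> pderiv k (B i) z = 0.
  move=> H; rewrite /pderiv -(@near_eq_derive _ _ _ (cst 0)) ?derive_cst//.
  by apply: filterS (oz z H) => w /B0 ->.
have ci i k : continuous (pderiv k (B i)) by exact: C1_pderiv_continuous.
have ii i k : mu1.-integrable (cylinder Oe t) (EFin \o pderiv k (B i)).
  by apply: integrable_cyl_box => //; exact: dB0.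
have cs : continuous (fun z => \sum_j pderiv (lift ord0 j) (B (lift ord0 j)) z).
  by apply: continuous_sumx => j; exact: ci.
have is_ : mu1.-integrable (cylinder Oe t) (EFin \o (fun z => \sum_j pderiv (lift ord0 j) (B (lift ord0 j)) z)).
  apply: (@integrable_cyl_box _ _ _ a b mO cs) => z H.
  by rewrite big1// => j _; exact: dB0.
rewrite (eq_integral (fun z => (pderiv ord0 (B ord0) z)%:E + (\sum_j pderiv (lift ord0 j) (B (lift ord0 j)) z)%:E)%E); last first.
  by move=> z _; rewrite big_ord_recl EFinD.
rewrite (@integralD _ _ _ mu1 _ mc _ _ (ii ord0 ord0) is_); congr (_ + _)%E.
  rewrite integral_cyl_space//.
  have isl s : mu.-integrable Oe (fun x => (slice (B ord0) s x)%:E).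
    apply: (integrableS measurableT) => //.
    by apply: (@continuous_box_integrable _ _ _ a b); [apply: continuous_slice; exact: C1_continuous|exact: sl0].
  rewrite -integralB//; apply: eq_integral => x _.
  have := FTC_open t0 (fun s => is_derive_time s x (B1 ord0)) (@continuous_time_line _ _ _ x (ci ord0 ord0)).
  by rewrite EFinB.
rewrite integral_cyl_time//; apply: eq_integral => s _.
rewrite (eq_integral (fun x => (\sum_j pderiv j (slice (B (lift ord0 j)) s) x)%:E)); last first.
  by move=> x _; congr EFin; apply: eq_bigr => j _; rewrite pderiv_slice.
have := @divergence_theorem R n S Oi nu sigma cS oOi OiS clOi nuP sigmaP
  (fun j => slice (B (lift ord0 j)) s) a b (fun j => C1_slice s (B1 _)) (fun j => sl0 s _).
rewrite /divergence_formula => ->.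
rewrite -mulN1e -integralZl//; first by apply: eq_integral => x _; rewrite -EFinM mulN1r.
  exact: measurable_compact.
under eq_fun do rewrite -sumEFin.
apply: integrable_sum => [|j _]; first exact: measurable_compact.
apply: (surface_integrable cS nuP sigmaP) => //; apply: continuous_slice; exact: C1_continuous.
Qed.

End slab.

(** * Pointwise positivity and flux of the tensor *)

Section pointwise.
Context {R : realType} {n : nat}.
Local Notation W := 'rV[R]_n.+1.
Implicit Types (A : 'M[R]_n.+1) (u v w xi : W).

Lemma bil_sum A xi : \sum_l \sum_m A l m * (xi ord0 l * xi ord0 m) = bil A xi xi.
Proof. by apply: eq_bigr => l _; apply: eq_bigr => m _; rewrite mulrA. Qed.

Lemma stress0E A xi : A^T = A -> stress A (xi ord0) ord0 =
  bil A (delta_mx ord0 ord0) xi ^+ 2 - 2^-1 * (A ord0 ord0 * bil A xi xi).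
Proof.
move=> sA; rewrite /stress bil_sum bil_delta// expr2; congr (_ * _ - _).
by apply: eq_bigr => k _; rewrite -[in LHS]sA mxE.
Qed.

(** Split [xi] into a multiple of the time covector [e] and a part [eta] orthogonal to it. The
    component becomes [(a^2 - g A(eta, eta)) / 2], and the form is negative on the complement of the
    timelike [e]. Only the signature and the sign of [g] enter, so this covers the points where the
    space block degenerates. *)
Lemma stress0_gt0 A xi : A^T = A -> lorentzian A -> 0 < A ord0 ord0 -> xi != 0 ->
  0 < stress A (xi ord0) ord0.
Proof.
move=> sA lA g0 xi0; rewrite stress0E//.
set e : W := delta_mx ord0 ord0; set g := A ord0 ord0 in g0 *.
have eg : bil A e e = g.
  rewrite bil_delta// (bigD1 ord0)//= mxE !eqxx mulr1 big1 ?addr0// => k k0.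
  by rewrite mxE (negPf k0) andbF mulr0.
set a := bil A e xi; pose eta := xi - (a / g) *: e.
have xiE : xi = (a / g) *: e + eta by rewrite /eta addrC subrK.
have en : bil A e eta = 0.
  rewrite /eta -scaleN1r bilDr// !bilZr// eg -/a mulN1r divfK ?subrr// gt_eqF//.
move: eta xiE en => eta xiE en.
have E : bil A xi xi = a ^+ 2 / g + bil A eta eta.
  rewrite {1 2}xiE bilDl !bilDr// !bilZl !bilZr// eg en (bilC eta e sA) en !mulr0 addr0 add0r.
  by congr (_ + _); rewrite expr2; field; rewrite gt_eqF.
have -> : a ^+ 2 - 2^-1 * (g * bil A xi xi) = 2^-1 * (a ^+ 2 - g * bil A eta eta).
  by rewrite E; field; rewrite gt_eqF.
rewrite pmulr_rgt0//; have [eta0|eta0] := eqVneq eta 0.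
  rewrite [bil A eta eta](_ : _ = 0) ?mulr0 ?subr0.
    rewrite exprn_even_gt0//=; apply: contraNneq xi0 => a0.
    by rewrite xiE a0 mul0r scale0r eta0 addr0.
  by rewrite eta0 -(scale0r eta) bilZl mul0r.
have := @timelike_orthogonal _ _ A e eta lA; rewrite eg => /(_ g0 en eta0) neg.
rewrite subr_gt0; apply: lt_le_trans (sqr_ge0 a).
by rewrite pmulr_rlt0.
Qed.

Lemma stressZ A (r : R) (v : 'I_n.+1 -> R) i :
  stress A (fun l => r * v l) i = r ^+ 2 * stress A v i.
Proof.
have E1 (b : 'I_n.+1 -> R) : \sum_l b l * (r * v l) = r * \sum_l b l * v l.
  by rewrite mulr_sumr; apply: eq_bigr => l _; ring.
have E2 : \sum_l \sum_m A l m * (r * v l * (r * v m)) = r ^+ 2 * \sum_l \sum_m A l m * (v l * v m).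
  by rewrite mulr_sumr; apply: eq_bigr => l _; rewrite mulr_sumr; apply: eq_bigr => m _; ring.
by rewrite /stress E2 !E1; ring.
Qed.

(** Completing squares, the component is [g^2 v0^2 / 4 + (g v0 + 2 b)^2 / 4 - g s / 2]. The middle
    square is dropped and the other terms are bounded below through [C0]; unlike a compactness
    argument, this gives a constant valid at infinity. *)
Lemma stress0_elliptic A (C0 : R) (v : 'I_n.+1 -> R) : 0 < C0 -> A^T = A -> C0 <= A ord0 ord0 ->
  (forall xi : 'rV[R]_n, \sum_j \sum_k row' ord0 (col' ord0 A) j k * xi ord0 j * xi ord0 k
     <= - C0 * \sum_j xi ord0 j ^+ 2) ->
  C0 ^+ 2 / 4 * \sum_l v l ^+ 2 <= stress A v ord0.
Proof.
move=> C00 sA gC ell.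
pose P := \sum_(j < n) v (lift ord0 j) ^+ 2.
pose b := \sum_(j < n) A ord0 (lift ord0 j) * v (lift ord0 j).
pose s := \sum_(j < n) \sum_(k < n) A (lift ord0 j) (lift ord0 k) * (v (lift ord0 j) * v (lift ord0 k)).
have sP : s <= - C0 * P.
  have := ell (\row_j v (lift ord0 j)); rewrite /s /P.
  under eq_bigr do under eq_bigr do rewrite !mxE.
  under [X in _ <= _ * X]eq_bigr do rewrite mxE.
  by under eq_bigr do under eq_bigr do rewrite -mulrA.
have P0 : 0 <= P by apply: sumr_ge0 => j _; rewrite sqr_ge0.
have sym j k : A j k = A k j by rewrite -[in LHS]sA mxE.
set g := A ord0 ord0 in gC *; set v0 := v ord0.
have E1 : \sum_l A ord0 l * v l = g * v0 + b by rewrite big_ord_recl.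
have E2 : \sum_k A k ord0 * v k = g * v0 + b.
  by rewrite -E1; apply: eq_bigr => k _; rewrite sym.
have E3 : \sum_l \sum_m A l m * (v l * v m) = g * v0 ^+ 2 + 2 * v0 * b + s.
  rewrite big_ord_recl big_ord_recl -/g -/v0 /=.
  under [X in _ + X]eq_bigr do rewrite big_ord_recl.
  rewrite big_split/= -/s.
  have -> : \sum_(i < n) A ord0 (lift ord0 i) * (v0 * v (lift ord0 i)) = v0 * b.
    by rewrite mulr_sumr; apply: eq_bigr => i _; ring.
  have -> : \sum_(i < n) A (lift ord0 i) ord0 * (v (lift ord0 i) * v ord0) = v0 * b.
    by rewrite mulr_sumr; apply: eq_bigr => i _; rewrite sym -/v0; ring.
  by ring.
rewrite /stress E1 E2 E3 -/g big_ord_recl -/v0 -/P.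
move: C00 gC sP P0; clear; move=> C00 gC sP P0.
have gs : C0 * (C0 * P) <= g * - s.
  apply: ler_pM; [exact: ltW|by rewrite mulr_ge0// ltW|exact: gC|by rewrite lerNr -mulNr].
have gg : C0 ^+ 2 * v0 ^+ 2 <= g ^+ 2 * v0 ^+ 2.
  by rewrite ler_wpM2r ?sqr_ge0// ler_sqr ?nnegrE ?(ltW C00)// (le_trans (ltW C00)).
have sq : 0 <= (g * v0 + 2 * b) ^+ 2 by exact: sqr_ge0.
have pC : 0 <= C0 ^+ 2 * P by rewrite mulr_ge0// sqr_ge0.
have -> : (g * v0 + b) * (g * v0 + b) - 2^-1 * (g * (g * v0 ^+ 2 + 2 * v0 * b + s)) =
  4^-1 * (g ^+ 2 * v0 ^+ 2) + 4^-1 * (g * v0 + 2 * b) ^+ 2 + 2^-1 * (g * - s) by field.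
have -> : C0 ^+ 2 / 4 * (v0 ^+ 2 + P) = 4^-1 * (C0 ^+ 2 * v0 ^+ 2) + 4^-1 * (C0 ^+ 2 * P) by field.
move: gs gg sq pC; move: (g * - s) (g ^+ 2 * v0 ^+ 2) (C0 ^+ 2 * v0 ^+ 2) ((g * v0 + 2 * b) ^+ 2) => p1 p2 p3 p4.
have -> : C0 * (C0 * P) = C0 ^+ 2 * P by ring.
by move: (C0 ^+ 2 * P) => p5; lra.
Qed.

(* At a point where the space block is singular, the covector [dx_0] is null. *)
Lemma degenerate_space_block A u : A^T = A -> lorentzian A ->
  \det (row' ord0 (col' ord0 A)) = 0 -> u ord0 ord0 = 0 -> bil A u u <= 0.
Proof.
move=> sA lA d0 u0.
have dA : A \in unitmx.
  have [P uP E] := lA; rewrite unitmxE unitfE; apply/eqP => dA0.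
  have := congr1 (fun X => \det X) E; rewrite !det_mulmx dA0 mulr0 mul0r det_diag.
  move=> /esym/eqP; rewrite prodf_seq_eq0 => /hasP[j _] /=; rewrite mxE.
  by case: ifP => _; rewrite ?oppr_eq0 oner_eq0.
pose w : W := row ord0 (invmx A).
have wA : w *m A = delta_mx ord0 ord0 by rewrite /w -row_mul mulVmx// row1.
have bw y : bil A w y = y ord0 ord0.
  rewrite bilE wA mxE (bigD1 ord0)//= !mxE !eqxx mul1r big1 ?addr0// => k k0.
  by rewrite !mxE (negPf k0) andbF mul0r.
apply: (@causal_orthogonal _ _ A w u) => //.
- apply: contra_eq_neq wA => ->; rewrite mul0mx; apply/eqP => /rowP/(_ ord0).
  by rewrite !mxE !eqxx => /eqP; rewrite eq_sym oner_eq0.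
- by rewrite bw mxE /invmx dA !mxE /cofactor d0 !mulr0.
- by rewrite bw.
Qed.

(** On covectors without time component the form is at most 0, and the conormal [N] attains the
    value 0; at such a maximum the linear term in any direction [e] must vanish. *)
Lemma null_normal A (nu : 'I_n -> R) k : A^T = A -> lorentzian A ->
  \det (row' ord0 (col' ord0 A)) = 0 ->
  \sum_j \sum_l row' ord0 (col' ord0 A) j l * nu j * nu l = 0 ->
  \sum_j A (lift ord0 j) (lift ord0 k) * nu j = 0.
Proof.
move=> sA lA d0 nn.
pose N : W := \row_i (if unlift ord0 i is Some j then nu j else 0).
have N0 : N ord0 ord0 = 0 by rewrite mxE unlift_none.
have Nl j : N ord0 (lift ord0 j) = nu j by rewrite mxE liftK.
pose e : W := delta_mx ord0 (lift ord0 k).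
have e0 : e ord0 ord0 = 0 by rewrite mxE eqxx (negPf (neq_lift _ _)).
have bN : bil A N N = 0.
  rewrite /bil big_ord_recl big1 ?add0r; last by move=> l _; rewrite N0 mulr0 mul0r.
  rewrite -[RHS]nn; apply: eq_bigr => j _; rewrite big_ord_recl N0 mulr0 add0r.
  by apply: eq_bigr => l _; rewrite !Nl !mxE.
have beN : bil A e N = \sum_j A (lift ord0 j) (lift ord0 k) * nu j.
  rewrite bil_delta// big_ord_recl N0 mulr0 add0r; apply: eq_bigr => j _.
  by rewrite Nl -[in LHS]sA mxE.
rewrite -beN; have be := degenerate_space_block sA lA d0 e0.
have H t : 2 * t * bil A e N + t ^+ 2 * bil A e e <= 0.
  have z0 : (N + t *: e) ord0 ord0 = 0.
    by rewrite mxE N0 add0r mxE [X in _ * X]e0 mulr0.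
  have := degenerate_space_block sA lA d0 z0.
  by rewrite bilDl !bilDr// !bilZl !bilZr// bN (bilC N e sA) => h; apply: le_trans h; rewrite le_eqVlt; apply/orP; left; apply/eqP; ring.
(* This [t] satisfies [p = - t (q - 1)], so that the inequality reads [- t^2 (q - 2) <= 0]; as
   [q <= 0], it forces [t = 0] and then [p = 0]. The shift by 1 avoids dividing by [q], which may be
   0. *)
move: (H (- bil A e N / (bil A e e - 1))) (H 0) be; move: (bil A e N) (bil A e e) => p q.
move=> h _ q0; have q1 : q - 1 < 0 by lra.
have q1' : q - 1 != 0 by rewrite lt_eqF.
move: h; set t := _ / _; have tE : t * (q - 1) = - p by rewrite /t divfK.
have -> : 2 * t * p + t ^+ 2 * q = - t ^+ 2 * (q - 2).
  have -> : p = - (t * (q - 1)) by rewrite tE opprK.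
  by ring.
move=> h; have t2 : t ^+ 2 <= 0.
  by move: (sqr_ge0 t) h; move: (t ^+ 2) => T; nra.
have /eqP : t ^+ 2 = 0 by apply/eqP; rewrite eq_le t2 sqr_ge0.
by rewrite sqrf_eq0 => /eqP t0; move: tE; rewrite t0 mul0r => /eqP; rewrite eq_sym oppr_eq0 => /eqP.
Qed.

(** Contracted with [nu], the first factor of the tensor keeps only its time part [B v0]; the cross
    terms [v0 b] then cancel against those of the quadratic form. *)
Lemma stress_flux A (nu : 'I_n -> R) (v : 'I_n.+1 -> R) : A^T = A ->
  (forall k, \sum_j A (lift ord0 j) (lift ord0 k) * nu j = 0) ->
  \sum_j stress A v (lift ord0 j) * nu j =
  2^-1 * (\sum_j A (lift ord0 j) ord0 * nu j) * (A ord0 ord0 * v ord0 ^+ 2 -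
    \sum_j \sum_k A (lift ord0 j) (lift ord0 k) * v (lift ord0 j) * v (lift ord0 k)).
Proof.
move=> sA nn.
pose b := \sum_(j < n) A ord0 (lift ord0 j) * v (lift ord0 j).
pose s := \sum_(j < n) \sum_(k < n) A (lift ord0 j) (lift ord0 k) * v (lift ord0 j) * v (lift ord0 k).
have sym j k : A j k = A k j by rewrite -[in LHS]sA mxE.
set g := A ord0 ord0; set v0 := v ord0.
have E2 : \sum_k A k ord0 * v k = g * v0 + b.
  by rewrite big_ord_recl; congr (_ + _); apply: eq_bigr => k _; rewrite sym.
have E3 : \sum_l \sum_m A l m * (v l * v m) = g * v0 ^+ 2 + 2 * v0 * b + s.
  rewrite big_ord_recl big_ord_recl -/g -/v0 /=.
  under [X in _ + X]eq_bigr do rewrite big_ord_recl.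
  rewrite big_split/=.
  have -> : \sum_(i < n) A ord0 (lift ord0 i) * (v0 * v (lift ord0 i)) = v0 * b.
    by rewrite mulr_sumr; apply: eq_bigr => i _; ring.
  have -> : \sum_(i < n) A (lift ord0 i) ord0 * (v (lift ord0 i) * v ord0) = v0 * b.
    by rewrite mulr_sumr; apply: eq_bigr => i _; rewrite sym -/v0; ring.
  rewrite (_ : \sum_(i < n) \sum_(i0 < n) _ = s); first by ring.
  by apply: eq_bigr => i _; apply: eq_bigr => k _; rewrite mulrA.
set B := \sum_(j < n) A (lift ord0 j) ord0 * nu j.
have E1 : \sum_j (\sum_l A (lift ord0 j) l * v l) * nu j = B * v0.
  transitivity (\sum_(j < n) (A (lift ord0 j) ord0 * nu j * v0 +
      \sum_(k < n) A (lift ord0 j) (lift ord0 k) * nu j * v (lift ord0 k))).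
    apply: eq_bigr => j _; rewrite big_ord_recl mulrDl mulr_suml; congr (_ + _); first by rewrite mulrAC.
    by apply: eq_bigr => k _; rewrite mulrAC.
  rewrite big_split/= -mulr_suml -/B exchange_big/= big1 ?addr0// => k _.
  by rewrite -mulr_suml nn mul0r.
rewrite /stress E2 E3 -/s.
transitivity ((\sum_j (\sum_l A (lift ord0 j) l * v l) * nu j) * (g * v0 + b) -
   2^-1 * (B * (g * v0 ^+ 2 + 2 * v0 * b + s))).
  move: (g * v0 + b) (g * v0 ^+ 2 + 2 * v0 * b + s) => p r.
  by rewrite /B !mulr_suml mulr_sumr -sumrB; apply: eq_bigr => j _; ring.
by rewrite E1; field.
Qed.

End pointwise.

Section cylindrical.
Context {R : realType} {n : nat}.
Local Notation V := 'rV[R]_n.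
Local Notation V1 := 'rV[R]_n.+1.

Lemma is_derive_cylindrical (f : V -> R) (z : V1) (i : 'I_n.+1) : (forall j x, derivable f x (delta_mx ord0 j)) ->
  is_derive z (delta_mx ord0 i : V1) (fun z => f (col' ord0 z))
    (if unlift ord0 i is Some j then pderiv j f (col' ord0 z) else 0).
Proof.
move=> df; apply/is_derive_line; have [j ->|->] := unliftP ord0 i.
  rewrite (_ : (fun h => _) = fun h : R => f (h *: delta_mx ord0 j + col' ord0 z)).
    exact: (proj1 (is_derive_line _ _ _ _) (derivableP (df _ _))).
  apply/funext => h; congr f; apply/rowP => k; rewrite !mxE (inj_eq (@lift_inj _ ord0)) //.
rewrite (_ : (fun h => _) = fun=> f (col' ord0 z)); first exact: is_derive_cst.
apply/funext => h; congr f; apply/rowP => k; rewrite !mxE.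
by rewrite [lift _ _ == _]eq_sym (negPf (neq_lift _ _)) andbF mulr0 add0r.
Qed.

Lemma pderiv_cylindrical (f : V -> R) (i : 'I_n.+1) : smooth f ->
  pderiv i (fun z : V1 => f (col' ord0 z)) =
  fun z => if unlift ord0 i is Some j then pderiv j f (col' ord0 z) else 0.
Proof.
move=> sf; apply/funext => z; apply: is_derive_val; apply: is_derive_cylindrical => j x.
exact: smooth_derivable.
Qed.

Lemma smooth_cylindrical (f : V -> R) : smooth f -> smooth (fun z : V1 => f (col' ord0 z)).
Proof.
move=> sf; apply: (@smooth_coind _ _ (fun g => exists2 h : V -> R, smooth h & g = fun z => h (col' ord0 z))); last by exists f.
move=> _ [{sf}f sf ->]; split.
  move=> z; apply: (@continuous_comp _ _ _ (fun z : V1 => col' ord0 z : V) f); first exact: (@continuous_col' R n.+1).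
  exact: (@smooth_continuous _ _ _ sf).
move=> i; split.
  by move=> z; apply: is_derive_ex (is_derive_cylindrical z i _) => j x; exact: smooth_derivable.
rewrite pderiv_cylindrical//; have [j _|_] := unliftP ord0 i.
  by exists (pderiv j f) => //; exact: smooth_pderiv.
by exists (fun=> 0) => //; exact: smooth_cst.
Qed.

End cylindrical.

(** * Uniform bounds on the coefficients *)

Section bounded_functions.
Context {R : realType} {n : nat}.
Local Notation V := 'rV[R]_n.

Definition C1_bounded (f : V -> R) := smooth f /\
  exists M : R, forall x, `|f x| <= M /\ forall i, `|pderiv i f x| <= M.

Lemma C1_bounded_cst c : C1_bounded (fun=> c).
Proof.
split; first exact: smooth_cst.
by exists `|c| => x; split => // i; rewrite pderiv_cst normr0.
Qed.

Lemma C1_boundedD f g : C1_bounded f -> C1_bounded g -> C1_bounded (fun x => f x + g x).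
Proof.
move=> [sf [M HM]] [sg [N HN]]; split; first exact: smoothD.
exists (M + N) => x; have [f1 f2] := HM x; have [g1 g2] := HN x; split.
  by apply: le_trans (ler_normD _ _) _; exact: lerD.
move=> i; rewrite pderivD; [|exact: smooth_derivable|exact: smooth_derivable].
by apply: le_trans (ler_normD _ _) _; exact: lerD.
Qed.

Lemma C1_boundedM f g : C1_bounded f -> C1_bounded g -> C1_bounded (fun x => f x * g x).
Proof.
move=> [sf [M HM]] [sg [N HN]]; split; first exact: smoothM.
exists (M * N + N * M) => x; have [f1 f2] := HM x; have [g1 g2] := HN x.
have M0 : 0 <= M by exact: le_trans f1.
have N0 : 0 <= N by exact: le_trans g1.
split.
  rewrite normrM; apply: (@le_trans _ _ (M * N)); first exact: ler_pM.
  by rewrite lerDl mulr_ge0.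
move=> i; rewrite pderivM; [|exact: smooth_derivable|exact: smooth_derivable].
by apply: le_trans (ler_normD _ _) _; rewrite !normrM; apply: lerD; apply: ler_pM.
Qed.

Lemma C1_bounded_sum (I : Type) (r : seq I) (P : pred I) (F : I -> V -> R) :
  (forall i, C1_bounded (F i)) -> C1_bounded (fun x => \sum_(i <- r | P i) F i x).
Proof.
move=> HF; elim: r => [|a r IH].
  rewrite (_ : (fun x => _) = fun=> 0); first exact: C1_bounded_cst.
  by apply/funext => x; rewrite big_nil.
have [Pa|Pa] := boolP (P a).
  rewrite (_ : (fun x => _) = fun x => F a x + \sum_(i <- r | P i) F i x); first exact: C1_boundedD.
  by apply/funext => x; rewrite big_cons Pa.
rewrite (_ : (fun x => _) = fun x => \sum_(i <- r | P i) F i x) //.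
by apply/funext => x; rewrite big_cons (negPf Pa).
Qed.

Lemma C1_bounded_prod (I : Type) (r : seq I) (P : pred I) (F : I -> V -> R) :
  (forall i, C1_bounded (F i)) -> C1_bounded (fun x => \prod_(i <- r | P i) F i x).
Proof.
move=> HF; elim: r => [|a r IH].
  rewrite (_ : (fun x => _) = fun=> 1); first exact: C1_bounded_cst.
  by apply/funext => x; rewrite big_nil.
have [Pa|Pa] := boolP (P a).
  rewrite (_ : (fun x => _) = fun x => F a x * \prod_(i <- r | P i) F i x); first exact: C1_boundedM.
  by apply/funext => x; rewrite big_cons Pa.
rewrite (_ : (fun x => _) = fun x => \prod_(i <- r | P i) F i x) //.
by apply/funext => x; rewrite big_cons (negPf Pa).
Qed.

Lemma bounded_derivatives_C1 f : smooth f -> bounded_derivatives f -> C1_bounded f.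
Proof.
move=> sf bf; split => //; have [M0 H0] := bf [::].
have /choice[M H] : forall i : 'I_n, exists M : R, forall x, `|pderiv i f x| <= M.
  by move=> i; exact: bf [:: i].
exists (`|M0| + \sum_i `|M i|) => x; split.
  apply: le_trans (H0 x) _; apply: le_trans (ler_norm _) _.
  by rewrite lerDl sumr_ge0.
move=> i; apply: le_trans (H i x) _; apply: le_trans (ler_norm _) _.
by rewrite (bigD1 i)//= addrCA lerDl addr_ge0// sumr_ge0.
Qed.

Lemma uniform_bound (I : finType) (P : I -> R -> Prop) :
  (forall i M N, M <= N -> P i M -> P i N) -> (forall i, exists M, P i M) -> exists M, forall i, P i M.
Proof.
move=> mono /choice[M HM]; exists (\sum_i `|M i|) => i; apply: mono (HM i).
by rewrite (bigD1 i)//= (le_trans (ler_norm _))// lerDl sumr_ge0.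
Qed.

End bounded_functions.

Section coefficients.
Context {R : realType} {n : nat}.
Local Notation V := 'rV[R]_n.
Local Notation V1 := 'rV[R]_n.+1.
Variables (gm : V -> 'M[R]_n.+1) (Omega : set V).
Hypotheses (gm_sym : forall x, (gm x)^T = gm x)
  (gm_signature : forall x, lorentzian (gm x))
  (gm_smooth : forall j k, smooth (fun x => gm x j k))
  (gm_bounded : forall j k, bounded_derivatives (fun x => gm x j k))
  (gm_elliptic : exists2 C0 : R, 0 < C0 &
    (forall x, C0 <= gm x ord0 ord0) /\
    exists rho : R, forall x, closure Omega x -> rho <= `|x| ->
      forall xi : 'rV[R]_n,
      \sum_j \sum_k space_block gm x j k * xi ord0 j * xi ord0 k
        <= - C0 * \sum_j xi ord0 j ^+ 2).

Lemma coefficients_bounded : exists M : R, forall x j k,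
  `|gm x j k| <= M /\ forall i, `|pderiv i (fun x => gm x j k) x| <= M.
Proof.
have [|jk|M HM] := @uniform_bound R ('I_n.+1 * 'I_n.+1)%type (fun jk M => forall x, `|gm x jk.1 jk.2| <= M /\
   forall i, `|pderiv i (fun x => gm x jk.1 jk.2) x| <= M).
- move=> jk M N MN H x; have [h1 h2] := H x; split; first exact: le_trans MN.
  by move=> i; exact: le_trans MN.
- by have [_] := bounded_derivatives_C1 (gm_smooth jk.1 jk.2) (@gm_bounded jk.1 jk.2).
- by exists M => x j k; exact: (HM (j, k) x).
Qed.

Lemma det_sign x : 0 < (-1) ^+ n * \det (gm x).
Proof.
have [P uP E] := gm_signature x; move: uP; rewrite unitmxE unitfE => dP.
have := congr1 (fun X => \det X) E; rewrite !det_mulmx det_tr det_diag.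
rewrite big_ord_recl mxE eqxx mul1r (eq_bigr (fun=> -1)); last first.
  by move=> j _; rewrite mxE.
rewrite prodr_const card_ord => H.
have {}H : \det (gm x) * \det P ^+ 2 = (-1) ^+ n by rewrite -H; ring.
have p : 0 < \det P ^+ 2 by rewrite exprn_even_gt0.
by rewrite -(pmulr_lgt0 _ p) -mulrA H -exprD addnn -mul2n exprM sqrrN expr1n.
Qed.

Let box (r : R) : set V := closed_box (const_mx (- r)) (const_mx r).

Let far (rho : R) x : ~ box (`|rho| + 1) x -> rho <= `|x|.
Proof.
move=> /existsNP[i /negP]; rewrite !mxE -ler_norml -ltNge => h.
apply: le_trans (coord_le_norm x i); apply: le_trans (ler_norm _) _; apply: ltW.
by apply: le_lt_trans h; rewrite lerDl.
Qed.

Lemma det_gm_smooth : smooth (fun x => (-1) ^+ n * \det (gm x)).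
Proof.
apply: smoothM; first exact: smooth_cst.
rewrite /determinant; apply: smooth_sum => s; apply: smoothM; first exact: smooth_cst.
by apply: smooth_prod => i; exact: gm_smooth.
Qed.

Lemma det_gm_C1_bounded : C1_bounded (fun x => (-1) ^+ n * \det (gm x)).
Proof.
apply: C1_boundedM; first exact: C1_bounded_cst.
rewrite /determinant; apply: C1_bounded_sum => s; apply: C1_boundedM; first exact: C1_bounded_cst.
by apply: C1_bounded_prod => i; apply: bounded_derivatives_C1; [exact: gm_smooth|exact: gm_bounded].
Qed.

(* Far out, changing the sign of the space part of a vector turns the form into
   a definite one; this bounds the inverse matrix. *)
Let det_far (C0 : R) (A : 'M[R]_n.+1) : 0 < C0 -> A^T = A -> C0 <= A ord0 ord0 -> A \in unitmx ->
  (forall xi : 'rV[R]_n, \sum_j \sum_k row' ord0 (col' ord0 A) j k * xi ord0 j * xi ord0 k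
     <= - C0 * \sum_j xi ord0 j ^+ 2) ->
  C0 ^+ n.+1 <= (n.+1)`!%:R * `|\det A|.
Proof.
move=> C00 sA gC uA ell.
have inv_le j k : `|invmx A j k| <= C0^-1.
  pose u : V1 := row j (invmx A).
  have uE : u *m A = delta_mx ord0 j by rewrite /u -row_mul mulVmx// row1.
  have ujk : invmx A j k = u ord0 k by rewrite mxE.
  move: u uE ujk => u uE ujk; pose uu : V1 := \row_l (if l == ord0 then u ord0 l else - u ord0 l).
  have b1 : bil A u uu = uu ord0 j.
    rewrite bilE uE mxE (bigD1 j)//= !mxE !eqxx mul1r big1 ?addr0// => l lj.
    by rewrite !mxE (negPf lj) andbF mul0r.
  have b2 : C0 * \sum_l u ord0 l ^+ 2 <= bil A u uu.
    pose s := \sum_(j < n) \sum_(k < n) A (lift ord0 j) (lift ord0 k) * u ord0 (lift ord0 j) * u ord0 (lift ord0 k).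
    have sP : s <= - C0 * \sum_(j < n) u ord0 (lift ord0 j) ^+ 2.
      have := ell (\row_j u ord0 (lift ord0 j)); rewrite /s.
      under eq_bigr do under eq_bigr do rewrite !mxE.
      by under [X in _ <= _ * X]eq_bigr do rewrite mxE.
    have -> : bil A u uu = A ord0 ord0 * u ord0 ord0 ^+ 2 - s.
      have l0 (l : 'I_n) : lift ord0 l == ord0 = false by rewrite eq_sym (negPf (neq_lift _ _)).
      rewrite /bil big_ord_recl big_ord_recl.
      under [X in _ + X + _]eq_bigr do rewrite mxE l0.
      under [X in _ + X]eq_bigr do rewrite big_ord_recl.
      rewrite big_split/= [uu ord0 ord0]mxE eqxx expr2 mulrA -!addrA; congr (_ + _).
      rewrite addrA [X in X + _](_ : _ = 0) ?add0r.
        rewrite /s -sumrN; apply: eq_bigr => i _; rewrite -sumrN; apply: eq_bigr => l _.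
        by rewrite mxE l0 mulrN.
      rewrite -big_split/= big1// => i _.
      have -> : A ord0 (lift ord0 i) = A (lift ord0 i) ord0 by rewrite -[in LHS]sA mxE.
      by ring.
    rewrite big_ord_recl mulrDr; apply: lerD; first by rewrite ler_wpM2r// sqr_ge0.
    by rewrite lerNr -mulNr.
  have b3 : C0 * \sum_l u ord0 l ^+ 2 <= `|u ord0 j|.
    apply: le_trans b2 _; rewrite b1 mxE; case: ifP => _; rewrite ?ler_norm//.
    by rewrite -normrN ler_norm.
  have uk l : u ord0 l ^+ 2 <= \sum_l u ord0 l ^+ 2.
    by rewrite (bigD1 l)//= lerDl sumr_ge0// => i _; rewrite sqr_ge0.
  rewrite ujk.
  move: (\sum_l u ord0 l ^+ 2) b3 (uk j) (uk k) => P b3 h1 h2.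
  have j1 : `|u ord0 j| <= C0^-1.
    have : C0 * `|u ord0 j| ^+ 2 <= `|u ord0 j|.
      by apply: le_trans b3; rewrite real_normK ?num_real// ler_pM2l.
    move: (normr_ge0 (u ord0 j)); move: `|u ord0 j| => p p0 h; rewrite leNgt; apply/negP => hp.
    have : 1 < C0 * p by rewrite mulrC -ltr_pdivrMr// div1r.
    have pp : 0 < p by apply: lt_trans hp; rewrite invr_gt0.
    move=> h3; have : p < C0 * p ^+ 2 by rewrite expr2 mulrA ltr_pMl.
    by move=> /lt_le_trans/(_ h); rewrite ltxx.
  have PC : P <= C0^-1 ^+ 2.
    by rewrite expr2 -ler_pdivrMl ?invr_gt0// invrK (le_trans b3).
  rewrite -ler_sqr ?nnegrE// ?invr_ge0 ?(ltW C00)// real_normK ?num_real//.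
  exact: le_trans PC.
have H : `|\det (invmx A)| <= (n.+1)`!%:R * C0^-1 ^+ n.+1.
  rewrite /determinant; apply: le_trans (ler_norm_sum _ _ _) _.
  have -> : (n.+1)`!%:R * C0^-1 ^+ n.+1 = \sum_(s : 'S_n.+1) C0^-1 ^+ n.+1.
    by rewrite sumr_const card_Sn mulr_natl.
  apply: ler_sum => s _; rewrite normrM normrX normrN normr1 expr1n mul1r normr_prod.
  have -> : C0^-1 ^+ n.+1 = \prod_(i < n.+1) C0^-1 by rewrite prodr_const card_ord.
  by apply: ler_prod => i _; rewrite normr_ge0/=.
move: H; rewrite det_inv normfV => H.
have dA : 0 < `|\det A| by rewrite normr_gt0 -unitfE -unitmxE.
move: H; rewrite exprVn ler_pdivlMr ?exprn_gt0// => H.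
by move: H; rewrite mulrC ler_pdivrMr.
Qed.

(** Continuity and a definite sign give a positive minimum on a large box, and [det_far] takes over
    outside it. The bound keeps the logarithmic derivative of the density, hence the drift,
    bounded. *)
Lemma det_lower : exists2 d : R, 0 < d & forall x, closure Omega x -> d <= (-1) ^+ n * \det (gm x).
Proof.
have [C0 C00 [gC [rho ell]]] := gm_elliptic.
pose a x := (-1) ^+ n * \det (gm x).
have [|||x0 _ Hmin] := @EVT_min_rV R n a (box (`|rho| + 1)).
- by exists 0 => i; rewrite !mxE -ler_norml normr0 addr_ge0.
- exact: compact_closed_box.
- by apply: continuous_subspaceT; exact: (@smooth_continuous _ _ _ det_gm_smooth).
pose d1 := C0 ^+ n.+1 / (n.+1)`!%:R.
have f0 : 0 < (n.+1)`!%:R :> R by rewrite ltr0n fact_gt0.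
exists (Num.min (a x0) d1).
  by rewrite lt_min det_sign divr_gt0// exprn_gt0.
move=> x Ox; have [bx|nb] := pselect (box (`|rho| + 1) x).
  by rewrite ge_min Hmin// inE.
rewrite ge_min; apply/orP; right.
have uA : gm x \in unitmx.
  rewrite unitmxE unitfE; have := det_sign x; apply: contraTneq => ->; rewrite mulr0 ltxx//.
have := det_far C00 (gm_sym x) (gC x) uA (ell x Ox (far nb)).
rewrite /d1 ler_pdivrMr// [_ * _`!%:R]mulrC => /le_trans; apply.
rewrite ler_wpM2l ?(ltW f0)//.
have -> : `|\det (gm x)| = `|a x| by rewrite /a normrM normrX normrN normr1 expr1n mul1r.
by rewrite ger0_norm// ltW// det_sign.
Qed.

Lemma densityE x : density gm x = Num.sqrt ((-1) ^+ n * \det (gm x))^-1.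
Proof. by rewrite /density invfM -exprVn invrN invr1. Qed.

Lemma density_gt0 x : 0 < density gm x.
Proof. by rewrite densityE sqrtr_gt0 invr_gt0 det_sign. Qed.

Lemma smooth_density : smooth (density gm).
Proof.
rewrite (_ : density gm = fun x => Num.sqrt ((-1) ^+ n * \det (gm x))^-1); last first.
  by apply/funext => x; rewrite densityE.
apply: smooth_sqrt => [|x]; last by rewrite invr_gt0 det_sign.
by apply: smoothV => [|x]; [exact: det_gm_smooth|rewrite gt_eqF// det_sign].
Qed.

(** Differentiate [r^2 a = 1], where [r] is the density and [a] the signed determinant:
    [r'/r = - a' / (2 a)], and [a] is bounded below by [d]. *)
Lemma log_density_bounded : exists M : R, forall x i, closure Omega x ->
  `|(density gm x)^-1 * pderiv i (density gm) x| <= M.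
Proof.
have [d d0 Hd] := det_lower; have [_ [M HM]] := det_gm_C1_bounded.
pose a x := (-1) ^+ n * \det (gm x).
exists (M / (2 * d)) => x i Ox; have sd := smooth_density; have sa := det_gm_smooth.
have := HM x; rewrite -/(a x) => -[_ /(_ i)]; have := Hd x Ox; rewrite -/(a x) => da.
have a0 : 0 < a x by exact: det_sign.
have r0 := density_gt0 x.
have E1 y : (density gm y * density gm y) * a y = 1.
  by rewrite -expr2 densityE sqr_sqrtr ?mulVf ?gt_eqF ?invr_ge0 ?ltW ?det_sign.
have sdd : smooth (fun x => density gm x * density gm x) by exact: smoothM.
have E2 : pderiv i (fun y => (density gm y * density gm y) * a y) x = 0.
  have -> : (fun y => (density gm y * density gm y) * a y) = fun=> 1.
    by apply/funext => y; exact: E1.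
  by rewrite pderiv_cst.
move: E2; rewrite pderivM; [|exact: smooth_derivable|exact: smooth_derivable].
rewrite pderivM; [|exact: smooth_derivable|exact: smooth_derivable].
move: (E1 x); rewrite -/a; move: (pderiv i a x) (pderiv i (density gm) x) (a x) (density gm x) a0 r0 da.
move=> da dr a1 r a0 r0 dale e1 e2 dM.
have -> : r^-1 * dr = - da / (2 * a1).
  have -> : da = - (2 * a1 * dr / r).
    have : r * r * da = - (a1 * (r * dr + r * dr)) by lra.
    move=> e3; apply: (@mulfI _ (r * r)); first by rewrite mulf_neq0 ?gt_eqF.
    by rewrite e3; field; rewrite gt_eqF.
  by field; rewrite !gt_eqF.
rewrite normrM normrN normfV (ger0_norm (_ : 0 <= 2 * a1)); last by rewrite mulr_ge0// ltW.
apply: ler_pM => //; first by rewrite invr_ge0 mulr_ge0// ltW.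
by rewrite lef_pV2 ?posrE ?mulr_gt0// ler_pM2l.
Qed.

(* The first-order coefficients of [L]. *)
Definition drift (l : 'I_n.+1) (z : V1) : R :=
  \sum_i (density gm (col' ord0 z))^-1 *
    pderiv i (fun z => density gm (col' ord0 z) * gm (col' ord0 z) i l) z.

Lemma drift_bounded : exists M : R, forall l z, closure Omega (col' ord0 z) -> `|drift l z| <= M.
Proof.
have [M HM] := coefficients_bounded; have [N HN] := log_density_bounded.
exists (\sum_(i < n.+1) (`|N| * `|M| + `|M|)) => l z Oz.
rewrite /drift; apply: le_trans (ler_norm_sum _ _ _) _; apply: ler_sum => i _.
have sg : smooth (fun x => density gm x * gm x i l).
  exact: (smoothM smooth_density (gm_smooth i l)).
rewrite (pderiv_cylindrical i sg); have [j ij|_] := unliftP ord0 i; last first.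
  by rewrite mulr0 normr0 addr_ge0// mulr_ge0.
rewrite (pderivM (@smooth_derivable _ _ _ j _ smooth_density) (@smooth_derivable _ _ _ j _ (gm_smooth i l))).
have r0 := density_gt0 (col' ord0 z).
have [h1 h2] := HM (col' ord0 z) i l; have h3 := HN (col' ord0 z) j Oz.
rewrite mulrDr mulrA mulVf ?gt_eqF// mul1r; apply: le_trans (ler_normD _ _) _.
rewrite addrC; apply: lerD; last exact: le_trans (h2 j) (ler_norm _).
rewrite mulrCA mulrC normrM; apply: ler_pM => //; first exact: le_trans h3 (ler_norm _).
exact: le_trans h1 (ler_norm _).
Qed.

(** [stress] is homogeneous of degree 2 in [v]: over a large box times the unit sphere its minimum
    is attained, hence positive by [stress0_gt0], and outside the box [stress0_elliptic] applies. *)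
Lemma stress0_coercive : exists2 c0 : R, 0 < c0 & forall x, closure Omega x ->
  forall v : 'I_n.+1 -> R, c0 * \sum_l v l ^+ 2 <= stress (gm x) v ord0.
Proof.
have [C0 C00 [gC [rho ell]]] := gm_elliptic.
pose sph : set V1 := [set xi | \sum_l xi ord0 l ^+ 2 = 1].
have csum : continuous (fun xi : V1 => \sum_l xi ord0 l ^+ 2).
  apply: continuous_sumx => l; rewrite (_ : (fun xi => _) = fun xi : V1 => xi ord0 l * xi ord0 l).
    by apply: continuousMx; exact: continuous_coord.
  by apply/funext => xi; rewrite expr2.
have ksph : compact sph.
  apply: (@subclosed_compact _ _ (closed_box (const_mx (- 1)) (const_mx 1))).
  - apply: (@closed_comp _ _ (fun xi : V1 => \sum_l xi ord0 l ^+ 2) [set 1]); last exact: closed_eq.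
    by move=> xi _; exact: csum.
  - exact: compact_closed_box.
  - move=> xi sx l; rewrite !mxE -ler_norml -(expr_le1 (n := 2))// real_normK ?num_real//.
    by rewrite -sx (bigD1 l)//= lerDl sumr_ge0// => k _; rewrite sqr_ge0.
pose K := box (`|rho| + 1) `*` sph.
pose J (p : V * V1) := stress (gm p.1) (p.2 ord0) ord0.
have cM (f g : V * V1 -> R) : continuous f -> continuous g -> continuous (fun p => f p * g p).
  by move=> cf cg p; exact: (cvgM (cf p) (cg p)).
have cS (r : seq 'I_n.+1) (F : 'I_n.+1 -> V * V1 -> R) : (forall i, continuous (F i)) -> continuous (fun p => \sum_(i <- r) F i p).
  move=> cF; elim: r => [|i r IH].
    rewrite (_ : (fun p => _) = fun=> 0); first exact: cst_continuous.
    by apply/funext => x; rewrite big_nil.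
  rewrite (_ : (fun p => _) = fun p => F i p + \sum_(i <- r) F i p).
    by move=> p; exact: (cvgD (cF i p) (IH p)).
  by apply/funext => x; rewrite big_cons.
have cg j k : continuous (fun p : V * V1 => gm p.1 j k).
  move=> p; apply: (@continuous_comp _ _ _ fst (fun x => gm x j k)); first exact: cvg_fst.
  exact: (@smooth_continuous _ _ _ (gm_smooth j k)).
have cv l : continuous (fun p : V * V1 => p.2 ord0 l).
  move=> p; apply: (@continuous_comp _ _ _ snd (fun x : V1 => x ord0 l)); first exact: cvg_snd.
  exact: continuous_coord.
have cJ : continuous J.
  have c1 : continuous (fun p : V * V1 => (\sum_l gm p.1 ord0 l * p.2 ord0 l) * (\sum_k gm p.1 k ord0 * p.2 ord0 k)).
    by apply: (cM); apply: (cS) => l; exact: (cM _ _ (cg _ _) (cv _)).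
  have c2 : continuous (fun p : V * V1 => 2^-1 * (gm p.1 ord0 ord0 * \sum_l \sum_m gm p.1 l m * (p.2 ord0 l * p.2 ord0 m))).
    apply: (cM); first exact: cst_continuous.
    apply: (cM); first exact: cg.
    by apply: (cS) => l; apply: (cS) => m; exact: (cM _ _ (cg _ _) (cM _ _ (cv _) (cv _))).
  by move=> p; exact: (cvgB (c1 p) (c2 p)).
have [|||[x0 xi0] K0 Hmin] := @compact_EVT_min _ R J K.
- exists (0, delta_mx ord0 ord0); split => /=.
    by move=> i; rewrite !mxE -ler_norml normr0 addr_ge0.
  rewrite /sph/= (bigD1 ord0)//= mxE !eqxx expr1n big1 ?addr0// => l l0.
  by rewrite mxE (negPf l0) andbF expr0n.
- by apply: compact_setX; [exact: compact_closed_box|exact: ksph].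
- exact: continuous_subspaceT.
have c1 : 0 < J (x0, xi0).
  apply: stress0_gt0 => //; first exact: lt_le_trans C00 (gC _).
  move: K0; rewrite inE => -[_ /= s1]; apply: contra_eq_neq s1 => ->.
  by rewrite big1 => [|l _]; rewrite ?mxE ?expr0n// eq_sym oner_eq0.
exists (Num.min (J (x0, xi0)) (C0 ^+ 2 / 4)).
  by rewrite lt_min c1 divr_gt0// exprn_gt0.
move=> x Ox v; pose P := \sum_l v l ^+ 2.
have P0 : 0 <= P by apply: sumr_ge0 => l _; rewrite sqr_ge0.
have [bx|nb] := pselect (box (`|rho| + 1) x); last first.
  apply: le_trans (stress0_elliptic v C00 (gm_sym x) (gC x) (ell x Ox (far nb))).
  by rewrite ler_wpM2r// ge_min lexx orbT.
have [PE|Pn] := eqVneq P 0.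
  have v0 l : v l = 0.
    have /psumr_eq0P H : forall i : 'I_n.+1, true -> 0 <= v i ^+ 2 by move=> i _; rewrite sqr_ge0.
    by have /eqP := H PE l isT; rewrite sqrf_eq0 => /eqP.
  rewrite -/P PE mulr0 (_ : v = fun l => 0 * v l); last by apply/funext => l; rewrite v0 mul0r.
  by rewrite stressZ expr0n mul0r.
have Pp : 0 < P by rewrite lt_neqAle eq_sym Pn.
pose r := Num.sqrt P; have r0 : 0 < r by rewrite sqrtr_gt0.
have r2 : r ^+ 2 = P by rewrite sqr_sqrtr.
pose xi : V1 := \row_l (r^-1 * v l).
have sxi : sph xi.
  rewrite /sph/=; under eq_bigr do rewrite mxE exprMn.
  by rewrite -mulr_sumr -/P exprVn r2 mulVf.
have := Hmin (x, xi); rewrite inE => /(_ (conj bx sxi)).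
have -> : J (x, xi) = r^-1 ^+ 2 * stress (gm x) v ord0.
  by rewrite /J/= -stressZ; congr stress; apply/funext => l; rewrite mxE.
rewrite exprVn r2 => H; apply: (@le_trans _ _ (J (x0, xi0) * P)).
  by rewrite ler_wpM2r// ge_min lexx.
by rewrite mulrC -ler_pdivlMl.
Qed.

End coefficients.

(** * The energy inequality for smooth fields *)

Section stress_derivative.
Context {R : realType} {n : nat}.
Local Notation V1 := 'rV[R]_n.+1.

Lemma is_derive_sumx (I : Type) (r : seq I) (P : pred I) (F : I -> V1 -> R) (dF : I -> R) x u :
  (forall i, is_derive x u (F i) (dF i)) ->
  is_derive x u (fun y => \sum_(i <- r | P i) F i y) (\sum_(i <- r | P i) dF i).
Proof.
move=> HF; elim: r => [|a r IH].
  rewrite big_nil (_ : (fun y => _) = fun=> 0); first exact: is_derive_cst.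
  by apply/funext => y; rewrite big_nil.
rewrite big_cons (_ : (fun y => _) = if P a then (fun y => F a y + \sum_(i <- r | P i) F i y)
  else (fun y => \sum_(i <- r | P i) F i y)); last first.
  by apply/funext => y; rewrite big_cons; case: (P a).
by case: (P a) => //; exact: is_deriveDx.
Qed.

Lemma is_derive_stress (G : 'I_n.+1 -> 'I_n.+1 -> V1 -> R) (v : 'I_n.+1 -> V1 -> R) x i :
  (forall j k, smooth (G j k)) -> (forall l, smooth (v l)) ->
  is_derive x (delta_mx ord0 i : V1) (fun y => stress (fun j k => G j k y) (v ^~ y) i)
    (dstress (fun j k => G j k x) (fun i j k => pderiv i (G j k) x) (v ^~ x)
       (fun i l => pderiv i (v l) x) i).
Proof.
move=> sG sv.
have dG j k : is_derive x (delta_mx ord0 i : V1) (G j k) (pderiv i (G j k) x).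
  by apply: derivableP; exact: smooth_derivable.
have dv l : is_derive x (delta_mx ord0 i : V1) (v l) (pderiv i (v l) x).
  by apply: derivableP; exact: smooth_derivable.
apply: is_deriveB.
  by apply: is_deriveMx; apply: is_derive_sumx => l; exact: is_deriveMx.
apply: (@is_deriveZ _ _ _ (fun y => G i ord0 y * \sum_l \sum_m G l m y * (v l y * v m y)) 2^-1).
apply: is_deriveMx => //; apply: is_derive_sumx => l; apply: is_derive_sumx => m.
by apply: is_deriveMx => //; exact: is_deriveMx.
Qed.

Definition weight (lam : R) (z : V1) : R := expR (- lam * z ord0 ord0).

Lemma smooth_weight lam : smooth (weight lam).
Proof.
pose gs (k : nat) (t : R) : R := (- lam) ^+ k * expR (- lam * t).
have H k (t : R) : is_derive t 1 (gs k) (gs k.+1 t).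
  have H1 : is_derive t 1 (fun t : R => - lam * t) (- lam).
    have := @is_deriveZ _ _ _ id (- lam) t 1 _ (is_derive_id t 1).
    by rewrite [_ *: 1]mulr1.
  have H2 := @is_derive1_comp _ expR (fun t : R => - lam * t) _ _ _ (is_derive_expR _) H1.
  have := @is_deriveZ _ _ _ _ ((- lam) ^+ k) _ _ _ H2.
  by congr is_derive; rewrite /gs exprS [_ *: _]mulrC; ring.
have := @smooth_comp R n.+1 gs (fun z => z ord0 ord0) H (@smooth_coord R n.+1 ord0).
by congr smooth; apply/funext => z; rewrite /weight /gs/= expr0 mul1r.
Qed.

Lemma is_derive_weight lam z i : is_derive z (delta_mx ord0 i : V1) (weight lam)
  (if i == ord0 then - lam * weight lam z else 0).
Proof.
have Hc := @is_derive_coord R n.+1 ord0 z (delta_mx ord0 i).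
have Hl : is_derive z (delta_mx ord0 i : V1) (fun z : V1 => - lam * z ord0 ord0) (- lam * (delta_mx ord0 i : V1) ord0 ord0).
  exact: is_deriveZ.
have := is_derive_compl Hl (is_derive_expR _).
congr is_derive; rewrite mxE eqxx /= eq_sym; case: eqP => _; rewrite ?mulr1 ?mulr0//.
by rewrite mulrC.
Qed.

End stress_derivative.

Section surface_time.
Context {R : realType} {n : nat}.
Local Notation V := 'rV[R]_n.
Local Notation V1 := 'rV[R]_n.+1.
Variables (S : set V) (sigma : {measure set V -> \bar R}).
Hypotheses (mS : measurable S) (sS : (sigma S < +oo)%E).

(** Tonelli is applied to the restriction of [sigma] to [S], whose total mass is finite; [sigma]
    itself is an arbitrary measure. *)
Lemma measurable_surface (P : measurableTypeR R * V -> \bar R) :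
  measurable_fun [set: measurableTypeR R * V] P -> (forall p, (0 <= P p)%E) ->
  measurable_fun [set: measurableTypeR R]
    (fun s : measurableTypeR R => (\int[sigma]_(x in S) P (s, x))%E).
Proof.
move=> mP P0.
pose P' p := (P \_ (setT `*` S)) p.
have mP' : measurable_fun [set: measurableTypeR R * V] P'.
  apply: (proj1 (measurable_restrictT _ _)); first exact: measurableX.
  exact: measurable_funTS.
have P'0 p : (0 <= P' p)%E by rewrite /P' erestrict_ge0.
pose sg : {finite_measure set V -> \bar R} := mfrestr mS sS.
have H := @measurable_fun_fubini_tonelli_F _ _ _ _ R sg P' mP'.
apply: (eq_measurable_fun _ _ (H P'0)) => s _; rewrite /fubini_F.
have mPs : measurable_fun [set: V] (fun x => P' (s, x)) by exact: measurable_fun_pair2.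
have inS x : ((s, x) \in [set: measurableTypeR R] `*` S) = (x \in S).
  by apply/idP/idP => /set_mem H'; apply/mem_set; [case: H'|split].
apply: esym; transitivity (\int[sigma]_(x in S) P' (s, x))%E.
  by apply: eq_integral => x Sx; rewrite /P' patchE inS Sx.
rewrite (@ge0_integral_density _ _ _ _ R sigma sg S S id (fun=> 1))//.
- rewrite [LHS]integral_mkcond; apply: eq_integral => x _; rewrite patchE ?mule1.
  by case: ifPn => // NS; rewrite /P' patchE inS (negPf NS).
- move=> A mA AS; rewrite integral_cst// mul1e /sg/= /mfrestr /mrestr preimage_id.
  by rewrite setIidl.
Qed.

Lemma measurable_surface_integral (F : V1 -> R) (h : V -> R) :
  measurable_fun [set: V1] F -> measurable_fun S h ->
  measurable_fun [set: measurableTypeR R]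
    (fun s : measurableTypeR R => (\int[sigma]_(x in S) (`|F (insert_rV ord0 (s : R) x) * h x|)%:E)%E).
Proof.
move=> mF mh; pose h' := h \_ S.
have mh' : measurable_fun [set: V] h' by exact: (proj1 (measurable_restrictT _ mS) mh).
pose P (p : measurableTypeR R * V) := (`|F (insert_rV ord0 (p.1 : R) p.2) * h' p.2|)%:E.
have mP : measurable_fun [set: measurableTypeR R * V] P.
  apply/measurable_EFinP; apply: measurableT_comp => //; apply: measurable_funM.
    exact: measurableT_comp mF (@measurable_insert_rV R n.+1 ord0).
  exact: measurableT_comp mh' measurable_snd.
have P0 p : (0 <= P p)%E by rewrite lee_fin.
apply: (eq_measurable_fun _ _ (measurable_surface mP P0)) => s _.
by apply: eq_integral => x Sx; rewrite /P/= /h' patchE Sx.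
Qed.

End surface_time.

Section energy.
Context {R : realType} {n : nat}.
Local Notation V := 'rV[R]_n.
Local Notation V1 := 'rV[R]_n.+1.
Local Notation I := 'I_n.+1.
Local Notation leb := (@lebesgue_measure R).
Local Notation mu := (lebesgue_rV R n).
Local Notation mu1 := (lebesgue_rV R n.+1).
Variables (gm : V -> 'M[R]_n.+1) (S Oi : set V) (nu : V -> V) (sigma : {measure set V -> \bar R}) (T : R).
Local Notation Omega := (~` closure Oi).
Hypotheses (gm_sym : forall x, (gm x)^T = gm x)
  (gm_signature : forall x, lorentzian (gm x))
  (gm_smooth : forall j k, smooth (fun x => gm x j k))
  (gm_bounded : forall j k, bounded_derivatives (fun x => gm x j k))
  (gm_elliptic : exists2 C0 : R, 0 < C0 &
    (forall x, C0 <= gm x ord0 ord0) /\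
    exists rho : R, forall x, closure Omega x -> rho <= `|x| ->
      forall xi : 'rV[R]_n,
      \sum_j \sum_k space_block gm x j k * xi ord0 j * xi ord0 k
        <= - C0 * \sum_j xi ord0 j ^+ 2)
  (Sdet : forall x, S x -> \det (space_block gm x) = 0)
  (cS : compact S) (oOi : open Oi) (OiS : Oi `&` S = set0)
  (clOi : closure Oi = Oi `|` S) (nuP : outer_unit_normal Oi S nu)
  (sigmaP : area_measure S sigma)
  (characteristic : forall x, S x ->
    \sum_j \sum_k space_block gm x j k * nu x ord0 j * nu x ord0 k = 0)
  (ingoing : forall x, S x ->
    \sum_(j < n) gm x (lift ord0 j) ord0 * nu x ord0 j < 0)
  (T0 : 0 < T).

Definition wave_field (v : I -> V1 -> R) z : R :=
  wave (gm (col' ord0 z)) (fun i l => pderiv i (v l) z) (v ^~ z) (fun l => drift gm l z).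

Definition null_form (w : I -> V1 -> R) z : R := w ord0 z ^+ 2 -
  \sum_j \sum_k space_block gm (col' ord0 z) j k * w (lift ord0 j) z * w (lift ord0 k) z.

Definition inflow x : R := \sum_(j < n) gm x (lift ord0 j) ord0 * nu x ord0 j.

(** The absolute value makes the integrand nonnegative everywhere, so that monotonicity and Tonelli
    apply without integrability conditions; on [S] it is the opposite of the signed density, by
    [surface_density]. *)
Definition surface_energy (w : I -> V1 -> R) (s : R) : \bar R :=
  (\int[sigma]_(x in S) (`|null_form w (insert_rV ord0 s x) * inflow x|)%:E)%E.

(** The space part of [w], completed by 0, is a covector without time component, and at points of
    [S] the form is at most 0 on these. *)
Lemma null_form_ge0 w z : S (col' ord0 z) -> 0 <= null_form w z.
Proof.
move=> Sx; rewrite subr_ge0; apply: le_trans (sqr_ge0 _).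
pose u : V1 := \row_i (if unlift ord0 i is Some j then w (lift ord0 j) z else 0).
have u0 : u ord0 ord0 = 0 by rewrite mxE unlift_none.
have ul j : u ord0 (lift ord0 j) = w (lift ord0 j) z by rewrite mxE liftK.
have := degenerate_space_block (gm_sym _) (gm_signature _) (Sdet Sx) u0.
rewrite /bil big_ord_recl big1 ?add0r; last by move=> l _; rewrite u0 mulr0 mul0r.
congr (_ <= _); apply: eq_bigr => j _; rewrite big_ord_recl u0 mulr0 add0r.
by apply: eq_bigr => l _; rewrite !ul !mxE.
Qed.

Lemma surface_density w z : S (col' ord0 z) ->
  `|null_form w z * inflow (col' ord0 z)| = - (null_form w z * inflow (col' ord0 z)).
Proof.
by move=> Sx; rewrite ler0_norm// mulr_ge0_le0 ?null_form_ge0// ltW// ingoing.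
Qed.

Lemma measurable_null_form w : (forall l, measurable_fun [set: V1] (w l)) ->
  measurable_fun [set: V1] (null_form w).
Proof.
move=> mw; apply: measurable_funB; first exact: measurable_funX.
apply: measurable_sum => j; apply: measurable_sum => k.
apply: measurable_funM; last exact: mw.
apply: measurable_funM; last exact: mw.
apply: continuous_measurable => //.
have -> : (fun z : V1 => space_block gm (col' ord0 z) j k) = (fun z => gm (col' ord0 z) (lift ord0 j) (lift ord0 k)).
  by apply/funext => z; rewrite /space_block !mxE.
exact: (@smooth_continuous _ _ _ (smooth_cylindrical (gm_smooth _ _))).
Qed.

Lemma measurable_inflow : measurable_fun S (inflow : V -> measurableTypeR R).
Proof.
have mS := measurable_compact cS.
apply: measurable_sum => j; apply: measurable_funM; last exact: (measurable_normal cS nuP sigmaP).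
apply: continuous_measurable => //; exact: (@smooth_continuous _ _ _ (gm_smooth _ _)).
Qed.

Lemma measurable_surface_energy w : (forall l, measurable_fun [set: V1] (w l)) ->
  measurable_fun [set: measurableTypeR R] (surface_energy w : measurableTypeR R -> \bar R).
Proof.
move=> mw; apply: measurable_surface_integral.
- exact: measurable_compact.
- exact: (surface_measure_fin cS nuP sigmaP).
- exact: measurable_null_form.
- exact: measurable_inflow.
Qed.

(** [stress_flux] puts the weight [gm x ord0 ord0] in front of the time square, while [null_form]
    puts 1. As both summands of the form are nonnegative, the smaller of [C0] and 1 compares the
    two; the factor [2^-1] is that of [stress_flux]. *)
Lemma stress_outflow : exists2 m : R, 0 < m & forall w z, S (col' ord0 z) ->
  m * `|null_form w z * inflow (col' ord0 z)| <=
  - \sum_j stress (gm (col' ord0 z)) (w ^~ z) (lift ord0 j) * nu (col' ord0 z) ord0 j.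
Proof.
have [C0 C00 [gC _]] := gm_elliptic.
exists (2^-1 * Num.min C0 1); first by rewrite mulr_gt0// lt_min C00/=.
move=> w z Sx; rewrite surface_density//; set x := col' ord0 z in Sx *.
rewrite stress_flux//; last first.
  by move=> k; apply: (null_normal k (gm_sym x) (gm_signature x) (Sdet Sx)); exact: characteristic.
have := null_form_ge0 w Sx; have := ingoing Sx; rewrite -/(inflow x) /null_form -/x.
have -> : \sum_j \sum_k space_block gm x j k * w (lift ord0 j) z * w (lift ord0 k) z =
  \sum_j \sum_k gm x (lift ord0 j) (lift ord0 k) * w (lift ord0 j) z * w (lift ord0 k) z.
  by apply: eq_bigr => j _; apply: eq_bigr => k _; rewrite /space_block !mxE.
have s0 : \sum_j \sum_k gm x (lift ord0 j) (lift ord0 k) * w (lift ord0 j) z * w (lift ord0 k) z <= 0.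
  (* Cancelling the time component isolates the sign of the space part in [null_form_ge0]. *)
  pose w' (i : I) (z : V1) : R := if i == ord0 then 0 else w i z.
  have := null_form_ge0 w' Sx; rewrite /null_form /w' eqxx expr0n/= sub0r oppr_ge0 -/x; congr (_ <= _).
  by apply: eq_bigr => j _; apply: eq_bigr => k _; rewrite /space_block !mxE.
move: (inflow x) (gC x) s0; move: (\sum_j _) (gm x ord0 ord0) (w ord0 z) => s g w0 b gC' s0 b0 _.
have m1 : Num.min C0 1 <= 1 by rewrite ge_min lexx orbT.
have mg : Num.min C0 1 <= g by rewrite ge_min gC'.
have m0 : 0 <= Num.min C0 1 by rewrite le_min (ltW C00)/=.
set m := Num.min C0 1 in m1 mg m0 *.
have -> : 2^-1 * m * - ((w0 ^+ 2 - s) * b) = (2^-1 * - b) * (m * (w0 ^+ 2 - s)) by ring.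
have -> : - (2^-1 * b * (g * w0 ^+ 2 - s)) = (2^-1 * - b) * (g * w0 ^+ 2 - s) by ring.
apply: ler_wpM2l; first by rewrite mulr_ge0// oppr_ge0 ltW.
rewrite mulrBr; apply: lerD; first by rewrite ler_wpM2r// sqr_ge0.
by rewrite lerN2 -[leLHS]mul1r ler_wnM2r.
Qed.

(* The factor [weight lam], with [lam] large, makes the terms quadratic in [v]
   in the divergence negative. *)
Let lam_bounds : exists (lam C1 C2 c0 : R), [/\ 0 <= lam, 0 <= C1, 0 <= C2, 0 < c0 &
  [/\ forall x, Omega x -> forall w : I -> R, c0 * \sum_l w l ^+ 2 <= stress (gm x) w ord0,
      forall x (w : I -> R) i, `|stress (gm x) w i| <= C2 * \sum_l w l ^+ 2 &
      forall v z, Omega (col' ord0 z) ->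
       \sum_i dstress (gm (col' ord0 z)) (fun i j k => pderiv i (fun z => gm (col' ord0 z) j k) z)
          (v ^~ z) (fun i l => pderiv i (v l) z) i
        - lam * stress (gm (col' ord0 z)) (v ^~ z) ord0 <=
       C1 * (wave_field v z ^+ 2 + \sum_i \sum_k (pderiv i (v k) z - pderiv k (v i) z) ^+ 2)]].
Proof.
have [M HM] := coefficients_bounded gm_smooth gm_bounded.
have [N HN] := drift_bounded gm_sym gm_signature gm_smooth gm_bounded gm_elliptic.
have [c0 c00 Hc] := stress0_coercive gm_sym gm_signature gm_smooth gm_elliptic.
pose K := `|M| + `|N|.
have [C1 C10 H1] := @dstress_bound R n K; have [C2 C20 H2] := @stress_bound R n K.
have MK : M <= K by rewrite /K (le_trans (ler_norm M))// lerDl.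
have NK : N <= K by rewrite /K (le_trans (ler_norm N))// lerDr.
(* With this weight, coercivity bounds [C1 |v|^2] by [lam] times the time component, which the
   derivative of the exponential subtracts. *)
exists (C1 / c0), C1, C2, c0; split => //; first by rewrite divr_ge0// ltW.
have clO x : Omega x -> closure Omega x by exact: subset_closure.
split.
- by move=> x Ox; exact: Hc (clO _ Ox).
- by move=> x w i; apply: H2 => j k; have [h _] := HM x j k; exact: le_trans MK.
move=> v z Oz; set x := col' ord0 z in Oz *.
have K0 : 0 <= K by rewrite addr_ge0.
have G1 j k : gm x j k = gm x k j by rewrite -[in LHS](gm_sym x) mxE.
have G2 j k : `|gm x j k| <= K by have [h _] := HM x j k; exact: le_trans MK.
have G3 i j k : `|pderiv i (fun z => gm (col' ord0 z) j k) z| <= K.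
  rewrite (pderiv_cylindrical i (gm_smooth j k)); case: (unlift ord0 i) => [l|]; last by rewrite normr0.
  by have [_ h] := HM x j k; exact: le_trans (h l) MK.
have G4 l : `|drift gm l z| <= K by apply: le_trans NK; apply: HN; exact: clO.
have := H1 _ _ (v ^~ z) (fun i l => pderiv i (v l) z) _ G1 G2 G3 G4.
have := Hc x (clO _ Oz) (v ^~ z); rewrite -/(wave_field v z).
set D := \sum_i dstress _ _ _ _ i; set st := stress _ _ _.
set q := wave_field v z ^+ 2 + _; set p := \sum_l _ => h1 h2.
have h3 : C1 * p <= C1 / c0 * st.
  by rewrite -mulrA ler_wpM2l// mulrC ler_pdivlMr// mulrC.
have h4 : D <= C1 * (q + p) by exact: le_trans (ler_norm _) h2.
by rewrite lerBlDr; apply: le_trans h4 _; rewrite mulrDr lerD2l.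
Qed.

(** Equal to 1 on the ball of radius [m + 1], with derivatives of order [1 / (m + 1)]. The fields
    are square integrable but not compactly supported, and this removes their flux through
    infinity. *)
Definition cutoff (m : nat) : V -> R := plateau 0 (m.+1%:R^-1).

Lemma cutoff_eventually1 (r : R) : exists N, forall m, (N <= m)%N -> forall x : V,
  (forall i, `|x ord0 i| <= r) -> cutoff m x = 1.
Proof.
(* [K] bounds the squared Euclidean norm of [x]. It suffices that [m + 1 >= K], since then
   [K / (m + 1)^2 <= 1]. *)
pose K : R := n%:R * `|r| ^+ 2.
exists (Num.truncn K).+1 => m Nm x xr; apply: plateau_eq1.
have d0 : 0 < m.+1%:R^-1 :> R by rewrite invr_gt0.
have Km : K <= m.+1%:R.
  apply: (@le_trans _ _ (Num.truncn K).+1%:R); last by rewrite ler_nat (leq_trans Nm).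
  by rewrite ltW// truncnS_gt// mulr_ge0// sqr_ge0.
apply: (@le_trans _ _ (\sum_(i < n) (m.+1%:R^-1 * `|r|) ^+ 2)).
  apply: ler_sum => i _; rewrite !mxE subr0 !exprMn ler_wpM2l ?sqr_ge0//.
  rewrite -real_normK ?num_real//.
  rewrite ler_sqr ?nnegrE//; apply: le_trans (xr i) (ler_norm _).
rewrite sumr_const card_ord.
have -> : (m.+1%:R^-1 * `|r|) ^+ 2 *+ n = m.+1%:R^-1 ^+ 2 * K by rewrite /K -mulr_natl; ring.
apply: (@le_trans _ _ (m.+1%:R^-1 ^+ 2 * m.+1%:R)); first by rewrite ler_wpM2l ?sqr_ge0.
by rewrite expr2 -mulrA mulVf ?pnatr_eq0// mulr1 invf_le1 ?ler1n.
Qed.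

Lemma cutoff_cvg (x : V) : cutoff m x @[m --> \oo] --> (1 : R).
Proof.
have [N HN] := cutoff_eventually1 `|x|.
apply: (@cvg_trans _ ((fun=> 1 : R) @ \oo)); last exact: cvg_cst.
apply: near_eq_cvg; near=> m; apply/esym/HN; last by move=> i; exact: coord_le_norm.
by near: m; exact: nbhs_infty_ge.
Unshelve. all: by end_near. Qed.

Lemma cutoff_support m x : ~ closed_box (const_mx (- (2 * m.+1%:R))) (const_mx (2 * m.+1%:R)) x -> cutoff m x = 0.
Proof.
move=> xN; apply: plateau_eq0; rewrite leNgt; apply/negP => H; apply: xN => i.
have := sqdist_coord i H; rewrite !mxE subr0 normrM (ger0_norm (_ : 0 <= m.+1%:R^-1)); last by rewrite invr_ge0.
by rewrite ler_pdivrMl ?ltr0n// mulrC -ler_norml.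
Qed.

Let mO : measurable Omega. Proof. exact: measurable_exterior. Qed.

Let p_ (v : I -> V1 -> R) z := \sum_l v l z ^+ 2.
Let q_ (v : I -> V1 -> R) z := wave_field v z ^+ 2 + \sum_i \sum_k (pderiv i (v k) z - pderiv k (v i) z) ^+ 2.

Let p_ge0 v z : 0 <= p_ v z.
Proof. by apply: sumr_ge0 => l _; exact: sqr_ge0. Qed.

Let q_ge0 v z : 0 <= q_ v z.
Proof.
rewrite addr_ge0 ?sqr_ge0//; apply: sumr_ge0 => i _; apply: sumr_ge0 => k _; exact: sqr_ge0.
Qed.

Section smooth_field.
Variables (v : I -> V1 -> R) (sv : forall l, smooth (v l)).

Let sgm j k : smooth (fun z : V1 => gm (col' ord0 z) j k).
Proof. exact: (smooth_cylindrical (gm_smooth j k)). Qed.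

Lemma smooth_stress_field i : smooth (fun z => stress (gm (col' ord0 z)) (v ^~ z) i).
Proof.
apply: smoothB.
  by apply: smoothM; apply: smooth_sum => l; apply: smoothM; [exact: sgm|exact: sv|exact: sgm|exact: sv].
apply: smoothM; first exact: smooth_cst.
apply: smoothM; first exact: sgm.
apply: smooth_sum => l; apply: smooth_sum => m; apply: smoothM; first exact: sgm.
by apply: smoothM; exact: sv.
Qed.

Lemma continuous_wave_field : continuous (wave_field v).
Proof.
have cpd i l : continuous (pderiv i (v l)) by exact: (@smooth_continuous _ _ _ (smooth_pderiv i (sv l))).
have sdr l : continuous (drift gm l).
  apply: continuous_sumx => i; apply: continuousMx.
    have sr : smooth (fun x => (density gm x)^-1).
      apply: smoothV; first exact: (smooth_density gm_signature gm_smooth).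
      by move=> x; rewrite gt_eqF// (density_gt0 gm_signature).
    exact: (@smooth_continuous _ _ _ (smooth_cylindrical sr)).
  apply: (@smooth_continuous _ _ _ (smooth_pderiv i _)).
  apply: smoothM; last exact: sgm.
  exact: (smooth_cylindrical (smooth_density gm_signature gm_smooth)).
apply: continuousDx.
  apply: continuous_sumx => i; apply: continuous_sumx => l; apply: continuousMx; last exact: cpd.
  exact: (@smooth_continuous _ _ _ (sgm _ _)).
apply: continuous_sumx => l; apply: continuousMx; first exact: sdr.
exact: (@smooth_continuous _ _ _ (sv l)).
Qed.

Let sqr_continuous (f : V1 -> R) : continuous f -> continuous (fun z => f z ^+ 2).
Proof.
move=> cf; rewrite (_ : (fun z => _) = fun z => f z * f z); first exact: continuousMx.
by apply/funext => z; rewrite expr2.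
Qed.

Let cp : continuous (p_ v).
Proof. by apply: continuous_sumx => l; apply: sqr_continuous; exact: (@smooth_continuous _ _ _ (sv l)). Qed.

Let cq : continuous (q_ v).
Proof.
have cpd i l : continuous (pderiv i (v l)) by exact: (@smooth_continuous _ _ _ (smooth_pderiv i (sv l))).
apply: continuousDx; first exact/sqr_continuous/continuous_wave_field.
apply: continuous_sumx => i; apply: continuous_sumx => k; apply: sqr_continuous.
exact: continuousBx.
Qed.

Let B lam m i z := cutoff m (col' ord0 z) * (weight lam z * stress (gm (col' ord0 z)) (v ^~ z) i).

Let scut m : smooth (fun z : V1 => cutoff m (col' ord0 z)).
Proof. exact: (smooth_cylindrical (smooth_plateau _ _)). Qed.

Let sB lam m i : smooth (B lam m i).
Proof.
by apply: smoothM; [exact: scut|apply: smoothM; [exact: smooth_weight|exact: smooth_stress_field]].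
Qed.

Let B0 lam m i z : ~ closed_box (const_mx (- (2 * m.+1%:R))) (const_mx (2 * m.+1%:R)) (col' ord0 z) ->
  B lam m i z = 0.
Proof. by move=> H; rewrite /B cutoff_support// mul0r. Qed.

Let div_B lam m z : \sum_i pderiv i (B lam m i) z =
  cutoff m (col' ord0 z) * (weight lam z *
   (\sum_i dstress (gm (col' ord0 z)) (fun i j k => pderiv i (fun z => gm (col' ord0 z) j k) z)
          (v ^~ z) (fun i l => pderiv i (v l) z) i - lam * stress (gm (col' ord0 z)) (v ^~ z) ord0))
  + weight lam z * \sum_i stress (gm (col' ord0 z)) (v ^~ z) i * pderiv i (fun z : V1 => cutoff m (col' ord0 z)) z.
Proof.
have dE i : pderiv i (B lam m i) z = cutoff m (col' ord0 z) * (weight lam z *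
   dstress (gm (col' ord0 z)) (fun i j k => pderiv i (fun z => gm (col' ord0 z) j k) z)
          (v ^~ z) (fun i l => pderiv i (v l) z) i
   + stress (gm (col' ord0 z)) (v ^~ z) i * (if i == ord0 then - lam * weight lam z else 0))
  + weight lam z * stress (gm (col' ord0 z)) (v ^~ z) i * pderiv i (fun z : V1 => cutoff m (col' ord0 z)) z.
  apply: is_derive_val; apply: is_deriveMx.
    by apply: derivableP; exact: (@smooth_derivable _ _ _ i z (scut m)).
  apply: is_deriveMx; first exact: is_derive_weight.
  exact: (@is_derive_stress R n (fun j k z => gm (col' ord0 z) j k)).
rewrite (eq_bigr _ (fun i _ => dE i)) big_split/= -mulr_sumr big_split/= -mulr_sumr.
have -> : \sum_i stress (gm (col' ord0 z)) (v ^~ z) i * (if i == ord0 then - lam * weight lam z else 0) =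
    stress (gm (col' ord0 z)) (v ^~ z) ord0 * (- lam * weight lam z).
  by rewrite (bigD1 ord0)//= big1 ?addr0// => i i0; rewrite (negPf i0) mulr0.
congr (_ + _); last by rewrite mulr_sumr; apply: eq_bigr => i _; rewrite mulrA.
by congr (_ * _); rewrite mulrBr; congr (_ + _); ring.
Qed.

Lemma cutoff_pderiv : exists2 Mp : R, 0 <= Mp & forall m (z : V1) i,
  `|pderiv i (fun z : V1 => cutoff m (col' ord0 z)) z| <= Mp * m.+1%:R^-1.
Proof.
have [|i|M HM] := @uniform_bound R 'I_n (fun i M => forall c d x, 0 < d -> `|pderiv i (plateau c d) x| <= M * d).
- move=> i M N MN H c d x d0; apply: le_trans (H c d x d0) _; by rewrite ler_wpM2r// ltW.
- by have [M _ HM] := @plateau_pderiv_bounded R n i; exists M.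
exists `|M| => // m z i; rewrite (pderiv_cylindrical i (smooth_plateau _ _)).
have d0 : 0 < m.+1%:R^-1 :> R by rewrite invr_gt0.
case: (unlift ord0 i) => [j|]; last by rewrite normr0 mulr_ge0// ltW.
apply: le_trans (HM j _ _ _ d0) _; by rewrite ler_wpM2r ?ler_norm// ltW.
Qed.

Lemma weight_bounds lam t : 0 <= lam -> 0 <= t <= T -> expR (- lam * T) <= expR (- lam * t) <= 1.
Proof.
move=> l0 /andP[t0 tT]; rewrite ler_expR mulNr mulNr lerN2 ler_wpM2l//=.
by rewrite expR_le1 oppr_le0 mulr_ge0.
Qed.

(** [slab_identity] for the product of cut-off, weight and [stress]: the final slice and the surface
    term are bounded below, the initial slice and the divergence above. The last integral, with the
    factor [1 / (m + 1)], pays for the derivatives of the cut-off. *)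
Lemma energy_step lam D1 D2 c0 Mp ms t m : 0 <= lam -> 0 <= D1 -> 0 <= D2 -> 0 < c0 -> 0 <= Mp -> 0 < ms ->
  (forall x, Omega x -> forall w : I -> R, c0 * \sum_l w l ^+ 2 <= stress (gm x) w ord0) ->
  (forall x (w : I -> R) i, `|stress (gm x) w i| <= D2 * \sum_l w l ^+ 2) ->
  (forall z, Omega (col' ord0 z) ->
       \sum_i dstress (gm (col' ord0 z)) (fun i j k => pderiv i (fun z => gm (col' ord0 z) j k) z)
          (v ^~ z) (fun i l => pderiv i (v l) z) i
        - lam * stress (gm (col' ord0 z)) (v ^~ z) ord0 <= D1 * q_ v z) ->
  (forall (z : V1) i, `|pderiv i (fun z : V1 => cutoff m (col' ord0 z)) z| <= Mp * m.+1%:R^-1) ->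
  (forall z, S (col' ord0 z) -> ms * `|null_form v z * inflow (col' ord0 z)| <=
    - \sum_j stress (gm (col' ord0 z)) (v ^~ z) (lift ord0 j) * nu (col' ord0 z) ord0 j) ->
  (forall x, S x -> cutoff m x = 1) -> 0 < t <= T ->
  ((expR (- lam * T) * c0)%:E * \int[mu]_(x in Omega) (cutoff m x * p_ v (insert_rV ord0 t x))%:E +
   (expR (- lam * T) * ms)%:E * \int[leb]_(s in `]0%R, t[) surface_energy v s <=
   D2%:E * \int[mu]_(x in Omega) (p_ v (insert_rV ord0 0 x))%:E +
   (D1%:E * \int[mu1]_(z in cylinder Omega T) (q_ v z)%:E +
   (n.+1%:R * (D2 * Mp) * m.+1%:R^-1)%:E * \int[mu1]_(z in cylinder Omega T) (p_ v z)%:E))%E.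
Proof.
move=> l0 C10 C20 c00 Mp0 ms0 H1 H2 H3 Hcut Hout cut1 /andP[t0 tT].
have mc s := measurable_cylinder s mO.
have mS := measurable_compact cS.
have cut0 x : 0 <= cutoff m x by exact: plateau_ge0.
have cutle x : cutoff m x <= 1 by exact: plateau_le1.
have kap0 : 0 <= expR (- lam * T) by exact: expR_ge0.
have B1 i : C1 (B lam m i) by exact/smooth_C1/sB.
have HI := @slab_identity R n S Oi nu sigma cS oOi OiS clOi nuP sigmaP (B lam m) _ _ t t0 B1 (@B0 lam m).
set A := LHS in HI; set Xt := (\int[mu]_(x in _) (slice _ t x)%:E)%E in HI.
set X0 := (\int[mu]_(x in _) (slice _ 0 x)%:E)%E in HI; set Fl := (\int[leb]_(s in _) _)%E in HI.
have isl s : mu.-integrable Omega (fun x => (slice (B lam m ord0) s x)%:E).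
  apply: (integrableS measurableT) => //.
  apply: (@continuous_box_integrable _ _ _ (const_mx (- (2 * m.+1%:R))) (const_mx (2 * m.+1%:R))).
    by apply: continuous_slice; exact: C1_continuous (B1 _).
  by move=> x xN; apply: B0; rewrite (@col'_insert_rV _ n.+1).
have BE i s x : B lam m i (insert_rV ord0 s x) = cutoff m x * (expR (- lam * s) * stress (gm x) (fun l => v l (insert_rV ord0 s x)) i).
  by rewrite /B /weight (@col'_insert_rV _ n.+1) insert_rV_same.
have H0 z x : Omega x -> 0 <= stress (gm x) (v ^~ z) ord0.
  by move=> Ox; apply: le_trans (H1 x Ox (v ^~ z)); exact: (mulr_ge0 (ltW c00) (p_ge0 v z)).
have mcont (f : V1 -> R) : continuous f -> forall s, measurable_fun [set: V] (fun x => f (insert_rV ord0 s x)).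
  by move=> cf s; apply: continuous_measurable => //; exact: continuous_slice.
have ccut : continuous (cutoff m) by exact: (@smooth_continuous _ _ _ (smooth_plateau _ _)).
have mcut : measurable_fun [set: V] (cutoff m) by exact: continuous_measurable.
have low1 : ((expR (- lam * T) * c0)%:E * \int[mu]_(x in Omega) (cutoff m x * p_ v (insert_rV ord0 t x))%:E <= Xt)%E.
  rewrite -ge0_integralZl//; last 3 first.
  - by apply/measurable_EFinP; apply: measurable_funTS; apply: measurable_funM => //; exact: mcont.
  - by move=> x _; rewrite lee_fin mulr_ge0.
  - by rewrite lee_fin mulr_ge0// ltW.
  apply: ge0_le_integral => //.
  - move=> x _; rewrite -EFinM lee_fin; apply: mulr_ge0; last exact: (mulr_ge0 (cut0 x) (p_ge0 v _)).
    by rewrite mulr_ge0// ltW.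
  - apply: measurable_funeM; apply/measurable_EFinP; apply: measurable_funTS; apply: measurable_funM => //; exact: mcont.
  - by apply: measurable_int (isl t).
  - move=> x Ox; rewrite -EFinM lee_fin /slice BE mulrCA; apply: ler_wpM2l => //.
    rewrite -mulrA; apply: ler_pM => //; first by rewrite mulr_ge0// ltW.
      have tT' : 0 <= t <= T by rewrite (ltW t0).
      by have /andP[] := weight_bounds l0 tT'.
    exact: H1.
have upp0 : (X0 <= D2%:E * \int[mu]_(x in Omega) (p_ v (insert_rV ord0 0 x))%:E)%E.
  have mp0 : measurable_fun Omega (fun x => (p_ v (insert_rV ord0 0 x))%:E).
    by apply/measurable_EFinP; apply: measurable_funTS; exact: mcont.
  rewrite -ge0_integralZl//; last by move=> x _; rewrite lee_fin.
  apply: ge0_le_integral => //.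
  - move=> x Ox; rewrite lee_fin /slice BE; apply: mulr_ge0 => //; apply: mulr_ge0; first exact: expR_ge0.
    exact: H0.
  - by apply: measurable_int (isl 0).
  - exact: measurable_funeM.
  - move=> x Ox; rewrite -EFinM lee_fin /slice BE mulr0 expR0 mul1r.
    apply: (@le_trans _ _ (1 * (D2 * p_ v (insert_rV ord0 0 x)))); last by rewrite mul1r.
    apply: ler_pM => //; last by apply: le_trans (ler_norm _) _; exact: H2.
    exact: H0.
have low2 : ((expR (- lam * T) * ms)%:E * \int[leb]_(s in `]0%R, t[) surface_energy v s <= Fl)%E.
  have mv l : measurable_fun [set: V1] (v l) by apply: continuous_measurable => //; exact: (@smooth_continuous _ _ _ (sv l)).
  have mse := measurable_surface_energy mv.
  have se0 s : (0 <= surface_energy v s)%E by apply: integral_ge0 => x _; rewrite lee_fin.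
  have cs0 : 0 <= expR (- lam * T) * ms by rewrite mulr_ge0// ltW.
  have pt s x : S x -> expR (- lam * T) * ms * `|null_form v (insert_rV ord0 s x) * inflow x| <=
      - \sum_j slice (B lam m (lift ord0 j)) s x * nu x ord0 j \/ ~ (0 <= s <= T).
    move=> Sx; have [sT|] := boolP (0 <= s <= T); last by move=> /negP; right.
    left; have -> : - \sum_j slice (B lam m (lift ord0 j)) s x * nu x ord0 j = expR (- lam * s) *
        - \sum_j stress (gm x) (fun l => v l (insert_rV ord0 s x)) (lift ord0 j) * nu x ord0 j.
      rewrite mulrN mulr_sumr; congr (- _); apply: eq_bigr => j _.
      by rewrite /slice BE cut1// mul1r mulrA.
    have := Hout (insert_rV ord0 s x); rewrite (@col'_insert_rV _ n.+1) => /(_ Sx) h.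
    have /andP[w1 _] := weight_bounds l0 sT.
    by rewrite -mulrA; apply: ler_pM => //; rewrite mulr_ge0// ltW.
  (* The normal is extended by 0 outside [S] and absolute values are taken, so that the flux becomes
     a nonnegative measurable function on the product of time and space; between 0 and [t] it
     coincides with the flux on [S]. *)
  pose P (p : measurableTypeR R * V) : \bar R := (`|\sum_j B lam m (lift ord0 j) (insert_rV ord0 (p.1 : R) p.2) * ((fun x => nu x ord0 j) \_ S) p.2|)%:E.
  have mP : measurable_fun [set: measurableTypeR R * V] P.
    apply/measurable_EFinP; apply: measurableT_comp => //; apply: measurable_sum => j; apply: measurable_funM.
      apply: (measurableT_comp _ (@measurable_insert_rV R n.+1 ord0)).
      by apply: continuous_measurable => //; exact: C1_continuous (B1 _).
    apply: measurableT_comp measurable_snd.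
    exact: (proj1 (measurable_restrictT _ mS) (measurable_normal cS nuP sigmaP j)).
  have P0 p : (0 <= P p)%E by rewrite lee_fin.
  have mQ := measurable_surface mS (surface_measure_fin cS nuP sigmaP) mP P0.
  have FlE : Fl = (\int[leb]_(s in `]0%R, t[) \int[sigma]_(x in S) P (s, x))%E.
    apply: eq_integral => s /set_mem/=; rewrite in_itv/= => /andP[s0 st].
    apply: eq_integral => x Sx; rewrite /P/=.
    have sT : 0 <= s <= T by rewrite (ltW s0)/= (le_trans (ltW st)).
    have -> : \sum_j B lam m (lift ord0 j) (insert_rV ord0 s x) * ((fun x => nu x ord0 j) \_ S) x =
      \sum_j slice (B lam m (lift ord0 j)) s x * nu x ord0 j.
      by apply: eq_bigr => j _; rewrite patchE Sx.
    case: (pt s x (set_mem Sx)) => // h; rewrite ler0_norm// -oppr_ge0.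
    by apply: le_trans h; rewrite mulr_ge0.
  rewrite FlE -ge0_integralZl//; last exact: measurable_funTS.
  apply: ge0_le_integral => //.
  - by move=> s _; rewrite mule_ge0// lee_fin.
  - by apply: measurable_funeM; exact: measurable_funTS.
  - exact: measurable_funTS.
  - move=> s /=; rewrite in_itv/= => /andP[s0 st].
    have sT : 0 <= s <= T by rewrite (ltW s0)/= (le_trans (ltW st)).
    have mi : measurable_fun S (fun x => (`|null_form v (insert_rV ord0 s x) * inflow x|)%:E).
      apply/measurable_EFinP; apply: measurableT_comp => //; apply: measurable_funM; last exact: measurable_inflow.
      apply: measurable_funTS; apply: measurableT_comp (measurable_null_form mv) _.
      exact: (measurable_fun_pair2 s (@measurable_insert_rV R n.+1 ord0)).
    rewrite -ge0_integralZl//.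
    apply: ge0_le_integral => //.
    + by move=> x _; rewrite -EFinM lee_fin mulr_ge0.
    + exact: measurable_funeM.
    + by apply: measurable_funTS; exact: measurable_fun_pair2.
    + move=> x Sx; rewrite -EFinM lee_fin /P/=.
      have -> : \sum_j B lam m (lift ord0 j) (insert_rV ord0 s x) * ((fun x => nu x ord0 j) \_ S) x =
        \sum_j slice (B lam m (lift ord0 j)) s x * nu x ord0 j.
        by apply: eq_bigr => j _; rewrite patchE mem_set.
      case: (pt s x Sx) => // h; apply: le_trans h _; rewrite -normrN; exact: ler_norm.
have mqE : measurable_fun (cylinder Omega T) (fun z => (q_ v z)%:E).
  by apply/measurable_EFinP; exact: continuous_measurable.
have mpE : measurable_fun (cylinder Omega T) (fun z => (p_ v z)%:E).
  by apply/measurable_EFinP; exact: continuous_measurable.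
pose C3 := n.+1%:R * (D2 * Mp) * m.+1%:R^-1.
have C30 : 0 <= C3 by rewrite !mulr_ge0// invr_ge0.
have uppA : (A <= D1%:E * \int[mu1]_(z in cylinder Omega T) (q_ v z)%:E +
   C3%:E * \int[mu1]_(z in cylinder Omega T) (p_ v z)%:E)%E.
  rewrite -!ge0_integralZl//; [|by move=> z _; rewrite lee_fin..].
  rewrite -ge0_integralD//; last 4 first.
  - by move=> z _; rewrite mule_ge0// lee_fin.
  - exact: measurable_funeM.
  - by move=> z _; rewrite mule_ge0// lee_fin.
  - exact: measurable_funeM.
  have mA : measurable_fun (cylinder Omega t) (fun z => (\sum_i pderiv i (B lam m i) z)%:E).
    apply/measurable_EFinP; apply: continuous_measurable => //; apply: continuous_sumx => i.
    by apply: C1_pderiv_continuous; exact: B1.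
  have sub : cylinder Omega t `<=` cylinder Omega T.
    by move=> z [Oz /andP[z0 zt]]; split => //; rewrite z0 (lt_le_trans zt).
  have g0 z : (0 <= D1%:E * (q_ v z)%:E + C3%:E * (p_ v z)%:E)%E.
    by rewrite adde_ge0// mule_ge0// lee_fin.
  have mg : measurable_fun (cylinder Omega T) (fun z => D1%:E * (q_ v z)%:E + C3%:E * (p_ v z)%:E)%E.
    by apply: emeasurable_funD; exact: measurable_funeM.
  apply: (@le_trans _ _ (\int[mu1]_(z in cylinder Omega t) (D1%:E * (q_ v z)%:E + C3%:E * (p_ v z)%:E))%E); last first.
    exact: ge0_subset_integral.
  (* For an upper bound the negative part of the divergence is discarded; the positive part lies
     below the nonnegative majorant. *)
  rewrite /A integralE.
  apply: (@le_trans _ _ (\int[mu1]_(z in cylinder Omega t) ((fun z => (\sum_i pderiv i (B lam m i) z)%:E)^\+ z))%E).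
    by apply: geeDl; rewrite oppe_le0; apply: integral_ge0.
  apply: ge0_le_integral => //.
  - exact: measurable_funepos.
  - exact: (measurable_funS (mc T) sub).
  move=> z [Oz /andP[z0 zt]]; rewrite funeposE ge_max g0 andbT -!EFinM -EFinD lee_fin.
  have zT : 0 <= z ord0 ord0 <= T by rewrite (ltW z0)/= (le_trans (ltW zt)).
  have w1 : weight lam z <= 1 by have /andP[] := weight_bounds l0 zT.
  have w0 : 0 <= weight lam z by exact: expR_ge0.
  rewrite div_B; apply: lerD.
    apply: (@le_trans _ _ (cutoff m (col' ord0 z) * (weight lam z * (D1 * q_ v z)))).
      by apply: ler_wpM2l => //; apply: ler_wpM2l => //; exact: H3.
    rewrite mulrA ler_piMl ?mulr_ge0// mulr_ile1//.
  apply: (@le_trans _ _ (1 * \sum_(i < n.+1) (D2 * p_ v z * (Mp * m.+1%:R^-1)))).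
    apply: le_trans (ler_norm _) _; rewrite normrM ger0_norm//; apply: ler_pM => //.
    apply: le_trans (ler_norm_sum _ _ _) _; apply: ler_sum => i _; rewrite normrM; apply: ler_pM => //.
  rewrite mul1r sumr_const card_ord -[_ *+ n.+1]mulr_natl /C3 le_eqVlt; apply/orP; left; apply/eqP; by ring.
(* The subtraction of [X0] can be undone because the cut-off makes it finite. *)
have E : (Xt + Fl = X0 + A)%E.
  by rewrite HI addeA [(X0 + _)%E]addeC subeK//; exact: integrable_fin_num.
apply: le_trans (leeD low1 low2) _; rewrite E; exact: leeD.
Qed.

End smooth_field.

Lemma sum_normL2sq (J : finType) (D : set V1) (F : J -> V1 -> R) : measurable D ->
  (forall j, measurable_fun D (F j)) ->
  (\int[mu1]_(z in D) (\sum_j F j z ^+ 2)%:E = \sum_j normL2sq D (F j))%E.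
Proof.
move=> mD mF; under eq_integral do rewrite -sumEFin.
rewrite ge0_integral_sum//; first by move=> j; apply/measurable_EFinP; exact: measurable_funX.
by move=> j z _; rewrite lee_fin sqr_ge0.
Qed.

(** [energy_step] as [m] tends to infinity: dominated convergence restores the full slice at time
    [t], and the cut-off error is [1 / (m + 1)] times a finite norm. The slice at time 0 occurs on
    the right only and may have infinite norm. *)
Lemma energy_smooth : exists2 C : R, 0 < C & forall (v : I -> V1 -> R) t, 0 < t <= T ->
  (forall l, smooth (v l)) -> (forall l, (normL2sq (cylinder Omega T) (v l) < +oo)%E) ->
  (forall l, (normL2sq Omega (slice (v l) t) < +oo)%E) ->
  (\sum_l normL2sq Omega (slice (v l) t) + \int[leb]_(s in `]0%R, t[) surface_energy v s <=
   C%:E * (\sum_l normL2sq Omega (slice (v l) 0) + (normL2sq (cylinder Omega T) (wave_field v) +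
     \sum_i \sum_k normL2sq (cylinder Omega T) (fun z => (pderiv i (v k) z - pderiv k (v i) z)%R))))%E.
Proof.
have [lam [D1 [D2 [c0 [l0 D10 D20 c00 [H1 H2 H3]]]]]] := lam_bounds.
have [Mp Mp0 Hcut] := cutoff_pderiv; have [ms ms0 Hout] := stress_outflow.
have [rS [_ HS]] := compact_bounded cS.
(* From some [m] on the cut-off is 1 on the compact [S], so that it does not affect the surface
   term. *)
have [N HN] := cutoff_eventually1 (`|rS| + 1).
have cutS m x : (N <= m)%N -> S x -> cutoff m x = 1.
  move=> Nm Sx; apply: (HN m Nm) => i; apply: le_trans (coord_le_norm x i) _.
  by apply: HS => //; apply: le_lt_trans (ler_norm rS) _; rewrite ltrDl.
pose kap := expR (- lam * T); have kap0 : 0 < kap by exact: expR_gt0.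
pose k := kap * Num.min c0 ms; have k0 : 0 < k by rewrite mulr_gt0// lt_min c00.
(* [D1] belongs to the divergence and [D2] to the initial slice; the summand 1 only makes [M]
   positive. *)
pose M := D1 + D2 + 1; have M0 : 0 < M by rewrite ltr_wpDl// addr_ge0.
exists (M / k); first by rewrite divr_gt0.
move=> v t /[dup] tT /andP[t0 _] sv vL vt.
have mc := measurable_cylinder T mO.
have cv l : continuous (v l) by exact: (@smooth_continuous _ _ _ (sv l)).
have mv l (D : set V1) : measurable D -> measurable_fun D (v l) by move=> mD; exact: continuous_measurable.
have mvs l s : measurable_fun Omega (slice (v l) s).
  by apply: continuous_measurable => //; exact: continuous_slice.
have PE s : (\int[mu]_(x in Omega) (p_ v (insert_rV ord0 s x))%:E = \sum_l normL2sq Omega (slice (v l) s))%E.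
  under eq_integral do rewrite -sumEFin.
  rewrite ge0_integral_sum//; first by move=> j; apply/measurable_EFinP; apply: measurable_funX; exact: mvs.
  by move=> j z _; rewrite lee_fin sqr_ge0.
have mcomm i l : measurable_fun (cylinder Omega T) (fun z => pderiv i (v l) z - pderiv l (v i) z).
  apply: continuous_measurable => //.
  by apply: continuousBx; exact: (@smooth_continuous _ _ _ (smooth_pderiv _ (sv _))).
have mwf : measurable_fun (cylinder Omega T) (wave_field v).
  by apply: continuous_measurable => //; exact: continuous_wave_field.
have QE : (\int[mu1]_(z in cylinder Omega T) (q_ v z)%:E = normL2sq (cylinder Omega T) (wave_field v) +
     \sum_i \sum_k normL2sq (cylinder Omega T) (fun z => (pderiv i (v k) z - pderiv k (v i) z)%R))%E.
  have sq0 (f : V1 -> R) z : (0 <= (f z ^+ 2)%:E)%E by rewrite lee_fin sqr_ge0.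
  have msq (f : V1 -> R) : measurable_fun (cylinder Omega T) f -> measurable_fun (cylinder Omega T) (fun z => (f z ^+ 2)%:E).
    by move=> mf; apply/measurable_EFinP; exact: measurable_funX.
  transitivity (\int[mu1]_(z in cylinder Omega T) ((wave_field v z ^+ 2)%:E +
     \sum_i \sum_k ((pderiv i (v k) z - pderiv k (v i) z) ^+ 2)%:E))%E.
    apply: eq_integral => z _; rewrite /q_ EFinD; congr (_ + _)%E.
    by rewrite -sumEFin; apply: eq_bigr => i _; rewrite sumEFin.
  rewrite ge0_integralD//; last 3 first.
  - exact: msq.
  - by move=> z _; apply: sume_ge0 => i _; apply: sume_ge0 => l _; exact: (sq0 (fun z => pderiv i (v l) z - pderiv l (v i) z)).
  - by apply: emeasurable_sum => i; apply: emeasurable_sum => l; exact: msq.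
  congr (_ + _)%E; rewrite ge0_integral_sum//; last 2 first.
  - by move=> i; apply: emeasurable_sum => l; exact: msq.
  - by move=> i z _; apply: sume_ge0 => l _; exact: (sq0 (fun z => pderiv i (v l) z - pderiv l (v i) z)).
  apply: eq_bigr => i _; rewrite ge0_integral_sum//; last 1 first.
  - by move=> l z _; exact: (sq0 (fun z => pderiv i (v l) z - pderiv l (v i) z)).
  by move=> l; exact: msq.
rewrite -!PE -QE; set X0 := (\int[mu]_(x in Omega) (p_ v (insert_rV ord0 0 x))%:E)%E.
set Q := (\int[mu1]_(z in cylinder Omega T) (q_ v z)%:E)%E.
set F := (\int[leb]_(s in `]0%R, t[) surface_energy v s)%E.
set Xt := (\int[mu]_(x in Omega) (p_ v (insert_rV ord0 t x))%:E)%E.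
pose P := (\int[mu1]_(z in cylinder Omega T) (p_ v z)%:E)%E.
have fin_of (y : \bar R) : (0 <= y)%E -> (y < +oo)%E -> y \is a fin_num by move=> y0; rewrite ge0_fin_numE.
have Pfin : P \is a fin_num.
  rewrite /P sum_normL2sq//; last by move=> l; exact: mv.
  rewrite sum_fin_num; apply/allP => x /mapP[l _ ->].
  apply: fin_of; first by apply: integral_ge0 => z _; rewrite lee_fin sqr_ge0.
  by [].
have Xfin : Xt \is a fin_num.
  rewrite /Xt PE sum_fin_num; apply/allP => x /mapP[l _ ->].
  apply: fin_of; first by apply: integral_ge0 => z _; rewrite lee_fin sqr_ge0.
  by [].
have pc s : continuous (fun x : V => p_ v (insert_rV ord0 s x)).
  apply: continuous_sumx => l; rewrite (_ : (fun x => _) = fun x => slice (v l) s x * slice (v l) s x).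
    by apply: continuousMx; apply: continuous_slice.
  by apply/funext => x; rewrite expr2.
have ip : mu.-integrable Omega (EFin \o (fun x : V => p_ v (insert_rV ord0 t x))).
  apply/integrableP; split; first by apply/measurable_EFinP; exact: continuous_measurable.
  have E : (\int[mu]_(x in Omega) `|(p_ v (insert_rV ord0 t x))%:E| = Xt)%E.
    by apply: eq_integral => x _; rewrite gee0_abs// lee_fin.
  by rewrite E ltey_eq Xfin.
have ccut m : continuous (cutoff m) by exact: (@smooth_continuous _ _ _ (smooth_plateau _ _)).
have [||||_ cvgX] := @dominated_cvg_real _ _ R mu Omega (fun m x => cutoff m x * p_ v (insert_rV ord0 t x))
  (fun x => 1 * p_ v (insert_rV ord0 t x)) (fun x => p_ v (insert_rV ord0 t x)) mO.
- move=> m; apply: continuous_measurable => //; exact: (continuousMx (ccut m) (pc t)).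
- by move=> x _; apply: cvgM; [exact: cutoff_cvg|exact: cvg_cst].
- exact: ip.
- move=> m x _; rewrite normrM ger0_norm; last exact: plateau_ge0.
  by rewrite ger0_norm// ler_piMl// plateau_le1.
have XtE : (\int[mu]_(x in Omega) (1 * p_ v (insert_rV ord0 t x))%:E = Xt)%E.
  by apply: eq_integral => x _; rewrite mul1r.
rewrite XtE in cvgX.
have F0 : (0 <= F)%E by apply: integral_ge0 => s _; apply: integral_ge0 => x _; rewrite lee_fin.
have X00 : (0 <= X0)%E by apply: integral_ge0 => x _; rewrite lee_fin.
have Q0 : (0 <= Q)%E by apply: integral_ge0 => x _; rewrite lee_fin.
have Xt0 : (0 <= Xt)%E by apply: integral_ge0 => x _; rewrite lee_fin.
have key : ((kap * c0)%:E * Xt + (kap * ms)%:E * F <= D2%:E * X0 + (D1%:E * Q + 0))%E.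
  have lhs : ((kap * c0)%:E * \int[mu]_(x in Omega) (cutoff m x * p_ v (insert_rV ord0 t x))%:E +
      (kap * ms)%:E * F @[m --> \oo] --> (kap * c0)%:E * Xt + (kap * ms)%:E * F)%E.
    apply: cvgeD; last exact: cvg_cst.
      by rewrite fin_num_adde_defr// fin_numM.
    by apply: cvgeZl.
  have rhs : (D2%:E * X0 + (D1%:E * Q + (n.+1%:R * (D2 * Mp) * m.+1%:R^-1)%:E * P) @[m --> \oo] -->
      D2%:E * X0 + (D1%:E * Q + 0))%E.
    have c3 : ((n.+1%:R * (D2 * Mp) * m.+1%:R^-1)%:E * P @[m --> \oo] --> 0)%E.
      rewrite -(fineK Pfin).
      have -> : (fun m : nat => (n.+1%:R * (D2 * Mp) * m.+1%:R^-1)%:E * (fine P)%:E)%E =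
         EFin \o (fun m : nat => n.+1%:R * (D2 * Mp) * m.+1%:R^-1 * fine P) by [].
      apply: cvg_EFin; first by near=> m.
      rewrite -[X in _ --> X](mul0r (fine P)) -(mulr0 (n.+1%:R * (D2 * Mp))).
      apply: cvgM; last exact: cvg_cst.
      by apply: cvgM; [exact: cvg_cst|exact: cvg_harmonic].
    apply: cvgeD; [|exact: cvg_cst|].
      by rewrite ge0_adde_def// inE ?adde_ge0// mule_ge0// lee_fin.
    apply: cvgeD; [|exact: cvg_cst|exact: c3].
    by rewrite fin_num_adde_defl.
  apply: (lee_cvg_to lhs rhs); near=> m.
  have Nm : (N <= m)%N by near: m; exact: nbhs_infty_ge.
  apply: (@energy_step v sv lam D1 D2 c0 Mp ms t m) => //; try exact: ltW.
  - by move=> z Oz; exact: (H3 v z Oz).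
  - by move=> z Sz; exact: (Hout v z Sz).
  - by move=> x Sx; exact: (cutS m x Nm Sx).
rewrite adde0 in key.
have : (k%:E * (Xt + F) <= M%:E * (X0 + Q))%E.
  have kXF : (k%:E * (Xt + F) <= (kap * c0)%:E * Xt + (kap * ms)%:E * F)%E.
    rewrite (ge0_muleDr _ Xt0 F0); apply: leeD; apply: lee_wpmul2r => //; rewrite lee_fin /k ler_wpM2l ?(ltW kap0)//.
      by rewrite ge_min lexx.
    by rewrite ge_min lexx orbT.
  apply: (le_trans kXF); apply: (le_trans key); rewrite (ge0_muleDr _ X00 Q0).
  apply: leeD; apply: lee_wpmul2r => //; rewrite lee_fin /M; first by rewrite -addrA addrCA lerDl addr_ge0.
  by rewrite -addrA lerDl addr_ge0.
move=> H; rewrite -(@lee_pmul2l _ k%:E)// muleA -EFinM.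
by have -> : k * (M / k) = M by rewrite mulrCA mulfV ?mulr1// gt_eqF.
Unshelve. all: by end_near. Qed.

End energy.

(** * Traces in time *)

Section traces.
Context {R : realType} {n : nat} (Omega : set 'rV[R]_n) (T : R).
Local Notation V := 'rV[R]_n.
Local Notation V1 := 'rV[R]_n.+1.
Local Notation leb := (@lebesgue_measure R).
Local Notation mu := (lebesgue_rV R n).
Local Notation mu1 := (lebesgue_rV R n.+1).
Local Notation cyl := (cylinder Omega T).
Local Notation J := (`]0, T[%classic : set (measurableTypeR R)).
Hypotheses (oO : open Omega) (T0 : 0 < T).

Let mO : measurable Omega. Proof. exact: measurable_open. Qed.
Let mc : measurable cyl. Proof. exact: measurable_cylinder. Qed.
Let mJ : measurable J. Proof. exact: measurable_itv. Qed.

Lemma bounded_L2 (k : R -> R) K : measurable_fun J (k : measurableTypeR R -> measurableTypeR R) ->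
  (forall s, J s -> `|k s| <= K) -> L2 leb J k.
Proof.
move=> mk kK; split => //.
apply: (@le_lt_trans _ _ (\int[leb]_(s in J) (K ^+ 2)%:E)%E).
  apply: ge0_le_integral => //.
  - by move=> s _; rewrite lee_fin sqr_ge0.
  - by apply/measurable_EFinP; exact: measurable_funX.
  - move=> s Js; rewrite lee_fin -real_normK ?num_real// ler_sqr ?nnegrE//; first exact: kK.
    exact: le_trans (kK s Js).
have lJ : leb J = T%:E by rewrite lebesgue_measure_itv/= lte_fin T0 -EFinB subr0.
by rewrite integral_cst//= [X in (_ * X)%E]lJ -EFinM ltry.
Qed.

Let one_L2 : L2 leb J (fun=> 1).
Proof. by apply: (@bounded_L2 _ 1) => // s _; rewrite normr1. Qed.

Lemma L2_one : L2 leb J (fun=> 1). Proof. exact: one_L2. Qed.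

Lemma inL2_time_slice (r : V1 -> R) : inL2 cyl r ->
  {ae mu, forall x, Omega x -> L2 leb J (fun s => r (insert_rV ord0 s x))}.
Proof.
move=> r2; have /(integrable_time_slice mO) := L2_sq_integrable mc r2.
apply: filterS => x H Ox; split.
  apply/measurable_EFinP; apply: (@measurable_time_slice R n Omega T mO (EFin \o r) x) => //.
  by apply/measurable_EFinP; case: r2.
have := integrable_lty mJ (H Ox); rewrite /sq /=; apply: le_lt_trans.
by rewrite le_eqVlt; apply/orP; left; apply/eqP; apply: eq_integral.
Qed.

Definition tmean (r : V1 -> R) (x : V) : R :=
  T^-1 * ip leb J (fun s => r (insert_rV ord0 s x)) (fun=> 1).

Lemma measurable_tmean r : measurable_fun cyl r -> measurable_fun Omega (tmean r).
Proof.
move=> mr; apply: measurable_funM; first exact: measurable_cst.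
have mrE : measurable_fun cyl (EFin \o r) by apply/measurable_EFinP.
apply: (measurableT_comp (fine_measurable measurableT)).
apply: (eq_measurable_fun (fun x => \int[leb]_(s in J) ((EFin \o r)^\+ (insert_rV ord0 s x)) -
  \int[leb]_(s in J) ((EFin \o r)^\- (insert_rV ord0 s x)))%E).
  move=> x _; rewrite [RHS]integralE; congr (_ - _)%E; apply: eq_integral => s _.
    by rewrite /= !funeposE /= mulr1.
  by rewrite /= !funenegE /= mulr1.
apply: emeasurable_funB; apply: measurable_time_integral => //.
  exact: measurable_funepos.
exact: measurable_funeneg.
Qed.

(** Cauchy-Schwarz in time on almost every vertical line, then integration over [Omega]. With
    [k = 1] it compares the traces of different functions, with a difference of kernels the traces
    at different times. *)
Lemma tmean_sub_le (r1 r2 f : V1 -> R) (k : R -> R) K c :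
  inL2 cyl r1 -> inL2 cyl r2 -> inL2 cyl f ->
  measurable_fun J (k : measurableTypeR R -> measurableTypeR R) -> (forall s, J s -> `|k s| <= K) ->
  ip leb J k k <= c -> (forall z, cyl z -> r1 z - r2 z = k (z ord0 ord0) * f z) ->
  (normL2sq Omega (tmean r1 \- tmean r2)%R <= (T^-1 ^+ 2 * c)%:E * normL2sq cyl f)%E.
Proof.
move=> r1L r2L fL mk kK kc rE.
have kL := bounded_L2 mk kK.
have c0 : 0 <= c by apply: le_trans kc; exact: ip_ge0.
have cc0 : 0 <= T^-1 ^+ 2 * c by rewrite mulr_ge0// sqr_ge0.
have mf2 : measurable_fun cyl (fun z => (f z ^+ 2)%:E).
  by apply/measurable_EFinP; apply: measurable_funX; case: fL.
rewrite /normL2sq (ge0_integral_cyl_space mO mf2); last by move=> z; rewrite lee_fin sqr_ge0.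
have mi := measurable_time_integral mO mf2 (fun z => sqr_ge0 (f z)).
rewrite -ge0_integralZl//; last first.
  by move=> x _; apply: integral_ge0 => s _; rewrite lee_fin sqr_ge0.
apply: ae_ge0_le_integral => //.
- by move=> x _; rewrite lee_fin sqr_ge0.
- apply/measurable_EFinP; apply: measurable_funX; apply: measurable_funB; apply: measurable_tmean.
    by case: r1L.
  by case: r2L.
- by move=> x _; rewrite mule_ge0 ?lee_fin//; apply: integral_ge0 => s _; rewrite lee_fin sqr_ge0.
- exact: measurable_funeM.
have := inL2_time_slice r1L; have := inL2_time_slice r2L; have := inL2_time_slice fL.
apply: filterS3 => x fx r2x r1x Ox; have {}fx := fx Ox; have {}r1x := r1x Ox; have {}r2x := r2x Ox.
have E : tmean r1 x - tmean r2 x = T^-1 * ip leb J k (fun s => f (insert_rV ord0 s x)).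
  rewrite /tmean -mulrBr -ipBl//; congr (_ * fine _); apply: eq_integral => s /set_mem Js.
  have /rE : cyl (insert_rV ord0 s x) by apply/cylinder_insert; split.
  by rewrite insert_rV_same mulr1 => ->.
rewrite [X in (_ <= _ * X)%E](_ : _ = (ip leb J (fun s => f (insert_rV ord0 s x)) (fun s => f (insert_rV ord0 s x)))%:E); last exact: (sqE mJ fx).
rewrite -EFinM lee_fin /= E exprMn.
have h : ip leb J k (fun s => f (insert_rV ord0 s x)) ^+ 2 <=
    c * ip leb J (fun s => f (insert_rV ord0 s x)) (fun s => f (insert_rV ord0 s x)).
  apply: le_trans (ip_cauchy_schwarz mJ kL fx) _; apply: ler_wpM2r => //; exact: ip_ge0.
rewrite -(mulrA (T^-1 ^+ 2) c); exact: (ler_wpM2l (sqr_ge0 T^-1) h).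
Qed.

(* Integration by parts against [K t] recovers the value at time [t] from the time
   averages of a function and of its time derivative. *)
Definition tkernel (t s : R) : R := s - T * (t < s)%R%:R.

Lemma measurable_tkernel t : measurable_fun setT (tkernel t : measurableTypeR R -> measurableTypeR R).
Proof.
apply: measurable_funB => //; apply: measurable_funM => //.
rewrite (_ : (fun x => _) = \1_(`]t, +oo[%classic : set (measurableTypeR R))); first exact: measurable_indic.
by apply/funext => s; rewrite indicE mem_setE in_itv/= andbT.
Qed.

Lemma tkernel_le t s : J s -> `|tkernel t s| <= T.
Proof.
rewrite /= in_itv/= => /andP[s0 sT]; rewrite /tkernel ler_norml.
by case: (t < s); rewrite ?mulr1 ?mulr0; apply/andP; split; lra.
Qed.

Definition tvalue (w w0 : V1 -> R) t (z : V1) : R := w z + tkernel t (z ord0 ord0) * w0 z.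

(** The integral of the derivative of [s psi] over [(0, T)] is [T psi(T)], and the kernel subtracts
    [T] times the integral of the derivative of [psi] over [(t, T)]; what is left is [T psi(t)]. *)
Lemma tmean_smooth (psi : V1 -> R) t x : C1 psi -> 0 <= t <= T ->
  tmean (tvalue psi (pderiv ord0 psi) t) x = psi (insert_rV ord0 t x).
Proof.
move=> psi1 /andP[t0 tT].
pose g (s : R) := psi (insert_rV ord0 s x); pose dg (s : R) := pderiv ord0 psi (insert_rV ord0 s x).
have dE (s : R) : is_derive s 1 g (dg s) by exact: is_derive_time.
have cdg : continuous dg by apply: continuous_time_line; exact: C1_pderiv_continuous.
have cg : continuous g by apply: continuous_time_line; exact: C1_continuous.
have cid : continuous (fun s : R => s) by move=> s; exact: cvg_id.
have E1 : (\int[leb]_(s in J) (g s + s * dg s)%:E = (T * g T)%:E)%E.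
  have d1 (s : R) : is_derive s 1 (fun s : R => s * g s) (g s + s * dg s).
    have := @is_deriveM _ _ id g s 1 1 (dg s) (is_derive_id s 1) (dE s).
    by congr is_derive; rewrite /= addrC [g s *: _]mulr1.
  rewrite (FTC_open T0 d1); first by rewrite mul0r subr0.
  by move=> s; exact: (cvgD (cg s) (cvgM (cid s) (cdg s))).
have cmeas (h : R -> R) : continuous h -> measurable_fun J (EFin \o h).
  by move=> ch; apply/measurable_EFinP; apply: measurable_funTS; exact: (continuous_measurable_fun ch).
have E2 : (\int[leb]_(s in J) (T * ((t < s)%R%:R * dg s))%:E = (T * (g T - g t))%:E)%E.
  transitivity (\int[leb]_(s in `]t, T[) (T * dg s)%:E)%E.
    rewrite integral_mkcond [RHS]integral_mkcond; apply: eq_integral => s _; rewrite !patchE !mem_setE !in_itv/=.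
    case: (ltP t s) => ts; rewrite ?andbF/=.
      by rewrite (le_lt_trans t0 ts)/= mul1r.
    by case: ifP; rewrite ?mul0r ?mulr0.
  have [tT'|Tt] := ltP t T.
    have d2 (s : R) : is_derive s 1 (fun s : R => T * g s) (T * dg s) by exact: is_deriveZ.
    rewrite (FTC_open tT' d2) ?mulrBr//.
    by move=> s; exact: (cvgM (cvg_cst _) (cdg s)).
  have -> : t = T by apply/le_anti; rewrite tT Tt.
  by rewrite subrr mulr0 set_itv_ge ?integral_set0// bnd_simp -leNgt.
have i1 : leb.-integrable J (fun s => (g s + s * dg s)%:E).
  have H : leb.-integrable `[0, T] (EFin \o (fun s => g s + s * dg s)).
    apply: continuous_compact_integrable; first exact: segment_compact.
    by apply: continuous_subspaceT => s; exact: (cvgD (cg s) (cvgM (cid s) (cdg s))).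
  by apply: (integrableS _ _ _ H) => //; exact: subset_itv_oo_cc.
have i2 : leb.-integrable J (fun s => (T * ((t < s)%R%:R * dg s))%:E).
  have H : leb.-integrable `[0, T] (EFin \o (fun s => T * `|dg s|)).
    apply: continuous_compact_integrable; first exact: segment_compact.
    apply: continuous_subspaceT => s; apply: cvgM; first exact: cvg_cst.
    by apply: (continuous_comp (cdg s)); exact: norm_continuous.
  have HJ : leb.-integrable J (EFin \o (fun s => T * `|dg s|)).
    by apply: (integrableS _ _ _ H) => //; exact: subset_itv_oo_cc.
  apply: (le_integrable mJ _ _ HJ).
    apply/measurable_EFinP; apply: measurable_funM => //; apply: measurable_funM.
      rewrite (_ : (fun x => _) = \1_(`]t, +oo[%classic : set (measurableTypeR R))); first exact: measurable_indic.
      by apply/funext => s; rewrite indicE mem_setE in_itv/= andbT.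
    by apply: measurable_funTS; exact: (continuous_measurable_fun cdg).
  move=> s _; rewrite /= lee_fin !normrM normr_id ler_wpM2l// ler_piMl//.
  by case: (t < s); rewrite ?normr1 ?normr0.
rewrite /tmean /ip.
have -> : (\int[leb]_(s in J) (tvalue psi (pderiv ord0 psi) t (insert_rV ord0 (s : R) x) * 1)%:E =
    \int[leb]_(s in J) ((g s + s * dg s)%:E - (T * ((t < s)%R%:R * dg s))%:E))%E.
  apply: eq_integral => s _; rewrite -EFinB /tvalue /tkernel insert_rV_same mulr1; congr EFin.
  by rewrite -/(g s) -/(dg s); ring.
rewrite (integralB mJ i1 i2) E1 E2 -EFinB /= -mulrBr opprB addrC subrK mulrA mulVf ?mul1r// gt_eqF//.
Qed.

Lemma inL2_tvalue w w0 t : inL2 cyl w -> inL2 cyl w0 -> inL2 cyl (tvalue w w0 t).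
Proof.
move=> wL w0L; apply: (L2D mc wL); apply: (@L2_bounded_mul _ _ _ _ _ mc _ T) => //.
- apply: measurable_funTS; apply: (measurableT_comp (measurable_tkernel t)).
  exact: measurable_coord.
- by move=> z [_ zT]; apply: tkernel_le; rewrite /= in_itv.
Qed.

Lemma measurable_trace w w0 t : inL2 cyl w -> inL2 cyl w0 ->
  measurable_fun Omega (tmean (tvalue w w0 t)).
Proof. by move=> wL w0L; apply: measurable_tmean; case: (inL2_tvalue t wL w0L). Qed.

Lemma trace_approx w w0 p p0 t : inL2 cyl w -> inL2 cyl w0 -> inL2 cyl p -> inL2 cyl p0 ->
  (normL2sq Omega (tmean (tvalue w w0 t) \- tmean (tvalue p p0 t))%R <=
   (2 * T^-1)%:E * (normL2sq cyl (w \- p)%R + (T ^+ 2)%:E * normL2sq cyl (w0 \- p0)%R))%E.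
Proof.
move=> wL w0L pL p0L.
have wpL : inL2 cyl (fun z => w z - p z) by exact: (L2B mc wL pL).
have wpL0 : inL2 cyl (fun z => w0 z - p0 z) by exact: (L2B mc w0L p0L).
have c1 : ip leb J (fun=> 1) (fun=> 1) <= T.
  rewrite /ip; under eq_integral do rewrite mulr1.
  have lJ : leb J = T%:E by rewrite lebesgue_measure_itv/= lte_fin T0 -EFinB subr0.
  by rewrite integral_cst//= mul1e [X in fine X]lJ.
apply: (le_trans (@tmean_sub_le _ _ (tvalue (fun z => w z - p z) (fun z => w0 z - p0 z) t) (fun=> 1) 1 T
   (inL2_tvalue t wL w0L) (inL2_tvalue t pL p0L) (inL2_tvalue t wpL wpL0) _ _ c1 _)) => //.
- by move=> s _; rewrite normr1.
- by move=> z _; rewrite /tvalue mul1r; ring.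
have -> : T^-1 ^+ 2 * T = T^-1 by rewrite expr2 mulfVK// gt_eqF.
have kL : inL2 cyl (fun z => tkernel t (z ord0 ord0) * (w0 z - p0 z)).
  apply: (@L2_bounded_mul _ _ _ _ _ mc _ T) => //.
    apply: measurable_funTS; apply: (measurableT_comp (measurable_tkernel t)); exact: measurable_coord.
  by move=> z [_ zT]; apply: tkernel_le; rewrite /= in_itv.
rewrite mulrC EFinM -muleA; apply: lee_wpmul2l; first by rewrite lee_fin invr_ge0 ltW.
apply: (le_trans (sqD_le mu1 mc (proj1 wpL) (proj1 kL))).
have s1 : (0 <= normL2sq cyl (w \- p)%R)%E by exact: sq_ge0.
have s2 : (0 <= normL2sq cyl (w0 \- p0)%R)%E by exact: sq_ge0.
have s3 : (0 <= (T ^+ 2)%:E * normL2sq cyl (w0 \- p0)%R)%E by rewrite mule_ge0// lee_fin sqr_ge0.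
rewrite (ge0_muleDr _ s1 s3); apply: leeD => //; apply: lee_wpmul2l => //.
have := @sqZ _ _ _ mu1 _ mc T _ (proj1 wpL0); rewrite /sq => <-.
apply: le_sq => //; [by case: kL|by apply: measurable_funM => //; case: wpL0|].
move=> z [_ zT]; rewrite !normrM ler_wpM2r// (ger0_norm (ltW T0)).
by apply: tkernel_le; rewrite /= in_itv.
Qed.

(** The two kernels differ only between [t] and [t'], and there by at most [T], so that the squared
    norm of their difference is at most [T^2 |t - t'|]: traces are Hoelder continuous of exponent
    1/2. *)
Lemma trace_continuity w w0 t t' : inL2 cyl w -> inL2 cyl w0 -> 0 <= t <= T -> 0 <= t' <= T ->
  (normL2sq Omega (tmean (tvalue w w0 t) \- tmean (tvalue w w0 t'))%R <= `|t - t'|%:E * normL2sq cyl w0)%E.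
Proof.
move=> wL w0L tT tT'.
pose k s := tkernel t s - tkernel t' s.
have mk : measurable_fun J (k : measurableTypeR R -> measurableTypeR R).
  by apply: measurable_funTS; apply: measurable_funB; exact: measurable_tkernel.
have kE s : `|k s| <= T * (\1_(`[Num.min t t', Num.max t t']%classic) s : R).
  rewrite indicE mem_setE in_itv/= /k /tkernel ge_min le_max.
  rewrite (_ : s - T * (t < s)%R%:R - (s - T * (t' < s)%R%:R) = T * ((t' < s)%R%:R - (t < s)%R%:R)); last by ring.
  rewrite normrM (ger0_norm (ltW T0)); apply: ler_wpM2l; first exact: ltW.
  by have [] := ltP t s; have [] := ltP t' s => h1 h2;
    rewrite ?(ltW h1) ?(ltW h2) ?h1 ?h2 ?orbT ?subrr ?normr0 ?ler0n//= ?subr0 ?sub0r ?normrN ?normr1.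
have kT s : J s -> `|k s| <= T.
  move=> _; apply: le_trans (kE s) _; rewrite indicE; case: (_ \in _); rewrite ?mulr1 ?mulr0 ?(ltW T0)//.
have kL := bounded_L2 mk kT.
have mm : Num.min t t' <= Num.max t t' by rewrite ge_min le_max lexx.
have lI : leb `[Num.min t t', Num.max t t'] = `|t - t'|%:E.
  rewrite lebesgue_measure_itv/= lte_fin; have [tt'|t't|->] := ltgtP t t'.
  - by rewrite tt' -EFinB distrC gtr0_norm ?subr_gt0.
  - by rewrite t't -EFinB gtr0_norm ?subr_gt0.
  - by rewrite ltxx subrr normr0.
have c1 : ip leb J k k <= T ^+ 2 * `|t - t'|.
  rewrite -lee_fin -(ipE mJ kL kL) EFinM -lI.
  have mI : measurable (`[Num.min t t', Num.max t t']%classic : set (measurableTypeR R)) by exact: measurable_itv.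
  rewrite -(setIT (`[_, _]%classic)) -integral_indic// -ge0_integralZl//; last 2 first.
  - by apply/measurable_EFinP; exact: measurable_indic.
  - by rewrite lee_fin sqr_ge0.
  apply: (@le_trans _ _ (\int[leb]_(s in J) ((T ^+ 2)%:E * (\1_(`[Num.min t t', Num.max t t']%classic) s : R)%:E))%E).
    apply: ge0_le_integral => //.
    + by move=> s _; rewrite lee_fin -expr2 sqr_ge0.
    + by apply/measurable_EFinP; exact: measurable_funM.
    + by apply: measurable_funeM; apply/measurable_EFinP; exact: measurable_indic.
    + move=> s _; rewrite -EFinM lee_fin -expr2 -real_normK ?num_real//.
      have -> : T ^+ 2 * (\1_(`[Num.min t t', Num.max t t']%classic) s : R) = (T * (\1_(`[Num.min t t', Num.max t t']%classic) s : R)) ^+ 2.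
        by rewrite exprMn indicE; case: (_ \in _); rewrite ?expr1n ?expr0n.
      by rewrite ler_sqr ?nnegrE// (le_trans _ (kE s)).
  apply: ge0_subset_integral => //.
    by apply: measurable_funeM; apply/measurable_EFinP; exact: measurable_indic.
  by move=> s _; rewrite -EFinM lee_fin mulr_ge0// sqr_ge0.
apply: (le_trans (@tmean_sub_le _ _ w0 k T _ (inL2_tvalue t wL w0L) (inL2_tvalue t' wL w0L) w0L mk kT c1 _)).
  by move=> z _; rewrite /tvalue /k; ring.
by rewrite mulrA -exprMn mulVf ?expr1n ?mul1r// gt_eqF.
Qed.

Lemma normL2sq_eq0 (f : V -> R) : measurable_fun Omega f -> normL2sq Omega f = 0%E ->
  {ae mu, forall x, Omega x -> f x = 0}.
Proof.
move=> mf f0.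
have H : (\int[mu]_(x in Omega) `|(f x ^+ 2)%:E| = 0)%E.
  by rewrite -f0; apply: eq_integral => x _; rewrite gee0_abs// lee_fin sqr_ge0.
have m2 : measurable_fun Omega (fun x => (f x ^+ 2)%:E) by apply/measurable_EFinP; exact: measurable_funX.
have := (ae_eq_integral_abs mu mO m2).1 H; apply: filterS => x h Ox.
by have := h Ox => /eqP; rewrite eqe sqrf_eq0 => /eqP.
Qed.

Section approximation.
Variables (w w0 : V1 -> R) (psi : nat -> V1 -> R).
Hypotheses (wL : inL2 cyl w) (w0L : inL2 cyl w0) (spsi : forall k, smooth (psi k))
  (cvgw : (normL2sq cyl (psi k \- w)%R @[k --> \oo] --> 0)%E)
  (cvgw0 : (normL2sq cyl (pderiv ord0 (psi k) \- w0)%R @[k --> \oo] --> 0)%E).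

Let W t := tmean (tvalue w w0 t).

Let mpsi k (D : set V1) : measurable D -> measurable_fun D (psi k).
Proof. by move=> mD; apply: continuous_measurable => //; exact: (@smooth_continuous _ _ _ (spsi k)). Qed.

Let mdpsi k (D : set V1) : measurable D -> measurable_fun D (pderiv ord0 (psi k)).
Proof.
by move=> mD; apply: continuous_measurable => //; exact: (@smooth_continuous _ _ _ (smooth_pderiv ord0 (spsi k))).
Qed.

Let eventually_L2 (p : nat -> V1 -> R) (f : V1 -> R) : inL2 cyl f ->
  (forall k, measurable_fun cyl (p k)) ->
  (normL2sq cyl (p k \- f)%R @[k --> \oo] --> 0)%E -> \forall k \near \oo, inL2 cyl (p k).
Proof.
move=> fL mp cf.
have : \forall k \near \oo, (normL2sq cyl (p k \- f)%R < 1)%E.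
  exact: (cf _ (open_ereal_lt' (@lte01 R))).

apply: filterS => k h.
have pfL : inL2 cyl (fun z => p k z - f z).
  by split; [apply: measurable_funB => //; case: fL|apply: lt_le_trans h _; rewrite leey].
have := L2D mc pfL fL; congr L2; apply/funext => z; exact: subrK.
Qed.

(** Smooth approximants need not be square integrable; once at finite distance from a square
    integrable function, they are. *)
Lemma approximants_inL2 : \forall k \near \oo, inL2 cyl (psi k) /\ inL2 cyl (pderiv ord0 (psi k)).
Proof.
apply: filterI; first exact: (eventually_L2 wL (fun k => mpsi k mc) cvgw).
exact: (eventually_L2 w0L (fun k => mdpsi k mc) cvgw0).
Qed.

(** An error bound independent of [t], as the integration over time in [time_trace_tmean]
    requires. *)
Let eps k : \bar R := ((2 * T^-1)%:E * (normL2sq cyl (psi k \- w)%R +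
  (T ^+ 2)%:E * normL2sq cyl (pderiv ord0 (psi k) \- w0)%R))%E.

Let eps_cvg : (eps k @[k --> \oo] --> 0)%E.
Proof.
rewrite /eps -[X in _ --> X](mule0 (2 * T^-1)%:E); apply: cvgeZl => //.
rewrite -[X in _ --> X](add0e 0%E); apply: cvgeD => //.
by rewrite -[X in _ --> X](mule0 (T ^+ 2)%:E); apply: cvgeZl.
Qed.

Lemma slice_trace_le k t : 0 <= t <= T -> inL2 cyl (psi k) -> inL2 cyl (pderiv ord0 (psi k)) ->
  (normL2sq Omega (slice (psi k) t \- W t)%R <= eps k)%E.
Proof.
move=> tT pL p0L; have := trace_approx t pL p0L wL w0L.
congr (_ <= _)%E; apply: eq_integral => x _; congr (((_ - _) ^+ 2)%:E).
by apply: tmean_smooth => //; exact: smooth_C1.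
Qed.

Lemma slice_trace_cvg t : 0 <= t <= T ->
  (normL2sq Omega (slice (psi k) t \- W t)%R @[k --> \oo] --> 0)%E.
Proof.
move=> tT; apply: (@squeeze_cvge _ _ _ _ (fun=> 0%E) _ eps); [|exact: cvg_cst|exact: eps_cvg].
have := approximants_inL2; apply: filterS => k [pL p0L].
by rewrite sq_ge0/=; exact: slice_trace_le.
Qed.

Lemma inL2_trace t : 0 <= t <= T -> inL2 Omega (W t).
Proof.
move=> tT; split; first exact: measurable_trace.
have zL : inL2 cyl (fun=> 0).
  by split => //; rewrite /normL2sq integral0_eq// => z _; rewrite expr0n.
have := trace_approx t wL w0L zL zL.
have -> : normL2sq Omega (tmean (tvalue w w0 t) \- tmean (tvalue (fun=> 0) (fun=> 0) t))%R = normL2sq Omega (W t).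
  apply: eq_integral => x _; rewrite /= [X in _ - X](_ : _ = 0) ?subr0//.
  rewrite /tmean /ip integral0_eq ?mulr0//= => s _; by rewrite /tvalue mulr0 addr0 mul0r.
have E (f : V1 -> R) : normL2sq cyl (f \- (fun=> 0))%R = normL2sq cyl f.
  by apply: eq_integral => z _; rewrite /= subr0.
rewrite !E => h; apply: (le_lt_trans h).
have [_ h1] := wL; have [_ h2] := w0L.
rewrite lte_mul_pinfty// ?lee_fin ?mulr_ge0 ?invr_ge0 ?(ltW T0)//.
by rewrite lte_add_pinfty// lte_mul_pinfty// lee_fin sqr_ge0.
Qed.

(** Continuity is [trace_continuity]. Agreement with the slices at almost every time comes from the
    approximants: their slices are close to [W t] at every time, and to those of [w] in the mean
    over time. *)
Lemma time_trace_tmean : time_trace Omega T w W.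
Proof.
split.
- by move=> t; rewrite in_itv/= => tT; exact: inL2_trace.
- move=> t; rewrite in_itv/= => tT.
  have w0f : normL2sq cyl w0 \is a fin_num by rewrite ge0_fin_numE ?sq_ge0//; case: w0L.
  apply: (@squeeze_cvge _ _ _ _ (fun=> 0%E) _ (fun s => `|s - t|%:E * normL2sq cyl w0)%E); [|exact: cvg_cst|].
    near=> s; rewrite sq_ge0/=; apply: trace_continuity => //.
    have : s \in `[0, T] by near: s; rewrite near_withinE; near=> s => /=; rewrite in_itv.
    by rewrite in_itv.
  rewrite -[X in _ --> X](mul0e (normL2sq cyl w0)); apply: cvgeZr => //.
  apply: cvg_EFin; first by near=> s.
  have : `|s - t| @[s --> within `[0, T] (nbhs t)] --> `|t - t|.
    by apply: cvg_norm; apply: cvgB; [apply: cvg_within_filter; exact: cvg_id|exact: cvg_cst].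
  by rewrite subrr normr0.
have [N _ HN] := approximants_inL2.
pose h k (t : measurableTypeR R) : \bar R := (eps (k + N) + normL2sq Omega (fun x => (slice (psi (k + N)) t x - slice w t x)%R))%E.
have mpw k : measurable_fun cyl (fun z => ((psi k z - w z) ^+ 2)%:E).
  by apply/measurable_EFinP; apply: measurable_funX; apply: measurable_funB; [exact: mpsi|case: wL].
have sq0 (f : V1 -> R) z : (0 <= (f z ^+ 2)%:E)%E by rewrite lee_fin sqr_ge0.
have mh k : measurable_fun J (h k).
  apply: emeasurable_funD; first exact: measurable_cst.
  exact: (measurable_integral_slice mO (mpw _) (sq0 (fun z => psi (k + N) z - w z))).
have eps0 k : (0 <= eps k)%E.
  rewrite /eps mule_ge0 ?lee_fin ?mulr_ge0 ?invr_ge0 ?(ltW T0)//.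
  by rewrite adde_ge0 ?sq_ge0// mule_ge0 ?sq_ge0// lee_fin sqr_ge0.
have h0 k t : (0 <= h k t)%E by rewrite adde_ge0// sq_ge0.
(* The infimum over [k] has integral 0, hence vanishes for almost every [t]; at such a [t] the
   squared distance between [W t] and the slice is at most twice this infimum. No subsequence has to
   be extracted. *)
pose g t := einfs (h ^~ t) 0.
have mg : measurable_fun J g by exact: measurable_fun_einfs.
have gh k t : (g t <= h k t)%E by apply: ereal_inf_lbound; exists k.
have g0 t : (0 <= g t)%E by apply: le_ereal_inf_tmp => _ [k _ <-]; exact: h0.
have lJ : leb J = T%:E by rewrite lebesgue_measure_itv/= lte_fin T0 -EFinB subr0.
have ig : (\int[leb]_(t in J) g t = 0)%E.
  apply/le_anti/andP; split; last by apply: integral_ge0.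
  have up : (eps k * T%:E + normL2sq cyl (psi k \- w)%R @[k --> \oo] --> 0)%E.
    rewrite -[X in _ --> X](add0e 0%E); apply: cvgeD => //.
    by rewrite -[X in _ --> X](mul0e T%:E); apply: cvgeZr.
  apply: (cvge_ge _ up); near=> k.
  have Nk : (N <= k)%N by near: k; exact: nbhs_infty_ge.
  apply: (@le_trans _ _ (\int[leb]_(t in J) h (k - N)%N t)%E); first exact: ge0_le_integral.
  rewrite /h subnK// ge0_integralD//; last 2 first.
  - by move=> t _; exact: sq_ge0.
  - exact: (measurable_integral_slice mO (mpw _) (sq0 (fun z => psi k z - w z))).
  rewrite integral_cst//= [X in (_ * X + _)%E]lJ leeD2l//.
  have := ge0_integral_cyl_time mO (mpw k) (sq0 (fun z => psi k z - w z)); rewrite /normL2sq => ->.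
  by rewrite le_eqVlt; apply/orP; left; apply/eqP; apply: eq_integral.
have ge : (\int[leb]_(t in J) `|g t| = 0)%E by rewrite -ig; apply: eq_integral => t _; rewrite gee0_abs.
have := (ae_eq_integral_abs leb mJ mg).1 ge; apply: filterS => t gt tJ.
have {}gt : g t = 0%E by exact: gt.
have mwt : measurable_fun Omega (slice w t).
  have := @measurable_slice R n Omega T mO (EFin \o w) t.
  move=> H; apply/measurable_EFinP; apply: H => //; apply/measurable_EFinP; by case: wL.
have tT : 0 <= t <= T by move: tJ; rewrite in_itv/= => /andP[? ?]; rewrite !ltW.
have mW : measurable_fun Omega (W t) by exact: measurable_trace.
have mps k : measurable_fun Omega (slice (psi k) t).
  apply: continuous_measurable => //; apply: continuous_slice; exact: (@smooth_continuous _ _ _ (spsi k)).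
have bound k : (normL2sq Omega (fun x => (W t x - slice w t x)%R) <= 2%:E * h k t)%E.
  have [pL p0L] := HN (k + N)%N (leq_addl _ _).
  have m1 : measurable_fun Omega (fun x => W t x - slice (psi (k + N)) t x) by exact: measurable_funB.
  have m2 : measurable_fun Omega (fun x => slice (psi (k + N)) t x - slice w t x) by exact: measurable_funB.
  have := sqD_le mu mO m1 m2.
  rewrite (_ : (fun x => W t x - slice (psi (k + N)) t x + (slice (psi (k + N)) t x - slice w t x)) = fun x => W t x - slice w t x); last first.
    by apply/funext => x; rewrite addrA subrK.
  move=> /le_trans; apply; rewrite /h (ge0_muleDr _ (eps0 _) (sq_ge0 _ _ _)).
  apply: leeD; last exact: lexx.
  apply: lee_wpmul2l; first by rewrite lee_fin.
  apply: le_trans (slice_trace_le tT pL p0L).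
  by rewrite le_eqVlt; apply/orP; left; apply/eqP; apply: eq_integral => x _; rewrite -sqrrN opprB.
have z0 : normL2sq Omega (fun x => W t x - slice w t x) = 0%E.
  apply/le_anti/andP; split; last exact: sq_ge0.
  rewrite -(mule0 2%:E) -gt -lee_pdivrMl//.
  apply: le_ereal_inf_tmp => _ [k _ <-]; rewrite lee_pdivrMl//; exact: bound.
have := normL2sq_eq0 (measurable_funB mW mwt) z0; apply: filterS => x H Ox.
by have /eqP := H Ox; rewrite subr_eq0 => /eqP.
Unshelve. all: by end_near. Qed.

End approximation.

End traces.

(** * Approximate identities in time *)

Section steps.
Context {R : realType}.
Implicit Types s c m : R.

Definition smooth_step s : R := theta s / (theta s + theta (1 - s)).

Definition smooth_step' s : R :=
  (theta' s * theta (1 - s) + theta s * theta' (1 - s)) / (theta s + theta (1 - s)) ^+ 2.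

Lemma smooth_step_den s : 0 < theta s + theta (1 - s).
Proof.
have [s0|s0] := lerP s 0; last by rewrite ltr_pwDl ?theta_gt0 ?theta_ge0.
by rewrite theta_le0// add0r theta_gt0; lra.
Qed.

Lemma smooth_step_le0 s : s <= 0 -> smooth_step s = 0.
Proof. by move=> s0; rewrite /smooth_step theta_le0// mul0r. Qed.

Lemma smooth_step_ge1 s : 1 <= s -> smooth_step s = 1.
Proof.
move=> s1; have := smooth_step_den s; rewrite /smooth_step (@theta_le0 _ (1 - s)); last lra.
by rewrite addr0 => d; rewrite divff// gt_eqF.
Qed.

Lemma smooth_step_itv s : 0 <= smooth_step s <= 1.
Proof.
have d := smooth_step_den s; have a := theta_ge0 s; have b := theta_ge0 (1 - s).
by rewrite /smooth_step; apply/andP; split; [rewrite divr_ge0// ltW|rewrite ler_pdivrMr// mul1r lerDl].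
Qed.

Lemma smooth_step'_ge0 s : 0 <= smooth_step' s.
Proof.
apply: divr_ge0; last exact: sqr_ge0.
by rewrite addr_ge0// mulr_ge0 ?theta'_ge0 ?theta_ge0.
Qed.

Lemma is_derive_congr (f g : R -> R) s (a b : R) : is_derive s 1 f a -> f = g -> a = b -> is_derive s 1 g b.
Proof. by move=> + <- <-. Qed.

Lemma is_derive_smooth_step s : is_derive s 1 smooth_step (smooth_step' s).
Proof.
have d := smooth_step_den s; have t1 := is_derive_theta s.
have t2 : is_derive s 1 (fun r : R => theta (1 - r)) (- theta' (1 - s)).
  have h : is_derive s 1 (fun r : R => 1 - r) (- 1).
    by apply: (is_derive_congr (is_deriveB (is_derive_cst (1 : R) s 1) (is_derive_id s (1 : R)))); rewrite ?sub0r.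
  have hc : is_derive s 1 (theta \o (fun r : R => 1 - r)) (theta' (1 - s) * - 1).
    by apply: is_derive1_comp; exact: is_derive_theta.
  apply: (is_derive_congr hc) => //.
  by rewrite /GRing.scale/=; ring.
have dD : is_derive s 1 (fun r : R => theta r + theta (1 - r)) (theta' s + - theta' (1 - s)).
  exact: (is_deriveD t1 t2).
have t3 := @is_deriveV R (fun r : R => theta r + theta (1 - r)) s _ 1 (lt0r_neq0 d) dD.
apply: (is_derive_congr (is_deriveM t1 t3)) => //.
rewrite /smooth_step' /GRing.scale/=; field; exact: lt0r_neq0.
Qed.

Lemma continuous_smooth_step' : continuous smooth_step'.
Proof.
move=> s; have d := smooth_step_den s.
have ct := @continuous_theta R.
have ct1 : theta (1 - r) @[r --> s] --> theta (1 - s).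
  by apply: (@cvg_comp _ _ _ (fun r : R => 1 - r) theta); [apply: cvgB; [exact: cvg_cst|exact: cvg_id]|exact: ct].
have ct2 : theta' (1 - r) @[r --> s] --> theta' (1 - s).
  by apply: (@cvg_comp _ _ _ (fun r : R => 1 - r) theta'); [apply: cvgB; [exact: cvg_cst|exact: cvg_id]|exact: continuous_theta'].
have cd : theta r + theta (1 - r) @[r --> s] --> theta s + theta (1 - s) by apply: cvgD => //; exact: ct.
rewrite /smooth_step'; apply: cvgM.
  by apply: cvgD; apply: cvgM => //; [exact: continuous_theta'|exact: ct].
apply: cvgV; first by rewrite expf_neq0// lt0r_neq0.
exact: (cvgM cd cd).
Qed.

Lemma smooth_smooth_step n (f : 'rV[R]_n -> R) : smooth f -> smooth (fun z => smooth_step (f z)).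
Proof.
move=> sf; apply: smoothM (smooth_theta sf) _.
apply: smoothV; last by move=> z; exact: lt0r_neq0 (smooth_step_den _).
exact: smoothD (smooth_theta sf) (smooth_theta (smoothB (smooth_cst 1) sf)).
Qed.

(** For positive [m], a mollified Heaviside function, whose derivative [spike] is an approximate
    Dirac mass on [[c, c + 1/m]]. Both act to the right of [c], so that the time 0 is approached
    from inside the interval. *)
Definition ramp m c s := smooth_step (m * (s - c)).
Definition spike m c s := m * smooth_step' (m * (s - c)).

Lemma is_derive_ramp m c s : is_derive s 1 (ramp m c) (spike m c s).
Proof.
have h : is_derive s 1 (fun r : R => m * (r - c)) m.
  apply: (is_derive_congr (is_deriveM (is_derive_cst m s 1) (is_deriveB (is_derive_id s 1) (is_derive_cst c s 1)))) => //.
  by rewrite subr0 /GRing.scale/= mulr1 mulr0 addr0.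
have hc : is_derive s 1 (smooth_step \o (fun r : R => m * (r - c))) (smooth_step' (m * (s - c)) * m).
  by apply: is_derive1_comp; exact: is_derive_smooth_step.
apply: (is_derive_congr hc) => //.
by rewrite /spike /GRing.scale/=; ring.
Qed.

Lemma continuous_spike m c : continuous (spike m c).
Proof.
move=> s; apply: cvgM; first exact: cvg_cst.
apply: (@cvg_comp _ _ _ (fun r : R => m * (r - c)) smooth_step'); last exact: continuous_smooth_step'.
by apply: cvgM; [exact: cvg_cst|apply: cvgB; [exact: cvg_id|exact: cvg_cst]].
Qed.

Lemma ramp_eq0 m c s : 0 < m -> s <= c -> ramp m c s = 0.
Proof. by move=> m0 sc; apply: smooth_step_le0; rewrite pmulr_rle0// subr_le0. Qed.

Lemma ramp_eq1 m c s : 0 < m -> c + m^-1 <= s -> ramp m c s = 1.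
Proof.
move=> m0 cs; apply: smooth_step_ge1; rewrite -(mulfV (lt0r_neq0 m0)) ler_pM2l//.
by rewrite lerBrDl.
Qed.

Lemma spike_eq0 m c s : 0 < m -> ~~ (c <= s <= c + m^-1) -> spike m c s = 0.
Proof.
move=> m0 h; rewrite /spike /smooth_step'.
have [s1|s1] := lerP (m * (s - c)) 0.
  by rewrite (theta_le0 s1) (flat_le0 _ s1 : theta' _ = 0) !mul0r addr0 mul0r mulr0.
have s2 : 1 <= m * (s - c).
  move: h; rewrite negb_and -!ltNge => /orP[h|h]; first by move: s1; rewrite pmulr_rgt0//; lra.
  by rewrite -(mulfV (lt0r_neq0 m0)) ler_pM2l//; lra.
have s3 : 1 - m * (s - c) <= 0 by lra.
by rewrite (theta_le0 s3) (flat_le0 _ s3 : theta' _ = 0) !mulr0 addr0 mul0r mulr0.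
Qed.

End steps.

Section products.
Context {R : realType} {n : nat} (Omega : set 'rV[R]_n) (T : R).
Local Notation V := 'rV[R]_n.
Local Notation V1 := 'rV[R]_n.+1.
Local Notation leb := (@lebesgue_measure R).
Local Notation mu := (lebesgue_rV R n).
Local Notation mu1 := (lebesgue_rV R n.+1).
Local Notation cyl := (cylinder Omega T).
Local Notation J := (`]0, T[%classic : set (measurableTypeR R)).
Hypotheses (oO : open Omega) (T0 : 0 < T).

Let mO : measurable Omega. Proof. exact: measurable_open. Qed.
Let mc : measurable cyl. Proof. exact: measurable_cylinder. Qed.
Let mJ : measurable J. Proof. exact: measurable_itv. Qed.

Lemma near_itv (Q : set R) (t : R) : t \in `[0, T] -> (\forall s \near within `[0, T] (nbhs t), Q s) ->
  exists a b : R, [/\ 0 <= a, a < b, b <= T & forall s, a < s < b -> Q s].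
Proof.
rewrite in_itv/= => /andP[t0 tT] /nbhs_ballP[e /= e0 He].
exists (Num.max 0 (t - e)), (Num.min T (t + e)).
split; rewrite ?le_max ?ge_min ?lexx ?orbT//.
  rewrite lt_min !gt_max T0/= ltrBlDr (le_lt_trans tT) ?ltrDl//= ltr_wpDl//=.
  by rewrite ltrBlDr -addrA ltrDl addr_gt0.
move=> s; rewrite gt_max lt_min => /andP[/andP[s0 se] /andP[sT se']].
apply: He; last by rewrite /= in_itv/= !ltW.
rewrite -ball_normE/= ltr_norml; apply/andP; split.
  by rewrite ltrNl opprB ltrBlDl.
by rewrite ltrBlDr -ltrBlDl.
Qed.

(** A neighbourhood of [t] in [[0, T]] contains an interval of positive length, which no null set
    covers. The endpoints of [[0, T]] are reached in this way too. *)
Lemma ae_near (P : R -> Prop) (Q : set R) (t : R) : {ae leb, forall s : R, s \in `]0, T[ -> P s} ->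
  t \in `[0, T] -> (\forall s \near within `[0, T] (nbhs t), Q s) ->
  exists s, [/\ s \in `]0, T[, P s & Q s].
Proof.
move=> [N [mN N0 sub]] tT /(near_itv tT)[a [b [a0 ab bT HQ]]].
apply: contrapT => no.
have sN : `]a, b[ `<=` N.
  move=> s; rewrite /= in_itv/= => sab; apply: sub => /= H; apply: no; exists s.
  have sJ : s \in `]0, T[ by rewrite in_itv/=; case/andP: sab => ? ?; rewrite (le_lt_trans a0)// (lt_le_trans _ bT).
  by split=> //; [exact: H|exact: HQ].
have mab : measurable (`]a, b[%classic : set (measurableTypeR R)) by exact: measurable_itv.
have lab : leb (`]a, b[%classic : set (measurableTypeR R)) = (b - a)%:E.
  by rewrite lebesgue_measure_itv/= lte_fin ab -EFinB.
have : (leb (`]a, b[%classic : set (measurableTypeR R)) <= leb N)%E := le_measure leb (mem_set mab) (mem_set mN) sN.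
have lN : leb N = 0%E := N0.
by rewrite lab lN lee_fin; lra.
Qed.

(** Arbitrarily near [t] there are times at which both representatives agree with the slice;
    continuity carries the equality over to [t], including [t = 0], where the initial data are
    prescribed. *)
Lemma time_trace_unique w W W' : time_trace Omega T w W -> time_trace Omega T w W' ->
  forall t : R, t \in `[0, T] -> {ae mu, forall x, Omega x -> W t x = W' t x}.
Proof.
move=> [WL Wc Wae] [W'L W'c W'ae] t tT.
have [[mWt _] [mWt' _]] := (WL t tT, W'L t tT).
suff d0 : normL2sq Omega (W t \- W' t)%R = 0%E.
  have mD : measurable_fun Omega (W t \- W' t)%R by exact: measurable_funB.
  have := normL2sq_eq0 oO mD d0; apply: filterS => x h Ox.
  by apply/eqP; rewrite -subr_eq0; apply/eqP; exact: h.
apply/le_anti/andP; split; last exact: sq_ge0.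
apply/lee_addgt0Pr => e e0; rewrite add0e.
have e4 : (0 < (e / 4)%:E)%E by rewrite lte_fin divr_gt0.
have n1 : \forall s \near within `[0, T] (nbhs t), (normL2sq Omega (W s \- W t)%R < (e / 4)%:E)%E.
  exact: (Wc t tT _ (open_ereal_lt' e4)).
have n2 : \forall s \near within `[0, T] (nbhs t), (normL2sq Omega (W' s \- W' t)%R < (e / 4)%:E)%E.
  exact: (W'c t tT _ (open_ereal_lt' e4)).
have Wab : {ae leb, forall s, s \in `]0, T[ -> {ae mu, forall x, Omega x -> W s x = slice w s x} /\
    {ae mu, forall x, Omega x -> W' s x = slice w s x}}.
  case: Wae => N [mN N0 sN]; case: W'ae => M [mM M0 sM].
  exists (N `|` M); split; first exact: measurableU.
    have lN : leb N = 0%E := N0.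
    have lM : leb M = 0%E := M0.
    have U : (leb (N `|` M) <= leb N + leb M)%E by exact: measureU2.
    rewrite lN lM adde0 in U.
    by apply/le_anti/andP; split; [exact: U|exact: measure_ge0].
  move=> s ns; apply: contrapT => /not_orP[nN nM]; apply: ns => sJ; split.
    have h : s \in `]0, T[ -> {ae mu, forall x, Omega x -> W s x = slice w s x} by apply: contrapT => h; apply: nN; exact: sN.
    exact: h.
  have h : s \in `]0, T[ -> {ae mu, forall x, Omega x -> W' s x = slice w s x} by apply: contrapT => h; apply: nM; exact: sM.
  exact: h.
have [s [sJ [ps ps'] [q1 q2]]] := ae_near Wab tT (filterI n1 n2).
have sT : s \in `[0, T] by move: sJ; rewrite !in_itv/= => /andP[? ?]; rewrite !ltW.
have [[mWs _] [mWs' _]] := (WL s sT, W'L s sT).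
have E : normL2sq Omega (W t \- W' t)%R = normL2sq Omega (fun x => (W' s x - W' t x) + - (W s x - W t x)).
  apply: ae_eq_integral => //.
  - by apply/measurable_EFinP; apply: measurable_funX; exact: measurable_funB.
  - apply/measurable_EFinP; apply: measurable_funX; apply: measurable_funD; first exact: measurable_funB.
    by apply: measurableT_comp => //; exact: measurable_funB.
  - move: ps ps'; apply: filterS2 => x h h' Ox; rewrite /= (h Ox) (h' Ox).
    by congr ((_ ^+ 2)%:E); ring.
rewrite E; apply: (le_trans (@sqD_le _ _ _ mu Omega mO (fun x => W' s x - W' t x) (fun x => - (W s x - W t x)) _ _)).
- exact: measurable_funB.
- by apply: measurableT_comp => //; exact: measurable_funB.
have -> : sq mu Omega (fun x => - (W s x - W t x)) = normL2sq Omega (W s \- W t)%R.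
  by apply: eq_integral => x _; rewrite sqrrN.
apply: (@le_trans _ _ (2%:E * (e / 4)%:E + 2%:E * (e / 4)%:E)%E).
  by apply: leeD; apply: lee_pmul => //; rewrite ?sq_ge0 ?lee_fin// ltW.
by rewrite -!EFinM -EFinD lee_fin; lra.
Qed.

Lemma continuous_pairing w W (chi : V -> R) : time_trace Omega T w W -> inL2 Omega chi ->
  {within `[0, T], continuous (fun s => ip mu Omega (W s) chi)}.
Proof.
move=> [WL Wc _] cL; apply/subspace_continuousP => t tT.
apply/cvgrPdist_lt => e e0.
pose Q := ip mu Omega chi chi; have Q0 : 0 <= Q := ip_ge0 _ _ _.
have d0 : (0 < (e ^+ 2 / (Q + 1))%:E)%E by rewrite lte_fin divr_gt0 ?exprn_gt0//; lra.
have n1 : \forall s \near within `[0, T] (nbhs t), (normL2sq Omega (W s \- W t)%R < (e ^+ 2 / (Q + 1))%:E)%E.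
  exact: (Wc t tT _ (open_ereal_lt' d0)).
have n2 : \forall s \near within `[0, T] (nbhs t), s \in `[0, T] by exact: withinT.
move: n1 n2; apply: filterS2 => s N sT.
have dL : L2 mu Omega (fun x => W s x - W t x) by apply: L2B => //; exact: WL.
rewrite distrC -(ipBl mO) ?real_normK//; try exact: WL.
rewrite -(@ltr_pXn2r _ 2) ?nnegrE//; last exact: ltW.
rewrite real_normK ?num_real//; apply: (le_lt_trans (ip_cauchy_schwarz mO dL cL)).
have N' : ip mu Omega (fun x => W s x - W t x) (fun x => W s x - W t x) < e ^+ 2 / (Q + 1).
  by rewrite -lte_fin -(sqE mO).
apply: (@le_lt_trans _ _ (e ^+ 2 / (Q + 1) * Q)); first by rewrite ler_wpM2r// ltW.
rewrite -mulrA gtr_pMr ?exprn_gt0// mulrC ltr_pdivrMr; lra.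
Qed.

Lemma continuous_itv_L2 (a : R -> R) : {within `[0, T], continuous a} -> L2 leb J a.
Proof.
move=> ca; have [M _ hM] := EVT_max (ltW T0) ca; have [m _ hm] := EVT_min (ltW T0) ca.
have sub : J `<=` (`[0, T]%classic : set (measurableTypeR R)).
  by move=> s; rewrite /= !in_itv/= => /andP[? ?]; rewrite !ltW.
have ma : measurable_fun J (a : measurableTypeR R -> measurableTypeR R).
  apply: measurable_funS sub _; first exact: measurable_itv.
  by apply: subspace_continuous_measurable_fun; [exact: measurable_itv|].
apply: (@bounded_L2 _ T T0 a (Num.max `|a M| `|a m|) ma) => s sJ.
have sT : s \in `[0, T] by exact: sub.
have := hM s sT; have := hm s sT => h1 h2.
rewrite ler_norml; apply/andP; split.
  apply: le_trans h1; rewrite lerNl; apply: (@le_trans _ _ `|a m|); last by rewrite le_max lexx orbT.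
  by rewrite -normrN ler_norm.
by apply: (le_trans h2); rewrite le_max ler_norm.
Qed.

(** The spike is nonnegative with integral 1: the pairing is an average of the values of [a] on its
    support. *)
Lemma spike_mean (a : R -> R) m c A e : L2 leb J a -> 0 < m -> 0 <= c -> c + m^-1 <= T ->
  (forall s, c <= s <= c + m^-1 -> J s -> `|a s - A| <= e) -> `|ip leb J a (spike m c) - A| <= e.
Proof.
move=> aL m0 c0 cT h.
have sm : measurable_fun J (spike m c : measurableTypeR R -> measurableTypeR R).
  by apply: measurable_funTS; apply: continuous_measurable_fun; exact: continuous_spike.
have I1 : (\int[leb]_(s in J) (spike m c s)%:E = 1)%E.
  rewrite (FTC_open T0 (is_derive_ramp m c) (@continuous_spike _ m c)).
  rewrite /ramp smooth_step_ge1 ?smooth_step_le0 ?subr0//.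
  - by rewrite sub0r mulrN oppr_le0 mulr_ge0// ltW.
  - by rewrite -(mulfV (lt0r_neq0 m0)) ler_pM2l//; lra.
have sL : L2 leb J (spike m c).
  by apply: continuous_itv_L2; apply: continuous_subspaceT; exact: continuous_spike.
have AL : L2 leb J (fun=> A) by apply: (@bounded_L2 _ T T0 (fun=> A) `|A|).
have dL := L2B mJ aL AL.
have sp0 s : 0 <= spike m c s by rewrite mulr_ge0 ?smooth_step'_ge0// ltW.
have -> : A = ip leb J (fun=> A) (spike m c).
  rewrite /ip; under eq_integral do rewrite EFinM.
  rewrite integralZl//; last by have := L2_mul_integrable mJ (L2_one T0) sL; apply: eq_integrable => // s _; rewrite mul1r.
  by rewrite I1 mule1.
rewrite -(ipBl mJ)// -lee_fin /ip -abse_EFin fineK; last first.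
  by apply: integrable_fin_num => //; exact: L2_mul_integrable.
apply: (le_trans (le_abse_integral _ _ _)) => //.
  by case: (L2_mul_integrable mJ dL sL) => /measurable_int.
apply: (@le_trans _ _ (\int[leb]_(s in J) (e%:E * (spike m c s)%:E))%E); last first.
  rewrite integralZl//; first by rewrite I1 mule1.
  by have := L2_mul_integrable mJ (L2_one T0) sL; apply: eq_integrable => // s _; rewrite mul1r.
apply: ge0_le_integral => //.
- by apply: measurableT_comp => //; apply: (measurable_int leb); exact: L2_mul_integrable.
- by apply: measurable_funeM; apply/measurable_EFinP.
move=> s sJ; rewrite -EFinM lee_fin normrM (ger0_norm (sp0 s)).
have [k|k] := boolP (c <= s <= c + m^-1); first by rewrite ler_wpM2r// h.
by rewrite spike_eq0// !mulr0.
Qed.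

End products.

Section time_tests.
Context {R : realType} {n : nat} (Omega : set 'rV[R]_n) (T : R).
Local Notation V := 'rV[R]_n.
Local Notation V1 := 'rV[R]_n.+1.
Local Notation leb := (@lebesgue_measure R).
Local Notation mu := (lebesgue_rV R n).
Local Notation mu1 := (lebesgue_rV R n.+1).
Local Notation cyl := (cylinder Omega T).
Local Notation J := (`]0, T[%classic : set (measurableTypeR R)).
Hypotheses (oO : open Omega) (T0 : 0 < T).

Let mO : measurable Omega. Proof. exact: measurable_open. Qed.
Let mc : measurable cyl. Proof. exact: measurable_cylinder. Qed.
Let mJ : measurable J. Proof. exact: measurable_itv. Qed.

Lemma smooth_ramp m c : smooth (fun z : V1 => ramp m c (z ord0 ord0)).
Proof. exact: smooth_smooth_step (smoothM (smooth_cst m) (smoothB (smooth_coord R ord0) (smooth_cst c))). Qed.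

Lemma pderiv_time (eta deta : R -> R) : (forall s : R, is_derive s 1 eta (deta s)) ->
  smooth (fun z : V1 => eta (z ord0 ord0)) ->
  pderiv ord0 (fun z : V1 => eta (z ord0 ord0)) = (fun z => deta (z ord0 ord0)).
Proof.
move=> de sE; apply/funext => z.
have h := is_derive_time (z ord0 ord0) (col' ord0 z) (smooth_C1 sE).
have e : (fun t => (fun z : V1 => eta (z ord0 ord0)) (insert_rV ord0 t (col' ord0 z))) = eta.
  by apply/funext => t; rewrite insert_rV_same.
rewrite e insert_rV_col' in h.
have e1 := is_derive_val h; have e2 := is_derive_val (de (z ord0 ord0)).
by transitivity ('D_1 eta (z ord0 ord0)); [rewrite -e1|rewrite e2].
Qed.

Lemma pderiv_time_lift (eta : R -> R) j : smooth (fun z : V1 => eta (z ord0 ord0)) ->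
  pderiv (lift ord0 j) (fun z : V1 => eta (z ord0 ord0)) = fun=> 0.
Proof.
move=> sE; apply/funext => z.
have := pderiv_slice (z ord0 ord0) j (smooth_C1 sE).
have -> : slice (fun z : V1 => eta (z ord0 ord0)) (z ord0 ord0) = fun=> eta (z ord0 ord0).
  by apply/funext => x; rewrite /slice insert_rV_same.
by rewrite pderiv_cst => /(congr1 (@^~ (col' ord0 z))); rewrite /slice insert_rV_col' => <-.
Qed.

Lemma smooth_spike m c : smooth (fun z : V1 => spike m c (z ord0 ord0)).
Proof. rewrite -(pderiv_time (is_derive_ramp m c) (smooth_ramp m c)); exact: smooth_pderiv (smooth_ramp m c). Qed.

Lemma test_product (eta : R -> R) (chi : V -> R) al be : 0 < al -> be < T ->
  smooth (fun z : V1 => eta (z ord0 ord0)) -> (forall s, eta s != 0 -> al <= s <= be) ->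
  test_function Omega chi -> test_function cyl (fun z => eta (z ord0 ord0) * chi (col' ord0 z)).
Proof.
move=> a0 bT sE sup [sc cK Ksub].
pose K := closure [set x | chi x != 0].
have [M [_ hM]] := compact_bounded cK.
have cA : compact [set z : V1 | (al <= z ord0 ord0 <= be) /\ K (col' ord0 z)].
  apply: (@subclosed_compact _ _ (closed_box (insert_rV ord0 al (const_mx (- (M + 1)))) (insert_rV ord0 be (const_mx (M + 1))))); last 1 first.
  - move=> z [zt Kz] i; have := hM (M + 1) _ _ Kz; rewrite ltrDl ltr01 => /(_ isT) h.
    case: (unliftP ord0 i) => [j ->|->]; last by rewrite !insert_rV_same.
    rewrite !insert_rV_lift !mxE -ler_norml; apply: le_trans h.
    by have := coord_le_norm (col' ord0 z) j; rewrite mxE.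
  - apply: closedI.
      have -> : (fun z : V1 => is_true (al <= z ord0 ord0 <= be)) = (fun z : V1 => z ord0 ord0) @^-1` `[al, be].
        by apply/seteqP; split => z; rewrite /= in_itv.
      apply: closed_comp; last exact: itv_closed.
      by move=> z _; exact: (@smooth_continuous _ _ _ (smooth_coord R ord0)).
    apply: (@closed_comp _ _ (fun z : V1 => col' ord0 z)); last exact: closed_closure.
    by move=> z _; exact: continuous_col'.
  - exact: compact_closed_box.
apply: (@test_functionP _ _ cyl _ _ (smoothM sE (smooth_cylindrical sc)) cA).
- move=> z; rewrite mulf_eq0 negb_or => /andP[e c]; split; first exact: sup.
  exact: subset_closure.
- move=> z [/andP[h1 h2] Kz]; split; first exact: Ksub.
  by apply/andP; split; lra.
Qed.

Lemma L2_one_compact (K : set V) : compact K -> L2 mu K (fun=> 1).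
Proof.
move=> cK; split=> //; have mK := measurable_compact cK.
rewrite /sq (@eq_integral _ _ _ mu K (fun=> 1%E)); last by move=> x _; rewrite expr1n.
by rewrite integral_cst// mul1e; exact: compact_fin_measure.
Qed.

Lemma L2_L1loc (f : V -> R) : inL2 Omega f -> inL1loc Omega f.
Proof.
move=> [mf fL] K cK KO.
have mK := measurable_compact cK.
have Kf : L2 mu K f.
  split; first exact: measurable_funS KO mf.
  apply: le_lt_trans fL; apply: ge0_subset_integral => //.
    by apply/measurable_EFinP; exact: measurable_funX.
  by move=> x _; rewrite lee_fin sqr_ge0.
have := L2_mul_integrable mK (L2_one_compact cK) Kf; apply: eq_integrable => // x _.
by rewrite mul1r.
Qed.

Lemma test_inL2 (chi : V -> R) : test_function Omega chi -> inL2 Omega chi.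
Proof.
move=> tchi; have [sc _ _] := tchi; have cc := @smooth_continuous _ _ _ sc.
split; first exact: continuous_measurable.
have l1 : inL1loc Omega (fun=> 1 : R).
  move=> K cK _; have mK := measurable_compact cK.
  have := L2_mul_integrable mK (L2_one_compact cK) (L2_one_compact cK); apply: eq_integrable => // x _.
  by rewrite mul1r.
have := integrable_lty mO (test_integrable oO (L1locM cc l1) tchi); apply: le_lt_trans.
by rewrite le_eqVlt; apply/orP; left; apply/eqP; apply: eq_integral => x _; rewrite mulr1.
Qed.

Lemma inL2_time_product (kap : R -> R) K (chi : V -> R) : measurable_fun setT (kap : measurableTypeR R -> measurableTypeR R) ->
  (forall s, `|kap s| <= K) -> continuous chi -> inL2 Omega chi ->
  inL2 cyl (fun z => kap (z ord0 ord0) * chi (col' ord0 z)).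
Proof.
move=> mk kK cc cL.
have ccol : continuous (fun z : V1 => chi (col' ord0 z)).
  by move=> z; apply: (@continuous_comp _ _ _ (fun z : V1 => col' ord0 z) chi); [exact: continuous_col'|exact: cc].
have cL1 : inL2 cyl (fun z => chi (col' ord0 z)).
  split; first exact: continuous_measurable.
  rewrite /normL2sq (ge0_integral_cyl_time mO); last 2 first.
  - by apply/measurable_EFinP; apply: measurable_funX; exact: continuous_measurable.
  - by move=> z; rewrite lee_fin sqr_ge0.
  rewrite (@eq_integral _ _ _ leb J (fun=> normL2sq Omega chi)); last first.
    by move=> s _; apply: eq_integral => x _; rewrite col'_insert_rV.
  have fin : normL2sq Omega chi \is a fin_num by rewrite ge0_fin_numE ?sq_ge0//; case: cL.
  have lJ : leb J = T%:E by rewrite lebesgue_measure_itv/= lte_fin T0 -EFinB subr0.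
  by rewrite -(fineK fin) integral_cst//= [X in (_ * X)%E]lJ -EFinM ltry.
apply: (@L2_bounded_mul _ _ _ mu1 cyl mc (fun z : V1 => kap (z ord0 ord0)) K) => //.
apply: measurable_funTS.
exact: (measurableT_comp mk (@measurable_coord R n.+1 ord0)).
Qed.

(** For test functions that are products, the space-time integral becomes a pairing in time with the
    continuous function [ip (W s) chi]. This is how information at almost every time becomes
    information at every time. *)
Lemma integral_pairing w W (chi : V -> R) (kap : R -> R) K : inL2 cyl w -> time_trace Omega T w W ->
  continuous chi -> inL2 Omega chi -> measurable_fun setT (kap : measurableTypeR R -> measurableTypeR R) ->
  (forall s, `|kap s| <= K) ->
  (\int[mu1]_(z in cyl) (w z * (kap (z ord0 ord0) * chi (col' ord0 z)))%:E =
   (ip leb J (fun s => ip mu Omega (W s) chi) kap)%:E)%E.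
Proof.
move=> wL wtr cc cL mk kK.
have kcL := inL2_time_product mk kK cc cL.
have iI := L2_mul_integrable mc wL kcL.
have mg := measurable_int _ iI.
have aL := continuous_itv_L2 T0 (continuous_pairing oO wtr cL).
have kL : L2 leb J kap by apply: (@bounded_L2 _ T T0 kap K) => //; exact: measurable_funTS.
rewrite (integral_cyl_time mO iI) -(ipE mJ aL kL).
pose g (z : V1) := (w z * (kap (z ord0 ord0) * chi (col' ord0 z)))%:E.
have mchi : measurable_fun Omega chi by exact: continuous_measurable.
case: (wtr) => WL _ wae.
apply: ae_eq_integral => //.
- rewrite (_ : (fun s => _) = fun s : measurableTypeR R => (\int[mu]_(x in Omega) (g^\+%E (insert_rV ord0 (s : R) x)) -
      \int[mu]_(x in Omega) (g^\-%E (insert_rV ord0 (s : R) x)))%E); last first.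
    by apply/funext => s; rewrite [LHS]integralE; congr (_ - _)%E; apply: eq_integral => x _; rewrite ?funeposE ?funenegE.
  apply: emeasurable_funB; apply: (measurable_integral_slice mO) => //.
  + exact: measurable_funepos.
  + exact: measurable_funeneg.
- by apply/measurable_EFinP; apply: measurable_funM; [case: aL|case: kL].
case: wae => N [mN N0 sN]; exists N; split => // s nh; apply: sN => h; apply: nh => sJ.
have {}h := h sJ.
have sT : s \in `[0, T] by move: (sJ); rewrite /= !in_itv/= => /andP[? ?]; rewrite !ltW.
have WsL := WL s sT.
transitivity (\int[mu]_(x in Omega) ((W s x * chi x)%:E * (kap s)%:E))%E; last first.
  rewrite integralZr; [|exact: mO|exact: L2_mul_integrable].
  by rewrite (ipE mO WsL cL) EFinM.
apply: ae_eq_integral => //.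
- exact: (measurable_slice mO mg sJ).
- by apply: emeasurable_funM; [apply/measurable_EFinP; apply: measurable_funM => //; case: WsL|exact: measurable_cst].
have := h; apply: filterS => x hx Ox.
by rewrite insert_rV_same col'_insert_rV (hx Ox) /slice -EFinM; congr EFin; ring.
Qed.

Lemma spike_bounded (m c : R) : 0 < m -> exists K : R, forall s, `|spike m c s| <= K.
Proof.
move=> m0; have cm : c <= c + m^-1 by rewrite lerDl invr_ge0 ltW.
have [r _ hr] := EVT_max cm (continuous_subspaceT (@continuous_spike _ m c)).
exists `|spike m c r| => s; have [h|h] := boolP (c <= s <= c + m^-1); last by rewrite spike_eq0// normr0.
have h' : s \in `[c, c + m^-1] by rewrite in_itv.
rewrite (ger0_norm (_ : 0 <= spike m c s)); last by rewrite mulr_ge0 ?smooth_step'_ge0// ltW.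
exact: le_trans (hr s h') (ler_norm _).
Qed.

Lemma measurable_spike m c : measurable_fun setT (spike m c : measurableTypeR R -> measurableTypeR R).
Proof. by apply: continuous_measurable_fun; exact: continuous_spike. Qed.

(** Tested against a fixed [psi], the defect of the identity is a continuous function of time. Were
    it nonzero at [t], it would stay close to that value on an interval, whereas its mean against a
    spike in that interval is 0 by the space-time identity. *)
Lemma weak_pderiv_trace i u ui U W : weak_pderiv cyl (lift ord0 i) u ui ->
  inL2 cyl u -> inL2 cyl ui -> time_trace Omega T u U -> time_trace Omega T ui W ->
  forall t : R, t \in `[0, T] -> weak_pderiv Omega i (U t) (W t).
Proof.
move=> [_ _ wp] uL uiL uU uW t tT.
case: (uU) => UL _ _; case: (uW) => WL _ _.
split; [exact: L2_L1loc (UL t tT)|exact: L2_L1loc (WL t tT)|move=> psi tpsi].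
have [sp _ _] := tpsi; have [sdp _ _] := test_pderiv i tpsi.
have pL := test_inL2 tpsi; have dpL := test_inL2 (test_pderiv i tpsi).
have cp := @smooth_continuous _ _ _ sp; have cdp := @smooth_continuous _ _ _ sdp.
pose aU s := ip mu Omega (U s) (pderiv i psi); pose aW s := ip mu Omega (W s) psi.
have caU : {within `[0, T], continuous aU} := continuous_pairing oO uU dpL.
have caW : {within `[0, T], continuous aW} := continuous_pairing oO uW pL.
have aUL := continuous_itv_L2 T0 caU; have aWL := continuous_itv_L2 T0 caW.
rewrite (ipE mO (UL t tT) dpL) (ipE mO (WL t tT) pL) -EFinN; congr EFin.
apply/eqP; rewrite -subr_eq0 opprK; apply/eqP.
rewrite -[ip _ _ (U t) _]/(aU t) -[ip _ _ (W t) _]/(aW t).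
apply: contrapT => /eqP A0; set A := aU t + aW t in A0.
have Apos : 0 < `|A| / 2 by rewrite divr_gt0 ?normr_gt0.
have nb : \forall s \near within `[0, T] (nbhs t), `|A - (aU s + aW s)| < `|A| / 2.
  have h1 : aU s @[s --> within `[0, T] (nbhs t)] --> aU t by exact: ((subspace_continuousP _ _).1 caU).
  have h2 : aW s @[s --> within `[0, T] (nbhs t)] --> aW t by exact: ((subspace_continuousP _ _).1 caW).
  have h3 : aU s + aW s @[s --> within `[0, T] (nbhs t)] --> A by exact: cvgD h1 h2.
  by move: h3 => /cvgrPdist_lt/(_ _ Apos).
have [a [b [a0 ab bT He]]] := near_itv T0 tT nb.
(* The support of the spike is the middle half of [(a, b)], so that the test function is compactly
   supported in the open time interval. *)
pose m := 2 / (b - a); pose c := a + (b - a) / 4.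
have m0 : 0 < m by rewrite divr_gt0// subr_gt0.
have mV : m^-1 = (b - a) / 2 by rewrite /m invf_div.
have [K sK] := spike_bounded c m0.
have sc : smooth (fun z : V1 => spike m c (z ord0 ord0)) := smooth_spike m c.
have tt : test_function cyl (fun z => spike m c (z ord0 ord0) * psi (col' ord0 z)).
  apply: (@test_product _ _ c (c + m^-1)) => //; rewrite ?mV /c; [lra|lra|].
  move=> s h; apply: contraNT h => h; apply/eqP; apply: spike_eq0 => //.
  by rewrite mV /c.
have := wp _ tt.
have -> : pderiv (lift ord0 i) (fun z => spike m c (z ord0 ord0) * psi (col' ord0 z)) =
    (fun z => spike m c (z ord0 ord0) * pderiv i psi (col' ord0 z)).
  apply/funext => z; rewrite pderivM; last 2 first.
  - exact: (@smooth_derivable _ _ _ _ _ sc).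
  - exact: (@smooth_derivable _ _ _ _ _ (smooth_cylindrical sp)).
  by rewrite (pderiv_time_lift _ sc) mulr0 addr0 (pderiv_cylindrical _ sp) liftK.
rewrite (integral_pairing uL uU cdp dpL (measurable_spike m c) sK).
rewrite (integral_pairing uiL uW cp pL (measurable_spike m c) sK) -EFinN => -[E].
have sL : L2 leb J (spike m c) by apply: (@bounded_L2 _ T T0 _ K) => //; exact: measurable_funTS (measurable_spike m c).
have Z : ip leb J (fun s => aU s + aW s) (spike m c) = 0 by rewrite (ipDl mJ)// E addNr.
have := @spike_mean _ T T0 (fun s => aU s + aW s) m c A (`|A| / 2) (L2D mJ aUL aWL) m0 _ _ _.
rewrite Z sub0r normrN => H.
suff : `|A| <= `|A| / 2 by lra.
apply: H; rewrite ?mV /c; [lra|lra|move=> s /andP[s1 s2] sJ].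
rewrite distrC ltW//; apply: He; apply/andP; split; lra.
Qed.

Lemma normL2sq_tmean r : inL2 cyl r -> (normL2sq Omega (tmean T r) <= (T^-1)%:E * normL2sq cyl r)%E.
Proof.
move=> rL.
have zL : inL2 cyl (fun=> 0).
  by split => //; rewrite /normL2sq integral0_eq// => z _; rewrite expr0n.
have z0 x : tmean T (fun=> 0) x = 0.
  by rewrite /tmean /ip integral0_eq ?mulr0//= => s _; rewrite mul0r.
have lJ : leb J = T%:E by rewrite lebesgue_measure_itv/= lte_fin T0 -EFinB subr0.
have c1 : ip leb J (fun=> 1) (fun=> 1) <= T.
  rewrite /ip (@eq_integral _ _ _ leb J (fun=> 1%E)); last by move=> s _; rewrite mulr1.
  by rewrite integral_cst// mul1e [X in fine X]lJ.
have := @tmean_sub_le _ _ _ _ oO T0 r (fun=> 0) r (fun=> 1) 1 T rL zL rL _ _ c1 _.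
have -> : T^-1 ^+ 2 * T = T^-1 by rewrite expr2 -mulrA mulVf ?mulr1// gt_eqF.
have -> : normL2sq Omega (tmean T r \- tmean T (fun=> 0))%R = normL2sq Omega (tmean T r).
  by apply: eq_integral => x _; rewrite /= z0 subr0.
by apply=> //; [move=> s _; rewrite normr1|move=> z _; rewrite subr0 mul1r].
Qed.

Lemma inL2_tmean r : inL2 cyl r -> inL2 Omega (tmean T r).
Proof.
move=> rL; split; first by apply: measurable_tmean => //; case: rL.
apply: (le_lt_trans (normL2sq_tmean rL)); case: rL => _ h.
by rewrite lte_mul_pinfty// ?lee_fin ?invr_ge0 ?ltW.
Qed.

Lemma tmean_pairing r (chi : V -> R) : inL2 cyl r -> continuous chi -> inL2 Omega chi ->
  (\int[mu1]_(z in cyl) (r z * (1 * chi (col' ord0 z)))%:E = (ip mu Omega (fun x => T * tmean T r x) chi)%:E)%E.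
Proof.
move=> rL cc cL.
have kcL : inL2 cyl (fun z => 1 * chi (col' ord0 z)).
  by apply: (@inL2_time_product (fun=> 1) 1) => // s; rewrite normr1.
have iI := L2_mul_integrable mc rL kcL.
have mg := measurable_int _ iI.
have tL := L2Z mO T (inL2_tmean rL).
rewrite (integral_cyl_space mO iI) -(ipE mO tL cL).
pose g (z : V1) := (r z * (1 * chi (col' ord0 z)))%:E.
apply: ae_eq_integral => //.
- rewrite (_ : (fun x => _) = fun x : V => (\int[leb]_(s in J) (g^\+%E (insert_rV ord0 (s : R) x)) -
      \int[leb]_(s in J) (g^\-%E (insert_rV ord0 (s : R) x)))%E); last first.
    by apply/funext => x; rewrite [LHS]integralE; congr (_ - _)%E; apply: eq_integral => s _; rewrite ?funeposE ?funenegE.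
  apply: emeasurable_funB; apply: (measurable_time_integral mO) => //.
  + exact: measurable_funepos.
  + exact: measurable_funeneg.
- by apply/measurable_EFinP; apply: measurable_funM; [case: tL|case: cL].
have := inL2_time_slice oO rL; apply: filterS => x xL Ox.
transitivity (\int[leb]_(s in J) ((r (insert_rV ord0 s x) * 1)%:E * (chi x)%:E))%E.
  by apply: eq_integral => s _; rewrite col'_insert_rV -EFinM; congr EFin; ring.
have oL := @L2_one R T T0.
have {}xL := xL Ox; have iJ := L2_mul_integrable mJ xL oL.
rewrite (integralZr mJ iJ).
by rewrite (ipE mJ xL oL) -EFinM /tmean mulrA mulfV ?gt_eqF// mul1r.
Qed.

(** The difference [U t - U 0] equals almost everywhere the integral [G] of [u0] over [(0, t)],
    obtained weakly. Cauchy-Schwarz in time and the inequality [(a + b)^2 <= 2 a^2 + 2 b^2] then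
    give the constants 2 and [2 T]. *)
Lemma trace_le u u0 U : weak_pderiv cyl ord0 u u0 -> inL2 cyl u -> inL2 cyl u0 ->
  time_trace Omega T u U -> forall t : R, t \in `[0, T] ->
  (normL2sq Omega (U t) <= 2%:E * normL2sq Omega (U 0%R) + (2 * T)%:E * normL2sq cyl u0)%E.
Proof.
move=> [_ _ wp] uL u0L uU t; rewrite in_itv/= => /andP[].
have s0 f : (0 <= normL2sq Omega f)%E by exact: sq_ge0.
have s1 : (0 <= (2 * T)%:E * normL2sq cyl u0)%E.
  by rewrite mule_ge0 ?sq_ge0// lee_fin mulr_ge0// ltW.
rewrite le_eqVlt => /predU1P[<- _|t0 tT].
  apply: (@le_trans _ _ (2%:E * normL2sq Omega (U 0%R))%E); last by rewrite leeDl.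
  by rewrite -[X in (X <= _)%E]mul1e lee_wpmul2r// lee_fin ler1n.
case: (uU) => UL _ _.
have tI : t \in `[0, T] by rewrite in_itv/= tT ltW.
have zI : 0 \in `[0, T] by rewrite in_itv/= lexx ltW.
pose kap (s : R) : R := (s < t)%R%:R.
have mkap : measurable_fun setT (kap : measurableTypeR R -> measurableTypeR R).
  have -> : kap = \1_(`]-oo, t[%classic : set R).
    by apply/funext => s; rewrite indicE mem_setE in_itv.
  by apply: measurable_indic; exact: measurable_itv.
have kap1 s : `|kap s| <= 1 by rewrite /kap; case: (_ < _)%R; rewrite ?normr1 ?normr0.
pose g (z : V1) := kap (z ord0 ord0) * u0 z.
have mkz : measurable_fun cyl (fun z : V1 => kap (z ord0 ord0)).
  by apply: measurable_funTS; exact: (measurableT_comp mkap (@measurable_coord R n.+1 ord0)).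
have gL : inL2 cyl g by apply: (@L2_bounded_mul _ _ _ mu1 cyl mc _ 1 _ mkz) => // z _; exact: kap1.
pose G x := T * tmean T g x.
have GL : inL2 Omega G := L2Z mO T (inL2_tmean gL).
have UtL := UL t tI; have U0L := UL 0 zI.
have H : {ae mu, forall x, Omega x -> U t x - U 0 x - G x = 0}.
  apply: (fundamental_lemma oO (L2_L1loc (L2B mO (L2B mO UtL U0L) GL))) => chi tchi.
  have [schi _ _] := tchi; have cc := @smooth_continuous _ _ _ schi; have cL := test_inL2 tchi.
  rewrite (ipE mO (L2B mO (L2B mO UtL U0L) GL) cL) (ipBl mO (L2B mO UtL U0L) GL cL) (ipBl mO UtL U0L cL).
  apply/eqP; rewrite eqe subr_eq0; apply/eqP.
  pose b s := ip mu Omega (U s) chi.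
  have cb : {within `[0, T], continuous b} := continuous_pairing oO uU cL.
  have bL := continuous_itv_L2 T0 cb.
  (* The bound [h k <= t / 4] keeps the rise of [eta] on [[h, 2h]] before its fall on
     [[t - 2h, t - h]]. *)
  pose h k : R := t / 4 * harmonic k.
  have h0 k : 0 < h k by rewrite mulr_gt0 ?divr_gt0// harmonic_gt0.
  have h4 k : h k <= t / 4 by rewrite ger_pMr ?divr_gt0// invf_le1 ?ltr0n// ler1n.
  have ch : h k @[k --> \oo] --> (0 : R).
    by rewrite -[X in _ --> X](mulr0 (t / 4)); apply: cvgM; [exact: cvg_cst|exact: cvg_harmonic].
  pose m k := (h k)^-1.
  have m0 k : 0 < m k by rewrite invr_gt0.
  have mV k : (m k)^-1 = h k by rewrite invrK.
  pose eta k s := ramp (m k) (h k) s - ramp (m k) (t - 2 * h k) s.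
  have seta k : smooth (fun z : V1 => eta k (z ord0 ord0)) by exact: smoothB (smooth_ramp _ _) (smooth_ramp _ _).
  have detak k (s : R) : is_derive s 1 (eta k) (spike (m k) (h k) s - spike (m k) (t - 2 * h k) s).
    exact: (is_deriveB (is_derive_ramp (m k) (h k) s) (is_derive_ramp (m k) (t - 2 * h k) s)).
  have etas k s : eta k s != 0 -> h k <= s <= t - h k.
    have := h4 k; have := h0 k => hk hk4.
    apply: contraNT; rewrite negb_and -!ltNge /eta => /orP[s1'|s1']; apply/eqP.
      by rewrite !ramp_eq0 ?subr0//; lra.
    by rewrite !ramp_eq1 ?mV ?subrr//; lra.
  have tt k : test_function cyl (fun z => eta k (z ord0 ord0) * chi (col' ord0 z)).
    by apply: (test_product (h0 k) _ (seta k) (etas k) tchi); have := h0 k; lra.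
  have key k : (\int[mu1]_(z in cyl) (u0 z * (eta k (z ord0 ord0) * chi (col' ord0 z)))%:E =
      (ip leb J b (spike (m k) (t - 2 * h k)) - ip leb J b (spike (m k) (h k)))%:E)%E.
    have [K1 K1P] := spike_bounded (h k) (m0 k); have [K2 K2P] := spike_bounded (t - 2 * h k) (m0 k).
    have := wp _ (tt k).
    have -> : pderiv ord0 (fun z => eta k (z ord0 ord0) * chi (col' ord0 z)) =
        (fun z => (spike (m k) (h k) (z ord0 ord0) - spike (m k) (t - 2 * h k) (z ord0 ord0)) * chi (col' ord0 z)).
      apply/funext => z; rewrite pderivM; last 2 first.
      - exact: (@smooth_derivable _ _ _ _ _ (seta k)).
      - exact: (@smooth_derivable _ _ _ _ _ (smooth_cylindrical schi)).
      by rewrite (pderiv_time (detak k) (seta k)) (pderiv_cylindrical _ schi) unlift_none mulr0 add0r mulrC.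
    rewrite (@integral_pairing u U chi (fun s => spike (m k) (h k) s - spike (m k) (t - 2 * h k) s) (K1 + K2) uL uU cc cL); last 2 first.
    - exact: (measurable_funB (measurable_spike _ _) (measurable_spike _ _)).
    - by move=> s; rewrite (le_trans (ler_normB _ _))// lerD.
    have L1 : L2 leb J (spike (m k) (h k)) by apply: (@bounded_L2 _ T T0 _ K1) => //; exact: measurable_funTS (measurable_spike _ _).
    have L2' : L2 leb J (spike (m k) (t - 2 * h k)) by apply: (@bounded_L2 _ T T0 _ K2) => //; exact: measurable_funTS (measurable_spike _ _).
    have e1 : ip leb J (fun s => spike (m k) (h k) s - spike (m k) (t - 2 * h k) s) b =
        ip leb J b (spike (m k) (h k)) - ip leb J b (spike (m k) (t - 2 * h k)).
      by rewrite (ipBl mJ L1 L2' bL); congr (_ - _); exact: ipC.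
    rewrite ipC e1 => E.
    by rewrite -[LHS]oppeK -E -EFinN opprB.
  (* The two spikes in the derivative of [eta] concentrate at 0 and at [t], so that their pairings
     with the continuous function [b] tend to its values there. *)
  have spikes c0 (tau : R) : tau \in `[0, T] -> (forall k, 0 <= c0 k) -> (forall k, c0 k + h k <= T) ->
      (forall k s, c0 k <= s <= c0 k + h k -> `|tau - s| <= 2 * h k) ->
      ip leb J b (spike (m k) (c0 k)) @[k --> \oo] --> b tau.
    move=> tauI c00 c0T c0s; apply/cvgrPdist_le => e e0.
    have h1 : b s @[s --> within `[0, T] (nbhs tau)] --> b tau by exact: ((subspace_continuousP _ _).1 cb).
    have /nbhs_ballP[d /= d0 Hd] : \forall s \near within `[0, T] (nbhs tau), `|b tau - b s| <= e.
      by move: h1 => /cvgrPdist_le/(_ _ e0).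
    have d2 : 0 < d / 2 by rewrite divr_gt0.
    have : \forall k \near \oo, `|0 - h k| < d / 2 by move: ch => /cvgrPdist_lt/(_ _ d2).
    apply: filterS => k; rewrite sub0r normrN (gtr0_norm (h0 k)) => hd.
    rewrite distrC; apply: (spike_mean T0 bL (m0 k) (c00 k)); rewrite ?mV//.
    move=> s sk sJ; rewrite distrC; apply: Hd.
      rewrite -ball_normE/=; apply: (le_lt_trans (c0s k s sk)).
      by rewrite mulrC -ltr_pdivlMr.
    by move: sJ; rewrite /= !in_itv/= => /andP[? ?]; rewrite !ltW.
  have p1 : ip leb J b (spike (m k) (h k)) @[k --> \oo] --> b 0.
    apply: (spikes h) => // k; have := h0 k; have := h4 k; [lra|lra|].
    by move=> hk4 hk0 s /andP[a1 a2]; rewrite sub0r normrN ger0_norm; lra.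
  have p2 : ip leb J b (spike (m k) (t - 2 * h k)) @[k --> \oo] --> b t.
    apply: (spikes (fun k => t - 2 * h k)) => // k; have := h0 k; have := h4 k; [lra|lra|].
    by move=> hk4 hk0 s /andP[a1 a2]; rewrite ger0_norm; lra.
  have kcL : inL2 cyl (fun z => 1 * chi (col' ord0 z)).
    by apply: (@inL2_time_product (fun=> 1) 1) => // s; rewrite normr1.
  have iD := integrable_abse (L2_mul_integrable mc u0L kcL).
  have hm k : measurable_fun cyl (fun z => u0 z * (eta k (z ord0 ord0) * chi (col' ord0 z))).
    apply: measurable_funM; first by case: u0L.
    by apply: continuous_measurable => //; apply: (@smooth_continuous _ _ _ (smoothM (seta k) (smooth_cylindrical schi))).
  have hp z : cyl z -> u0 z * (eta k (z ord0 ord0) * chi (col' ord0 z)) @[k --> \oo] --> g z * (1 * chi (col' ord0 z)).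
    move=> [_ /andP[z0 zT]]; apply: cvg_near_cst.
    have [zt|zt] := ltP (z ord0 ord0) t.
      have a1 : 0 < z ord0 ord0 / 2 by rewrite divr_gt0.
      have a2 : 0 < (t - z ord0 ord0) / 2 by rewrite divr_gt0// subr_gt0.
      have n1 : \forall k \near \oo, `|0 - h k| < z ord0 ord0 / 2 by move: ch => /cvgrPdist_lt/(_ _ a1).
      have n2 : \forall k \near \oo, `|0 - h k| < (t - z ord0 ord0) / 2 by move: ch => /cvgrPdist_lt/(_ _ a2).
      move: n1 n2; apply: filterS2 => k; rewrite sub0r normrN (gtr0_norm (h0 k)) => b1 b2.
      have r1 : ramp (m k) (h k) (z ord0 ord0) = 1 by apply: ramp_eq1; rewrite ?mV//; lra.
      have r2 : ramp (m k) (t - 2 * h k) (z ord0 ord0) = 0 by apply: ramp_eq0 => //; lra.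
      by rewrite /g /kap zt /eta r1 r2 /=; ring.
    apply: nearW => k; have hk4 := h4 k; have hk0 := h0 k.
    rewrite /g /kap ltNge zt /= /eta !ramp_eq1 ?mV//; [by rewrite subrr !mul0r mulr0|lra|lra].
  have hb k z : cyl z -> `|u0 z * (eta k (z ord0 ord0) * chi (col' ord0 z))| <= `|u0 z * (1 * chi (col' ord0 z))|.
    move=> zc; rewrite normrM [leRHS]normrM ler_wpM2l// mul1r normrM ler_piMl//.
    have /andP[a1 a2] := smooth_step_itv (m k * (z ord0 ord0 - h k)).
    have /andP[b1 b2] := smooth_step_itv (m k * (z ord0 ord0 - (t - 2 * h k))).
    by rewrite /eta /ramp ler_norml; apply/andP; split; lra.
  have [_ lim] := @dominated_cvg_real _ _ _ mu1 cyl _ _ _ mc hm hp iD hb.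
  have lim' : (ip leb J b (spike (m k) (t - 2 * h k)) - ip leb J b (spike (m k) (h k)))%:E @[k --> \oo] -->
      (ip mu Omega G chi)%:E.
    by move: lim; rewrite (tmean_pairing gL cc cL); under eq_fun do rewrite key.
  have /fine_cvgP[_ l1] := lim'.
  exact: (cvg_unique _ (cvgB p2 p1) l1).
have mG := GL.1; have mU0 := U0L.1; have mUt := UtL.1.
have -> : normL2sq Omega (U t) = sq mu Omega (fun x => U 0 x + G x).
  apply: ae_eq_integral => //.
  - by apply/measurable_EFinP; exact: measurable_funX.
  - by apply/measurable_EFinP; apply: measurable_funX; exact: measurable_funD.
  move: H; apply: filterS => x hx Ox; congr ((_ ^+ 2)%:E).
  by have := hx Ox; lra.
apply: (le_trans (sqD_le mu mO mU0 mG)); apply: leeD; first exact: lexx.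
rewrite EFinM -muleA; apply: lee_wpmul2l; first by rewrite lee_fin.
rewrite (sqZ mu mO T (inL2_tmean gL).1).
apply: (@le_trans _ _ ((T ^+ 2)%:E * ((T^-1)%:E * normL2sq cyl g))%E).
  by apply: lee_wpmul2l; [rewrite lee_fin sqr_ge0|exact: normL2sq_tmean].
rewrite muleA -EFinM expr2 mulfK ?gt_eqF//; apply: lee_wpmul2l; first by rewrite lee_fin ltW.
apply: (le_sq mu1 mc gL.1 u0L.1) => z _.
by rewrite normrM ler_piMl.
Qed.

End time_tests.

(** * Passage to the limit *)

Section sobolev_norms.
Context {R : realType} {n : nat} (Omega : set 'rV[R]_n).
Local Notation V := 'rV[R]_n.
Local Notation mu := (lebesgue_rV R n).
Hypothesis oO : open Omega.
Let mO : measurable Omega. Proof. exact: measurable_open. Qed.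

Lemma eq_ae_normL2sq (f g : V -> R) : measurable_fun Omega f -> measurable_fun Omega g ->
  {ae mu, forall x, Omega x -> f x = g x} -> normL2sq Omega f = normL2sq Omega g.
Proof.
move=> mf mg fg; apply: ae_eq_integral => //.
- by apply/measurable_EFinP; exact: measurable_funX.
- by apply/measurable_EFinP; exact: measurable_funX.
by move: fg; apply: filterS => x h Ox; rewrite (h Ox).
Qed.

(** Weak derivatives are unique almost everywhere, so that all members of the set under the infimum
    coincide. *)
Lemma normH1sqE (f : V -> R) df : inH1 Omega f df ->
  normH1sq Omega f = (normL2sq Omega f + \sum_i normL2sq Omega (df i))%E.
Proof.
move=> fH; apply/le_anti/andP; split; first by apply: ereal_inf_lbound; exists df.
apply: le_ereal_inf_tmp => _ [dg [gL gH] ->].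
apply: leeD; first exact: lexx.
rewrite le_eqVlt; apply/orP; left; apply/eqP; apply: eq_bigr => i _.
have [_ dfH] := fH; have [[mdf _] wf] := dfH i; have [[mdg _] wg] := gH i.
exact: eq_ae_normL2sq (weak_pderiv_unique oO wf wg).
Qed.

Lemma weak_pderiv_ae (f g : V -> R) i df : inL2 Omega f -> inL2 Omega g ->
  {ae mu, forall x, Omega x -> f x = g x} -> weak_pderiv Omega i f df -> weak_pderiv Omega i g df.
Proof.
move=> fL gL fg [fl dfl H]; split; [exact: (L2_L1loc oO gL)|exact: dfl|move=> psi tpsi].
rewrite -(H psi tpsi); apply: ae_eq_integral => //.
- exact: measurable_int (test_integrable oO (L2_L1loc oO gL) (test_pderiv i tpsi)).
- exact: measurable_int (test_integrable oO fl (test_pderiv i tpsi)).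
by move: fg; apply: filterS => x h Ox; rewrite (h Ox).
Qed.

(** Expand the square norm of [W s - W t]: it tends to 0, and the cross term is a pairing with the
    fixed [W t]. Continuity of the energy is what makes its maximum attained. *)
Lemma continuous_trace_norm T (w : 'rV[R]_n.+1 -> R) W : time_trace Omega T w W ->
  {within `[0, T], continuous (fun s => ip mu Omega (W s) (W s))}.
Proof.
move=> wW; case: (wW) => WL Wc _; apply/subspace_continuousP => t tT.
have WtL := WL t tT.
have c1 : ip mu Omega (W s) (W t) @[s --> within `[0, T] (nbhs t)] --> ip mu Omega (W t) (W t).
  exact: ((subspace_continuousP _ _).1 (continuous_pairing oO wW WtL)).
have c2 : fine (normL2sq Omega (W s \- W t)%R) @[s --> within `[0, T] (nbhs t)] --> (0 : R).
  by apply: (fine_cvg (Wc t tT)).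
have E : \forall s \near within `[0, T] (nbhs t),
    fine (normL2sq Omega (W s \- W t)%R) + (ip mu Omega (W s) (W t) *+ 2 - ip mu Omega (W t) (W t)) = ip mu Omega (W s) (W s).
  have n2 : \forall s \near within `[0, T] (nbhs t), s \in `[0, T] by exact: withinT.
  move: n2; apply: filterS => s sT; have WsL := WL s sT; have dL := L2B mO WsL WtL.
  have -> : normL2sq Omega (W s \- W t)%R = (ip mu Omega (fun x => W s x - W t x) (fun x => W s x - W t x))%:E.
    by rewrite -(sqE mO dL).
  rewrite /= (ipBl mO WsL WtL dL) (ipC mu Omega (W s) (fun x => W s x - W t x)) (ipC mu Omega (W t) (fun x => W s x - W t x)).
  by rewrite (ipBl mO WsL WtL WsL) (ipBl mO WsL WtL WtL) (ipC mu Omega (W t) (W s)) mulr2n; ring.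
have c3 : fine (normL2sq Omega (W s \- W t)%R) + (ip mu Omega (W s) (W t) *+ 2 - ip mu Omega (W t) (W t))
    @[s --> within `[0, T] (nbhs t)] --> ip mu Omega (W t) (W t).
  rewrite [X in _ --> X](_ : _ = 0 + (ip mu Omega (W t) (W t) *+ 2 - ip mu Omega (W t) (W t))); last by rewrite mulr2n; ring.
  apply: (cvgD c2); apply: cvgB; last exact: cvg_cst.
  exact: (cvgD c1 c1).
exact: cvg_trans (near_eq_cvg E) c3.
Qed.

Lemma cvg_sumr {X : Type} {F : set_system X} {FF : Filter F} (I : Type) (r : seq I) (f : I -> X -> R) (a : I -> R) :
  (forall i, f i x @[x --> F] --> a i) -> \sum_(i <- r) f i x @[x --> F] --> \sum_(i <- r) a i.
Proof.
move=> H; elim: r => [|i r IH].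
  rewrite big_nil (_ : (fun x => _) = fun=> 0); first exact: cvg_cst.
  by apply/funext => x; rewrite big_nil.
rewrite big_cons (_ : (fun x => _) = fun x => f i x + \sum_(j <- r) f j x); first exact: (cvgD (H i) IH).
by apply/funext => x; rewrite big_cons.
Qed.

Lemma cvge_sum0 (I : Type) (r : seq I) (a : I -> nat -> \bar R) :
  (forall i, a i k @[k --> \oo] --> 0%E) -> (\sum_(i <- r) a i k)%E @[k --> \oo] --> 0%E.
Proof.
move=> H; elim: r => [|i r IH].
  rewrite (_ : (fun k => _) = fun=> 0%E); first exact: cvg_cst.
  by apply/funext => k; rewrite big_nil.
rewrite (_ : (fun k => _) = fun k => (a i k + \sum_(j <- r) a j k)%E); last first.
  by apply/funext => k; rewrite big_cons.
by rewrite -[X in _ --> X](add0e 0%E); apply: cvgeD => //.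
Qed.

Lemma normL2sq_lin (I : finType) (D : set V) (c d : I -> V -> R) (M : R) : measurable D ->
  (forall i, measurable_fun D (d i)) -> (forall i, measurable_fun D (c i)) ->
  (forall i x, D x -> `|c i x| <= M) ->
  (normL2sq D (fun x => \sum_i c i x * d i x)%R <= (#|I|%:R * M ^+ 2)%:E * \sum_i normL2sq D (d i))%E.
Proof.
move=> mD md mc cM.
have m2 i : measurable_fun D (fun x => (d i x ^+ 2)%:E) by apply/measurable_EFinP; exact: measurable_funX.
have s2 i x : (0 <= (d i x ^+ 2)%:E)%E by rewrite lee_fin sqr_ge0.
have K0 : 0 <= #|I|%:R * M ^+ 2 :> R by rewrite mulr_ge0 ?sqr_ge0.
rewrite -ge0_integral_sum// -ge0_integralZl//; last 2 first.
- exact: emeasurable_sum.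
- by move=> x _; exact: sume_ge0.
apply: ge0_le_integral => //.
- by move=> x _; rewrite lee_fin sqr_ge0.
- apply/measurable_EFinP; apply: measurable_funX; apply: measurable_sum => i.
  exact: measurable_funM.
- by apply: measurable_funeM; exact: emeasurable_sum.
move=> x Dx; rewrite sumEFin -EFinM lee_fin.
have := cauchy_schwarz_sum (index_enum I) xpredT (fun i => c i x * d i x) (fun=> 1).
rewrite (eq_bigr (fun i => c i x * d i x)); last by move=> i _; rewrite mulr1.
move=> /le_trans; apply.
rewrite [X in _ * X](_ : _ = #|I|%:R); last first.
  by rewrite (eq_bigr (fun=> 1)); [rewrite sumr_const|move=> i _; rewrite expr1n].
rewrite mulrC -mulrA ler_wpM2l// mulr_sumr; apply: ler_sum => i _.
rewrite exprMn ler_wpM2r ?sqr_ge0// -real_normK ?num_real// ler_sqr ?nnegrE ?cM//.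
exact: le_trans (cM i x Dx).
Qed.

Lemma cvg_normL2sq_lin (I : finType) (D : set V) (c : I -> V -> R) (d : I -> nat -> V -> R) (M : R) : measurable D ->
  (forall i k, measurable_fun D (d i k)) -> (forall i, measurable_fun D (c i)) ->
  (forall i x, D x -> `|c i x| <= M) -> (forall i, normL2sq D (d i k) @[k --> \oo] --> 0%E) ->
  normL2sq D (fun x => \sum_i c i x * d i k x) @[k --> \oo] --> 0%E.
Proof.
move=> mD md mc cM cd.
apply: (@squeeze_cvge _ _ _ _ (fun=> 0%E) _ (fun k => (#|I|%:R * M ^+ 2)%:E * \sum_i normL2sq D (d i k))%E); [|exact: cvg_cst|].
  by apply: nearW => k; rewrite sq_ge0/=; apply: normL2sq_lin.
by rewrite -[X in _ --> X](mule0 (#|I|%:R * M ^+ 2)%:E); apply: cvgeZl => //; exact: cvge_sum0.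
Qed.

End sobolev_norms.

Section null_forms.
Context {R : realType} {n : nat} (gm : 'rV[R]_n -> 'M[R]_n.+1).
Local Notation V1 := 'rV[R]_n.+1.
Implicit Types (a b w : 'I_n.+1 -> V1 -> R) (z : V1).

(** [a] and [2 b - a] are symmetric about [b]. Where the form is nonnegative, dropping its value at
    [2 b - a] bounds the value at [a] by twice those at [b] and at [b - a], without a Cauchy-Schwarz
    inequality for the form. *)
Lemma null_form_parallelogram a b z :
  null_form gm a z + null_form gm (fun l y => b l y *+ 2 - a l y) z =
  null_form gm b z *+ 2 + null_form gm (fun l y => b l y - a l y) z *+ 2.
Proof.
rewrite /null_form.
set g := fun j k => space_block gm (col' ord0 z) j k.
have E : \sum_j \sum_k g j k * a (lift ord0 j) z * a (lift ord0 k) z +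
    \sum_j \sum_k g j k * (b (lift ord0 j) z *+ 2 - a (lift ord0 j) z) * (b (lift ord0 k) z *+ 2 - a (lift ord0 k) z) =
    (\sum_j \sum_k g j k * b (lift ord0 j) z * b (lift ord0 k) z) *+ 2 +
    (\sum_j \sum_k g j k * (b (lift ord0 j) z - a (lift ord0 j) z) * (b (lift ord0 k) z - a (lift ord0 k) z)) *+ 2.
  rewrite -!sumrMnl -!big_split/=; apply: eq_bigr => j _.
  rewrite -!sumrMnl -!big_split/=; apply: eq_bigr => k _.
  by rewrite !mulr2n; ring.
move: E; set s1 := \sum_j _; set s2 := \sum_j _; set s3 := \sum_j _; set s4 := \sum_j _ => E.
have -> : s1 = s3 *+ 2 + s4 *+ 2 - s2 by rewrite -E addrK.
by rewrite !mulr2n; ring.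
Qed.

Lemma null_form_bound (M : R) w z : (forall j k, `|gm (col' ord0 z) j k| <= M) ->
  null_form gm w z <= (1 + n%:R * M) * \sum_l w l z ^+ 2.
Proof.
move=> gM; rewrite /null_form big_ord_recl.
set S := \sum_(i < n) w (lift ord0 i) z ^+ 2.
have S0 : 0 <= S by apply: sumr_ge0 => i _; exact: sqr_ge0.
have M0 : 0 <= M by exact: le_trans (gM ord0 ord0).
have H : - (\sum_j \sum_k space_block gm (col' ord0 z) j k * w (lift ord0 j) z * w (lift ord0 k) z) <= n%:R * M * S.
  apply: (@le_trans _ _ (\sum_(j < n) \sum_(k < n) (M / 2 * (w (lift ord0 j) z ^+ 2 + w (lift ord0 k) z ^+ 2)))).
    rewrite -sumrN; apply: ler_sum => j _; rewrite -sumrN; apply: ler_sum => k _.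
    have := gM (lift ord0 j) (lift ord0 k); rewrite -[gm _ _ _](_ : space_block gm (col' ord0 z) j k = _); last by rewrite !mxE.
    set g := space_block _ _ _ _; set p := w _ _; set q := w _ _; rewrite ler_norml => /andP[g1 g2].
    have h1 : 0 <= (M + g) * (p + q) ^+ 2 by rewrite mulr_ge0 ?sqr_ge0//; lra.
    have h2 : 0 <= (M - g) * (p - q) ^+ 2 by rewrite mulr_ge0 ?sqr_ge0//; lra.
    nra.
  rewrite (eq_bigr (fun j => M / 2 * (n%:R * w (lift ord0 j) z ^+ 2 + S))); last first.
    by move=> j _; rewrite -mulr_sumr big_split/= sumr_const card_ord mulr_natl.
  rewrite -mulr_sumr big_split/= -mulr_sumr -/S sumr_const card_ord -mulr_natl.
  by rewrite le_eqVlt; apply/orP; left; apply/eqP; field.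
have nM : 0 <= n%:R * M by rewrite mulr_ge0.
have := sqr_ge0 (w ord0 z); set p := w ord0 z ^+ 2 => p0.
by have := mulr_ge0 nM p0; lra.
Qed.

End null_forms.

Lemma sum_normL2sq_le {R : realType} {n : nat} (I : finType) (D : set 'rV[R]_n) (p q : I -> 'rV[R]_n -> R) : measurable D ->
  (forall i, measurable_fun D (p i)) -> (forall i, measurable_fun D (q i)) ->
  (\sum_i normL2sq D (p i) <= 2%:E * \sum_i normL2sq D (q i) + 2%:E * \sum_i normL2sq D (p i \- q i)%R)%E.
Proof.
move=> mD mp mq.
rewrite !ge0_sume_distrr; [|by move=> i _; exact: sq_ge0|by move=> i _; exact: sq_ge0].
rewrite -big_split/=; apply: lee_sum => i _.
apply: le_trans (sqD_le _ mD (mq i) (measurable_funB (mp i) (mq i))).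
by rewrite le_eqVlt; apply/orP; left; apply/eqP; apply: eq_integral => x _ /=; rewrite addrC subrK.
Qed.

Section weak_energy.
Context {R : realType} {n : nat} (gm : 'rV[R]_n -> 'M[R]_n.+1).
Variables (S Oi : set 'rV[R]_n) (nu : 'rV[R]_n -> 'rV[R]_n)
  (sigma : {measure set 'rV[R]_n -> \bar R}) (T : R).
Local Notation I := 'I_n.+1.
Local Notation V := 'rV[R]_n.
Local Notation V1 := 'rV[R]_n.+1.
Local Notation mu1 := (lebesgue_rV R n.+1).
Local Notation leb := (@lebesgue_measure R).
Local Notation Omega := (~` closure Oi).
Local Notation cyl := (cylinder Omega T).
Local Notation SE := (surface_energy gm S nu sigma).
Hypotheses
  (gm_sym : forall x, (gm x)^T = gm x)
  (gm_signature : forall x, lorentzian (gm x))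
  (gm_smooth : forall j k, smooth (fun x => gm x j k))
  (gm_bounded : forall j k, bounded_derivatives (fun x => gm x j k))
  (gm_elliptic : exists2 C0 : R, 0 < C0 &
    (forall x, C0 <= gm x ord0 ord0) /\
    exists rho : R, forall x, closure Omega x -> rho <= `|x| ->
      forall xi : 'rV_n,
      \sum_j \sum_k space_block gm x j k * xi ord0 j * xi ord0 k
        <= - C0 * \sum_j xi ord0 j ^+ 2)
  (Sdet : forall x, S x -> \det (space_block gm x) = 0)
  (cS : compact S) (oOi : open Oi) (OiS : Oi `&` S = set0) (clOi : closure Oi = Oi `|` S)
  (nuP : outer_unit_normal Oi S nu) (sigmaP : area_measure S sigma)
  (characteristic : forall x, S x ->
    \sum_j \sum_k space_block gm x j k * nu x ord0 j * nu x ord0 k = 0)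
  (ingoing : forall x, S x ->
    \sum_(j < n) gm x (lift ord0 j) ord0 * nu x ord0 j < 0)
  (T0 : 0 < T).

Let oO : open Omega. Proof. by apply: closed_openC; exact: closed_closure. Qed.
Let mO : measurable Omega. Proof. exact: measurable_open. Qed.
Let mc : measurable cyl. Proof. exact: measurable_cylinder. Qed.
Let mS : measurable S. Proof. exact: measurable_compact. Qed.

Lemma measurable_insert_time (s : R) : measurable_fun [set: V] (insert_rV ord0 s : V -> V1).
Proof.
apply: measurable_fun_rV => i; case: (unliftP ord0 i) => [k ->|->].
  rewrite (_ : (fun _ => _) = (fun x : 'rV[R]_n => x ord0 k : measurableTypeR R)); first exact: measurable_coord.
  by apply/funext => y; rewrite /= mxE liftK.
rewrite (_ : (fun _ => _) = cst s); first exact: measurable_cst.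
by apply/funext => y; rewrite /= mxE unlift_none.
Qed.

(** The factors 2 come from [null_form_parallelogram]; [K] combines one of them with the bound of
    the form by the sum of squares and with the bound [B] of the inflow. *)
Lemma surface_energy_le : exists2 K : R, 0 <= K & forall (v w : I -> V1 -> R) s,
  (forall l, measurable_fun [set: V1] (v l)) -> (forall l, measurable_fun [set: V1] (w l)) ->
  (SE v s <= 2%:E * SE w s + K%:E * \sum_l \int[sigma]_(x in S) (slice (w l \- v l) s x ^+ 2)%:E)%E.
Proof.
have [M hM] := coefficients_bounded gm_smooth gm_bounded.
have gM x j k : `|gm x j k| <= M by case: (hM x j k).
have M0 : 0 <= M by exact: le_trans (gM 0 ord0 ord0).
have nu1 x j : S x -> `|nu x ord0 j| <= 1.
  move=> Sx; have [h _] := nuP Sx; rewrite -(@ler_sqr _ _ 1) ?nnegrE// expr1n real_normK ?num_real// -h.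
  by rewrite (bigD1 j)//= lerDl sumr_ge0// => i _; exact: sqr_ge0.
pose B := n%:R * M; have B0 : 0 <= B by rewrite mulr_ge0.
have inB x : S x -> `|inflow gm nu x| <= B.
  move=> Sx; apply: le_trans (ler_norm_sum _ _ _) _.
  apply: (@le_trans _ _ (\sum_(j < n) M)); last by rewrite sumr_const card_ord -mulr_natl.
  by apply: ler_sum => j _; rewrite normrM -[leRHS]mulr1 ler_pM// nu1.
pose K := 2 * (1 + n%:R * M) * B.
have K0 : 0 <= K by rewrite mulr_ge0// mulr_ge0// addr_ge0// mulr_ge0.
exists K => // v w s mv mw.
have msl (F : V1 -> R) : measurable_fun setT F -> measurable_fun S (fun x => F (insert_rV ord0 s x)).
  by move=> mF; apply: measurable_funTS; exact: measurableT_comp mF (measurable_insert_time s).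
have mi := measurable_inflow gm_smooth cS nuP sigmaP.
have mSE w' : (forall l, measurable_fun [set: V1] (w' l)) ->
    measurable_fun S (fun x => (`|null_form gm w' (insert_rV ord0 s x) * inflow gm nu x|)%:E).
  move=> mw'; apply/measurable_EFinP; apply: measurableT_comp => //; apply: measurable_funM; last exact: mi.
  exact: msl (measurable_null_form gm_smooth mw').
have md l : measurable_fun S (fun x => (slice (w l \- v l) s x ^+ 2)%:E).
  by apply/measurable_EFinP; apply: measurable_funX; exact: (msl _ (measurable_funB (mw l) (mv l))).
have d0 l x : S x -> (0 <= (slice (w l \- v l) s x ^+ 2)%:E)%E by rewrite lee_fin sqr_ge0.
apply: (@le_trans _ _ (\int[sigma]_(x in S) (2%:E * (`|null_form gm w (insert_rV ord0 s x) * inflow gm nu x|)%:E +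
   K%:E * \sum_l (slice (w l \- v l) s x ^+ 2)%:E))%E).
  apply: ge0_le_integral => //.
  - exact: mSE.
  - by apply: emeasurable_funD; apply: measurable_funeM; [exact: mSE|exact: emeasurable_sum].
  move=> x Sx; rewrite sumEFin -!EFinM -EFinD lee_fin.
  have Sz : S (col' ord0 (insert_rV ord0 s x)) by rewrite col'_insert_rV.
  have P := null_form_parallelogram gm v w (insert_rV ord0 s x).
  have a0 := null_form_ge0 gm_sym gm_signature Sdet v Sz.
  have b0 := null_form_ge0 gm_sym gm_signature Sdet w Sz.
  have c0 := null_form_ge0 gm_sym gm_signature Sdet (fun l y => w l y *+ 2 - v l y) Sz.
  have d1 := null_form_bound (fun l y => w l y - v l y) (fun j k => gM (col' ord0 (insert_rV ord0 s x)) j k).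
  rewrite !normrM !(ger0_norm a0, ger0_norm b0).
  have i0 := normr_ge0 (inflow gm nu x); have iB := inB x Sx.
  set D := \sum_l _ in d1 *.
  have D0 : 0 <= D by apply: sumr_ge0 => l _; exact: sqr_ge0.
  have h1 : null_form gm v (insert_rV ord0 s x) <= 2 * null_form gm w (insert_rV ord0 s x) + 2 * ((1 + n%:R * M) * D).
    by move: P; rewrite !mulr2n; lra.
  apply: le_trans (ler_wpM2r i0 h1) _; rewrite mulrDl -mulrA lerD2l /K.
  have -> : 2 * (1 + n%:R * M) * B * D = 2 * ((1 + n%:R * M) * D) * B by ring.
  by rewrite ler_wpM2l// mulr_ge0// mulr_ge0// addr_ge0// mulr_ge0.
have S0 x : S x -> (0 <= \sum_l (slice (w l \- v l) s x ^+ 2)%:E)%E by move=> Sx; apply: sume_ge0 => l _; exact: d0.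
rewrite ge0_integralD; [|exact: mS|by move=> x Sx; rewrite mule_ge0|by apply: measurable_funeM; exact: mSE
  |by move=> x Sx; rewrite mule_ge0// S0|by apply: measurable_funeM; exact: emeasurable_sum].
rewrite ge0_integralZl//; last exact: mSE.
rewrite ge0_integralZl//; last exact: emeasurable_sum.
by rewrite ge0_integral_sum.
Qed.

(** [energy_smooth] is applied to one member of the approximating sequences, late enough for all
    errors to be below [d]. Leaving the limit on the right and returning to it on the left cost a
    factor 2 each, whence [4 * C1]. *)
Lemma weak_energy : exists2 C : R, 0 < C &
  forall (du : I -> V1 -> R) (dw : I -> I -> V1 -> R) (psi : I -> nat -> V1 -> R) (v : I -> V1 -> R) (f : V1 -> R),
  (forall l, inL2 cyl (du l)) -> (forall l j, inL2 cyl (dw l j)) -> inL2 cyl f ->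
  (forall l j, {ae mu1, forall z, cyl z -> dw l j z = dw j l z}) ->
  {ae mu1, forall z, cyl z -> wave (gm (col' ord0 z)) (fun i l => dw l i z) (du^~ z) ((drift gm)^~ z) = f z} ->
  (forall l k, smooth (psi l k)) ->
  (forall l, normL2sq cyl (psi l k \- du l)%R @[k --> \oo] --> 0%E) ->
  (forall l j, normL2sq cyl (pderiv j (psi l k) \- dw l j)%R @[k --> \oo] --> 0%E) ->
  (forall l, measurable_fun [set: V1] (v l)) ->
  (forall l, (\int[leb]_(t in `[0%R, T]) \int[sigma]_(x in S) (slice (psi l k \- v l) t x ^+ 2)%:E)%E @[k --> \oo] --> 0%E) ->
  forall t : R, 0 < t <= T ->
  (\sum_l normL2sq Omega (tmean T (tvalue T (du l) (dw l ord0) t)) + \int[leb]_(s in `]0%R, t[) SE v s <=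
   C%:E * (\sum_l normL2sq Omega (tmean T (tvalue T (du l) (dw l ord0) 0)) + normL2sq cyl f))%E.
Proof.
have [C1 C10 HC1] := energy_smooth T gm_sym gm_signature gm_smooth gm_bounded gm_elliptic Sdet cS oOi OiS clOi nuP sigmaP characteristic ingoing.
have [K K0 HK] := surface_energy_le.
have [M hM] := coefficients_bounded gm_smooth gm_bounded.
have gM x j k : `|gm x j k| <= M by case: (hM x j k).
have [Md hMd] := drift_bounded gm_sym gm_signature gm_smooth gm_bounded gm_elliptic.
exists (4 * C1); first by rewrite mulr_gt0.
move=> du dw psi v f duL dwL fL sym pde spsi c0 c1 mv cv t tT.
pose W l t := tmean T (tvalue T (du l) (dw l ord0) t).
have tT' : 0 <= t <= T by case/andP: tT => /ltW ->.
suff main (z0 : R) : z0 = 0 -> (\sum_l normL2sq Omega (W l t) + \int[leb]_(s in `]0%R, t[) SE v s <=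
    (4 * C1)%:E * (\sum_l normL2sq Omega (W l z0) + normL2sq cyl f))%E by exact: main.
move=> z0E; have zT : 0 <= z0 <= T by rewrite z0E lexx ltW.
have HZ (w : I -> V1 -> R) : (forall l, smooth (w l)) -> (forall l, (normL2sq cyl (w l) < +oo)%E) ->
    (forall l, (normL2sq Omega (slice (w l) t) < +oo)%E) ->
    (\sum_l normL2sq Omega (slice (w l) t) + \int[leb]_(s in `]0%R, t[) SE w s <=
     C1%:E * (\sum_l normL2sq Omega (slice (w l) z0) + (normL2sq cyl (wave_field gm w) +
       \sum_i \sum_k normL2sq cyl (fun z => (pderiv i (w k) z - pderiv k (w i) z)%R))))%E.
  by rewrite z0E => h1 h2 h3; exact: HC1.
have mpsi l k (D : set V1) : measurable D -> measurable_fun D (psi l k).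
  by move=> mD; apply: continuous_measurable => //; exact: (@smooth_continuous _ _ _ (spsi l k)).
have mdpsi l k j (D : set V1) : measurable D -> measurable_fun D (pderiv j (psi l k)).
  by move=> mD; apply: continuous_measurable => //; exact: (@smooth_continuous _ _ _ (smooth_pderiv j (spsi l k))).
have msl l k s : measurable_fun Omega (slice (psi l k) s).
  by apply: continuous_measurable => //; apply: continuous_slice; exact: (@smooth_continuous _ _ _ (spsi l k)).
have mdu l : measurable_fun cyl (du l) := (duL l).1.
have mdw l j : measurable_fun cyl (dw l j) := (dwL l j).1.
have WL l s : 0 <= s <= T -> inL2 Omega (W l s) by move=> sT; exact: inL2_trace.
have e1 s : 0 <= s <= T -> (\sum_l normL2sq Omega (slice (psi l k) s \- W l s)%R)%E @[k --> \oo] --> 0%E.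
  move=> sT; apply: cvge_sum0 => l.
  exact: (slice_trace_cvg oO T0 (duL l) (dwL l ord0) (spsi l) (c0 l) (c1 l ord0) sT).
have mgm j k : measurable_fun cyl (fun z => gm (col' ord0 z) j k).
  apply: continuous_measurable => //; exact: (@smooth_continuous _ _ _ (smooth_cylindrical (gm_smooth j k))).
have mdr l : measurable_fun cyl (drift gm l).
  have sd := smooth_density gm_signature gm_smooth.
  apply: measurable_sum => i; apply: measurable_funM.
    apply: continuous_measurable => //.
    exact: (@smooth_continuous _ _ _ (smoothV (smooth_cylindrical sd) (fun z => lt0r_neq0 (density_gt0 gm_signature (col' ord0 z))))).
  apply: continuous_measurable => //.
  exact: (@smooth_continuous _ _ _ (smooth_pderiv i (smoothM (smooth_cylindrical sd) (smooth_cylindrical (gm_smooth i l))))).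
(* Once [f] is expressed by the equation, the difference is linear in the errors of the approximants
   and of their derivatives, with the bounded coefficients [gm] and [drift]. *)
have e3 : normL2sq cyl (wave_field gm (fun l => psi l k) \- f)%R @[k --> \oo] --> 0%E.
  pose A k z := \sum_(p : I * I) gm (col' ord0 z) p.1 p.2 * (pderiv p.1 (psi p.2 k) z - dw p.2 p.1 z).
  pose Bk k z := \sum_(l : I) drift gm l z * (psi l k z - du l z).
  have mA k : measurable_fun cyl (A k).
    by apply: measurable_sum => p; apply: measurable_funM => //; apply: measurable_funB => //; exact: mdpsi.
  have mB k : measurable_fun cyl (Bk k).
    by apply: measurable_sum => p; apply: measurable_funM => //; apply: measurable_funB => //; exact: mpsi.
  have cA : normL2sq cyl (A k) @[k --> \oo] --> 0%E.
    apply: (@cvg_normL2sq_lin _ _ _ cyl (fun p z => gm (col' ord0 z) p.1 p.2)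
      (fun p k z => pderiv p.1 (psi p.2 k) z - dw p.2 p.1 z) M mc) => //.
    - by move=> p k; apply: measurable_funB => //; exact: mdpsi.
    - by move=> p; exact: c1.
  have cB : normL2sq cyl (Bk k) @[k --> \oo] --> 0%E.
    apply: (@cvg_normL2sq_lin _ _ _ cyl (drift gm) (fun l k z => psi l k z - du l z) Md mc) => //.
    - by move=> l k; apply: measurable_funB => //; exact: mpsi.
    - by move=> l z [Oz _]; apply: hMd; exact: subset_closure.
  apply: (@squeeze_cvge _ _ _ _ (fun=> 0%E) _ (fun k => 2%:E * normL2sq cyl (A k) + 2%:E * normL2sq cyl (Bk k))%E); [|exact: cvg_cst|].
    apply: nearW => k; rewrite sq_ge0/=.
    apply: le_trans (sqD_le mu1 mc (mA k) (mB k)).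
    rewrite le_eqVlt; apply/orP; left; apply/eqP; apply: ae_eq_integral => //.
    - apply/measurable_EFinP; apply: measurable_funX; apply: measurable_funB; last by case: fL.
      apply: measurable_funD.
        apply: measurable_sum => i; apply: measurable_sum => l; apply: measurable_funM => //; exact: mdpsi.
      by apply: measurable_sum => l; apply: measurable_funM => //; exact: mpsi.
    - by apply/measurable_EFinP; apply: measurable_funX; exact: measurable_funD.
    move: pde; apply: filterS => z hz zc; congr ((_ ^+ 2)%:E).
    rewrite /= -(hz zc) /wave_field /wave opprD addrACA; congr (_ + _).
      rewrite /A -(pair_bigA _ (fun i l => gm (col' ord0 z) i l * (pderiv i (psi l k) z - dw l i z)))/=.
      rewrite -sumrB; apply: eq_bigr => i _; rewrite -sumrB; apply: eq_bigr => l _.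
      by rewrite mulrBr.
    by rewrite /Bk -sumrB; apply: eq_bigr => l _; rewrite mulrBr.
  rewrite -[X in _ --> X](adde0 0%E); apply: cvgeD => //.
    by rewrite -[X in _ --> X](mule0 2%:E); apply: cvgeZl.
  by rewrite -[X in _ --> X](mule0 2%:E); apply: cvgeZl.
(* By [sym] the limit fields have commutator 0, so that the commutator of the approximants is a
   difference of two errors. *)
have e4 : (\sum_i \sum_j normL2sq cyl (fun z => pderiv i (psi j k) z - pderiv j (psi i k) z)%R)%E @[k --> \oo] --> 0%E.
  apply: cvge_sum0 => i; apply: cvge_sum0 => j.
  apply: (@squeeze_cvge _ _ _ _ (fun=> 0%E) _ (fun k => 2%:E * normL2sq cyl (pderiv i (psi j k) \- dw j i)%R +
    2%:E * normL2sq cyl (pderiv j (psi i k) \- dw i j)%R)%E); [|exact: cvg_cst|].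
    apply: nearW => k; rewrite sq_ge0/=.
    have m1 : measurable_fun cyl (pderiv i (psi j k) \- dw j i)%R by apply: measurable_funB => //; exact: mdpsi.
    have m2 : measurable_fun cyl (pderiv j (psi i k) \- dw i j)%R by apply: measurable_funB => //; exact: mdpsi.
    have m3 : measurable_fun cyl (fun z => - (pderiv j (psi i k) \- dw i j)%R z) by apply: measurableT_comp.
    have -> : normL2sq cyl (pderiv j (psi i k) \- dw i j)%R = sq mu1 cyl (fun z => - (pderiv j (psi i k) \- dw i j)%R z).
      by apply: eq_integral => z _; rewrite sqrrN.
    apply: le_trans (sqD_le mu1 mc m1 m3).
    rewrite le_eqVlt; apply/orP; left; apply/eqP; apply: ae_eq_integral => //.
    - by apply/measurable_EFinP; apply: measurable_funX; apply: measurable_funB; exact: mdpsi.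
    - by apply/measurable_EFinP; apply: measurable_funX; exact: measurable_funD.
    move: (sym i j); apply: filterS => z hz zc; congr ((_ ^+ 2)%:E).
    by rewrite /= (hz zc); ring.
  rewrite -[X in _ --> X](adde0 0%E); apply: cvgeD => //.
    by rewrite -[X in _ --> X](mule0 2%:E); apply: cvgeZl.
  by rewrite -[X in _ --> X](mule0 2%:E); apply: cvgeZl.
have e5 := cvge_sum0 (index_enum I) cv.
have fin_sum (F : I -> V -> R) : (forall l, inL2 Omega (F l)) -> (\sum_l normL2sq Omega (F l))%E \is a fin_num.
  move=> FL; rewrite ge0_fin_numE; last by apply: sume_ge0 => l _; exact: sq_ge0.
  by apply: lte_sum_pinfty => l _; case: (FL l).
have /fineK Afin : (\sum_l normL2sq Omega (W l z0))%E \is a fin_num by apply: fin_sum => l; exact: WL.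
have /fineK Ffin : normL2sq cyl f \is a fin_num by rewrite ge0_fin_numE ?sq_ge0//; case: fL.
set a := fine _ in Afin; set phi := fine _ in Ffin.
rewrite -[X in (_ <= _ * (X + _))%E]Afin -Ffin -EFinD -EFinM.
apply/lee_addgt0Pr => e e0.
(* The errors are [2 * 5 C1 d] from the smooth estimate, [2 d] from the slices at time [t] and [K d]
   from the surface: together [den * d = e]. *)
pose den := 10 * C1 + 2 + K; have den0 : 0 < den by rewrite /den; lra.
pose d := e / den; have d0 : 0 < d by rewrite divr_gt0.
have dE : (0 < d%:E)%E by rewrite lte_fin.
have near_lt_ (a_ : nat -> \bar R) : a_ k @[k --> \oo] --> 0%E -> \forall k \near \oo, (a_ k < d%:E)%E.
  by move=> ca; exact: (ca _ (open_ereal_lt' dE)).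
have aL : \forall k \near \oo, forall l, inL2 cyl (psi l k).
  apply: filter_forall => l; have := approximants_inL2 oO (duL l) (dwL l ord0) (spsi l) (c0 l) (c1 l ord0).
  by apply: filterS => k [].
have N s (sT : 0 <= s <= T) : \forall k \near \oo, (\sum_l normL2sq Omega (slice (psi l k) s \- W l s)%R < d%:E)%E.
  exact: near_lt_ (e1 s sT).
have N3 : \forall k \near \oo, (normL2sq cyl (wave_field gm (fun l => psi l k) \- f)%R < d%:E)%E.
  exact: near_lt_ e3.
have N4 : \forall k \near \oo, (\sum_i \sum_j normL2sq cyl (fun z => pderiv i (psi j k) z - pderiv j (psi i k) z)%R < d%:E)%E.
  exact: near_lt_ e4.
have N5 : \forall k \near \oo, (\sum_l \int[leb]_(t in `[0%R, T]) \int[sigma]_(x in S) (slice (psi l k \- v l) t x ^+ 2)%:E < d%:E)%E.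
  exact: near_lt_ e5.
have [k [kL [k1 [k2 [k3 [k4 k5]]]]]] :=
  filter_ex (filterI aL (filterI (N t tT') (filterI (N z0 zT) (filterI N3 (filterI N4 N5))))).
have sL l : inL2 Omega (slice (psi l k) t).
  have dL : inL2 Omega (fun x => slice (psi l k) t x - W l t x).
    split; first by apply: measurable_funB => //; exact: (WL l t tT').1.
    apply: le_lt_trans (ltry d); apply: le_trans (ltW k1).
    by rewrite (bigD1 l)//= leeDl// sume_ge0// => i _; exact: sq_ge0.
  have := L2D mO dL (WL l t tT'); congr L2; apply/funext => x; exact: subrK.
have H := HZ (fun l => psi l k) (fun l => spsi l k) (fun l => (kL l).2) (fun l => (sL l).2).
set P := (\sum_l normL2sq Omega (slice (psi l k) t))%E in H.
set G := (\int[leb]_(s in `]0%R, t[) SE (fun l => psi l k) s)%E in H.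
have P0 : (0 <= P)%E by apply: sume_ge0 => l _; exact: sq_ge0.
have G0 : (0 <= G)%E by apply: integral_ge0 => s _; apply: integral_ge0 => x _; rewrite lee_fin.
have X : (P + G <= (C1 * (2 * a + 2 * phi + 5 * d))%:E)%E.
  apply: (le_trans H); rewrite EFinM; apply: lee_wpmul2l; first by rewrite lee_fin ltW.
  have h1 : (\sum_l normL2sq Omega (slice (psi l k) z0) <= (2 * a + 2 * d)%:E)%E.
    apply: (le_trans (sum_normL2sq_le mO (fun l => msl l k z0) (fun l => (WL l z0 zT).1))).
    rewrite -[X in (_ * X + _)%E]Afin [X in (_ <= X)%E]EFinD; apply: leeD; first by rewrite EFinM.
    by rewrite EFinM; apply: lee_wpmul2l; [rewrite lee_fin|exact: (ltW k2)].
  have h2 : (normL2sq cyl (wave_field gm (fun l => psi l k)) <= (2 * phi + 2 * d)%:E)%E.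
    have mw : measurable_fun cyl (wave_field gm (fun l => psi l k)).
      apply: measurable_funD.
        apply: measurable_sum => i; apply: measurable_sum => l; apply: measurable_funM => //; exact: mdpsi.
      by apply: measurable_sum => l; apply: measurable_funM => //; exact: mpsi.
    have := sqD_le mu1 mc fL.1 (measurable_funB mw fL.1).
    have -> : (fun z => f z + (wave_field gm (fun l => psi l k) \- f)%R z) = wave_field gm (fun l => psi l k).
      by apply/funext => z /=; rewrite addrC subrK.
    move=> /le_trans; apply; rewrite [X in (_ <= X)%E]EFinD; apply: leeD.
      by rewrite -[sq _ _ _]/(normL2sq cyl f) -Ffin EFinM.
    by rewrite EFinM; apply: lee_wpmul2l; [rewrite lee_fin|exact: ltW].
  apply: (le_trans (leeD h1 (leeD h2 (ltW k4)))).
  by rewrite -!EFinD lee_fin; lra.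
have Y1 : (\sum_l normL2sq Omega (W l t) <= 2%:E * P + (2 * d)%:E)%E.
  apply: (le_trans (sum_normL2sq_le mO (fun l => (WL l t tT').1) (fun l => msl l k t))).
  apply: leeD; first exact: lexx.
  rewrite EFinM; apply: lee_wpmul2l => //; apply: le_trans (ltW k1).
  apply: lee_sum => l _; rewrite le_eqVlt; apply/orP; left; apply/eqP; apply: eq_integral => x _.
  by rewrite /= -sqrrN opprB.
have mSE w : (forall l, measurable_fun [set: V1] (w l)) ->
    measurable_fun (`]0, t[%classic : set (measurableTypeR R)) (SE w : measurableTypeR R -> \bar R).
  by move=> mw; apply: measurable_funTS; exact: (measurable_surface_energy gm_smooth cS nuP sigmaP mw).
have mq l : measurable_fun [set: measurableTypeR R]
    (fun s : measurableTypeR R => \int[sigma]_(x in S) (slice (psi l k \- v l) (s : R) x ^+ 2)%:E)%E.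
  have mF : measurable_fun [set: V1] (fun z => (psi l k z - v l z) ^+ 2).
    by apply: measurable_funX; apply: measurable_funB => //; exact: mpsi.
  have := measurable_surface_integral mS (surface_measure_fin cS nuP sigmaP) mF (measurable_cst (1 : R)).
  congr (measurable_fun _ _); apply/funext => s; apply: eq_integral => x _.
  by rewrite mulr1 ger0_norm ?sqr_ge0.
have Y2 : (\int[leb]_(s in `]0%R, t[) SE v s <= 2%:E * G + (K * d)%:E)%E.
  have mt : measurable (`]0, t[%classic : set (measurableTypeR R)) by exact: measurable_itv.
  have mT : measurable (`[0, T]%classic : set (measurableTypeR R)) by exact: measurable_itv.
  have q0 l s : (0 <= \int[sigma]_(x in S) (slice (psi l k \- v l) s x ^+ 2)%:E)%E.
    by apply: integral_ge0 => x _; rewrite lee_fin sqr_ge0.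
  have S0 w s : (0 <= SE w s)%E by apply: integral_ge0 => x _; rewrite lee_fin.
  have mpk l : measurable_fun [set: V1] (psi l k) by exact: mpsi.
  apply: (@le_trans _ _ (\int[leb]_(s in `]0%R, t[) (2%:E * SE (fun l => psi l k) s +
      K%:E * \sum_l \int[sigma]_(x in S) (slice (psi l k \- v l) s x ^+ 2)%:E))%E).
    apply: ge0_le_integral => //.
    - exact: mSE.
    - apply: emeasurable_funD; apply: measurable_funeM; first exact: mSE.
      by apply: emeasurable_sum => l; exact: measurable_funTS (mq l).
    - by move=> s _; exact: HK.
  have mQ : measurable_fun (`]0, t[%classic : set (measurableTypeR R))
      (fun s : measurableTypeR R => \sum_l \int[sigma]_(x in S) (slice (psi l k \- v l) (s : R) x ^+ 2)%:E)%E.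
    by apply: emeasurable_sum => l; exact: measurable_funTS (mq l).
  rewrite ge0_integralD; [|exact: mt|by move=> s _; rewrite mule_ge0|by apply: measurable_funeM; exact: mSE
    |by move=> s _; rewrite mule_ge0// sume_ge0|exact: measurable_funeM].
  rewrite ge0_integralZl//; last exact: mSE.
  rewrite ge0_integralZl//; last by move=> s _; rewrite sume_ge0.
  apply: leeD; first exact: lexx.
  rewrite EFinM; apply: lee_wpmul2l; first by rewrite lee_fin.
  apply: le_trans (ltW k5).
  rewrite ge0_integral_sum//; last by move=> l; exact: measurable_funTS (mq l).
  apply: lee_sum => l _; apply: ge0_subset_integral => //; first exact: measurable_funTS (mq l).
  by move=> s; rewrite /= !in_itv/= => /andP[? ?]; case/andP: tT => _ tT1; rewrite !ltW//; apply: lt_le_trans tT1.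
apply: (le_trans (leeD Y1 Y2)).
rewrite addeACA -(ge0_muleDr _ P0 G0).
apply: (@le_trans _ _ (2%:E * (C1 * (2 * a + 2 * phi + 5 * d))%:E + ((2 * d)%:E + (K * d)%:E))%E).
  by apply: leeD; [apply: lee_wpmul2l|exact: lexx].
have -> : (2%:E * (C1 * (2 * a + 2 * phi + 5 * d))%:E = (2 * (C1 * (2 * a + 2 * phi + 5 * d)))%:E)%E by rewrite EFinM.
rewrite -!EFinD lee_fin.
have -> : e = den * d by rewrite /d mulrC divfK// gt_eqF.
by rewrite /den; lra.
Qed.

End weak_energy.

(** * From the estimate of the derivatives to the full energy *)

Theorem theorem8p3 (R : realType) (n : nat) (n_ge2 : (2 <= n)%N)
  (gm : 'rV[R]_n -> 'M[R]_n.+1)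
  (gm_sym : forall x, (gm x)^T = gm x)
  (gm_signature : forall x, lorentzian (gm x))
  (gm_smooth : forall j k, smooth (fun x => gm x j k))
  (gm_bounded : forall j k, bounded_derivatives (fun x => gm x j k))
  (S Omega_int Omega_ext : set 'rV[R]_n)
  (S_def : S = [set x | \det (space_block gm x) = 0])
  (S_hypersurface : smooth_hypersurface S)
  (S_compact : compact S)
  (int_open : open Omega_int)
  (int_bounded : bounded_set Omega_int)
  (int_disjoint : Omega_int `&` S = set0)
  (int_closure : closure Omega_int = Omega_int `|` S)
  (ext_def : Omega_ext = ~` closure Omega_int)
  (ext_sign : forall x, Omega_ext x ->
    0 < (-1) ^+ n * \det (space_block gm x))
  (int_sign : forall x, Omega_int x ->
    (-1) ^+ n * \det (space_block gm x) < 0)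
  (gm_elliptic : exists2 C0 : R, 0 < C0 &
    (forall x, C0 <= gm x ord0 ord0) /\
    exists rho : R, forall x, closure Omega_ext x -> rho <= `|x| ->
      forall xi : 'rV[R]_n,
      \sum_j \sum_k space_block gm x j k * xi ord0 j * xi ord0 k
        <= - C0 * \sum_j xi ord0 j ^+ 2)
  (nu : 'rV[R]_n -> 'rV[R]_n)
  (nu_normal : outer_unit_normal Omega_int S nu)
  (sigma : {measure set 'rV[R]_n -> \bar R})
  (sigma_area : area_measure S sigma)
  (characteristic : forall x, S x ->
    \sum_j \sum_k space_block gm x j k * nu x ord0 j * nu x ord0 k = 0)
  (ingoing : forall x, S x ->
    \sum_(j < n) gm x (lift ord0 j) ord0 * nu x ord0 j < 0) :
  forall T : R, 0 < T -> exists2 C : R, 0 < C &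
  forall (u f : 'rV[R]_n.+1 -> R) (phi0 phi1 : 'rV[R]_n -> R)
    (du : 'I_n.+1 -> 'rV[R]_n.+1 -> R)
    (U Ut : R -> 'rV[R]_n -> R)
    (v : 'I_n.+1 -> 'rV[R]_n.+1 -> R),
  inH2 (cylinder Omega_ext T) u du ->
  time_trace Omega_ext T u U ->
  time_trace Omega_ext T (du ord0) Ut ->
  (forall j, lateral_trace Omega_ext T S sigma (du j) (v j)) ->
  inL2 (cylinder Omega_ext T) f ->
  solves gm (cylinder Omega_ext T) du f ->
  inL2 Omega_ext phi0 -> inL2 Omega_ext phi1 ->
  {ae lebesgue_rV R n, forall x, Omega_ext x -> U 0 x = phi0 x} ->
  {ae lebesgue_rV R n, forall x, Omega_ext x -> Ut 0 x = phi1 x} ->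
  let E t := (normH1sq Omega_ext (U t) + normL2sq Omega_ext (Ut t))%E in
  exists tmax : R,
  [/\ tmax \in `[0, T],
      forall t, t \in `[0, T] -> (E t <= E tmax)%E
    & (E tmax
       - \int[@lebesgue_measure R]_(t in `[0%R, T]) \int[sigma]_(x in S)
           ((slice (v ord0) t x ^+ 2
             - \sum_j \sum_k space_block gm x j k
                 * slice (v (lift ord0 j)) t x * slice (v (lift ord0 k)) t x)
            * \sum_(j < n) gm x (lift ord0 j) ord0 * nu x ord0 j)%:E
       <= C%:E * (normH1sq Omega_ext phi0 + normL2sq Omega_ext phi1)
          + C%:E * \int[@lebesgue_measure R]_(t in `[0%R, T])
                     normL2sq Omega_ext (slice f t))%E].
Proof.
move=> T T0; subst Omega_ext; set Oe := ~` closure Omega_int in gm_elliptic ext_sign *.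
have oO : open Oe by apply: closed_openC; exact: closed_closure.
have mO : measurable Oe by exact: measurable_open.
have oC := @open_cylinder R n Oe T oO.
have mc : measurable (cylinder Oe T) by exact: measurable_open.
have Sdet x : S x -> \det (space_block gm x) = 0 by rewrite S_def.
have [C1 C10 HC] := weak_energy gm_sym gm_signature gm_smooth gm_bounded gm_elliptic Sdet S_compact
  int_open int_disjoint int_closure nu_normal sigma_area characteristic ingoing T0.
(* At least 1, so that the bound of the derivatives by [D * Q] also holds at [t = 0], which
   [weak_energy] leaves out. *)
pose D := C1 + 1; have D1 : 1 <= D by rewrite /D lerDr ltW.
(* The first 2 comes from the initial value in [trace_le], [2 T^2 D] from the time derivative of
   [u], with one factor [T] from its integration over the cylinder and one from [trace_le], and
   [2 D] from the derivatives and the surface term. *)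
pose C := 2 + (2 * T ^+ 2 + 2) * D.
have T2 : 0 <= T ^+ 2 by exact: sqr_ge0.
exists C; first by rewrite /C ltr_pwDl// mulr_ge0//; lra.
move=> u f phi0 phi1 du U Ut v uH2 uU uUt lat fL pde phi0L phi1L U0phi Utphi E.
have [[uL uW] _] := uH2.
have /choice[dw Hdw] : forall j, exists dw : 'I_n.+1 -> 'rV[R]_n.+1 -> R, exists psi : nat -> 'rV[R]_n.+1 -> R,
    [/\ inH1 (cylinder Oe T) (du j) dw, forall k, smooth (psi k),
      normL2sq (cylinder Oe T) (psi k \- du j)%R @[k --> \oo] --> 0%E,
      forall i, normL2sq (cylinder Oe T) (pderiv i (psi k) \- dw i)%R @[k --> \oo] --> 0%E
    & (\int[@lebesgue_measure R]_(t in `[0%R, T])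
         \int[sigma]_(x in S) (slice (psi k \- v j) t x ^+ 2)%:E)%E @[k --> \oo] --> 0%E].
  by move=> j; have [_ [dw [psi h]]] := lat j; exists dw, psi.
have /choice[psi Hpsi] := Hdw.
have duL l : inL2 (cylinder Oe T) (du l) := (uW l).1.
have wdu l : weak_pderiv (cylinder Oe T) l u (du l) := (uW l).2.
have dwL l j : inL2 (cylinder Oe T) (dw l j) by case: (Hpsi l) => [[_ h] _ _ _ _]; exact: (h j).1.
have wdw l j : weak_pderiv (cylinder Oe T) j (du l) (dw l j) by case: (Hpsi l) => [[_ h] _ _ _ _]; exact: (h j).2.
have spsi l k : smooth (psi l k) by case: (Hpsi l) => _ h _ _ _; exact: h.
have c0 l : normL2sq (cylinder Oe T) (psi l k \- du l)%R @[k --> \oo] --> 0%E by case: (Hpsi l) => _ _ h _ _; exact: h.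
have c1 l j : normL2sq (cylinder Oe T) (pderiv j (psi l k) \- dw l j)%R @[k --> \oo] --> 0%E.
  by case: (Hpsi l) => _ _ _ h _; exact: h.
have cv l : (\int[@lebesgue_measure R]_(t in `[0%R, T])
    \int[sigma]_(x in S) (slice (psi l k \- v l) t x ^+ 2)%:E)%E @[k --> \oo] --> 0%E.
  by case: (Hpsi l) => _ _ _ _ h; exact: h.
have mv l : measurable_fun [set: 'rV[R]_n.+1] (v l) := (lat l).1.
have sym l j : {ae lebesgue_rV R n.+1, forall z, cylinder Oe T z -> dw l j z = dw j l z}.
  exact: (weak_pderivC oC (wdu l) (wdu j) (wdw l j) (wdw j l)).
(* The divergence form is expanded by the product rule: the derivatives of [density * gm] build up
   [drift], and the density cancels in the principal part. *)
have wf : {ae lebesgue_rV R n.+1, forall z, cylinder Oe T z ->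
    wave (gm (col' ord0 z)) (fun i l => dw l i z) (du^~ z) ((drift gm)^~ z) = f z}.
  have [p wp pf] := pde.
  have sd := smooth_density gm_signature gm_smooth.
  pose a j k (z : 'rV[R]_n.+1) := density gm (col' ord0 z) * gm (col' ord0 z) j k.
  have sa j k : smooth (a j k) by exact: smoothM (smooth_cylindrical sd) (smooth_cylindrical (gm_smooth j k)).
  have pE j k : {ae lebesgue_rV R n.+1, forall z, cylinder Oe T z ->
      p j k z = pderiv j (a j k) z * du k z + a j k z * dw k j z}.
    exact: (weak_pderiv_unique oC (wp j k) (weak_pderivM oC (sa j k) (wdw k j))).
  have pA : {ae lebesgue_rV R n.+1, forall z, forall j k, cylinder Oe T z ->
      p j k z = pderiv j (a j k) z * du k z + a j k z * dw k j z}.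
    by apply: filter_forall => j; apply: filter_forall => k; exact: pE.
  move: pf pA; apply: filterS2 => z pf pA zc; rewrite -(pf zc).
  have r0 := lt0r_neq0 (density_gt0 gm_signature (col' ord0 z)).
  transitivity (\sum_j \sum_k (gm (col' ord0 z) j k * dw k j z +
      (density gm (col' ord0 z))^-1 * pderiv j (a j k) z * du k z)); last first.
    apply: eq_bigr => j _; apply: eq_bigr => k _; rewrite (pA j k zc) /a.
    by field.
  rewrite /wave /drift [RHS](eq_bigr (fun j => \sum_k gm (col' ord0 z) j k * dw k j z +
      \sum_k (density gm (col' ord0 z))^-1 * pderiv j (a j k) z * du k z)); last by move=> j _; rewrite big_split.
  rewrite big_split/=; congr (_ + _); rewrite exchange_big/=; apply: eq_bigr => k _.
  by rewrite mulr_suml.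
(* Explicit traces of all the derivatives. Uniqueness of traces identifies [W ord0] with [Ut], and
   [weak_pderiv_trace] makes the others the weak gradient of [U t]. *)
pose W l t := tmean T (tvalue T (du l) (dw l ord0) t).
have WT l : time_trace Oe T (du l) (W l).
  exact: (time_trace_tmean oO T0 (duL l) (dwL l ord0) (spsi l) (c0 l) (c1 l ord0)).
have WL l (t : R) : t \in `[0, T] -> inL2 Oe (W l t) by case: (WT l) => h _ _; exact: h.
have UL (t : R) : t \in `[0, T] -> inL2 Oe (U t) by case: uU => h _ _; exact: h.
have UtL (t : R) : t \in `[0, T] -> inL2 Oe (Ut t) by case: uUt => h _ _; exact: h.
have zI : (0 : R) \in `[0, T] by rewrite in_itv/= lexx ltW.
have wU (t : R) (i : 'I_n) : t \in `[0, T] -> weak_pderiv Oe i (U t) (W (lift ord0 i) t).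
  by move=> tI; exact: (weak_pderiv_trace oO T0 (wdu (lift ord0 i)) uL (duL _) uU (WT _) tI).
have UH (t : R) : t \in `[0, T] -> inH1 Oe (U t) (fun i => W (lift ord0 i) t).
  by move=> tI; split; [exact: UL|move=> i; split; [exact: WL|exact: wU]].
have phi0H : inH1 Oe phi0 (fun i => W (lift ord0 i) 0).
  split=> // i; split; first exact: WL.
  exact: (weak_pderiv_ae oO (UL 0 zI) phi0L U0phi (wU 0 i zI)).
have Ut0 (t : R) : t \in `[0, T] -> normL2sq Oe (Ut t) = normL2sq Oe (W ord0 t).
  move=> tI; apply: (eq_ae_normL2sq oO (UtL t tI).1 (WL ord0 t tI).1).
  exact: (time_trace_unique oO T0 uUt (WT ord0) tI).
have phi0E : normL2sq Oe phi0 = normL2sq Oe (U 0%R).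
  by apply: esym; exact: (eq_ae_normL2sq oO (UL 0 zI).1 phi0L.1 U0phi).
have phi1E : normL2sq Oe phi1 = normL2sq Oe (W ord0 0%R).
  by rewrite -(Ut0 0 zI); apply: esym; exact: (eq_ae_normL2sq oO (UtL 0 zI).1 phi1L.1 Utphi).
have EE (t : R) : t \in `[0, T] -> E t = (normL2sq Oe (U t) + \sum_l normL2sq Oe (W l t))%E.
  move=> tI; rewrite /E (normH1sqE oO (UH t tI)) (Ut0 t tI) big_ord_recl -addeA.
  by congr (_ + _)%E; rewrite addeC.
(* The energy as a finite real number, to which the extreme value theorem applies. *)
pose e t := ip (lebesgue_rV R n) Oe (U t) (U t) + \sum_l ip (lebesgue_rV R n) Oe (W l t) (W l t).
have Ee (t : R) : t \in `[0, T] -> E t = (e t)%:E.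
  move=> tI; rewrite (EE t tI) /e EFinD -sumEFin; congr (_ + _)%E; first exact: (sqE mO (UL t tI)).
  by apply: eq_bigr => l _; exact: (sqE mO (WL l t tI)).
have ce : {within `[0, T], continuous e}.
  apply/subspace_continuousP => t tI.
  have h1 : ip (lebesgue_rV R n) Oe (U s) (U s) @[s --> within `[0, T] (nbhs t)] --> ip (lebesgue_rV R n) Oe (U t) (U t).
    exact: ((subspace_continuousP _ _).1 (continuous_trace_norm oO uU) t tI).
  have h2 l : ip (lebesgue_rV R n) Oe (W l s) (W l s) @[s --> within `[0, T] (nbhs t)] --> ip (lebesgue_rV R n) Oe (W l t) (W l t).
    exact: ((subspace_continuousP _ _).1 (continuous_trace_norm oO (WT l)) t tI).
  have h3 : \sum_l ip (lebesgue_rV R n) Oe (W l s) (W l s) @[s --> within `[0, T] (nbhs t)] -->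
      \sum_l ip (lebesgue_rV R n) Oe (W l t) (W l t).
    by apply: (@cvg_sumr _ _ _ _ _ _ (fun l s => ip (lebesgue_rV R n) Oe (W l s) (W l s))
      (fun l => ip (lebesgue_rV R n) Oe (W l t) (W l t))).
  exact: (cvgD h1 h3).
have [tm tmI htm] := EVT_max (ltW T0) ce.
exists tm; split=> //.
  by move=> t tI; rewrite (Ee t tI) (Ee tm tmI) lee_fin htm.
(* The sign of the inflow makes the surface integral of the statement the opposite of a nonnegative
   quantity, so that subtracting it adds [surface_energy]. *)
have inner (s : R) : (\int[sigma]_(x in S) ((slice (v ord0) s x ^+ 2 - \sum_j \sum_k space_block gm x j k
      * slice (v (lift ord0 j)) s x * slice (v (lift ord0 k)) s x)
      * \sum_(j < n) gm x (lift ord0 j) ord0 * nu x ord0 j)%:E = - surface_energy gm S nu sigma v s)%E.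
  rewrite /surface_energy -integral_ge0N; last by move=> x _; rewrite lee_fin.
  apply: eq_integral => x /set_mem Sx.
  have Sz : S (col' ord0 (insert_rV ord0 s x)) by rewrite col'_insert_rV.
  have := surface_density gm_sym gm_signature Sdet ingoing v Sz; rewrite col'_insert_rV => ->.
  by rewrite -EFinN opprK; congr EFin; rewrite /null_form /inflow col'_insert_rV.
have mSE : measurable_fun (`]0, T[%classic : set (measurableTypeR R)) (surface_energy gm S nu sigma v : measurableTypeR R -> \bar R).
  by apply: measurable_funTS; exact: (measurable_surface_energy gm_smooth S_compact nu_normal sigma_area mv).
have SE0 s : (0 <= surface_energy gm S nu sigma v s)%E by apply: integral_ge0 => x _; rewrite lee_fin.
have -> : (\int[@lebesgue_measure R]_(t in `[0%R, T]) \int[sigma]_(x in S)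
      ((slice (v ord0) t x ^+ 2 - \sum_j \sum_k space_block gm x j k
      * slice (v (lift ord0 j)) t x * slice (v (lift ord0 k)) t x)
      * \sum_(j < n) gm x (lift ord0 j) ord0 * nu x ord0 j)%:E =
    - \int[@lebesgue_measure R]_(t in `]0%R, T[) surface_energy gm S nu sigma v t)%E.
  rewrite -(integral_itv_bndoo true false mSE) -integral_ge0N//.
  by apply: eq_integral => s _; exact: inner.
rewrite oppeK.
set G := (\int[_]_(_ in _) _)%E.
have mf2 : measurable_fun (cylinder Oe T) (fun z => (f z ^+ 2)%:E).
  by apply/measurable_EFinP; apply: measurable_funX; exact: fL.1.
have f20 z : (0 <= (f z ^+ 2)%:E)%E by rewrite lee_fin sqr_ge0.
have -> : (\int[@lebesgue_measure R]_(t in `[0%R, T]) normL2sq Oe (slice f t) = normL2sq (cylinder Oe T) f)%E.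
  rewrite /normL2sq (ge0_integral_cyl_time mO mf2 f20).
  exact: (integral_itv_bndoo true false (measurable_integral_slice mO mf2 f20)).
have fin_L2 m (A : set 'rV[R]_m) g : inL2 A g -> normL2sq A g \is a fin_num.
  by move=> [_ h]; rewrite ge0_fin_numE ?sq_ge0.
rewrite (normH1sqE oO phi0H) phi0E phi1E.
have /fineK ufin := fin_L2 _ _ _ (UL 0 zI); have /fineK ffin := fin_L2 _ _ _ fL.
pose q := \sum_l ip (lebesgue_rV R n) Oe (W l 0%R) (W l 0%R).
have qfin : (\sum_l normL2sq Oe (W l 0%R))%E = q%:E.
  by rewrite /q -sumEFin; apply: eq_bigr => l _; exact: (sqE mO (WL l 0 zI)).
have -> : (normL2sq Oe (U 0%R) + \sum_(i < n) normL2sq Oe (W (lift ord0 i) 0%R) + normL2sq Oe (W ord0 0%R) =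
    normL2sq Oe (U 0%R) + \sum_l normL2sq Oe (W l 0%R))%E.
  by rewrite big_ord_recl -addeA; congr (_ + _)%E; rewrite addeC.
set b := fine _ in ufin; set ph := fine _ in ffin.
have b0 : 0 <= b by rewrite /b fine_ge0// sq_ge0.
have ph0 : 0 <= ph by rewrite /ph fine_ge0// sq_ge0.
have q0 : 0 <= q by apply: sumr_ge0 => l _; exact: ip_ge0.
pose Q := q + ph; have Q0 : 0 <= Q by rewrite addr_ge0.
have key (t : R) : 0 < t <= T -> (\sum_l normL2sq Oe (W l t) +
    \int[@lebesgue_measure R]_(s in `]0%R, t[) surface_energy gm S nu sigma v s <= (D * Q)%:E)%E.
  move=> tT; apply: (le_trans (HC du dw psi v f duL dwL fL sym wf spsi c0 c1 mv cv t tT)).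
  rewrite -/(W _ _) qfin -ffin -EFinD -EFinM lee_fin ler_wpM2r//.
  by rewrite /D lerDl.
have Wt (t : R) : t \in `[0, T] -> (\sum_l normL2sq Oe (W l t) <= (D * Q)%:E)%E.
  rewrite in_itv/= => /andP[]; rewrite le_eqVlt => /predU1P[<- _|t0 tT].
    by rewrite qfin lee_fin /Q; nra.
  apply: le_trans (key t _); last by rewrite t0.
  by rewrite leeDl// integral_ge0.
have GQ : (G <= (D * Q)%:E)%E.
  apply: le_trans (key T _); last by rewrite T0 lexx.
  by rewrite /G leeDr// sume_ge0// => l _; exact: sq_ge0.
have mJ : measurable (`]0, T[%classic : set (measurableTypeR R)) by exact: measurable_itv.
(* The estimate of the derivatives holds at every time and does not involve [u]; integrated over
   [(0, T)] it bounds the time derivative on the cylinder, which is what [trace_le] needs for [u]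
   itself. *)
have du0 : (normL2sq (cylinder Oe T) (du ord0) <= (T * (D * Q))%:E)%E.
  have md2 : measurable_fun (cylinder Oe T) (fun z => (du ord0 z ^+ 2)%:E).
    by apply/measurable_EFinP; apply: measurable_funX; exact: (duL ord0).1.
  have d20 z : (0 <= (du ord0 z ^+ 2)%:E)%E by rewrite lee_fin sqr_ge0.
  rewrite /normL2sq (ge0_integral_cyl_time mO md2 d20).
  have lI : (\int[@lebesgue_measure R]_(s in `]0%R, T[) (D * Q)%:E = (T * (D * Q))%:E)%E.
    have lJ : lebesgue_measure (`]0, T[%classic : set (measurableTypeR R)) = T%:E.
      by rewrite lebesgue_measure_itv/= lte_fin T0 -EFinB subr0.
    by rewrite integral_cst//= [X in (_ * X)%E]lJ -EFinM mulrC.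
  rewrite -lI.
  have DQ : 0 <= D * Q by nra.
  apply: ae_ge0_le_integral => //.
  - by move=> s _; apply: integral_ge0.
  - exact: (measurable_integral_slice mO md2 d20).
  case: (WT ord0) => _ _ [N [mN N0 sN]]; exists N; split => // s ns; apply: sN => h; apply: ns => sJ.
  have sI : s \in `[0, T] by move: (sJ); rewrite /= !in_itv/= => /andP[? ?]; rewrite !ltW.
  apply: le_trans (Wt s sI); rewrite (bigD1 ord0)//=.
  have -> : (\int[lebesgue_rV R n]_(x in Oe) (du ord0 (insert_rV ord0 s x) ^+ 2)%:E = normL2sq Oe (W ord0 s))%E.
    apply: ae_eq_integral => //.
    - exact: (measurable_slice mO md2 sJ).
    - by apply/measurable_EFinP; apply: measurable_funX; exact: (WL ord0 s sI).1.
    by have := h sJ; apply: filterS => x hx Ox; rewrite (hx Ox).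
  by rewrite leeDl// sume_ge0// => l _; exact: sq_ge0.
rewrite (EE tm tmI).
have Um := trace_le oO T0 (wdu ord0) uL (duL ord0) uU tmI.
have Um' : (normL2sq Oe (U tm) <= (2 * b + 2 * T * (T * (D * Q)))%:E)%E.
  apply: (le_trans Um); rewrite -ufin [X in (_ <= X)%E]EFinD; apply: leeD; first by rewrite EFinM.
  rewrite [X in (_ <= X)%E]EFinM; apply: lee_wpmul2l => //; rewrite lee_fin; lra.
apply: (le_trans (leeD (leeD Um' (Wt tm tmI)) GQ)).
have fin : 2 * b + 2 * T * (T * (D * Q)) + D * Q + D * Q <= C * (b + q) + C * ph.
  have -> : C * (b + q) + C * ph = 2 * b + 2 * Q + ((2 * T ^+ 2 + 2) * D * b + (2 * T ^+ 2 + 2) * D * Q) by rewrite /C /Q; ring.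
  have -> : 2 * b + 2 * T * (T * (D * Q)) + D * Q + D * Q = 2 * b + (2 * T ^+ 2 + 2) * D * Q by ring.
  have h1 : 0 <= (2 * T ^+ 2 + 2) * D * b by rewrite !mulr_ge0//; lra.
  lra.
rewrite -ufin qfin -ffin.
have fin' : ((2 * b + 2 * T * (T * (D * Q)) + D * Q + D * Q)%:E <= (C * (b + q) + C * ph)%:E)%E by rewrite lee_fin.
exact: fin'.
Qed.
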